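(* Fix $2<p<\infty$. Let $E\subset\mathbb{R}^2$ be finite with cardinality $N$. Then there exist a linear operator $T:L^{2,p}(\mathbb{R}^2)|_E\to L^{2,p}(\mathbb{R}^2)$, linear functionals $\lambda_1,\dots,\lambda_{N_0}$ on $L^{2,p}(\mathbb{R}^2)|_E=\{f:E\to\mathbb{R}\}$ with $N_0\le CN^2$, and, setting $M(f)=\big(\sum_{i=1}^{N_0}|\lambda_i(f)|^p\big)^{1/p}$, the following hold for every $f:E\to\mathbb{R}$: (1) $Tf|_E=f$; (2) $C^{-1}M(f)\le \|f\|_{L^{2,p}(\mathbb{R}^2)|_E}\le\|Tf\|_{L^{2,p}(\mathbb{R}^2)}\le C\|f\|_{L^{2,p}(\mathbb{R}^2)|_E}\le C^2 M(f)$, where $C$ depends only on $p$ (and not on $E$ or $N$).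
   Context: $L^{2,p}(\mathbb{R}^2)$ is the homogeneous Sobolev space of functions $F:\mathbb{R}^2\to\mathbb{R}$ with finite seminorm $\|F\|_{L^{2,p}(\mathbb{R}^2)}=\|\nabla^2F\|_{L^p(\mathbb{R}^2)}$; for $p>2$ such functions are (after modification on a null set) continuously differentiable. For $E\subset\mathbb{R}^2$ and $f:E\to\mathbb{R}$, the trace seminorm is $\|f\|_{L^{2,p}(\mathbb{R}^2)|_E}=\inf\{\|F\|_{L^{2,p}(\mathbb{R}^2)}:F|_E=f\}$. *)

(* Defs.v *)
From HB Require Import structures.
From mathcomp Require Import all_boot all_order all_algebra.
From mathcomp Require Import all_classical all_reals all_analysis.
From mathcomp Require Import finmap.
Set Implicit Arguments. Unset Strict Implicit. Unset Printing Implicit Defensive.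
Import Order.TTheory GRing.Theory Num.Theory.
Import numFieldNormedType.Exports.
Local Open Scope classical_set_scope.
Local Open Scope ring_scope.

Section Sobolev.
Variable R : realType.

(* The plane R^2, realised as R * R (normed with the max norm; the choice of
   norm on R^2 is irrelevant for differentiability / compactness). *)
Definition plane := (R * R)%type.

Definition leb2 := (@lebesgue_measure R \x @lebesgue_measure R)%E.

Definition dir (b : bool) : plane := if b then (0, 1) else (1, 0).

Definition partial (b : bool) (f : plane -> R) : plane -> R :=
  fun x => 'D_(dir b) f x.

Fixpoint dpart (s : seq bool) (f : plane -> R) : plane -> R :=
  match s with
  | [::] => f
  | b :: s' => partial b (dpart s' f)
  end.

Definition test_function (phi : plane -> R) : Prop :=
  (forall (s : seq bool) (x : plane), differentiable (dpart s phi) x) /\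
  compact (closure [set x | phi x != 0]).

Definition weak_hessian (F : plane -> R) (g : bool -> bool -> plane -> R) : Prop :=
  forall i j, measurable_fun setT (g i j) /\
    forall phi, test_function phi ->
      (\int[leb2]_x (F x * dpart [:: i; j] phi x)%:E =
       \int[leb2]_x (g i j x * phi x)%:E)%E.

Definition hess_Lp_norm (p : R) (g : bool -> bool -> plane -> R) : \bar R :=
  ((\int[leb2]_x (\sum_(i : bool) \sum_(j : bool) `|g i j x| `^ p)%:E)
     `^ p^-1)%E.

(* F belongs to the homogeneous Sobolev space L^{2,p}(R^2)
   (continuous representative, weak Hessian in L^p) *)
Definition L2p (p : R) (F : plane -> R) : Prop :=
  continuous F /\
  exists g, weak_hessian F g /\ (hess_Lp_norm p g < +oo)%E.

Definition L2p_norm (p : R) (F : plane -> R) : \bar R :=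
  ereal_inf [set hess_Lp_norm p g | g in weak_hessian F].

Definition trace_norm (p : R) (E : {fset plane}) (f : E -> R) : \bar R :=
  ereal_inf [set L2p_norm p F | F in
     [set F | L2p p F /\ forall x : E, F (fsval x) = f x]].

End Sobolev.

(* Main.v *)
Require Import Defs.
From HB Require Import structures.
From mathcomp Require Import all_boot all_order all_algebra.
From mathcomp Require Import all_classical all_reals all_analysis.
From mathcomp Require Import finmap.
From mathcomp Require Import measurable_realfun ring lra zify.
Set Implicit Arguments. Unset Strict Implicit. Unset Printing Implicit Defensive.
Import Order.TTheory GRing.Theory Num.Theory.
Import numFieldNormedType.Exports.
Local Open Scope classical_set_scope.
Local Open Scope ring_scope.

(* Fix 2 < r < p and a scale rho far below the separation of E. The gradient at scale rho of a function F (the gradient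
   of its mean) satisfies Taylor estimates in terms of the averages of |D^2 F|^r over squares, hence in terms of a
   discrete Hardy-Littlewood maximal function m on cells of side rho, and the l^p norm of m is controlled by the norm
   of D^2 F in L^p.

   The values of F on E determine the gradient of F at x in E up to an error controlled by the local energy, except when
   the data is flat at the relevant scale: some h of small energy vanishes at the nearby points of E and has slope at
   least 1 there. Let del x be the largest dyadic scale at which E is flat near x; if it is infinite, then E lies on a
   line. Otherwise the gradient at x is determined, linearly in the data, at scale 2 del x (Hahn-Banach). Choose a net
   adapted to del, replace every point of the net by a "keystone" so that the balls that carry the errors have bounded
   overlap, and blend the keystone gradients by a partition of unity. At scales below del x the blended gradient may be
   off by a vector that is nearly constant; correcting it along the segment from x to its nearest neighbour leaves only
   the error transversal to that segment, whose variation is controlled by the function h that witnesses flatness.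

   The resulting first-order jets (f(x), g_x) depend linearly on f, and on a cell at distance about s from E they are
   compatible up to s^2 times a function with controlled l^p norm. The extension T f interpolates the jets through a
   sequence of dyadic grids, and on a cell at distance s its second derivatives are controlled by the differences of
   boundedly many jets at points at distance about s. These differences, summed over the cells and regrouped by pairs of
   points of E, give three functionals for each pair. *)

(** The constants may depend on [p] alone, and everything chosen along the way (scales, net,
    keystones, witnesses, grids) may depend on E but not on f; otherwise T would not be linear. The
    exponent r is squeezed from both sides: r > 2 makes the increments of the gradient summable over
    small scales, and r < p makes the maximal operator bounded on l^(p/r). The side [rho] only
    serves to discretise: sums over cells carry the factor [rho ^+ 2], so no constant sees the
    number of cells. Flatness is the obstacle. Where E nearly lies on a line, its data says almost
    nothing about the transversal derivative, so the gradients cannot be recovered one by one with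
    small error; what has to be small is only the variation of the error, and its effect along
    differences of points of E. The witness h costs d^(2 - p), the energy of a Hessian of size 1/d
    on a square of side d, and this is the factor that lets its contributions be summed over the
    net. Numerical factors such as 16 and 64 are slack between neighbouring scales and are not
    optimised. *)

Local Notation leb R := (@lebesgue_measure R \x @lebesgue_measure R)%E.

(* [lra] reifies the whole context, so it is run on the comparisons and equalities only. It fails when a section
   hypothesis is missing: in a section, a [Let] of type [barrier] stops the clearing. *)
Variant barrier : Prop := Barrier.

Ltac clear_context := repeat match goal with H : ?T |- _ => lazymatch T with
  | barrier => fail 1
  | is_true (@Order.le _ _ _ _) => fail
  | is_true (@Order.lt _ _ _ _) => fail
  | is_true (andb _ _) => fail
  | @eq _ _ _ => fail
  | _ => clear H
  end end.

Ltac linear := clear_context; lra.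

(** * Smooth functions of one variable *)

(** An iterated existential instead of iterated [derive1]: closure under sums, products and affine
    substitutions then goes by induction on the order, without computing higher derivatives. *)
Fixpoint times_derivable (R : realType) (n : nat) (f : R -> R) : Prop :=
  if n is n'.+1 then
    exists f' : R -> R, (forall x : R, is_derive x 1 f (f' x)) /\ times_derivable n' f'
  else True.

Definition smooth (R : realType) (f : R -> R) := forall n, times_derivable n f.

Lemma times_derivableW (R : realType) n (f : R -> R) :
  times_derivable n.+1 f -> times_derivable n f.
Proof.
elim: n f => [//|n IH] f [f' [ff' h]]; exists f'; split=> //; exact: IH.
Qed.

Lemma times_derivable_cst (R : realType) n (c : R) : times_derivable n (fun _ : R => c).
Proof.
elim: n c => [//|n IH] c; exists (fun=> 0); split; last exact: IH.
by move=> x; exact: is_derive_cst.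
Qed.

Lemma times_derivableD (R : realType) n (f g : R -> R) :
  times_derivable n f -> times_derivable n g -> times_derivable n (fun x => f x + g x).
Proof.
elim: n f g => [//|n IH] f g [f' [ff' hf]] [g' [gg' hg]].
exists (fun x => f' x + g' x); split; last exact: IH.
by move=> x; exact: is_deriveD.
Qed.

Lemma times_derivableM (R : realType) n (f g : R -> R) :
  times_derivable n f -> times_derivable n g -> times_derivable n (fun x => f x * g x).
Proof.
elim: n f g => [//|n IH] f g hf hg.
have [f' [ff' hf']] := hf; have [g' [gg' hg']] := hg.
exists (fun x => f x * g' x + g x * f' x); split; first by move=> x; exact: is_deriveM.
by apply: times_derivableD; apply: IH => //; exact: times_derivableW.
Qed.

Lemma is_derive_unique (R : realType) (f f1 f2 : R -> R) :
  (forall x : R, is_derive x 1 f (f1 x)) -> (forall x : R, is_derive x 1 f (f2 x)) -> f1 = f2.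
Proof.
by move=> h1 h2; apply/funext => x; rewrite -(@derive_val _ _ _ _ _ _ _ (h1 x)) -(@derive_val _ _ _ _ _ _ _ (h2 x)).
Qed.

(** The definition supplies a derivative for each order separately; uniqueness of the derivative
    identifies them all with [derive1 f]. *)
Lemma smooth_derive (R : realType) (f : R -> R) : smooth f ->
  (forall x : R, is_derive x 1 f (derive1 f x)) /\ smooth (derive1 f).
Proof.
move=> sf; have [g [fg _]] := sf 1%N.
have e : derive1 f = g by apply/funext => x; rewrite derive1E (@derive_val _ _ _ _ _ _ _ (fg x)).
split=> [x|n]; first by rewrite e.
by have [g' [fg' h]] := sf n.+1; rewrite e (is_derive_unique fg fg').
Qed.

Lemma smooth_from (R : realType) (f f' : R -> R) :
  (forall x : R, is_derive x 1 f (f' x)) -> smooth f' -> smooth f.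
Proof. by move=> ff' sf' [//|n]; exists f'; split=> //; exact: sf'. Qed.

Lemma smooth_cont (R : realType) (f : R -> R) : smooth f -> continuous f.
Proof.
move=> /smooth_derive[h _] x; apply: differentiable_continuous.
by apply/derivable1_diffP; exact: (@ex_derive _ _ _ _ _ _ _ (h x)).
Qed.

Lemma smooth_cst (R : realType) (c : R) : smooth (fun _ : R => c).
Proof.
by move=> n; exact: times_derivable_cst.
Qed.

Lemma smooth_id (R : realType) : smooth (fun x : R => x).
Proof. by apply: (@smooth_from _ _ (fun=> 1)); exact: smooth_cst. Qed.

Lemma smoothD (R : realType) (f g : R -> R) : smooth f -> smooth g -> smooth (fun x => f x + g x).
Proof.
by move=> sf sg n; exact: times_derivableD.
Qed.

Lemma smoothM (R : realType) (f g : R -> R) : smooth f -> smooth g -> smooth (fun x => f x * g x).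
Proof.
by move=> sf sg n; exact: times_derivableM.
Qed.

(** Handles the points where no differentiation rule applies, notably [flat_exp] at 0, where it is
    squeezed between 0 and a multiple of the square. *)
Lemma is_derive_quadratic (R : realType) (f : R -> R) (x d C : R) :
  (forall h, `|h| <= 1 -> `|f (x + h) - f x - h * d| <= C * h ^+ 2) -> is_derive x 1 f d.
Proof.
move=> H.
have C0 : 0 <= C by have := H 1; rewrite normr1 lexx expr1n mulr1 => /(_ isT); exact: le_trans.
have cv : (h : R)^-1 *: (f (h *: 1 + x) - f x) @[h --> 0^'] --> d.
  apply/cvgrPdist_le => e e0.
  have C1 : 0 < C + 1 by rewrite ltr_wpDl.
  near=> h.
  have h0 : h != 0 by near: h; exact: nbhs_dnbhs_neq.
  have hs : `|h| < Num.min 1 (e / (C + 1)).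
    near: h; apply: (@dnbhs0_lt _ R^o); rewrite lt_min ltr01/=; exact: divr_gt0.
  have {hs} [h1 h2] : `|h| <= 1 /\ `|h| <= e / (C + 1).
    by move: hs; rewrite lt_min => /andP[/ltW ? /ltW ?].
  have hn0 : 0 < `|h| by rewrite normr_gt0.
  have -> : h^-1 *: (f (h *: 1 + x) - f x) = (f (x + h) - f x) / h.
    by rewrite /GRing.scale/= mulr1 mulrC [h + x]addrC.
  rewrite distrC -(ler_pM2l hn0) -normrM mulrBr mulrCA divff// mulr1.
  apply: le_trans (H _ h1) _.
  rewrite -(real_normK (num_real h)) expr2 mulrCA ler_pM2l//.
  apply: (@le_trans _ _ ((C + 1) * (e / (C + 1)))).
    by apply: ler_pM => //; rewrite lerDl.
  by rewrite mulrC divfK// gt_eqF.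
apply: DeriveDef; first by apply/cvg_ex; exists d.
exact: cvg_lim cv.
Unshelve. all: by end_near. Qed.

Lemma is_derive_affine (R : realType) (a b x : R) : is_derive x 1 (fun y => a * y + b) a.
Proof.
apply: (@is_derive_quadratic _ _ _ _ 0) => h _.
by rewrite mul0r (_ : _ - _ = 0) ?normr0//; ring.
Qed.

Lemma smooth_affine (R : realType) (f : R -> R) (a b : R) : smooth f -> smooth (fun x => f (a * x + b)).
Proof.
move=> sf n; move: (sf n); elim: n f {sf} => [//|n IH] f [f' [ff' hf]].
exists (fun x => f' (a * x + b) * a); split.
  move=> x; apply: (@is_derive1_comp _ f (fun x => a * x + b)).
  exact: is_derive_affine.
by apply: times_derivableM; [exact: IH|exact: times_derivable_cst].
Qed.

Lemma smooth_inv (R : realType) (f : R -> R) : (forall x, f x != 0) -> smooth f ->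
  smooth (fun x => (f x)^-1).
Proof.
move=> f0 sf n; elim: n => [//|n IH].
have [ff' sf'] := smooth_derive sf.
exists (fun x => - (f x) ^- 2 *: derive1 f x); split; first by move=> x; exact: is_deriveV.
have -> : (fun x => - (f x) ^- 2 *: derive1 f x) = (fun x => ((f x)^-1 * (f x)^-1) * (- 1 * derive1 f x)).
  by apply/funext => x; rewrite expr2 invfM /GRing.scale/=; ring.
apply: times_derivableM; first exact: times_derivableM.
by apply: times_derivableM; [exact: times_derivable_cst|exact: sf'].
Qed.

(** The function x^-k exp(-1/x), extended by 0. The index k makes the span of the family closed
    under differentiation, so that all orders are treated by one induction. *)
Definition flat_exp (R : realType) (k : nat) (x : R) : R :=
  if 0 < x then x^-1 ^+ k * expR (- x^-1) else 0.

(** With y = 1/x this is y^(k+2) / (k+2)! <= exp y, a term of the exponential series. The quadratic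
    bound gives the derivative at 0. *)
Lemma flat_exp_le (R : realType) (k : nat) (x : R) : 0 <= flat_exp k x <= (k.+2)`!%:R * x ^+ 2.
Proof.
rewrite /flat_exp; case: ifPn => [x0|]; last by rewrite lexx mulr_ge0// exprn_even_ge0.
have y0 : 0 < x^-1 by rewrite invr_gt0.
apply/andP; split; first by rewrite mulr_ge0 ?expR_ge0 ?exprn_ge0// ltW.
rewrite expRN ler_pdivrMr ?expR_gt0//.
have := expR_ge1Dxn k.+1 (ltW y0) => h.
have : x^-1 ^+ k.+2 / (k.+2)`!%:R <= expR x^-1.
  by apply: le_trans h; rewrite lerDr.
rewrite ler_pdivrMr ?ltr0n ?fact_gt0// => h2.
rewrite -mulrA mulrCA -ler_pdivrMl ?exprn_gt0//.
by rewrite -exprVn -exprD add2n [leRHS]mulrC.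
Qed.

Lemma flat_exp_derive (R : realType) (k : nat) (x : R) :
  is_derive x 1 (@flat_exp R k) (flat_exp k.+2 x - k%:R * flat_exp k.+1 x).
Proof.
have [x0|x0|->] := ltgtP x 0.
- rewrite /flat_exp ltNge (ltW x0)/= mulr0 subr0.
  apply: (@near_eq_is_derive _ _ _ (fun=> 0 : R)).
  have xlt : \forall y \near x, y < 0 by exact: lt_nbhsl.
  by near=> y; rewrite ltNge ltW//=; near: y.
- pose g (y : R) : R := y^-1 ^+ k * expR (- y^-1).
  apply: (@near_eq_is_derive _ _ _ g).
    have xgt : \forall y \near x, 0 < y by exact: lt_nbhsr.
    by near=> y; rewrite /flat_exp/g ifT//; near: y.
  have dV : is_derive x 1 (fun y : R => y^-1) (- x ^- 2).
    have x00 : x != 0 by rewrite gt_eqF.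
    by apply: is_derive_eq (is_deriveV (f := id) x00 (is_derive_id x 1)) _; rewrite scaler1.
  have dE : is_derive x 1 (fun y : R => expR (- y^-1)) (expR (- x^-1) * (x ^- 2)).
    apply: (@is_derive1_comp _ expR (fun y => - y^-1)).
    by rewrite -[x ^- 2]opprK; exact: is_deriveN.
  have dX : is_derive x 1 (fun y : R => y^-1 ^+ k) (k%:R * x^-1 ^+ k.-1 *: (- x ^- 2)).
    have -> : (fun y : R => y^-1 ^+ k) = (fun y : R => y^-1) ^+ k by rewrite exprfctE.
    exact: is_deriveX.
  apply: is_derive_eq (is_deriveM dX dE) _.
  rewrite /flat_exp x0 /GRing.scale/= -!exprVn.
  by case: (k) => [|k']; rewrite ?mulr0n/= !exprS; ring.
- rewrite /flat_exp ltxx mulr0 subr0.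
  apply: (@is_derive_quadratic _ _ _ _ (k.+2)`!%:R) => h _.
  rewrite /flat_exp ltxx mulr0 !subr0 add0r ger0_norm.
    by have /andP[] := flat_exp_le k h.
  by have /andP[] := flat_exp_le k h.
Unshelve. all: by end_near. Qed.

Lemma flat_exp_smooth (R : realType) k : smooth (@flat_exp R k).
Proof.
move=> n; elim: n k => [//|n IH] k; eexists; split; first exact: flat_exp_derive.
have -> : (fun x : R => flat_exp k.+2 x - k%:R * flat_exp k.+1 x) =
    (fun x : R => flat_exp k.+2 x + - k%:R * flat_exp k.+1 x).
  by apply/funext => x; rewrite mulNr.
apply: times_derivableD; first exact: IH.
by apply: times_derivableM; [exact: times_derivable_cst|exact: IH].
Qed.

(** The quotient e(1+x) / (e(1+x) + e(1-x)) with e(x) = exp(-1/x) for x > 0: at least one of 1+x and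
    1-x is positive, so the denominator never vanishes. *)
Lemma smooth_step (R : realType) : exists s : R -> R,
  [/\ smooth s, forall x, x <= -1 -> s x = 0 & forall x, 1 <= x -> s x = 1].
Proof.
pose e := @flat_exp R 0.
have e0 x : x <= 0 -> e x = 0 by rewrite /e/flat_exp ltNge => ->.
have e1 x : 0 < x -> 0 < e x by rewrite /e/flat_exp => ->; rewrite expr0 mul1r expR_gt0.
have ege x : 0 <= e x by have /andP[] := flat_exp_le 0 x.
pose d x := e (1 * x + 1) + e (-1 * x + 1).
have d0 x : d x != 0.
  rewrite gt_eqF// /d; have [x0|x0] := ltP x 0.
    by rewrite ltr_wpDl// e1//; linear.
  by rewrite ltr_pwDl// e1//; linear.
exists (fun x => e (1 * x + 1) * (d x)^-1); split.
- apply: smoothM; first by apply: smooth_affine; exact: flat_exp_smooth.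
  apply: smooth_inv => //; apply: smoothD; apply: smooth_affine; exact: flat_exp_smooth.
- by move=> x x1; rewrite e0 ?mul0r//; linear.
- move=> x x1; rewrite /d (e0 (-1 * x + 1)) ?addr0 ?divff ?gt_eqF//; [apply: e1|]; linear.
Qed.

Lemma cont_supp_bounded (R : realType) (f : R -> R) (L : R) : continuous f ->
  (forall x, L < `|x| -> f x = 0) -> exists2 M, 0 < M & forall x, `|f x| <= M.
Proof.
move=> cf f0.
have : compact (f @` `[- L, L]).
  by apply: continuous_compact; [exact: continuous_subspaceT|exact: segment_compact].
move=> /compact_bounded [M [_ /(_ (`|M| + 1))]].
rewrite ltr_pwDr// ?ler_norm// => /(_ isT) HM.
exists (`|M| + 1); first by rewrite ltr_wpDl.
move=> x; have [xL|/f0 ->] := leP `|x| L; last by rewrite normr0 addr_ge0.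
by apply: HM; exists x => //; rewrite /= in_itv/= -ler_norml.
Qed.

(** * A discrete Hardy-Littlewood maximal inequality *)

Lemma young_powR (R : realType) (q a x : R) : 1 < q -> 0 <= a -> 0 <= x ->
  a `^ (q - 1) * x <= (q - 1) / q * a `^ q + x `^ q / q.
Proof.
move=> q1 a0 x0; have q0 : 0 < q by linear.
have q10 : 0 < q - 1 by linear.
have := @conjugate_powR R (a `^ (q - 1)) x (q / (q - 1)) q (powR_ge0 _ _) x0.
rewrite -powRrM mulrCA divff ?gt_eqF// mulr1 invf_div => /(_ _ q0) h.
rewrite (le_trans (h _ _))//; first by rewrite divr_gt0.
  by field; rewrite gt_eqF.
by rewrite mulrC.
Qed.

(** Either v is at most k/2 times y and the first term suffices, or y is at most 2/k times v and the
    second one does. The factor k/2 leaves half of a term k y^q after absorption. *)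
Lemma absorb_powR (R : realType) (q k y v : R) : 1 < q -> 0 < k -> 0 <= y -> 0 <= v ->
  y `^ (q - 1) * v <= k / 2 * y `^ q + (2 / k) `^ (q - 1) * v `^ q.
Proof.
move=> q1 k0 y0 v0; have q0 : 0 < q by linear.
have [vy|yv] := leP v (k / 2 * y).
  apply: (@le_trans _ _ (k / 2 * y `^ q)).
    by rewrite -(mulr_powRB1 y0 q0) mulrA mulrC ler_wpM2r ?powR_ge0.
  by rewrite lerDl mulr_ge0 ?powR_ge0.
apply: (@le_trans _ _ ((2 / k) `^ (q - 1) * v `^ q)); last first.
  by rewrite lerDr mulr_ge0 ?powR_ge0// divr_ge0// ltW.
rewrite -(mulr_powRB1 v0 q0).
have -> : (2 / k) `^ (q - 1) * (v * v `^ (q - 1)) = (2 / k * v) `^ (q - 1) * v.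
  by rewrite [in RHS]powRM ?divr_ge0// 1?ltW//; ring.
rewrite ler_wpM2r// ge0_ler_powR//; rewrite ?nnegrE//; first linear.
- by rewrite mulr_ge0// divr_ge0 1?ltW.
- have -> : y = 2 / k * (k / 2 * y) by field; rewrite gt_eqF.
  by rewrite ler_wpM2l ?divr_ge0 1?ltW.
Qed.

(** The dyadic maximal function on an interval of length 2^J. The argument [a] carries the largest
    average over the dyadic ancestors down the tree. *)
Fixpoint dyadic_max (R : realType) (J : nat) (v : nat -> R) (a : R) (i : nat) : R :=
  let a' := Num.max a ((\sum_(k < 2 ^ J) v k) / (2 ^ J)%:R) in
  if J is J'.+1 then
    if (i < 2 ^ J')%N then dyadic_max J' v a' i
    else dyadic_max J' (fun k => v (2 ^ J' + k)%N) a' (i - 2 ^ J')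
  else a'.

Lemma dyadic_max_ge (R : realType) J (v : nat -> R) a i : a <= dyadic_max J v a i.
Proof.
elim: J v a i => [|J IH] v a i /=; first by rewrite le_max lexx.
by case: ifP => _; apply: le_trans (IH _ _ _); rewrite le_max lexx.
Qed.

Lemma sum_pow2S (R : realType) J (v : nat -> R) :
  \sum_(k < 2 ^ J.+1) v k =
  \sum_(k < 2 ^ J) v k + \sum_(k < 2 ^ J) v (2 ^ J + k)%N.
Proof.
rewrite -!(big_mkord xpredT v) expnS mul2n -addnn (big_cat_nat _ (n := 2 ^ J))//= ?leq_addr//.
rewrite -[in X in _ + X](add0n (2 ^ J)%N) big_addn addnK big_mkord; congr (_ + _).
by rewrite big_mkord; apply: eq_bigr => i _; rewrite addnC.
Qed.

Lemma dyadic_max_avg (R : realType) J j (v : nat -> R) a i : (j <= J)%N -> (i < 2 ^ J)%N ->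
  \sum_(k < 2 ^ j) v (i %/ 2 ^ j * 2 ^ j + k)%N <= (2 ^ j)%:R * dyadic_max J v a i.
Proof.
have p2 n : 0 < (2 ^ n)%:R :> R by rewrite ltr0n expn_gt0.
have top J' v' a' i' : (i' < 2 ^ J')%N ->
    \sum_(k < 2 ^ J') v' (i' %/ 2 ^ J' * 2 ^ J' + k)%N <= (2 ^ J')%:R * dyadic_max J' v' a' i'.
  move=> i'J; rewrite divn_small// mul0n -ler_pdivrMl//.
  rewrite [X in X * _ <= _](_ : _ = (2 ^ J')%:R^-1)// mulrC.
  case: J' i'J => [|J'] i'J /=; first by rewrite le_max lexx orbT.
  by case: ifP => _; apply: le_trans (dyadic_max_ge _ _ _ _); rewrite le_max lexx orbT.
elim: J v a i => [|J IH] v a i.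
  by rewrite leqn0 => /eqP ->; exact: top.
rewrite leq_eqVlt => /orP[/eqP ->|]; first exact: top.
rewrite ltnS => jJ iJ /=; case: ifPn => [iJ'|]; first exact: IH.
rewrite -leqNgt => Ji.
have iJ2 : (i - 2 ^ J < 2 ^ J)%N by rewrite ltn_subLR// addnn -mul2n -expnS.
have := IH (fun k => v (2 ^ J + k)%N)
  (Num.max a ((\sum_(k < 2 ^ J.+1) v k) / (2 ^ J.+1)%:R)) (i - 2 ^ J)%N jJ iJ2.
apply: le_trans; rewrite le_eqVlt; apply/orP; left; apply/eqP.
apply: eq_bigr => k _; congr v.
have d2 : (2 ^ j %| 2 ^ J)%N by rewrite dvdn_exp2l.
rewrite -{1}(subnKC Ji) divnDl// mulnDl divnK//; lia.
Qed.

(** A Bellman function argument. A node with running maximum a and mean x of v has potential (q-1)/q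
    a^q - a^(q-1) x per unit of length. This is affine in x, so it splits exactly between the two
    halves of an interval, and it does not grow when a is raised to max(a, x). *)
Lemma dyadic_max_potential (R : realType) (q : R) J (v : nat -> R) a :
  1 < q -> (forall i, 0 <= v i) -> 0 <= a ->
  \sum_(i < 2 ^ J) ((q - 1) / q * dyadic_max J v a i `^ q
                    - dyadic_max J v a i `^ (q - 1) * v i)
  <= (2 ^ J)%:R * ((q - 1) / q * a `^ q)
     - a `^ (q - 1) * \sum_(i < 2 ^ J) v i.
Proof.
move=> q1; have q0 : 0 < q by linear.
have p2 n : 0 < (2 ^ n)%:R :> R by rewrite ltr0n expn_gt0.
(* Raising the running maximum to the average does not increase the potential, by Young's inequality. *)
have step (b x : R) : 0 <= b -> 0 <= x ->
    (q - 1) / q * Num.max b x `^ q - Num.max b x `^ (q - 1) * x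
    <= (q - 1) / q * b `^ q - b `^ (q - 1) * x.
  move=> b0 x0; have [xb|bx] := leP x b; first by rewrite lexx.
  rewrite [X in _ - X <= _]mulrC (mulr_powRB1 x0 q0).
  have := young_powR q1 b0 x0.
  have -> : (q - 1) / q * x `^ q = x `^ q - x `^ q / q by field; rewrite gt_eqF.
  linear.
have stepS n (w : nat -> R) (b : R) : (forall i, 0 <= w i) -> 0 <= b ->
    forall S b', S = \sum_(k < 2 ^ n) w k -> b' = Num.max b (S / (2 ^ n)%:R) ->
    (2 ^ n)%:R * ((q - 1) / q * b' `^ q) - b' `^ (q - 1) * S <=
    (2 ^ n)%:R * ((q - 1) / q * b `^ q) - b `^ (q - 1) * S.
  move=> w0 b0 S b' -> ->; set S' := \sum_(_ < _) _.
  have S0 : 0 <= S' / (2 ^ n)%:R by rewrite divr_ge0 ?sumr_ge0// ltW.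
  have := step _ _ b0 S0; rewrite -(ler_pM2l (p2 n)) !mulrBr.
  by rewrite ![_%:R * (_ * (S' / _))]mulrCA ![_%:R * (S' / _)]mulrC divfK ?gt_eqF.
elim: J v a => [|J IH] v a v0 a0.
  by have := stepS 0%N v a v0 a0 _ _ erefl erefl; rewrite /= (_ : 2 ^ 0 = 1)%N// !big_ord1 !mul1r.
apply: le_trans (stepS J.+1 v a v0 a0 _ _ erefl erefl) => /=.
set b := Num.max _ _; have b0 : 0 <= b by rewrite le_max a0.
have := lerD (IH v b v0 b0) (IH (fun k => v (2 ^ J + k)%N) b (fun i => v0 _) b0).
move=> h; rewrite (sum_pow2S J v).
rewrite (sum_pow2S J (fun i => (q - 1) / q *
  (if (i < 2 ^ J)%N then dyadic_max J v b i
   else dyadic_max J (fun k : nat => v (2 ^ J + k)%N) b (i - 2 ^ J)) `^ q -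
  (if (i < 2 ^ J)%N then dyadic_max J v b i
   else dyadic_max J (fun k : nat => v (2 ^ J + k)%N) b (i - 2 ^ J)) `^ (q - 1) * v i)).
rewrite (eq_bigr (fun i : 'I_(2 ^ J) => (q - 1) / q * dyadic_max J v b i `^ q -
    dyadic_max J v b i `^ (q - 1) * v i)); last by move=> i _; rewrite ltn_ord.
rewrite [X in _ + X <= _](eq_bigr (fun i : 'I_(2 ^ J) => (q - 1) / q *
    dyadic_max J (fun k : nat => v (2 ^ J + k)%N) b i `^ q -
    dyadic_max J (fun k : nat => v (2 ^ J + k)%N) b i `^ (q - 1) * v (2 ^ J + i)%N)); last first.
  by move=> i _; rewrite ltnNge leq_addr/= addKn.
apply: (le_trans h).
by rewrite expnS natrM; linear.
Qed.

(** At the root the running maximum is 0 and so is the potential; hence (q-1)/q times the sum of m^q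
    is at most the sum of m^(q-1) v, and [absorb_powR] lets half of the left side absorb the part of
    the right side that contains m. *)
Lemma dyadic_max_norm (R : realType) (q : R) : 1 < q -> exists2 C : R, 0 < C &
  forall J (v : nat -> R), (forall i, 0 <= v i) ->
  \sum_(i < 2 ^ J) dyadic_max J v 0 i `^ q <= C * \sum_(i < 2 ^ J) v i `^ q.
Proof.
move=> q1; have q0 : 0 < q by linear.
set k := (q - 1) / q; have k0 : 0 < k by rewrite divr_gt0//; linear.
exists (2 / k * (2 / k) `^ (q - 1)).
  by rewrite mulr_gt0 ?powR_gt0// divr_gt0.
move=> J v v0.
have := dyadic_max_potential J q1 v0 (lexx 0).
rewrite powR0 ?gt_eqF// powR0 ?gt_eqF ?subr_gt0// mulr0 mulr0 mul0r subr0 sumrB subr_le0 -/k.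
move=> h.
have h2 : \sum_(i < 2 ^ J) dyadic_max J v 0 i `^ (q - 1) * v i <=
   \sum_(i < 2 ^ J) (k / 2 * dyadic_max J v 0 i `^ q + (2 / k) `^ (q - 1) * v i `^ q).
  apply: ler_sum => i _; apply: absorb_powR => //; exact: dyadic_max_ge.
have := le_trans h h2.
rewrite big_split/= -!mulr_sumr => h3.
have h4 : k / 2 * \sum_(i < 2 ^ J) dyadic_max J v 0 i `^ q <= (2 / k) `^ (q - 1) * \sum_(i < 2 ^ J) v i `^ q.
  by move: h3; linear.
rewrite -(ler_pM2l (_ : 0 < k / 2)) ?divr_gt0//.
apply: le_trans h4 _; rewrite le_eqVlt; apply/orP; left; apply/eqP.
  by field; rewrite gt_eqF.
by linear.
Qed.

Lemma ler_sum_inj (R : realType) (I J : finType) (w : I -> R) (u : J -> R) (g : I -> J) :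
  (forall j, 0 <= u j) -> (forall i, 0 < w i -> w i <= u (g i)) ->
  (forall i i', 0 < w i -> 0 < w i' -> g i = g i' -> i = i') ->
  \sum_i w i <= \sum_j u j.
Proof.
move=> u0 wu gI.
pose A := [set i : I | 0 < w i]%SET.
apply: (@le_trans _ _ (\sum_(i in A) u (g i))).
  rewrite [leRHS]big_mkcond/=; apply: ler_sum => i _.
  by rewrite inE; case: ifPn => [/wu//|]; rewrite -leNgt.
rewrite -(big_imset (fun j => u j)) /=; last first.
  by move=> i i'; rewrite !inE => wi wi'; exact: gI.
by rewrite big_mkcond/=; apply: ler_sum => j _; case: ifP.
Qed.

Lemma ler_sum_inj_nat (R : realType) n L (w u : nat -> R) (g : nat -> nat) :
  (forall j, 0 <= u j) -> (forall i, (i < n)%N -> 0 < w i -> w i <= u (g i) /\ (g i < L)%N) ->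
  (forall i i', 0 < w i -> 0 < w i' -> g i = g i' -> i = i') ->
  \sum_(i < n) w i <= \sum_(j < L) u j.
Proof.
case: L => [|L] u0 wu gI.
  rewrite big_ord0 sumr_le0// => i _; rewrite leNgt; apply/negP.
  by move/(wu _ (ltn_ord i)) => [].
apply: (@ler_sum_inj _ _ _ (fun i : 'I_n => w i) (fun j : 'I_L.+1 => u j) (fun i => inord (g i))) => //.
  by move=> i w0; have [h gL] := wu _ (ltn_ord i) w0; rewrite inordK.
move=> i i' w0 w0' /(congr1 val)/=; have [_ gL] := wu _ (ltn_ord i) w0.
have [_ gL'] := wu _ (ltn_ord i') w0'; rewrite !inordK// => /gI e.
by apply: val_inj; exact: e.
Qed.

Lemma powR_addr_le (R : realType) (q a b : R) : 0 <= q -> 0 <= a -> 0 <= b ->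
  (a + b) `^ q <= 2 `^ q * (a `^ q + b `^ q).
Proof.
move=> q0 a0 b0; wlog ab : a b a0 b0 / a <= b.
  move=> h; have [/h|/ltW/h] := leP a b; first exact.
  by rewrite addrC (addrC (_ `^ _)); exact.
apply: (@le_trans _ _ ((2 * b) `^ q)).
  by apply: ge0_ler_powR => //; rewrite ?nnegrE; linear.
by rewrite powRM// ler_wpM2l ?powR_ge0// lerDr powR_ge0.
Qed.

(* The two dyadic grids are the standard one and its translate by a third of the root interval:
   translating by w moves the boundaries of every scale 2^j by a third of 2^j, up to rounding. *)
Lemma one_third_trick J j c s i w : (2 ^ J = 3 * w + 2 ^ J %% 3)%N -> (0 < 2 ^ J %% 3 < 3)%N ->
  c = (2 ^ j)%N -> (j <= J)%N -> (8 * s < c)%N -> (0 < s)%N ->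
  (i %/ c * c + s <= i)%N && (i + s < (i %/ c).+1 * c)%N \/
  (i < s)%N && (i + s < c)%N \/
  ((w + i) %/ c * c + s <= w + i)%N && (w + i + s < ((w + i) %/ c).+1 * c)%N.
Proof.
move=> w3 e12 cE jJ sc s0.
have [d dE] : exists d, (2 ^ J = c * d)%N.
  by exists (2 ^ (J - j))%N; rewrite cE -expnD subnKC.
move: (2 ^ J %% 3)%N w3 e12 => e w3 e12; rewrite {}dE in w3.
have c0 : (0 < c)%N by lia.
have [a [b [iE bc ->]]] : exists a b, [/\ i = (a * c + b)%N, (b < c)%N & (i %/ c = a)%N].
  by exists (i %/ c)%N, (i %% c)%N; rewrite -divn_eq ltn_mod.
have [a' [b' [iE' bc' ->]]] :
    exists a b, [/\ (w + i = a * c + b)%N, (b < c)%N & ((w + i) %/ c = a)%N].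
  by exists ((w + i) %/ c)%N, ((w + i) %% c)%N; rewrite -divn_eq ltn_mod.
have [/andP[h1 h2]|h1] := boolP ((s <= b) && (b + s < c))%N; first by left; lia.
have [/andP[h2 h3]|h2] := boolP ((s <= b') && (b' + s < c))%N; first by right; right; lia.
exfalso; move: w3; have -> : (w = a' * c + b' - (a * c + b))%N by lia.
move=> w3.
(* If i is within s of an endpoint in both grids, the integer X with c X = 3 (b' - b) + e can only
   be 0, 3 or -3. Each of these makes e divisible by 3, which 0 < e < 3 excludes. *)
have [X XE] : exists X : int, X = d%:Z - 3 * (a'%:Z - a%:Z) by eexists.
have XY : c%:Z * X = 3 * (b'%:Z - b%:Z) + e%:Z by rewrite XE; nia.
have [[bs bs']|[[bs bs']|[[bs bs']|[bs bs']]]] :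
  (b < s)%N /\ (b' < s)%N \/ (b < s)%N /\ (c <= b' + s)%N \/
  (c <= b + s)%N /\ (b' < s)%N \/ (c <= b + s)%N /\ (c <= b' + s)%N by lia.
- have X0 : X = 0 by nia.
  by move: XY; rewrite X0; lia.
- have X0 : X = 3 by nia.
  by move: XY; rewrite X0; lia.
- have X0 : X = - 3 by nia.
  by move: XY; rewrite X0; lia.
- have X0 : X = 0 by nia.
  by move: XY; rewrite X0; lia.
Qed.

Lemma maximal_1D (R : realType) (q : R) : 1 < q -> exists2 C : R, 0 < C &
  forall n (v : nat -> R), (forall i, 0 <= v i) -> exists m : nat -> R,
  [/\ forall i, 0 <= m i,
      forall i s, (i < n)%N -> (0 < s)%N ->
        \sum_(k < n | (k <= i + s)%N && (i <= k + s)%N) v k <= C * s%:R * m i &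
      \sum_(i < n) m i `^ q <= C * \sum_(i < n) v i `^ q].
Proof.
move=> q1; have q0 : 0 < q by linear.
have [C C0 HC] := dyadic_max_norm q1.
exists (16 + 2 `^ q * (C *+ 2)).
  by rewrite addr_gt0// mulr_gt0 ?pmulrn_lgt0// powR_gt0.
move=> n v v0.
(* Four times the length of the data fits into the root interval, so the data translated by a third
   of that interval still lies inside. *)
pose J := n.+2; pose w := (2 ^ J %/ 3)%N.
have n2J : (4 * n.+1 <= 2 ^ J)%N.
  by rewrite /J 2!expnS mulnA leq_mul2l/=; exact: ltn_expl.
pose v1 i := if (i < n)%N then v i else 0.
pose v2 i := if (w <= i)%N && (i - w < n)%N then v (i - w)%N else 0.
have v10 i : 0 <= v1 i by rewrite /v1; case: ifP.
have v20 i : 0 <= v2 i by rewrite /v2; case: ifP.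
have w3 : (2 ^ J = 3 * w + 2 ^ J %% 3)%N by rewrite /w {1}(divn_eq (2 ^ J) 3) mulnC.
have e12 : (0 < 2 ^ J %% 3 < 3)%N.
  rewrite ltn_mod/= andbT lt0n; apply/eqP => h0.
  have : (3 %| 2 ^ J)%N by rewrite /dvdn h0.
  by rewrite Euclid_dvdX.
have wn : (w + n < 2 ^ J)%N by lia.
have v2w k : (k < n)%N -> v2 (w + k)%N = v k by move=> kn; rewrite /v2 leq_addr addKn kn.
have v1k k : (k < n)%N -> v1 k = v k by move=> kn; rewrite /v1 kn.
pose m i := dyadic_max J v1 0 i + dyadic_max J v2 0 (w + i).
have M0 (u : nat -> R) i : 0 <= dyadic_max J u 0 i by exact: dyadic_max_ge.
exists m; split.
- by move=> i; rewrite addr_ge0.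
- move=> i s ilt s0.
  suff [j [jJ js H]] : exists j, [/\ (j <= J)%N, (2 ^ j <= 16 * s)%N &
    \sum_(k < n | (k <= i + s)%N && (i <= k + s)%N) v k <= (2 ^ j)%:R * m i].
    apply: (le_trans H); rewrite ler_wpM2r ?addr_ge0//.
    apply: (@le_trans _ _ (16 * s%:R)); first by rewrite -natrM ler_nat.
    by rewrite ler_wpM2r// lerDl mulr_ge0 ?powR_ge0// mulrn_wge0// ltW.
  rewrite big_mkcond/=.
  have [big|small] := leqP (2 ^ J) (16 * s).
    exists J; split=> //.
    have iJ : (i < 2 ^ J)%N by lia.
    have := @dyadic_max_avg R J J v1 0 i (leqnn _) iJ.
    rewrite divn_small// mul0n => h.
    apply: (@le_trans _ _ ((2 ^ J)%:R * dyadic_max J v1 0 i)); last first.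
      by rewrite ler_wpM2l// lerDl.
    apply: le_trans h; apply: (@ler_sum_inj_nat _ _ _ (fun k => if (k <= i + s)%N && (i <= k + s)%N then v k else 0) _ id) => //.
    by move=> k kn; case: ifP => [_|]; rewrite ?ltxx// v1k// => _; split=> //; lia.
  (* Dyadic intervals of this length are long enough for the one-third trick and short enough to
     lose only a factor 16. *)
  have [j jJ /andP[sj js]] : exists2 j, (j <= J)%N & (8 * s < 2 ^ j <= 16 * s)%N.
    pose j0 := (trunc_log 2 (8 * s)).+1.
    have s8 : (0 < 8 * s)%N by rewrite muln_gt0.
    have [l1 l2] := (trunc_logP (isT : (1 < 2)%N) s8, trunc_log_ltn (8 * s) (isT : (1 < 2)%N)).
    exists j0; last by rewrite l2/= /j0 expnS; lia.
    rewrite -(leq_exp2l _ _ (isT : (1 < 2)%N)) /j0 expnS; lia.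
  exists j; split=> //.
  have [/andP[a b]|[/andP[a b]|/andP[a b]]] := one_third_trick i w3 e12 erefl jJ sj s0.
  + have iJ : (i < 2 ^ J)%N by lia.
    have h := @dyadic_max_avg R J j v1 0 i jJ iJ.
    apply: (@le_trans _ _ ((2 ^ j)%:R * dyadic_max J v1 0 i)); last by rewrite ler_wpM2l// lerDl.
    apply: le_trans h.
    apply: (@ler_sum_inj_nat _ _ _ (fun k => if (k <= i + s)%N && (i <= k + s)%N then v k else 0)
      (fun k => v1 (i %/ 2 ^ j * 2 ^ j + k)%N) (fun k => (k - i %/ 2 ^ j * 2 ^ j)%N)) => //.
    * move=> k kn; case: ifP => [kk|]; rewrite ?ltxx// => _; rewrite subnKC; last lia.
      by rewrite v1k//; split=> //; lia.
    * move=> k k'; case: ifP => [kk|]; rewrite ?ltxx// => _.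
      by case: ifP => [kk'|]; rewrite ?ltxx// => _; lia.
  + have iJ : (i < 2 ^ J)%N by lia.
    have h := @dyadic_max_avg R J j v1 0 i jJ iJ.
    apply: (@le_trans _ _ ((2 ^ j)%:R * dyadic_max J v1 0 i)); last by rewrite ler_wpM2l// lerDl.
    apply: le_trans h; rewrite divn_small ?mul0n; last lia.
    apply: (@ler_sum_inj_nat _ _ _ (fun k => if (k <= i + s)%N && (i <= k + s)%N then v k else 0)
      (fun k => v1 (0 + k)%N) id) => //.
    by move=> k kn; case: ifP => [kk|]; rewrite ?ltxx// => _; rewrite add0n v1k//; split=> //; lia.
  + have iJ : (w + i < 2 ^ J)%N by lia.
    have h := @dyadic_max_avg R J j v2 0 (w + i)%N jJ iJ.
    apply: (@le_trans _ _ ((2 ^ j)%:R * dyadic_max J v2 0 (w + i))); last by rewrite ler_wpM2l// lerDr.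
    apply: le_trans h.
    apply: (@ler_sum_inj_nat _ _ _ (fun k => if (k <= i + s)%N && (i <= k + s)%N then v k else 0)
      (fun k => v2 ((w + i) %/ 2 ^ j * 2 ^ j + k)%N) (fun k => (w + k - (w + i) %/ 2 ^ j * 2 ^ j)%N)) => //.
    * move=> k kn; case: ifP => [kk|]; rewrite ?ltxx// => _; rewrite subnKC; last lia.
      by rewrite v2w//; split=> //; lia.
    * move=> k k'; case: ifP => [kk|]; rewrite ?ltxx// => _.
      by case: ifP => [kk'|]; rewrite ?ltxx// => _; lia.
- have P0 (x : R) : 0 <= x `^ q by exact: powR_ge0.
  have z0 : 0 `^ q = 0 :> R by rewrite powR0// gt_eqF.
  have N1 : \sum_(i < 2 ^ J) v1 i `^ q <= \sum_(i < n) v i `^ q.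
    apply: (@ler_sum_inj_nat _ _ _ (fun k => v1 k `^ q) (fun k => v k `^ q) id) => //.
    by move=> k _; rewrite /v1; case: ifP; rewrite ?z0 ?ltxx.
  have N2 : \sum_(i < 2 ^ J) v2 i `^ q <= \sum_(i < n) v i `^ q.
    apply: (@ler_sum_inj_nat _ _ _ (fun k => v2 k `^ q) (fun k => v k `^ q) (subn^~ w)) => //.
      by move=> k _; rewrite /v2; case: ifP => [/andP[]|]; rewrite ?z0 ?ltxx.
    move=> k k'; rewrite /v2; case: ifP => [/andP[wk _]|]; rewrite ?z0 ?ltxx// => _.
    by case: ifP => [/andP[wk' _]|]; rewrite ?z0 ?ltxx// => _; lia.
  apply: (@le_trans _ _ (\sum_(i < n) 2 `^ q * (dyadic_max J v1 0 i `^ q + dyadic_max J v2 0 (w + i)%N `^ q))).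
    by apply: ler_sum => i _; apply: powR_addr_le => //; exact: ltW.
  rewrite -mulr_sumr big_split/=.
  have A1 : \sum_(i < n) dyadic_max J v1 0 i `^ q <= \sum_(i < 2 ^ J) dyadic_max J v1 0 i `^ q.
    apply: (@ler_sum_inj_nat _ _ _ (fun k => dyadic_max J v1 0 k `^ q) (fun k => dyadic_max J v1 0 k `^ q) id) => //.
    by move=> k kn _; split=> //; lia.
  have A2 : \sum_(i < n) dyadic_max J v2 0 (w + i)%N `^ q <= \sum_(i < 2 ^ J) dyadic_max J v2 0 i `^ q.
    apply: (@ler_sum_inj_nat _ _ _ (fun k => dyadic_max J v2 0 (w + k)%N `^ q) (fun k => dyadic_max J v2 0 k `^ q) (addn w)) => //.
      by move=> k kn _; split=> //; lia.
    by move=> k k' _ _ /addnI.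
  set S := \sum_(i < n) v i `^ q in N1 N2 *.
  have S0 : 0 <= S by exact: sumr_ge0.
  apply: (@le_trans _ _ (2 `^ q * (C *+ 2) * S)); last by rewrite ler_wpM2r// lerDr.
  rewrite -mulrA ler_wpM2l// mulr2n mulrDl lerD//.
    by apply: (le_trans A1); apply: (le_trans (HC _ _ v10)); rewrite ler_pM2l.
  by apply: (le_trans A2); apply: (le_trans (HC _ _ v20)); rewrite ler_pM2l.
Qed.

(** The one-dimensional operator is applied in each row and then to the results in each column; a
    sum over a square is an iterated sum, and the constants multiply. *)
Lemma maximal_2D (R : realType) (q : R) : 1 < q -> exists2 C : R, 0 < C &
  forall n (v : nat -> nat -> R), (forall i j, 0 <= v i j) -> exists m : nat -> nat -> R,
  [/\ forall i j, 0 <= m i j,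
      forall i j s, (i < n)%N -> (j < n)%N -> (0 < s)%N ->
        \sum_(k < n | (k <= i + s)%N && (i <= k + s)%N)
           \sum_(l < n | (l <= j + s)%N && (j <= l + s)%N) v k l <= C * s%:R ^+ 2 * m i j &
      \sum_(i < n) \sum_(j < n) m i j `^ q <= C * \sum_(i < n) \sum_(j < n) v i j `^ q].
Proof.
move=> q1; have [C C0 HC] := maximal_1D q1.
exists (C ^+ 2); first by rewrite exprn_gt0.
move=> n v v0.
have /boolp.choice [m1 Hm1] : forall k, exists m : nat -> R, [/\ forall i, 0 <= m i,
      forall i s, (i < n)%N -> (0 < s)%N ->
        \sum_(l < n | (l <= i + s)%N && (i <= l + s)%N) v k l <= C * s%:R * m i &
      \sum_(i < n) m i `^ q <= C * \sum_(i < n) v k i `^ q].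
  by move=> k; exact: HC.
have /boolp.choice [m2 Hm2] : forall j, exists m : nat -> R, [/\ forall i, 0 <= m i,
      forall i s, (i < n)%N -> (0 < s)%N ->
        \sum_(k < n | (k <= i + s)%N && (i <= k + s)%N) m1 k j <= C * s%:R * m i &
      \sum_(i < n) m i `^ q <= C * \sum_(i < n) m1 i j `^ q].
  move=> j; by apply: (HC n (m1^~ j)) => i; have [] := Hm1 i.
exists (fun i j => m2 j i); split.
- by move=> i j; have [] := Hm2 j.
- move=> i j s il jl s0; have [_ H2 _] := Hm2 j.
  apply: (@le_trans _ _ (\sum_(k < n | (k <= i + s)%N && (i <= k + s)%N) C * s%:R * m1 k j)).
    by apply: ler_sum => k _; have [_ H1 _] := Hm1 k; exact: H1.
  have -> : C ^+ 2 * s%:R ^+ 2 * m2 j i = (C * s%:R) * (C * s%:R * m2 j i) by ring.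
  rewrite -mulr_sumr ler_wpM2l//; last exact: H2.
  by rewrite mulr_ge0// ltW.
- rewrite exchange_big/=.
  apply: (@le_trans _ _ (\sum_(j < n) C * \sum_(i < n) m1 i j `^ q)).
    by apply: ler_sum => j _; have [_ _] := Hm2 j.
  rewrite -mulr_sumr exchange_big expr2 -mulrA ler_pM2l//= mulr_sumr.
  by apply: ler_sum => i _; have [_ _] := Hm1 i.
Qed.

(** * Integration of continuous functions on the plane *)

Definition cbox (R : realType) (x : plane R) (r : R) : set (plane R) :=
  `[x.1 - r, x.1 + r] `*` `[x.2 - r, x.2 + r].

Lemma cboxP (R : realType) (x w : plane R) (r : R) :
  cbox x r w <-> `|w.1 - x.1| <= r /\ `|w.2 - x.2| <= r.
Proof. by rewrite /cbox /= !in_itv/= !ler_distl. Qed.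

Lemma measurable_cbox (R : realType) (x : plane R) r : measurable (cbox x r).
Proof. by apply: measurableX; exact: measurable_itv. Qed.

Lemma leb2_cbox (R : realType) (x : plane R) r : 0 <= r ->
  leb R (cbox x r) = ((2 * r) ^+ 2)%:E.
Proof.
move=> r0; rewrite /cbox product_measure1E; [|exact: measurable_itv|exact: measurable_itv].
have h (a : R) : lebesgue_measure (`[(a - r), (a + r)]%classic : set R) = (2 * r)%:E.
  rewrite lebesgue_measure_itv/= lte_fin; case: ifPn => [_|].
    by rewrite -EFinB; congr EFin; ring.
  rewrite -leNgt => h; have -> : r = 0 by linear.
  by rewrite mulr0.
by transitivity ((2 * r)%:E * (2 * r)%:E)%E; [congr (_ * _)%E; exact: h|rewrite -EFinM expr2].
Qed.

Lemma compact_cbox (R : realType) (x : plane R) r : compact (cbox x r).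
Proof. by apply: compact_setX; exact: segment_compact. Qed.

Definition line (R : realType) (b : bool) (x : plane R) (t : R) : plane R :=
  if b then (x.1, t) else (t, x.2).

Definition coord (R : realType) (b : bool) (x : plane R) : R := if b then x.2 else x.1.

Lemma continuous_line (R : realType) b (y : plane R) : continuous (line b y).
Proof.
case: b => t; rewrite /line /continuous_at.
  by apply: (cvg_pair (G := nbhs y.1) (H := nbhs t)); [exact: cvg_cst|exact: cvg_id].
by apply: (cvg_pair (G := nbhs t) (H := nbhs y.2)); [exact: cvg_id|exact: cvg_cst].
Qed.

(** Measurability refers to the product sigma-algebra. Rounding the first coordinate down to a
    multiple of 1/(n+1) leaves a function that is measurable on each of countably many strips, and
    these functions converge pointwise to f. *)
Lemma continuous_plane_measurable (R : realType) (f : plane R -> R) :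
  continuous f -> measurable_fun setT f.
Proof.
move=> cf.
pose c n (w : plane R) : R := (Num.floor (n.+1%:R * w.1))%:~R / n.+1%:R.
pose h n (w : plane R) := f (c n w, w.2).
apply: (@measurable_fun_cvg _ _ _ _ h).
  move=> n _ Y mY; rewrite setTI.
  have -> : h n @^-1` Y = \bigcup_(k : int)
      ((fst @^-1` `[k%:~R / n.+1%:R, (k + 1)%:~R / n.+1%:R[) `&`
       ((fun w : plane R => f (k%:~R / n.+1%:R, w.2)) @^-1` Y)).
    apply/seteqP; split => w /=.
      move=> Yw; exists (Num.floor (n.+1%:R * w.1)) => //; split=> //=.
      have /andP[a b] := floor_itv (n.+1%:R * w.1).
      by rewrite in_itv/= ler_pdivrMr// ltr_pdivlMr// ![w.1 * _]mulrC a.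
    move=> [k _ [/=]]; rewrite in_itv/= ler_pdivrMr// ltr_pdivlMr// => /andP[a b] Yw.
    rewrite /h /c; have -> // : Num.floor (n.+1%:R * w.1) = k.
    by apply/eqP; rewrite floor_eq mulrC a.
  apply: countable_bigcupT_measurable => [|k]; first exact: countableP.
  apply: measurableI.
    by rewrite -[X in measurable X]setTI; exact: measurable_fst.
  have cg : continuous (fun y : R => f (k%:~R / n.+1%:R, y)).
    move=> y; apply: (@continuous_comp _ _ _ (line true (k%:~R / n.+1%:R, 0)) f); last exact: cf.
    exact: continuous_line.
  have mg := continuous_measurable_fun cg.
  have := @measurableT_comp _ _ _ _ _ _ _ _ _ mg (@measurable_snd _ _ R R).
  by move=> /(_ measurableT Y mY); rewrite setTI.
move=> w _; rewrite /h.
apply: (@cvg_comp _ _ _ (fun n => (c n w, w.2)) f \oo (nbhs w)); last exact: cf.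
have -> : nbhs w = nbhs (w.1, w.2) by case: (w).
apply: (cvg_pair (G := nbhs w.1) (H := nbhs w.2)); last exact: cvg_cst.
have h1 : (fun n => w.1 - n.+1%:R^-1) @ \oo --> w.1.
  rewrite -[X in _ --> X]subr0; apply: cvgB; [exact: cvg_cst|exact: cvg_harmonic].
apply: (@squeeze_cvgr _ _ _ _ (fun n => w.1 - n.+1%:R^-1) (fun=> w.1)) => //; last exact: cvg_cst.
near=> n.
have /andP[a b] := floor_itv (n.+1%:R * w.1).
rewrite /c ler_pdivrMr// ler_pdivlMr// [w.1 * _]mulrC a andbT mulrBl mulVf ?pnatr_eq0//.
rewrite mulrC; move: b; rewrite intrD; linear.
Unshelve. all: by end_near. Qed.

Lemma supported_bounded (R : realType) (f : plane R -> R) x r : continuous f ->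
  (forall w, ~ cbox x r w -> f w = 0) -> exists2 M, 0 < M & forall w, `|f w| <= M.
Proof.
move=> cf f0.
have : compact (f @` cbox x r).
  by apply: continuous_compact; [exact: continuous_subspaceT|exact: compact_cbox].
move=> /compact_bounded [M [_ /(_ (`|M| + 1))]].
rewrite ltr_pwDr// ?ler_norm// => /(_ isT) HM.
exists (`|M| + 1); first by rewrite ltr_wpDl.
move=> w; have [/= xL|/f0 ->] := pselect (cbox x r w); last by rewrite normr0 addr_ge0.
by apply: HM; exists w.
Qed.

Lemma integrable_supported (R : realType) (f : plane R -> R) x r M : measurable_fun setT f ->
  (forall w, ~ cbox x r w -> f w = 0) -> (forall w, `|f w| <= M) ->
  (leb R).-integrable setT (EFin \o f).
Proof.
move=> mf f0 fM.
have fE : EFin \o f = (EFin \o f) \_ (cbox x r).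
  apply/funext => w; rewrite patchE; case: ifPn => //=.
  by rewrite notin_setE => /f0 ->.
rewrite fE; have H := integrable_mkcond (mu := leb R) (EFin \o f) (measurable_cbox x r); apply H => {H}.
have [r0|r0] := leP 0 r; last first.
  rewrite (_ : cbox x r = set0); first exact: integrable_set0.
  by apply/seteqP; split => // w /cboxP[]; have := normr_ge0 (w.1 - x.1); linear.
apply: measurable_bounded_integrable; first exact: measurable_cbox.
- by apply: (@eq_ind_r _ _ (fun z => (z < +oo)%E) _ _ (leb2_cbox x r0)); rewrite ltry.
- exact: measurable_funTS.
- by exists M; split; [exact: num_real|move=> t Mt w _ /=; rewrite (le_trans (fM w))// ltW].
Qed.

Lemma integrable_continuous (R : realType) (f : plane R -> R) x r : continuous f ->
  (forall w, ~ cbox x r w -> f w = 0) -> (leb R).-integrable setT (EFin \o f).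
Proof.
move=> cf f0; have [M _ HM] := supported_bounded cf f0.
by apply: integrable_supported f0 HM; exact: continuous_plane_measurable.
Qed.

Lemma integral_derivative_step (R : realType) (F f : R -> R) (a L A B : R) :
  (forall t : R, is_derive t 1 F (f t)) -> continuous f ->
  (forall t, t < a - L -> F t = A) -> (forall t, a + L < t -> F t = B) ->
  (forall t, L < `|t - a| -> f t = 0) ->
  (\int[lebesgue_measure]_t (f t)%:E = (B - A)%:E)%E.
Proof.
move=> dF cf FA FB f0.
pose b := a - `|L| - 1; pose c := a + `|L| + 1.
have bc : b < c by rewrite /b/c; have := normr_ge0 L; linear.
have Lb : b < a - L by rewrite /b; have := ler_norm L; linear.
have Lc : a + L < c by rewrite /c; have := ler_norm L; linear.
have cF t : {for t, continuous F}.
  apply: differentiable_continuous; apply/derivable1_diffP.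
  exact: (@ex_derive _ _ _ _ _ _ _ (dF t)).
have := @continuous_FTC2 R f F b c bc (continuous_subspaceT cf).
rewrite (FA b)// (FB c)// -EFinB => <-.
- rewrite [RHS]integral_mkcond; apply: eq_integral => t _; rewrite patchE; case: ifPn => //.
  rewrite notin_setE/= in_itv/= => /negP; rewrite negb_and -!ltNge => h.
  rewrite f0//; have hL := ler_norm L; have hL0 := normr_ge0 L; case/orP: h; rewrite /b/c => h.
    rewrite ltr0_norm; linear.
  rewrite gtr0_norm; linear.
- split.
  + by move=> t _; exact: (@ex_derive _ _ _ _ _ _ _ (dF t)).
  + exact/cvg_at_right_filter/cF.
  + exact/cvg_at_left_filter/cF.
- by move=> t _; rewrite derive1E (@derive_val _ _ _ _ _ _ _ (dF t)).
Qed.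

Lemma integral_derivative_supported (R : realType) (F f : R -> R) (a L : R) :
  (forall t : R, is_derive t 1 F (f t)) -> continuous f ->
  (forall t, L < `|t - a| -> F t = 0) -> (forall t, L < `|t - a| -> f t = 0) ->
  (\int[lebesgue_measure]_t (f t)%:E = 0)%E.
Proof.
move=> dF cf F0 f0; rewrite (@integral_derivative_step _ F f a L 0 0)// ?subrr// => t h; apply: F0.
  by rewrite ltr_normr; apply/orP; right; linear.
by rewrite ltr_normr; apply/orP; left; linear.
Qed.

Lemma partial_line (R : realType) b (f : plane R -> R) x :
  partial b f x = derive1 (fun t => f (line b x t)) (coord b x).
Proof.
rewrite /partial /dir /derive1 /derive; set g := (fun h : R => _); set k := (fun h : R => _); suff -> : g = k by [].
rewrite /g /k; apply/funext => h {g k}; rewrite /line /coord /=; congr (_ *: (f _ - f _)); case: b; case: x => //= x1 x2; congr pair.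
all: by rewrite /= ?[_ *: 0]mulr0 ?[_ *: 1]mulr1 ?add0r.
Qed.

(** Fubini with the inner integral along [line b], which vanishes by the fundamental theorem of
    calculus. *)
Lemma integral_partial_supported (R : realType) b (H h : plane R -> R) x r :
  (forall w, is_derive (coord b w) 1 (fun t => H (line b w t)) (h w)) -> continuous h ->
  (forall w, ~ cbox x r w -> H w = 0) -> (forall w, ~ cbox x r w -> h w = 0) ->
  (\int[leb R]_w (h w)%:E = 0)%E.
Proof.
move=> dH ch H0 h0.
have ih := integrable_continuous ch h0.
have hl y t : h (line b y t) = h (line b y t) by [].
have key y : (\int[lebesgue_measure]_t (h (line b y t))%:E = 0)%E.
  apply: (@integral_derivative_supported R (fun t => H (line b y t)) _ (coord b x) r).
  - move=> t; have := dH (line b y t); case: (b) => //.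
  - move=> t; apply: (@continuous_comp _ _ _ (line b y) h); last exact: ch.
    exact: continuous_line.
  - move=> t rt; apply: H0 => /cboxP[]; case: (b) rt => /= rt a c; linear.
  - move=> t rt; apply: h0 => /cboxP[]; case: (b) rt => /= rt a c; linear.
case: b key {dH hl} => key.
  rewrite -(integral12_prod_meas1 ih) /fubini_F.
  rewrite (eq_integral (fun=> 0%E)) ?integral0// => y _.
  exact: (key (y, 0)).
rewrite -(integral21_prod_meas1 ih) /fubini_G.
rewrite (eq_integral (fun=> 0%E)) ?integral0// => y _.
exact: (key (0, y)).
Qed.

(** * Tensor test functions *)

(** The test functions of the estimates are built from products of two functions of one variable:
    partial derivatives of such products are again of this form, which reduces smoothness on the
    plane to one variable. *)
Definition tensor (R : realType) (u v : R -> R) : plane R -> R := fun w => u w.1 * v w.2.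

Lemma fst_differentiable (R : realType) (x : plane R) : differentiable (fst : plane R -> R) x.
Proof.
have lin : linear (fst : plane R -> R) by [].
pose M := GRing.isLinear.Build _ _ _ _ _ lin.
pose L : {linear plane R -> R} := HB.pack (fst : plane R -> R) M.
by apply: (@linear_differentiable _ _ _ L) => y; exact: cvg_fst.
Qed.

Lemma snd_differentiable (R : realType) (x : plane R) : differentiable (snd : plane R -> R) x.
Proof.
have lin : linear (snd : plane R -> R) by [].
pose M := GRing.isLinear.Build _ _ _ _ _ lin.
pose L : {linear plane R -> R} := HB.pack (snd : plane R -> R) M.
by apply: (@linear_differentiable _ _ _ L) => y; exact: cvg_snd.
Qed.

Lemma tensor_differentiable (R : realType) (u v : R -> R) x :
  smooth u -> smooth v -> differentiable (tensor u v) x.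
Proof.
move=> su sv.
have du t : differentiable u t.
  by apply/derivable1_diffP; have [h _] := smooth_derive su; exact: (@ex_derive _ _ _ _ _ _ _ (h t)).
have dv t : differentiable v t.
  by apply/derivable1_diffP; have [h _] := smooth_derive sv; exact: (@ex_derive _ _ _ _ _ _ _ (h t)).
have -> : tensor u v = (u \o fst) * (v \o snd) by [].
apply: differentiableM; apply: differentiable_comp => //.
  exact: fst_differentiable.
exact: snd_differentiable.
Qed.

Lemma tensor_continuous (R : realType) (u v : R -> R) : smooth u -> smooth v -> continuous (tensor u v).
Proof. by move=> su sv x; apply: differentiable_continuous; exact: tensor_differentiable. Qed.

Lemma partial_tensor (R : realType) b (u v : R -> R) : smooth u -> smooth v ->
  partial b (tensor u v) = if b then tensor u (derive1 v) else tensor (derive1 u) v.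
Proof.
move=> su sv; apply/funext => x; rewrite partial_line.
have [hu _] := smooth_derive su; have [hv _] := smooth_derive sv.
case: b; rewrite /line/tensor/coord/= derive1E.
  have h := @is_deriveZ _ _ _ v (u x.1) x.2 1 _ (hv x.2).
  by rewrite (_ : (fun t => u x.1 * v t) = u x.1 \*: v)// (@derive_val _ _ _ _ _ _ _ h).
have h := @is_deriveZ _ _ _ u (v x.2) x.1 1 _ (hu x.1).
rewrite (_ : (fun t => u t * v x.2) = v x.2 \*: u).
  by rewrite (@derive_val _ _ _ _ _ _ _ h) mulrC.
by apply/funext => t; rewrite mulrC.
Qed.

Lemma dpart_tensor (R : realType) s (u v : R -> R) : smooth u -> smooth v ->
  exists u' v', [/\ smooth u', smooth v' & dpart s (tensor u v) = tensor u' v'].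
Proof.
move=> su sv; elim: s => [|b s [u' [v' [su' sv' e]]]]; first by exists u, v.
rewrite /= e partial_tensor//; case: b.
  by exists u', (derive1 v'); split=> //; have [] := smooth_derive sv'.
by exists (derive1 u'), v'; split=> //; have [] := smooth_derive su'.
Qed.

Definition supp_in (R : realType) (a r : R) (u : R -> R) := forall t, r < `|t - a| -> u t = 0.

Lemma tensor_supp (R : realType) (u v : R -> R) (x : plane R) r :
  supp_in x.1 r u -> supp_in x.2 r v -> forall w, ~ cbox x r w -> tensor u v w = 0.
Proof.
move=> su sv w /cboxP h; rewrite /tensor.
have [h1|h1] := leP `|w.1 - x.1| r; last by rewrite su// mul0r.
have [h2|h2] := leP `|w.2 - x.2| r; last by rewrite sv// mulr0.
by exfalso; apply: h.
Qed.

Lemma tensor_test (R : realType) (u v : R -> R) (x : plane R) r : smooth u -> smooth v ->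
  supp_in x.1 r u -> supp_in x.2 r v -> test_function (tensor u v).
Proof.
move=> su sv hu hv; split=> [s w|].
  by have [u' [v' [su' sv' ->]]] := dpart_tensor s su sv; exact: tensor_differentiable.
apply: (@subclosed_compact _ _ (cbox x r)).
- exact: closed_closure.
- exact: compact_cbox.
- rewrite [X in _ `<=` X](iffLR (closure_id (cbox x r))); last first.
    by apply: compact_closed; [exact: norm_hausdorff|exact: compact_cbox].
  apply: closure_subset => w /= /eqP t0; apply: contrapT => /(tensor_supp hu hv); exact: t0.
Qed.

(** [fine] sends infinite values to 0, so additivity is claimed only for continuous functions paired
    with continuous functions of bounded support, where the integral is finite. *)
Definition pairing (R : realType) (F Phi : plane R -> R) : R :=
  fine (\int[leb R]_w (F w * Phi w)%:E)%E.

Lemma pairing_integrable (R : realType) (F Phi : plane R -> R) x r :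
  continuous F -> continuous Phi -> (forall w, ~ cbox x r w -> Phi w = 0) ->
  (leb R).-integrable setT (EFin \o (fun w => F w * Phi w)).
Proof.
move=> cF cP P0; apply: (@integrable_continuous _ _ x r).
  by move=> w; apply: continuousM; [exact: cF|exact: cP].
by move=> w /P0 ->; rewrite mulr0.
Qed.

Lemma pairingD (R : realType) (F Phi Psi : plane R -> R) x r :
  continuous F -> continuous Phi -> continuous Psi ->
  (forall w, ~ cbox x r w -> Phi w = 0) -> (forall w, ~ cbox x r w -> Psi w = 0) ->
  pairing F (fun w => Phi w + Psi w) = pairing F Phi + pairing F Psi.
Proof.
move=> cF c1 c2 s1 s2.
have i1 := pairing_integrable cF c1 s1; have i2 := pairing_integrable cF c2 s2.
rewrite /pairing -fineD; [|exact: integrable_fin_num|exact: integrable_fin_num].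
by rewrite -integralD_EFin//; congr fine; apply: eq_integral => w _; rewrite mulrDr.
Qed.

Lemma pairingZ (R : realType) (F Phi : plane R -> R) c x r :
  continuous F -> continuous Phi -> (forall w, ~ cbox x r w -> Phi w = 0) ->
  pairing F (fun w => c * Phi w) = c * pairing F Phi.
Proof.
move=> cF c1 s1; have i1 := pairing_integrable cF c1 s1.
have := @RintegralZl _ _ _ (leb R) setT _ c measurableT i1.
by rewrite /Rintegral /pairing => <-; congr fine; apply: eq_integral => w _; rewrite mulrCA.
Qed.

Lemma pairing_linear (R : realType) (F G Phi : plane R -> R) a x r :
  continuous F -> continuous G -> continuous Phi -> (forall w, ~ cbox x r w -> Phi w = 0) ->
  pairing (fun w => a * F w + G w) Phi = a * pairing F Phi + pairing G Phi.
Proof.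
move=> cF cG c1 s1; have i1 := pairing_integrable cF c1 s1; have i2 := pairing_integrable cG c1 s1.
have caF : continuous (fun w => a * F w) by move=> w; apply: continuousM; [exact: cst_continuous|exact: cF].
have i3 := pairing_integrable caF c1 s1.
have := @RintegralZl _ _ _ (leb R) setT _ a measurableT i1; rewrite /Rintegral /pairing => <-.
rewrite -fineD; [|apply: integrable_fin_num|exact: integrable_fin_num] => //.
- rewrite -integralD_EFin//; last by apply: eq_integrable i3 => // w _ /=; rewrite mulrA.
  by congr fine; apply: eq_integral => w _ /=; rewrite -EFinD mulrDl mulrA.
- by apply: eq_integrable i3 => // w _ /=; rewrite mulrA.
Qed.

(** * Weak Hessians and their local energies *)

Definition gam (R : realType) (g : bool -> bool -> plane R -> R) (w : plane R) : R :=
  \sum_(i : bool) \sum_(j : bool) `|g i j w|.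

(** An integral without the q-th root, of the entrywise l^1 norm [gam], which is subadditive
    pointwise. The value is meaningful when the integral is finite, as [energy_fin] ensures on
    squares for positive exponents up to p. *)
Definition energy (R : realType) (q : R) (g : bool -> bool -> plane R -> R) (B : set (plane R)) : R :=
  fine (\int[leb R]_(w in B) (gam g w `^ q)%:E)%E.

Definition sobolev (R : realType) (p : R) (F : plane R -> R) (g : bool -> bool -> plane R -> R) :=
  [/\ continuous F, weak_hessian F g & (\int[leb R]_w (gam g w `^ p)%:E < +oo)%E].

Lemma gam_ge0 (R : realType) (g : bool -> bool -> plane R -> R) w : 0 <= gam g w.
Proof. by apply: sumr_ge0 => i _; apply: sumr_ge0. Qed.

Lemma gam_ge (R : realType) (g : bool -> bool -> plane R -> R) i j w : `|g i j w| <= gam g w.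
Proof.
rewrite /gam (bigD1 i)//= (bigD1 j)//= -addrA lerDl addr_ge0//; apply: sumr_ge0 => // k _.
exact: sumr_ge0.
Qed.

Lemma measurable_gam (R : realType) (F : plane R -> R) g : weak_hessian F g -> measurable_fun setT (gam g).
Proof.
move=> wh; rewrite /gam; apply: measurable_sum => i; apply: measurable_sum => j.
by apply: measurableT_comp => //; have [] := wh i j.
Qed.

Lemma measurable_EFinS (R : realType) (D : set (plane R)) (f : plane R -> R) :
  measurable_fun setT f -> measurable_fun D (fun w => (f w)%:E).
Proof. by move=> mf; apply/measurable_EFinP; exact: measurable_funTS. Qed.

Lemma fine_abs_le (R : realType) (x : \bar R) (c : R) : (`|x| <= c%:E)%E -> `|fine x| <= c.
Proof.
by case: x => [r| |] /=; rewrite ?leye_eq// lee_fin => ?.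
Qed.

Lemma measurable_gam_powR (R : realType) (F : plane R -> R) g (s : R) :
  weak_hessian F g -> measurable_fun setT (fun w => gam g w `^ s).
Proof.
move=> wh; apply: (@measurableT_comp _ _ _ _ _ _ (@powR R ^~ s)); first exact: measurable_powR.
exact: measurable_gam wh.
Qed.

(** Pointwise gam^q is at most 1 + gam^p, and a square has finite area. *)
Lemma energy_fin (R : realType) (p q : R) F g x r : 0 < q <= p -> sobolev p F g ->
  (\int[leb R]_(w in cbox x r) (gam g w `^ q)%:E < +oo)%E.
Proof.
move=> /andP[q0 qp] [cF wh fin].
have mg := measurable_gam wh.
have mP (s : R) : measurable_fun setT (fun w => gam g w `^ s).
  exact: measurable_gam_powR wh.
apply: (@le_lt_trans _ _ (\int[leb R]_(w in cbox x r) (1 + gam g w `^ p)%:E)%E).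
  apply: ge0_le_integral => //.
  - exact: measurable_cbox.
  - by move=> w _; rewrite lee_fin powR_ge0.
  - by apply: measurable_EFinS; exact: mP.
  - by apply: measurable_EFinS; apply: measurable_funD => //; exact: mP.
  - move=> w _; rewrite lee_fin; have [g1|g1] := leP (gam g w) 1.
      rewrite -[leLHS]addr0 lerD ?powR_ge0//.
      have -> : 1 = 1 `^ q :> R by rewrite powR1.
      apply: ge0_ler_powR; rewrite ?nnegrE ?gam_ge0//; linear.
    by rewrite -[leLHS]add0r lerD// ler_powR// ltW.
under eq_integral do rewrite EFinD.
rewrite ge0_integralD//; last 3 first.
- exact: measurable_cbox.
- by move=> w _; rewrite lee_fin powR_ge0.
- by apply: measurable_EFinS; exact: mP.
apply: lte_add_pinfty.
  rewrite integral_cst ?mul1e; last exact: measurable_cbox.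
  have [r0|r0] := leP 0 r.
    by apply: (@eq_ind_r _ _ (fun z => (z < +oo)%E) _ _ (leb2_cbox x r0)); rewrite ltry.
  rewrite (_ : cbox x r = set0) ?measure0//.
  by apply/seteqP; split => // w /cboxP[]; have := normr_ge0 (w.1 - x.1); linear.
apply: le_lt_trans fin; apply: ge0_subset_integral => //.
- exact: measurable_cbox.
- by apply: measurable_EFinS; exact: mP.
- by move=> w _; rewrite lee_fin powR_ge0.
Qed.

Lemma energy_ge0 (R : realType) (q : R) g (B : set (plane R)) : 0 <= energy q g B.
Proof. by apply: fine_ge0; apply: integral_ge0 => w _; rewrite lee_fin powR_ge0. Qed.

(* Young's inequality [gam <= l (1 + (gam/l)^q)], optimised in [l], replaces Hoelder's inequality. *)
Lemma pairing_bound (R : realType) (p q : R) F g x r i j (Phi : plane R -> R) M :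
  1 <= q <= p -> sobolev p F g -> 0 < r -> 0 <= M -> measurable_fun setT Phi ->
  (forall w, ~ cbox x r w -> Phi w = 0) -> (forall w, `|Phi w| <= M) ->
  `|pairing (g i j) Phi| <= 5 * M * r `^ (2 - 2 / q) * (energy q g (cbox x r)) `^ q^-1.
Proof.
move=> /andP[q1 qp] sob r0 M0 mPhi Phi0 PhiM; have [cF wh fin] := sob.
have q0 : 0 < q by linear.
have [mg _] := wh i j; have mG := measurable_gam wh.
have mbox := measurable_cbox x r.
have mP (s : R) : measurable_fun setT (fun w => gam g w `^ s).
  exact: measurable_gam_powR wh.
set I := energy q g (cbox x r).
have I0 : 0 <= I by exact: energy_ge0.
have IE : (\int[leb R]_(w in cbox x r) (gam g w `^ q)%:E = I%:E)%E.
  rewrite /I /energy fineK// ge0_fin_numE; first by apply: energy_fin sob; rewrite q0.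
  by apply: integral_ge0 => w _; rewrite lee_fin powR_ge0.
have key (l : R) : 0 < l -> `|pairing (g i j) Phi| <= M * l * (4 * r ^+ 2 + l `^ (- q) * I).
  move=> l0; rewrite /pairing -lee_fin.
  have mprod : measurable_fun setT (fun w => g i j w * Phi w) by exact: measurable_funM.
  have le1 : (`|\int[leb R]_w (g i j w * Phi w)%:E| <= (M * l * (4 * r ^+ 2 + l `^ (- q) * I))%:E)%E.
    apply: le_trans (le_abse_integral _ _ _) _ => //; first exact/measurable_EFinP.
    apply: (@le_trans _ _ (\int[leb R]_(w in cbox x r) (M * l * (1 + l `^ (- q) * gam g w `^ q))%:E)%E).
      rewrite [leRHS]integral_mkcond; apply: ge0_le_integral => //.
      - by apply: measurableT_comp => //; exact/measurable_EFinP.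
      - apply: (iffLR (measurable_restrictT _ _)) => //.
        apply: measurable_EFinS; apply: measurable_funM => //.
        by apply: measurable_funD => //; apply: measurable_funM => //; exact: mP.
      - move=> w _ /=; rewrite patchE; case: ifPn => [_|]; last first.
          by rewrite notin_setE => /Phi0 ->; rewrite mulr0 normr0.
        rewrite lee_fin normrM mulrC -mulrA ler_pM// (le_trans (gam_ge g i j w))//.
        rewrite powRN -ler_pdivrMl// mulrC.
        have -> : (l `^ q)^-1 * gam g w `^ q = (gam g w / l) `^ q.
          rewrite powRM ?gam_ge0 ?invr_ge0 1?ltW// mulrC; congr (_ * _).
          by rewrite -[l^-1]powR_inv1 ?ltW// -powRrM mulN1r powRN.
        have u0 : 0 <= gam g w / l by rewrite divr_ge0 ?gam_ge0// ltW.
        have [u1|u1] := leP (gam g w / l) 1; first by rewrite ler_wpDr ?powR_ge0.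
        by rewrite ler_wpDl// -[leLHS]powRr1// ler_powR// ltW.
    under eq_integral do rewrite EFinM.
    rewrite ge0_integralZl//; last 3 first.
    - apply: measurable_EFinS; apply: measurable_funD => //; apply: measurable_funM => //; exact: mP.
    - by move=> w _; rewrite lee_fin addr_ge0// mulr_ge0// powR_ge0.
    - by rewrite lee_fin mulr_ge0// ltW.
    rewrite [leRHS]EFinM lee_wpmul2l//; first by rewrite lee_fin mulr_ge0// ltW.
    under eq_integral do rewrite EFinD.
    rewrite ge0_integralD//; last 2 first.
    - by move=> w _; rewrite lee_fin mulr_ge0// powR_ge0.
    - by apply: measurable_EFinS; apply: measurable_funM => //; exact: mP.
    under [X in (_ + X)%E]eq_integral do rewrite EFinM.
    rewrite ge0_integralZl//; last 3 first.
    - by apply: measurable_EFinS; exact: mP.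
    - by move=> w _; rewrite lee_fin powR_ge0.
    - by rewrite lee_fin powR_ge0.
    rewrite IE integral_cst// mul1e.
    apply: (@eq_ind_r _ _ (fun z => (z + _ <= _)%E) _ _ (leb2_cbox x (ltW r0))).
    by rewrite -EFinM -EFinD lee_fin lerD2r exprMn -natrX.
  by rewrite lee_fin; exact: fine_abs_le.
(* For zero energy no l is optimal: the bound tends to 0 with l. A value of l proportional to the
   pairing already makes the bound smaller than the pairing. *)
have [I0'|I0'] := eqVneq I 0.
  rewrite I0' powR0 ?mulr0; last by rewrite invr_neq0// gt_eqF.
  rewrite leNgt; apply/negP => P0.
  have r20 : 0 < r ^+ 2 by rewrite exprn_gt0.
  have d0 : 0 < 8 * (M + 1) * r ^+ 2 by rewrite mulr_gt0// mulr_gt0// ltr_wpDl.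
  have := key _ (divr_gt0 P0 d0); rewrite I0' mulr0 addr0; set P := `|_|.
  have -> : M * (P / (8 * (M + 1) * r ^+ 2)) * (4 * r ^+ 2) = P * (M / (2 * (M + 1))).
    have M1 : M + 1 != 0 by rewrite gt_eqF// ltr_wpDl.
    by field; rewrite M1 gt_eqF.
  apply/negP; rewrite -ltNge -[ltRHS]mulr1 ltr_pM2l// ltr_pdivrMr; linear.
have I1 : 0 < I by rewrite lt0r I0' I0.
(* The optimal l: it makes l^(-q) times the energy equal to [r ^+ 2], the order of the other
   term. *)
have l0 : 0 < I `^ q^-1 * r `^ (- (2 / q)) by rewrite mulr_gt0// powR_gt0.
apply: le_trans (key _ l0) _.
have lq : (I `^ q^-1 * r `^ (- (2 / q))) `^ (- q) * I = r ^+ 2.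
  rewrite powRM ?powR_ge0// -!powRrM.
  have -> : q^-1 * - q = - 1 by field; rewrite gt_eqF.
  have -> : - (2 / q) * - q = 2 by field; rewrite gt_eqF.
  by rewrite powR_inv1// -(powR_mulrn 2 (ltW r0)) mulrAC mulVf ?mul1r.
rewrite lq (_ : 4 * r ^+ 2 + r ^+ 2 = 5 * r ^+ 2); last by ring.
rewrite powRD; last by rewrite (gt_eqF r0) implybT.
rewrite (powR_mulrn 2 (ltW r0)) le_eqVlt; apply/orP; left; apply/eqP; ring.
Qed.

(** * Local polynomial approximation *)

(* [T 0] interpolates smoothly between 0 and the identity, and [T k] is its k-th derivative;
   thus [T 2] is a bump of integral 1 and vanishing first moment whose primitives are explicit. *)
Definition bump_tower (R : realType) (T : nat -> R -> R) (M : R) :=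
  [/\ forall k, smooth (T k) /\ (forall u : R, is_derive u 1 (T k) (T k.+1 u)),
      forall u, u < -1 -> T 0 u = 0 /\ T 1 u = 0,
      forall u, 1 < u -> T 0 u = u /\ T 1 u = 1,
      forall k, (2 <= k)%N -> supp_in 0 1 (T k) &
      1 <= M /\ (forall u, `|T 0 u| <= M + `|u|) /\ forall k u, (1 <= k <= 3)%N -> `|T k u| <= M].

(** The derivatives of u s(u), with s a smooth step from 0 to 1. Only T 0 is unbounded, and it grows
    like u; hence the separate bound M + |u|. *)
Lemma bump_tower_exists (R : realType) : exists T (M : R), bump_tower T M.
Proof.
have [s [ss s0 s1]] := smooth_step R.
pose T k := iter k (@derive1 R R) (fun u => u * s u).
have sT k : smooth (T k).
  elim: k => [|k IH]; first by apply: smoothM => //; exact: smooth_id.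
  by rewrite /T iterS; have [] := smooth_derive IH.
have dT k (u : R) : is_derive u 1 (T k) (T k.+1 u).
  by have [h _] := smooth_derive (sT k); exact: h.
have Teq k (u c : R) (f : R -> R) (N : set R) : nbhs u N -> (forall v, N v -> T k v = f v) ->
    is_derive u 1 f c -> T k.+1 u = c.
  move=> uN TN df.
  have := @near_eq_is_derive _ _ _ f (T k) u 1 c _ df.
  move=> h; have {}h : is_derive u 1 (T k) c by apply: h; apply: filterS uN => v /TN.
  by rewrite -(@derive_val _ _ _ _ _ _ _ h) -(@derive_val _ _ _ _ _ _ _ (dT k u)).
have lo (u : R) : u < -1 -> nbhs u [set v | v < -1] by exact: lt_nbhsl.
have hi (u : R) : 1 < u -> nbhs u [set v | 1 < v] by exact: lt_nbhsr.
have T0lo u : u < -1 -> T 0 u = 0 by move=> h; rewrite /T/= s0 ?mulr0// ltW.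
have T0hi u : 1 < u -> T 0 u = u by move=> h; rewrite /T/= s1 ?mulr1// ltW.
have T1lo u : u < -1 -> T 1 u = 0.
  by move=> h; apply: (Teq 0 u 0 (fun=> 0) _ (lo _ h)) => v /T0lo.
have T1hi u : 1 < u -> T 1 u = 1.
  by move=> h; apply: (Teq 0 u 1 id _ (hi _ h)) => v /T0hi.
have T2 k u : 1 < `|u| -> T k.+2 u = 0.
  elim: k u => [|k IH] u.
    rewrite ltr_normr => /orP[h|h].
      by apply: (Teq 1 u 0 (fun=> 1) _ (hi _ h)) => v /T1hi.
    have h' : u < -1 by linear.
    by apply: (Teq 1 u 0 (fun=> 0) _ (lo _ h')) => v /T1lo.
  rewrite ltr_normr => /orP[h|h].
    apply: (Teq k.+2 u 0 (fun=> 0) _ (hi _ h)) => v /= hv.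
    by apply: IH; rewrite gtr0_norm//; linear.
  have h' : u < -1 by linear.
  apply: (Teq k.+2 u 0 (fun=> 0) _ (lo _ h')) => v /= hv.
  by apply: IH; rewrite ltr0_norm; linear.
have cT k := smooth_cont (sT k).
have bd (f : R -> R) : continuous f -> exists M, 0 < M /\ forall u, `|u| <= 1 -> `|f u| <= M.
  move=> cf; have : compact (f @` `[- 1, 1]).
    by apply: continuous_compact; [exact: continuous_subspaceT|exact: segment_compact].
  move=> /compact_bounded [M [_ /(_ (`|M| + 1))]].
  rewrite ltr_pwDr// ?ler_norm// => /(_ isT) HM.
  exists (`|M| + 1); split; first by rewrite ltr_wpDl.
  by move=> x x1; apply: HM; exists x => //; rewrite /= in_itv/= -ler_norml.
have [M0 [M00 H0]] := bd _ (cT 0%N); have [M1 [M10 H1]] := bd _ (cT 1%N).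
have [M2 [M20 H2]] := bd _ (cT 2%N); have [M3 [M30 H3]] := bd _ (cT 3%N).
exists T, (M0 + M1 + M2 + M3 + 1); split=> //.
- by move=> u h; rewrite T0lo ?T1lo.
- by move=> u h; rewrite T0hi ?T1hi.
- by move=> k k2 u; rewrite subr0; case: k k2 => [|[|k]]// _; exact: T2.
- split; first linear.
  split=> [u|k u].
    have [u1|] := leP `|u| 1; first by have := H0 u u1; have := normr_ge0 u; linear.
    have := normr_ge0 u; rewrite ltr_normr => nu /orP[h|h]; first by rewrite T0hi//; linear.
    by rewrite T0lo ?normr0; linear.
  case: k => [|[|[|[|k]]]]// _.
  + have [u1|] := leP `|u| 1; first by have := H1 u u1; linear.
    rewrite ltr_normr => /orP[h|h]; first by rewrite T1hi// normr1; linear.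
    by rewrite T1lo ?normr0; linear.
  + have [u1|h] := leP `|u| 1; first by have := H2 u u1; linear.
    by rewrite (T2 0%N)// normr0; linear.
  + have [u1|h] := leP `|u| 1; first by have := H3 u u1; linear.
    by rewrite (T2 1%N)// normr0; linear.
Qed.

(** The k-th derivative in w of t T_0((w - x)/t); for k = 2 it is a bump of integral 1 around x with
    radius t. The argument is written as an affine function to match [smooth_affine]. *)
Definition rescale (R : realType) (T : nat -> R -> R) (t x : R) (k : nat) (w : R) : R :=
  t * t^-1 ^+ k * T k (t^-1 * w + (- (x / t))).

Section Rescale.
Variables (R : realType) (T : nat -> R -> R) (M : R).
Hypothesis HT : bump_tower T M.

Lemma rescale_smooth t x k : smooth (rescale T t x k).
Proof.
have [h _ _ _ _] := HT; have [sk _] := h k.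
by apply: smoothM; [exact: smooth_cst|exact: smooth_affine].
Qed.

Lemma rescale_is_derive t x k (w : R) : is_derive w 1 (rescale T t x k) (rescale T t x k.+1 w).
Proof.
have [h _ _ _ _] := HT; have [_ dk] := h k.
have d1 := @is_derive1_comp _ (T k) (fun w => t^-1 * w + - (x / t)) w _ _ (dk _) (is_derive_affine _ _ w).
apply: is_derive_eq (@is_deriveZ _ _ _ _ (t * t^-1 ^+ k) w 1 _ d1) _.
by rewrite /rescale exprSr /GRing.scale/=; ring.
Qed.

Lemma rescale_derive t x k : derive1 (rescale T t x k) = rescale T t x k.+1.
Proof.
by apply/funext => w; rewrite derive1E (@derive_val _ _ _ _ _ _ _ (rescale_is_derive t x k w)).
Qed.

Lemma rescale_arg (t x w : R) : t^-1 * w + - (x / t) = (w - x) / t.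
Proof. by rewrite mulrBl [w / t]mulrC. Qed.

Lemma rescale_supp t x k : 0 < t -> (2 <= k)%N -> supp_in x t (rescale T t x k).
Proof.
have [_ _ _ h _] := HT => t0 k2 w tw; rewrite /rescale h ?mulr0// subr0.
by rewrite rescale_arg normrM normfV (gtr0_norm t0) ltr_pdivlMr// mul1r.
Qed.

Lemma rescale_bound t x k w : 0 < t -> (1 <= k <= 3)%N -> `|rescale T t x k w| <= M * t * t^-1 ^+ k.
Proof.
have [_ _ _ _ [_ [_ h]]] := HT => t0 k13; rewrite /rescale normrM mulrC -mulrA ler_pM//; first exact: h.
by rewrite ger0_norm// mulr_ge0 ?exprn_ge0 ?invr_ge0 ?ltW.
Qed.

(* Second primitive of the remainder [phi_y - phi_x + (y - x) phi_x']. *)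
Definition remainder0 (t s x y w : R) : R :=
  rescale T s y 0 w + (- 1 * rescale T t x 0 w + (y - x) * rescale T t x 1 w).

(** A primitive of phi_y - phi_x; its support is bounded because the two bumps have the same
    integral. *)
Definition remainder1 (t s x y w : R) : R :=
  rescale T s y 1 w + - 1 * rescale T t x 1 w.

Lemma combo_derive (f g h : R -> R) a b : smooth f -> smooth g -> smooth h ->
  derive1 (fun w => f w + (a * g w + b * h w)) =
  (fun w => derive1 f w + (a * derive1 g w + b * derive1 h w)).
Proof.
move=> sf sg sh; have [df _] := smooth_derive sf; have [dg _] := smooth_derive sg.
have [dh _] := smooth_derive sh; apply/funext => w; rewrite derive1E.
have d := is_deriveD (df w) (is_deriveD (is_deriveZ a (dg w)) (is_deriveZ b (dh w))).
exact: (@derive_val _ _ _ _ _ _ _ d).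
Qed.

Lemma combo2_derive (f g : R -> R) a : smooth f -> smooth g ->
  derive1 (fun w => f w + a * g w) = (fun w => derive1 f w + a * derive1 g w).
Proof.
move=> sf sg; have [df _] := smooth_derive sf; have [dg _] := smooth_derive sg.
apply/funext => w; rewrite derive1E; have d := is_deriveD (df w) (is_deriveZ a (dg w)).
exact: (@derive_val _ _ _ _ _ _ _ d).
Qed.

Lemma remainder0_smooth t s x y : smooth (remainder0 t s x y).
Proof.
apply: smoothD; first exact: rescale_smooth.
by apply: smoothD; apply: smoothM; try exact: smooth_cst; exact: rescale_smooth.
Qed.

Lemma remainder1_smooth t s x y : smooth (remainder1 t s x y).
Proof.
apply: smoothD; first exact: rescale_smooth.
by apply: smoothM; [exact: smooth_cst|exact: rescale_smooth].
Qed.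

Lemma remainder0_derive2 t s x y : derive1 (derive1 (remainder0 t s x y)) =
  (fun w => rescale T s y 2 w + (- 1 * rescale T t x 2 w + (y - x) * rescale T t x 3 w)).
Proof.
rewrite /remainder0 combo_derive; try exact: rescale_smooth.
by rewrite !rescale_derive combo_derive; try exact: rescale_smooth; rewrite !rescale_derive.
Qed.

Lemma remainder1_derive t s x y : derive1 (remainder1 t s x y) =
  (fun w => rescale T s y 2 w + - 1 * rescale T t x 2 w).
Proof. by rewrite /remainder1 combo2_derive ?rescale_derive//; exact: rescale_smooth. Qed.

Lemma remainder1_derive2 t s x y : derive1 (derive1 (remainder1 t s x y)) =
  (fun w => rescale T s y 3 w + - 1 * rescale T t x 3 w).
Proof.
by rewrite remainder1_derive combo2_derive ?rescale_derive//; exact: rescale_smooth.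
Qed.

Lemma far_arg (t s x y w : R) : 0 < t -> 0 < s <= t -> `|y - x| <= t -> 2 * t < `|w - x| ->
  ((w - x) / t < -1 /\ (w - y) / s < -1) \/ (1 < (w - x) / t /\ 1 < (w - y) / s).
Proof.
move=> t0 /andP[s0 st]; rewrite ler_norml => /andP[a b]; rewrite ltr_normr => /orP[h|h].
  by right; rewrite !ltr_pdivlMr// !mul1r; lra.
by left; rewrite !ltr_pdivrMr//; lra.
Qed.

(** To the left of both bumps all terms vanish; to the right they add up to (w - y) - (w - x) + (y -
    x) = 0. This is where the equal integrals and the vanishing first moments enter. *)
Lemma remainder0_supp t s x y : 0 < t -> 0 < s <= t -> `|y - x| <= t ->
  supp_in x (2 * t) (remainder0 t s x y).
Proof.
have [_ lo hi _ _] := HT => t0 st xy w tw; have /andP[s0 _] := st.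
rewrite /remainder0 /rescale !rescale_arg !expr0 !expr1 !mulr1 mulfV ?gt_eqF//.
have [[h1 h2]|[h1 h2]] := far_arg t0 st xy tw.
  by have [-> _] := lo _ h2; have [-> ->] := lo _ h1; rewrite !mulr0 !addr0.
have [-> _] := hi _ h2; have [-> ->] := hi _ h1.
by field; rewrite !gt_eqF.
Qed.

Lemma remainder1_supp t s x y : 0 < t -> 0 < s <= t -> `|y - x| <= t ->
  supp_in x (2 * t) (remainder1 t s x y).
Proof.
have [_ lo hi _ _] := HT => t0 st xy w tw; have /andP[s0 _] := st.
rewrite /remainder1 /rescale !rescale_arg !expr1 !mulfV ?gt_eqF//.
have [[h1 h2]|[h1 h2]] := far_arg t0 st xy tw.
  by have [_ ->] := lo _ h2; have [_ ->] := lo _ h1; rewrite !mulr0 !addr0.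
by have [_ ->] := hi _ h2; have [_ ->] := hi _ h1; ring.
Qed.

Lemma remainder0_bound t s x y w : 0 < t -> 0 < s <= t -> `|y - x| <= t ->
  `|remainder0 t s x y w| <= 8 * M * t.
Proof.
have [_ _ _ _ [M1 [b0 b1]]] := HT => t0 st xy; have /andP[s0 st'] := st.
have [wx|wx] := leP `|w - x| (2 * t); last first.
  rewrite (remainder0_supp t0 st xy wx) normr0 mulr_ge0 ?mulr_ge0//; lra.
have h0 z r : 0 < r -> `|r * T 0 ((w - z) / r)| <= r * M + `|w - z|.
  move=> r0; rewrite normrM gtr0_norm//.
  have -> : r * M + `|w - z| = r * (M + `|(w - z) / r|).
    by rewrite normrM normfV (gtr0_norm r0) mulrDr; congr (_ + _); rewrite mulrCA divff ?mulr1// gt_eqF.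
  by rewrite ler_pM2l.
have H1 := h0 y s s0; have H2 := h0 x t t0.
have H3 : `|(y - x) * T 1 ((w - x) / t)| <= t * M by rewrite normrM ler_pM// b1.
have wy : `|w - y| <= 3 * t.
  have -> : w - y = (w - x) - (y - x) by ring.
  by rewrite (le_trans (ler_normB _ _))//; lra.
rewrite /remainder0 /rescale !rescale_arg !expr0 !expr1 !mulr1 mulfV ?gt_eqF// mul1r.
rewrite (le_trans (ler_normD _ _))//.
have h4 := ler_normD (- 1 * (t * T 0 ((w - x) / t))) ((y - x) * T 1 ((w - x) / t)).
rewrite [in X in _ <= X + _]normrM normrN1 mul1r in h4.
have sM : s * M <= t * M by rewrite ler_wpM2r//; lra.
have tM : t <= t * M by rewrite ler_peMr// ltW.
lra.
Qed.

Lemma remainder1_bound t s x y w : 0 < t -> 0 < s -> `|remainder1 t s x y w| <= 2 * M.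
Proof.
have [_ _ _ _ [M1 [b0 b1]]] := HT => t0 s0.
rewrite /remainder1 /rescale !rescale_arg !expr1 !mulfV ?gt_eqF// !mul1r.
rewrite (le_trans (ler_normD _ _))// normrM normrN1 mul1r.
have := b1 1%N ((w - y) / s) isT; have := b1 1%N ((w - x) / t) isT; lra.
Qed.
Definition tfun (x : plane R) (r : R) (Phi : plane R -> R) :=
  continuous Phi /\ forall w, ~ cbox x r w -> Phi w = 0.

Lemma tfunD x r Phi Psi : tfun x r Phi -> tfun x r Psi -> tfun x r (fun w => Phi w + Psi w).
Proof.
move=> [c1 s1] [c2 s2]; split=> [w|w h]; last by rewrite s1// s2// addr0.
by apply: continuousD; [exact: c1|exact: c2].
Qed.

Lemma tfunZ x r c Phi : tfun x r Phi -> tfun x r (fun w => c * Phi w).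
Proof.
move=> [c1 s1]; split=> [w|w h]; last by rewrite s1// mulr0.
by apply: continuousM; [exact: cst_continuous|exact: c1].
Qed.

Lemma tfun_tensor (x : plane R) r u v : smooth u -> smooth v -> supp_in x.1 r u -> supp_in x.2 r v ->
  tfun x r (tensor u v).
Proof. by move=> su sv hu hv; split; [exact: tensor_continuous|exact: tensor_supp]. Qed.

Lemma tfun_pairingD F x r Phi Psi : continuous F -> tfun x r Phi -> tfun x r Psi ->
  pairing F (fun w => Phi w + Psi w) = pairing F Phi + pairing F Psi.
Proof. by move=> cF [c1 s1] [c2 s2]; exact: (@pairingD _ _ _ _ x r). Qed.

Lemma tfun_pairingZ F x r c Phi : continuous F -> tfun x r Phi ->
  pairing F (fun w => c * Phi w) = c * pairing F Phi.
Proof. by move=> cF [c1 s1]; exact: (@pairingZ _ _ _ _ x r). Qed.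

Lemma tfun_pairing6 F x r c2 c3 c6 P1 P2 P3 P4 P5 P6 : continuous F -> tfun x r P1 -> tfun x r P2 ->
  tfun x r P3 -> tfun x r P4 -> tfun x r P5 -> tfun x r P6 ->
  pairing F (fun w => P1 w + (c2 * P2 w + (c3 * P3 w + (P4 w + (P5 w + c6 * P6 w))))) =
  pairing F P1 + (c2 * pairing F P2 + (c3 * pairing F P3 + (pairing F P4 + (pairing F P5 + c6 * pairing F P6)))).
Proof.
move=> cF t1 t2 t3 t4 t5 t6.
have u2 := tfunZ c2 t2; have u3 := tfunZ c3 t3; have u6 := tfunZ c6 t6.
have v5 := tfunD t5 u6; have v4 := tfunD t4 v5; have v3 := tfunD u3 v4; have v2 := tfunD u2 v3.
rewrite (tfun_pairingD cF t1 v2) (tfun_pairingD cF u2 v3) (tfun_pairingD cF u3 v4).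
rewrite (tfun_pairingD cF t4 v5) (tfun_pairingD cF t5 u6).
by rewrite (tfun_pairingZ _ cF t2) (tfun_pairingZ _ cF t3) (tfun_pairingZ _ cF t6).
Qed.

Lemma supp_sub a b r1 r2 (u : R -> R) : supp_in a r1 u -> `|a - b| + r1 <= r2 -> supp_in b r2 u.
Proof.
move=> h r12 t rt; apply: h; have -> : t - a = (t - b) - (a - b) by ring.
by have := lerB_dist (t - b) (a - b); lra.
Qed.

Lemma weak_pairing p (F : plane R -> R) g i j Phi : sobolev p F g -> test_function Phi ->
  pairing F (dpart [:: i; j] Phi) = pairing (g i j) Phi.
Proof. by move=> [_ wh _] tPhi; have [_ /(_ _ tPhi)] := wh i j; rewrite /pairing /leb2 => ->. Qed.

(** * Means and gradients at a given scale *)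

Definition avg (F : plane R -> R) (t : R) (x : plane R) : R :=
  pairing F (tensor (rescale T t x.1 2) (rescale T t x.2 2)).

(** The derivative falls on the bump, whence the sign; this is the partial derivative of the mean at
    x, and [b = true] stands for the second coordinate. *)
Definition grad (F : plane R -> R) (t : R) (b : bool) (x : plane R) : R :=
  - pairing F (tensor (rescale T t x.1 (if b then 2 else 3)%N) (rescale T t x.2 (if b then 3 else 2)%N)).

(** Both derivatives are moved onto the weak Hessian. The factor 20 is 5 from [pairing_bound] times
    4 from the radius 2t in place of t. *)
Lemma weak_bound p q F g x t i j (u v : R -> R) A B : 1 <= q <= p -> sobolev p F g -> 0 < t ->
  smooth u -> smooth v -> supp_in x.1 (2 * t) u -> supp_in x.2 (2 * t) v ->
  0 <= A -> 0 <= B -> (forall w, `|u w| <= A) -> (forall w, `|v w| <= B) ->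
  `|pairing F (dpart [:: i; j] (tensor u v))| <=
  20 * (A * B) * (t `^ (2 - 2 / q) * (energy q g (cbox x (2 * t))) `^ q^-1).
Proof.
move=> qp sob t0 su sv hu hv A0 B0 uA vB.
have t20 : 0 < 2 * t by rewrite mulr_gt0.
rewrite (weak_pairing i j sob); last exact: tensor_test su sv hu hv.
have q1 : 1 <= q by case/andP: qp.
apply: le_trans (pairing_bound (M := A * B) i j qp sob t20 _ _ (tensor_supp hu hv) _) _.
- by rewrite mulr_ge0.
- by apply: continuous_plane_measurable; exact: tensor_continuous.
- by move=> w; rewrite /tensor normrM ler_pM.
set e := energy _ _ _ `^ _; have e0 : 0 <= e by exact: powR_ge0.
have -> : 20 * (A * B) * (t `^ (2 - 2 / q) * e) = 5 * (A * B) * (4 * t `^ (2 - 2 / q)) * e by ring.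
rewrite ler_wpM2r// ler_wpM2l//; first by rewrite mulr_ge0 ?mulr_ge0.
rewrite powRM ?(ltW t0)//; apply: ler_wpM2r; first exact: powR_ge0.
have -> : 4 = 2 `^ 2 :> R by rewrite (powR_mulrn 2)//; ring.
by rewrite ler_powR ?ler1n// gerBl divr_ge0//; lra.
Qed.

Section OneStep.
Variables (p q : R) (F : plane R -> R) (g : bool -> bool -> plane R -> R) (x y : plane R) (t s : R).
Hypotheses (qp : 1 <= q <= p) (sob : sobolev p F g) (t0 : 0 < t) (ts : t / 2 <= s <= t)
  (xy : cbox x t y).

Let M1 : 1 <= M. Proof. by case: HT => _ _ _ _ []. Qed.
Let s0 : 0 < s. Proof. by have := t0; case/andP: ts => a b c; lra. Qed.
Let st : 0 < s <= t. Proof. by rewrite s0; case/andP: ts. Qed.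
Let cF : continuous F. Proof. by case: sob. Qed.
Let xy1 : `|y.1 - x.1| <= t. Proof. by case/cboxP: xy. Qed.
Let xy2 : `|y.2 - x.2| <= t. Proof. by case/cboxP: xy. Qed.
Let sm tt xx k : smooth (rescale T tt xx k). Proof. exact: rescale_smooth. Qed.
Let ab a b k : `|b - a| <= t -> (2 <= k)%N -> supp_in a (2 * t) (rescale T s b k).
Proof.
move=> h k2; have H : `|b - a| + s <= 2 * t by case/andP: st => _; lra.
exact: (supp_sub (rescale_supp s0 k2) H).
Qed.
Let xb a k : (2 <= k)%N -> supp_in a (2 * t) (rescale T t a k).
Proof. move=> k2; have H : `|a - a| + t <= 2 * t by rewrite subrr normr0; have := t0; lra.
exact: (supp_sub (rescale_supp t0 k2) H). Qed.
Let bdt a k w : (1 <= k <= 3)%N -> `|rescale T t a k w| <= M * t * t^-1 ^+ k.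
Proof. exact: rescale_bound. Qed.
Let bds2 a w : `|rescale T s a 2 w| <= 2 * M / t.
Proof.
apply: le_trans (@rescale_bound s a 2 w s0 isT) _.
have -> : M * s * s^-1 ^+ 2 = M * s^-1 by field; rewrite gt_eqF.
rewrite mulrAC mulrC ler_wpM2r//; first by have := M1; lra.
by rewrite ler_pdivlMr// mulrC ler_pdivrMr//; case/andP: ts; lra.
Qed.
Let mtt k : M * t * t^-1 ^+ k.+2 = M / t ^+ k.+1.
Proof. by rewrite exprS mulrA -(mulrA M) divff ?gt_eqF// mulr1 exprVn. Qed.

(** The difference of the two bumps minus its first-order part is a sum of second derivatives of
    tensors of bounded support: the second primitive z1 handles the first variable, z2 the second
    one, and the mixed derivative of the old bump is left with the factor h1 h2. The three terms
    cost 320, 320 and 20, which 700 covers. *)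
Lemma avg_step : `|avg F s y - avg F t x - (y.1 - x.1) * grad F t false x - (y.2 - x.2) * grad F t true x|
  <= 700 * M ^+ 2 * (t `^ (2 - 2 / q) * (energy q g (cbox x (2 * t))) `^ q^-1).
Proof.
move: (t0) (M1) (s0) (ts) => t0' M1' s0' ts'; set h1 := y.1 - x.1; set h2 := y.2 - x.2; set N := _ * _ `^ _.
pose a1 := rescale T s y.1 2; pose a2 := rescale T s y.2 2.
pose b1 := rescale T t x.1 2; pose b2 := rescale T t x.2 2.
pose c1 := rescale T t x.1 3; pose c2 := rescale T t x.2 3.
pose z1 := remainder0 t s x.1 y.1; pose z2 := remainder0 t s x.2 y.2.
have sz1 : smooth z1 by exact: remainder0_smooth.
have sz2 : smooth z2 by exact: remainder0_smooth.
have hz1 : supp_in x.1 (2 * t) z1 by exact: remainder0_supp.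
have hz2 : supp_in x.2 (2 * t) z2 by exact: remainder0_supp.
pose e1 w := b1 w + - h1 * c1 w.
have se1 : smooth e1 by exact: (smoothD (sm t x.1 2) (smoothM (smooth_cst (- h1)) (sm t x.1 3))).
have he1 : supp_in x.1 (2 * t) e1.
  by move=> w hw; rewrite /e1 /b1 /c1 !xb// mulr0 addr0.
have dd (u v : R -> R) : smooth u -> smooth v ->
    [/\ dpart [:: false; false] (tensor u v) = tensor (derive1 (derive1 u)) v,
        dpart [:: true; true] (tensor u v) = tensor u (derive1 (derive1 v)) &
        dpart [:: false; true] (tensor u v) = tensor (derive1 u) (derive1 v)].
  move=> su sv; have [_ su'] := smooth_derive su; have [_ sv'] := smooth_derive sv.
  by split; rewrite /= !partial_tensor.
have [D1 _ _] := dd z1 a2 sz1 (sm _ _ _).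
have [_ D2 _] := dd e1 z2 se1 sz2.
have [_ _ D3] := dd b1 b2 (sm _ _ _) (sm _ _ _).
have T1 : tfun x (2 * t) (tensor b1 b2) by apply: tfun_tensor; try exact: sm; exact: xb.
have T2 : tfun x (2 * t) (tensor c1 b2) by apply: tfun_tensor; try exact: sm; exact: xb.
have T3 : tfun x (2 * t) (tensor b1 c2) by apply: tfun_tensor; try exact: sm; exact: xb.
have sd (u : R -> R) : smooth u -> smooth (derive1 u) by case/smooth_derive.
have U1 : tfun x (2 * t) (dpart [:: false; false] (tensor z1 a2)).
  rewrite D1; apply: tfun_tensor; try exact: sm; [exact: (sd _ (sd _ sz1))| |exact: ab].
  by rewrite remainder0_derive2 => w hw; rewrite ?(ab xy1)// ?(ab xy2)// !xb// !mulr0 !addr0.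
have U2 : tfun x (2 * t) (dpart [:: true; true] (tensor e1 z2)).
  rewrite D2; apply: tfun_tensor => //; first exact: (sd _ (sd _ sz2)).
  by rewrite remainder0_derive2 => w hw; rewrite ?(ab xy1)// ?(ab xy2)// !xb// !mulr0 !addr0.
have U3 : tfun x (2 * t) (dpart [:: false; true] (tensor b1 b2)).
  by rewrite D3 !rescale_derive; apply: tfun_tensor; try exact: sm; exact: xb.
have AE : avg F s y = pairing F (tensor b1 b2) + (- h1 * pairing F (tensor c1 b2) +
   (- h2 * pairing F (tensor b1 c2) + (pairing F (dpart [:: false; false] (tensor z1 a2)) +
   (pairing F (dpart [:: true; true] (tensor e1 z2)) +
    h1 * h2 * pairing F (dpart [:: false; true] (tensor b1 b2)))))).
  rewrite -(tfun_pairing6 _ _ _ cF T1 T2 T3 U1 U2 U3).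
  congr pairing; apply/funext => w; rewrite D1 D2 D3 /tensor !rescale_derive !remainder0_derive2.
  by rewrite /e1 /b1 /b2 /c1 /c2 /a2 /h1 /h2; ring.
rewrite AE /grad /avg -/b1 -/b2 -/c1 -/c2 {AE}.
have alg (P1 P2 P3 P4 P5 P6 : R) : P1 + (- h1 * P2 + (- h2 * P3 + (P4 + (P5 + h1 * h2 * P6)))) -
    P1 - h1 * - P2 - h2 * - P3 = P4 + (P5 + h1 * h2 * P6) by ring.
rewrite {}alg.
have tM0 : 0 <= M * t by rewrite mulr_ge0 1?ltW//; lra.
have Mt0 : 0 <= M / t by rewrite divr_ge0 1?ltW//; lra.
have N0 : 0 <= N by rewrite mulr_ge0 ?powR_ge0.
have B1 : `|pairing F (dpart [:: false; false] (tensor z1 a2))| <= 20 * ((8 * M * t) * (2 * M / t)) * N.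
  apply: (weak_bound _ _ qp sob t0 sz1 (sm s y.2 2) hz1 (@ab _ _ 2 xy2 isT)); try lra.
    by move=> w; exact: remainder0_bound.
  by move=> w; exact: bds2.
have B2 : `|pairing F (dpart [:: true; true] (tensor e1 z2))| <= 20 * ((2 * (M / t)) * (8 * M * t)) * N.
  apply: (weak_bound _ _ qp sob t0 se1 sz2 he1 hz2); try lra.
    move=> w; rewrite /e1; apply: le_trans (ler_normD _ _) _; rewrite [ `|- h1 * _| ]normrM normrN.
    have c1b := bdt x.1 w (isT : (1 <= 3 <= 3)%N); have b1b := bdt x.1 w (isT : (1 <= 2 <= 3)%N).
    rewrite !mtt ?expr1 in c1b b1b.
    have : `|h1| * `|c1 w| <= t * (M / t ^+ 2) by rewrite ler_pM.
    have -> : t * (M / t ^+ 2) = M / t by field; rewrite gt_eqF.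
    rewrite -/b1 in b1b; lra.
  by move=> w; exact: remainder0_bound.
have B3 : `|pairing F (dpart [:: false; true] (tensor b1 b2))| <= 20 * ((M / t) * (M / t)) * N.
  apply: (weak_bound _ _ qp sob t0 (sm t x.1 2) (sm t x.2 2) (@xb _ 2 isT) (@xb _ 2 isT)) => //.
    by move=> w; have := bdt x.1 w (isT : (1 <= 2 <= 3)%N); rewrite mtt expr1.
  by move=> w; have := bdt x.2 w (isT : (1 <= 2 <= 3)%N); rewrite mtt expr1.
have B3' : `|h1 * h2 * pairing F (dpart [:: false; true] (tensor b1 b2))| <= 20 * (M * M) * N.
  rewrite normrM (le_trans (ler_pM _ _ (_ : _ <= t * t) B3))//; first by rewrite normrM ler_pM.
  by rewrite le_eqVlt; apply/orP; left; apply/eqP; field; rewrite gt_eqF.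
have -> : 700 * M ^+ 2 * N = 20 * (8 * M * t * (2 * M / t)) * N + (20 * (2 * (M / t) * (8 * M * t)) * N + 20 * (M * M) * N) + 40 * M ^+ 2 * N.
  by field; rewrite gt_eqF.
rewrite -[leLHS]addr0; apply: lerD; last by rewrite mulr_ge0// mulr_ge0// sqr_ge0.
apply: le_trans (ler_normD _ _) _; apply: lerD => //.
by apply: le_trans (ler_normD _ _) _; apply: lerD.
Qed.

(** As in [avg_step], but to first order only: the difference of two differentiated bumps is a pure
    second derivative plus a mixed one, of tensors that contain [remainder1]. The extra derivative
    costs one power of t. *)
Lemma grad_step b : `|grad F s b y - grad F t b x|
  <= 700 * M ^+ 2 * (t `^ (1 - 2 / q) * (energy q g (cbox x (2 * t))) `^ q^-1).
Proof.
move: (t0) (M1) (s0) (ts) => t0' M1' s0' ts'; set N := _ * _ `^ _.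
have NE : t `^ (2 - 2 / q) * energy q g (cbox x (2 * t)) `^ q^-1 = t * N.
  rewrite /N mulrA; congr (_ * _).
  have -> : 2 - 2 / q = 1 + (1 - 2 / q) by ring.
  by rewrite powRD ?powRr1 ?ltW// (gt_eqF t0) implybT.
have N0 : 0 <= N by rewrite mulr_ge0 ?powR_ge0.
pose a1 k := rescale T s y.1 k; pose a2 k := rescale T s y.2 k.
pose b1 k := rescale T t x.1 k; pose b2 k := rescale T t x.2 k.
pose z1 := remainder1 t s x.1 y.1; pose z2 := remainder1 t s x.2 y.2.
have sz1 : smooth z1 by exact: remainder1_smooth.
have sz2 : smooth z2 by exact: remainder1_smooth.
have hz1 : supp_in x.1 (2 * t) z1 by exact: remainder1_supp.
have hz2 : supp_in x.2 (2 * t) z2 by exact: remainder1_supp.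
have dd (u v : R -> R) : smooth u -> smooth v ->
    [/\ dpart [:: false; false] (tensor u v) = tensor (derive1 (derive1 u)) v,
        dpart [:: true; true] (tensor u v) = tensor u (derive1 (derive1 v)) &
        dpart [:: false; true] (tensor u v) = tensor (derive1 u) (derive1 v)].
  move=> su sv; have [_ su'] := smooth_derive su; have [_ sv'] := smooth_derive sv.
  by split; rewrite /= !partial_tensor.
have sd (u : R -> R) : smooth u -> smooth (derive1 u) by case/smooth_derive.
have Mt0 : 0 <= M / t by rewrite divr_ge0 1?ltW//; lra.
have M2t0 : 0 <= 2 * M / t by rewrite divr_ge0 1?ltW//; lra.
have bb a w : `|rescale T t a 2 w| <= M / t.
  by have := bdt a w (isT : (1 <= 2 <= 3)%N); rewrite mtt expr1.
have zb xx yy w : `|remainder1 t s xx yy w| <= 2 * M by exact: remainder1_bound.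
suff key Phi Psi : pairing F (tensor (rescale T s y.1 (if b then 2 else 3)%N) (rescale T s y.2 (if b then 3 else 2)%N)) =
    pairing F (tensor (rescale T t x.1 (if b then 2 else 3)%N) (rescale T t x.2 (if b then 3 else 2)%N)) +
    (pairing F Phi + pairing F Psi) ->
   `|pairing F Phi| <= 20 * ((2 * M) * (2 * M / t)) * (t * N) ->
   `|pairing F Psi| <= 20 * ((2 * M) * (2 * M / t)) * (t * N) ->
   `|grad F s b y - grad F t b x| <= 700 * M ^+ 2 * N.
  case: b key => key.
  - have [_ D1 _] := dd (a1 2%N) z2 (sm _ _ _) sz2.
    have [_ _ D2] := dd z1 (b2 2%N) sz1 (sm _ _ _).
    apply: (key (dpart [:: true; true] (tensor (a1 2%N) z2)) (dpart [:: false; true] (tensor z1 (b2 2%N)))).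
    + have T1 : tfun x (2 * t) (tensor (b1 2%N) (b2 3%N)) by apply: tfun_tensor; try exact: sm; exact: xb.
      have U1 : tfun x (2 * t) (dpart [:: true; true] (tensor (a1 2%N) z2)).
        rewrite D1; apply: tfun_tensor; try exact: sm; [exact: (sd _ (sd _ sz2))|exact: ab|].
        by rewrite remainder1_derive2 => w hw; rewrite ?(ab xy1)// ?(ab xy2)// xb// mulr0 addr0.
      have U2 : tfun x (2 * t) (dpart [:: false; true] (tensor z1 (b2 2%N))).
        rewrite D2; apply: tfun_tensor; try exact: sm; [exact: (sd _ sz1)|exact: (sd _ (sm _ _ _))| |].
          by rewrite remainder1_derive => w hw; rewrite ?(ab xy1)// ?(ab xy2)// xb// mulr0 addr0.
        by rewrite rescale_derive; exact: xb.
      rewrite -!(@tfun_pairingD F x (2 * t))//; last exact: tfunD.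
      congr pairing; apply/funext => w; rewrite D1 D2 /tensor !rescale_derive remainder1_derive2 remainder1_derive.
      by rewrite /a1 /b1 /b2; ring.
    + rewrite -NE (mulrC (2 * M) (2 * M / t)); apply: (weak_bound _ _ qp sob t0 (sm s y.1 2) sz2 (@ab _ _ 2 xy1 isT) hz2) => //; try lra.
      by move=> w; exact: zb.
    + rewrite -NE; apply: le_trans (weak_bound (A := 2 * M) (B := M / t) _ _ qp sob t0 sz1 (sm t x.2 2) hz1 (@xb _ 2 isT) _ _ _ _) _ => //; try lra.
        by move=> w; exact: zb.
      apply: ler_wpM2r; first by rewrite mulr_ge0 ?powR_ge0.
      apply: ler_wpM2l => //; apply: ler_wpM2l; first by lra.
      by rewrite -mulrA; lra.
  - have [D1 _ _] := dd z1 (a2 2%N) sz1 (sm _ _ _).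
    have [_ _ D2] := dd (b1 2%N) z2 (sm _ _ _) sz2.
    apply: (key (dpart [:: false; false] (tensor z1 (a2 2%N))) (dpart [:: false; true] (tensor (b1 2%N) z2))).
    + have T1 : tfun x (2 * t) (tensor (b1 3%N) (b2 2%N)) by apply: tfun_tensor; try exact: sm; exact: xb.
      have U1 : tfun x (2 * t) (dpart [:: false; false] (tensor z1 (a2 2%N))).
        rewrite D1; apply: tfun_tensor; try exact: sm; [exact: (sd _ (sd _ sz1))| |exact: ab].
        by rewrite remainder1_derive2 => w hw; rewrite ?(ab xy1)// ?(ab xy2)// xb// mulr0 addr0.
      have U2 : tfun x (2 * t) (dpart [:: false; true] (tensor (b1 2%N) z2)).
        rewrite D2; apply: tfun_tensor; try exact: sm; [exact: (sd _ (sm _ _ _))|exact: (sd _ sz2)| |].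
          by rewrite rescale_derive; exact: xb.
        by rewrite remainder1_derive => w hw; rewrite ?(ab xy1)// ?(ab xy2)// xb// mulr0 addr0.
      rewrite -!(@tfun_pairingD F x (2 * t))//; last exact: tfunD.
      congr pairing; apply/funext => w; rewrite D1 D2 /tensor !rescale_derive remainder1_derive2 remainder1_derive.
      by rewrite /a2 /b1 /b2; ring.
    + rewrite -NE; apply: (weak_bound _ _ qp sob t0 sz1 (sm s y.2 2) hz1 (@ab _ _ 2 xy2 isT)) => //; try lra.
      by move=> w; exact: zb.
    + rewrite -NE (mulrC (2 * M) (2 * M / t)); apply: le_trans (weak_bound (A := M / t) (B := 2 * M) _ _ qp sob t0 (sm t x.1 2) sz2 (@xb _ 2 isT) hz2 _ _ _ _) _ => //; try lra.
        by move=> w; exact: zb.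
      apply: ler_wpM2r; first by rewrite mulr_ge0 ?powR_ge0.
      apply: ler_wpM2l => //; apply: ler_wpM2r; first by lra.
      by rewrite -mulrA; lra.
move=> E B1 B2; rewrite /grad E.
rewrite [X in `|X|](_ : _ = - (pairing F Phi + pairing F Psi)); last by ring.
rewrite normrN; apply: le_trans (ler_normD _ _) _.
have e : 20 * (2 * M * (2 * M / t)) * (t * N) = 80 * M ^+ 2 * N by field; rewrite gt_eqF.
rewrite e in B1 B2; have : 0 <= M ^+ 2 * N by rewrite mulr_ge0// sqr_ge0.
lra.
Qed.
End OneStep.
End Rescale.

Lemma ler_normDl (R : realType) (a b A B : R) : `|a| <= A -> `|b| <= B -> `|a + b| <= A + B.
Proof. by move=> h1 h2; apply: le_trans (ler_normD _ _) _; exact: lerD. Qed.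

Definition dot (R : realType) (u v : plane R) : R := u.1 * v.1 + u.2 * v.2.

Lemma plane_norm_le (R : realType) (u : plane R) (c : R) : (`|u| <= c) = (`|u.1| <= c) && (`|u.2| <= c).
Proof. by rewrite prod_normE ge_max. Qed.

Lemma plane_norm1 (R : realType) (u : plane R) : `|u.1| <= `|u|.
Proof. by rewrite [leRHS]prod_normE le_max lexx. Qed.

Lemma plane_norm2 (R : realType) (u : plane R) : `|u.2| <= `|u|.
Proof. by rewrite [leRHS]prod_normE le_max lexx orbT. Qed.

Lemma dot_le (R : realType) (u v : plane R) : `|dot u v| <= 2 * `|u| * `|v|.
Proof.
rewrite /dot; apply: le_trans (ler_normD _ _) _; rewrite !normrM.
have := plane_norm1 u; have := plane_norm2 u; have := plane_norm1 v; have := plane_norm2 v => a b c d.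
have : `|u.1| * `|v.1| <= `|u| * `|v| by rewrite ler_pM.
have : `|u.2| * `|v.2| <= `|u| * `|v| by rewrite ler_pM.
by linear.
Qed.

Lemma cbox_norm (R : realType) (x w : plane R) (r : R) : cbox x r w <-> `|w - x| <= r.
Proof. by rewrite plane_norm_le; split=> [/cboxP[a b]|/andP[a b]]; [exact/andP|exact/cboxP]. Qed.

Lemma cbox_sub (R : realType) (x y : plane R) (r s : R) : `|y - x| + r <= s -> cbox y r `<=` cbox x s.
Proof.
move=> h w /cbox_norm wy; apply/cbox_norm; apply: le_trans h.
have -> : w - x = (y - x) + (w - y) by rewrite [RHS]addrC addrA subrK.
by apply: le_trans (ler_normD _ _) _; rewrite lerD2l.
Qed.

Lemma energy_le (R : realType) (p q : R) F g x r (B : set (plane R)) : 0 < q <= p -> sobolev p F g ->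
  measurable B -> B `<=` cbox x r -> energy q g B <= energy q g (cbox x r).
Proof.
move=> qp sob mB Bx; have [cF wh fin] := sob; rewrite /energy.
have mP D := measurable_EFinS (D := D) (measurable_gam_powR q wh).
have le : (\int[leb R]_(w in B) (gam g w `^ q)%:E <= \int[leb R]_(w in cbox x r) (gam g w `^ q)%:E)%E.
  apply: ge0_subset_integral => //; [exact: measurable_cbox|exact: mP|].
  by move=> w _; rewrite lee_fin powR_ge0.
have f1 := energy_fin x r qp sob.
apply: fine_le => //; rewrite ge0_fin_numE; try (by apply: integral_ge0 => w _; rewrite lee_fin powR_ge0); last exact: f1.
exact: le_lt_trans le f1.
Qed.

Lemma energy_root_le (R : realType) (p q : R) F g x y r s : 0 < q <= p -> sobolev p F g ->
  `|y - x| + r <= s -> energy q g (cbox y r) `^ q^-1 <= energy q g (cbox x s) `^ q^-1.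
Proof.
move=> qp sob h; apply: ge0_ler_powR; rewrite ?nnegrE ?energy_ge0//.
  by rewrite invr_ge0; linear.
by apply: (energy_le qp sob); [exact: measurable_cbox|exact: cbox_sub].
Qed.

(** * Telescoping over dyadic scales *)

Section Taylor.
Variables (R : realType) (T : nat -> R -> R) (M : R).
Hypothesis HT : bump_tower T M.

Lemma integral_rescale t x : 0 < t -> (\int[lebesgue_measure]_w (rescale T t x 2 w)%:E = 1%:E)%E.
Proof.
move=> t0; have [_ lo hi _ _] := HT.
rewrite (integral_derivative_step (a := x) (L := t) (A := 0) (B := 1) (rescale_is_derive HT t x 1)) ?subr0//.
- exact/smooth_cont/(rescale_smooth HT).
- move=> w h; rewrite /rescale rescale_arg; have [|_ ->] := lo ((w - x) / t); last by rewrite mulr0.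
  by rewrite ltr_pdivrMr//; lra.
- move=> w h; rewrite /rescale rescale_arg; have [|_ ->] := hi ((w - x) / t).
    by rewrite ltr_pdivlMr//; lra.
  by rewrite expr1 mulr1 divff// gt_eqF.
- by move=> w h; apply: (rescale_supp HT (x := x) t0).
Qed.

Let phi t (x : plane R) := tensor (rescale T t x.1 2) (rescale T t x.2 2).

Lemma phi_cont t x : continuous (phi t x).
Proof. by apply: tensor_continuous; exact: (rescale_smooth HT). Qed.

Lemma phi_supp t (x : plane R) : 0 < t -> forall w, ~ cbox x t w -> phi t x w = 0.
Proof. by move=> t0; apply: tensor_supp; exact: (rescale_supp HT). Qed.

Lemma integral_phi t x : 0 < t -> pairing (fun=> 1) (phi t x) = 1.
Proof.
move=> t0; have i1 := integrable_continuous (@phi_cont t x) (phi_supp t0).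
rewrite /pairing; under eq_integral do rewrite mul1r.
have -> : (\int[leb R]_w (phi t x w)%:E = 1%:E)%E; last by [].
rewrite -(integral12_prod_meas1 i1) /fubini_F /=.
rewrite -[RHS](integral_rescale x.1 t0); apply: eq_integral => u _; rewrite /phi /tensor /=.
under eq_integral do rewrite EFinM.
rewrite integralZl// ?integral_rescale ?mule1//.
have E : (fun w => (rescale T t x.2 2 w)%:E) = (EFin \o rescale T t x.2 2) \_ `[x.2 - t, x.2 + t].
  apply/funext => w; rewrite patchE; case: ifPn => //; rewrite notin_setE/= in_itv/= => /negP h.
  congr EFin; apply: (rescale_supp HT (x := x.2) t0) => //.
  by rewrite ltNge ler_distl.
rewrite E.
have H := integrable_mkcond (mu := @lebesgue_measure R) (EFin \o rescale T t x.2 2) (measurable_itv `[x.2 - t, x.2 + t]).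
apply H => {H}; apply: continuous_compact_integrable; first exact: segment_compact.
by apply: continuous_subspaceT; apply/smooth_cont/(rescale_smooth HT).
Qed.

Lemma avg_near F t x e : continuous F -> 0 < t -> 0 <= e -> (forall w, cbox x t w -> `|F w - F x| <= e) ->
  `|avg T F t x - F x| <= 4 * M ^+ 2 * e.
Proof.
move=> cF t0 e0 Fe.
have cF1 : continuous (fun w => - F x * 1 + F w) by move=> w; apply: (@continuousD _ _ _ (fun=> - F x * 1) F); [exact: cst_continuous|exact: cF].
have -> : avg T F t x - F x = pairing (fun w => - F x * 1 + F w) (phi t x).
  rewrite (@pairing_linear R (fun=> 1) F (phi t x) (- F x) x t)//; first by rewrite integral_phi// mulr1 addrC.
  - exact: cst_continuous.
  - exact: phi_cont.
  - exact: phi_supp.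
rewrite /pairing; apply: fine_abs_le.
have i1 := pairing_integrable cF1 (@phi_cont t x) (phi_supp t0).
have [_ mi] := integrableP _ _ _ i1.
have M1 : 1 <= M by case: HT => _ _ _ _ [].
apply: (@le_trans _ _ (\int[leb R]_w `|((- F x * 1 + F w) * phi t x w)%:E|)%E).
  by apply: le_abse_integral => //; have /integrableP[] := i1.
apply: (@le_trans _ _ (\int[leb R]_(w in cbox x t) (e * (M / t) ^+ 2)%:E)%E).
  rewrite [leRHS]integral_mkcond; apply: ge0_le_integral => //.
  - by apply: measurableT_comp => //; have /integrableP[] := i1.
  - apply: (iffLR (measurable_restrictT _ _)) => //; exact: measurable_cbox.
  - move=> w _ /=; rewrite patchE; case: ifPn => [|]; last first.
      by rewrite notin_setE => /(phi_supp t0) ->; rewrite mulr0 normr0.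
    move=> /set_mem wx; rewrite lee_fin normrM ler_pM//; first by rewrite mulr1 addrC; exact: Fe.
    rewrite /phi /tensor normrM expr2; have b (u a : R) : `|rescale T t a 2 u| <= M / t.
      apply: le_trans (rescale_bound HT _ _ _ _) _ => //.
      by rewrite le_eqVlt; apply/orP; left; apply/eqP; field; rewrite gt_eqF.
    by rewrite ler_pM.
rewrite integral_cst; last exact: measurable_cbox.
apply: (@eq_ind_r _ _ (fun z => (_ * z <= _)%E) _ _ (leb2_cbox x (ltW t0))).
rewrite -EFinM lee_fin le_eqVlt; apply/orP; left; apply/eqP; field; rewrite gt_eqF//.
Qed.

Lemma avg_cvg F t x : continuous F -> 0 < t -> (fun n => avg T F (t / 2 ^+ n) x) @ \oo --> F x.
Proof.
move=> cF t0; have M1 : 1 <= M by case: HT => _ _ _ _ [].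
have M0 : 0 < 4 * M ^+ 2 + 1 by rewrite ltr_wpDl// mulr_ge0// sqr_ge0.
apply/cvgrPdist_le => e e0.
have [d /= d0 Hd] : \forall d \near 0^'+, forall w, cbox x d w -> `|F w - F x| <= e / (4 * M ^+ 2 + 1).
  have /cvgrPdist_le /(_ (e / (4 * M ^+ 2 + 1)) (divr_gt0 e0 M0)) := cF x.
  move=> /nbhs_ballP [d d0 Hd]; near=> c => w /cbox_norm wx.
  rewrite distrC; apply: Hd; rewrite -ball_normE/= distrC; apply: le_lt_trans wx _.
  by near: c; exact: nbhs_right_lt.
have : (fun n => t / 2 ^+ n) @ \oo --> 0.
  have -> : (fun n => t / 2 ^+ n) = geometric t 2^-1 by apply/funext => n; rewrite /geometric /= exprVn.
  by apply: cvg_geometric; rewrite ger0_norm; lra.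
move=> /cvgrPdist_lt /(_ _ d0) [N _ HN]; exists N => // n /= Nn.
have tn : 0 < t / 2 ^+ n by rewrite divr_gt0// exprn_gt0.
have {}HN := HN n Nn; rewrite distrC.
apply: le_trans (avg_near cF tn (e := e / (4 * M ^+ 2 + 1)) _ _) _; first by rewrite divr_ge0// ltW.
  apply: Hd => //=; by rewrite distrC.
rewrite mulrA ler_pdivrMr// mulrC ler_pM2l//; lra.
Unshelve. all: by end_near. Qed.

Lemma grad_linear F G (a t : R) b x : continuous F -> continuous G -> 0 < t ->
  grad T (fun w => a * F w + G w) t b x = a * grad T F t b x + grad T G t b x.
Proof.
move=> cF cG t0; rewrite /grad (@pairing_linear R F G _ a x t)//; first by rewrite mulrN opprD.
  by apply: tensor_continuous; exact: (rescale_smooth HT).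
by apply: tensor_supp; apply: (rescale_supp HT) => //; case: b.
Qed.

Variables (p q : R).
Hypothesis qp : 2 < q <= p.

Let a1 : 0 < 1 - 2 / q.
Proof. by case/andP: qp => a b; rewrite subr_gt0 ltr_pdivrMr; lra. Qed.
Let qp1 : 1 <= q <= p. Proof. by case/andP: qp => a b; apply/andP; split; lra. Qed.
Let qp0 : 0 < q <= p. Proof. by case/andP: qp => a b; apply/andP; split; lra. Qed.
Variable S : R.
Hypothesis S0 : 0 < S.
Hypothesis avgS : forall F g x y t s, sobolev p F g -> 0 < t -> t / 2 <= s <= t -> cbox x t y ->
  `|avg T F s y - avg T F t x - (y.1 - x.1) * grad T F t false x - (y.2 - x.2) * grad T F t true x|
    <= S * (t `^ (2 - 2 / q) * (energy q g (cbox x (2 * t))) `^ q^-1).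
Hypothesis gradS : forall F g x y t s b, sobolev p F g -> 0 < t -> t / 2 <= s <= t -> cbox x t y ->
  `|grad T F s b y - grad T F t b x| <= S * (t `^ (1 - 2 / q) * (energy q g (cbox x (2 * t))) `^ q^-1).

(* [1 / (1 - 2^-a)] is the sum of the geometric series over the dyadic scales. *)
Let K (a : R) := S / (1 - 2^-1 `^ a).

Let half_lt a : 0 < a -> 2^-1 `^ a < 1 :> R.
Proof.
move=> a0; apply: (@lt_le_trans _ _ (1 `^ a)); last by rewrite powR1.
apply: gt0_ltr_powR; rewrite ?nnegrE//; lra.
Qed.

Let K0 a : 0 < a -> 0 < K a.
Proof. by move=> a0; rewrite divr_gt0// subr_gt0 half_lt. Qed.

Let KS a : 0 < a -> S <= K a.
Proof.
move=> a0; rewrite ler_pdivlMr ?subr_gt0 ?half_lt// ler_piMr ?(ltW S0)// gerBl; exact: powR_ge0.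
Qed.

Let scal c a t u e : 0 <= c -> u <= e -> c * (t `^ a * u) <= c * (t `^ a * e) :> R.
Proof. by move=> c0 ue; apply: ler_wpM2l => //; apply: ler_wpM2l => //; exact: powR_ge0. Qed.

(** The recursion of the geometric series: the errors from t/2 downwards plus one step at t. *)
Let KE a (t e : R) : 0 < a -> 0 < t -> K a * (t `^ a * e) = K a * ((t / 2) `^ a * e) + S * (t `^ a * e).
Proof.
move=> a0 t0; rewrite powRM ?invr_ge0// ?ltW//; have := half_lt a0; rewrite /K => h.
by field; rewrite subr_eq0 gt_eqF.
Qed.

(** The means at the scales t / 2^n converge to F x by continuity, and the steps between them are
    dominated by a geometric series of ratio 2^-(2 - 2/q). *)
Lemma avg_taylor F g t x : sobolev p F g -> 0 < t ->
  `|F x - avg T F t x| <= K (2 - 2 / q) * (t `^ (2 - 2 / q) * energy q g (cbox x (2 * t)) `^ q^-1).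
Proof.
move=> sob t0; have [cF _ _] := sob.
have a2 : 0 < 2 - 2 / q by move: a1; lra.
have key n : forall t, 0 < t -> `|avg T F (t / 2 ^+ n) x - avg T F t x| <=
    K (2 - 2 / q) * (t `^ (2 - 2 / q) * energy q g (cbox x (2 * t)) `^ q^-1).
  elim: n => [|n IH] {t0}t t0.
    by rewrite expr0 divr1 subrr normr0 mulr_ge0 ?(ltW (K0 _))// mulr_ge0 ?powR_ge0.
  have t20 : 0 < t / 2 by lra.
  rewrite KE//.
  have -> : avg T F (t / 2 ^+ n.+1) x - avg T F t x =
      (avg T F (t / 2 / 2 ^+ n) x - avg T F (t / 2) x) + (avg T F (t / 2) x - avg T F t x).
    by rewrite addrA subrK exprS invfM mulrA.
  apply: le_trans (ler_normD _ _) _; apply: lerD.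
    apply: le_trans (IH _ t20) _; apply: scal; first exact/ltW/K0.
    by apply: (energy_root_le qp0 sob); rewrite subrr normr0; lra.
  have tt : t / 2 <= t / 2 <= t by apply/andP; split; lra.
  have xx : cbox x t x by apply/cbox_norm; rewrite subrr normr0 ltW.
  have := avgS sob t0 tt xx.
  by rewrite !subrr !mul0r !subr0.
have h : (fun n => `|avg T F (t / 2 ^+ n) x - avg T F t x|) @ \oo --> `|F x - avg T F t x|.
  by apply: cvg_norm; apply: cvgB; [exact: avg_cvg|exact: cvg_cst].
have <- := cvg_lim (@norm_hausdorff _ _) h.
by apply: limr_le; [by apply/cvg_ex; eexists; exact: h|apply: nearW => n; exact: key].
Qed.

(** The sum over scales stops at r. Since q > 2, the exponent 1 - 2/q is positive and the bound does
    not depend on the number of steps. *)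
Lemma grad_taylor F g r t b x : sobolev p F g -> 0 < r -> r <= t ->
  `|grad T F r b x - grad T F t b x| <= K (1 - 2 / q) * (t `^ (1 - 2 / q) * energy q g (cbox x (2 * t)) `^ q^-1).
Proof.
move=> sob r0.
have step s' t' : 0 < t' -> t' / 2 <= s' <= t' -> `|grad T F s' b x - grad T F t' b x| <=
    S * (t' `^ (1 - 2 / q) * energy q g (cbox x (2 * t')) `^ q^-1).
  move=> t0 st; have xx : cbox x t' x by apply/cbox_norm; rewrite subrr normr0 ltW.
  exact: (gradS b sob t0 st xx).
have e0 t' : 0 <= t' `^ (1 - 2 / q) * energy q g (cbox x (2 * t')) `^ q^-1 by rewrite mulr_ge0 ?powR_ge0.
have key n : forall t, r <= t -> t <= 2 ^+ n * r -> `|grad T F r b x - grad T F t b x| <=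
    K (1 - 2 / q) * (t `^ (1 - 2 / q) * energy q g (cbox x (2 * t)) `^ q^-1).
  elim: n => [|n IH] {}t rt tn.
    have -> : t = r by move: tn; rewrite expr0; lra.
    by rewrite subrr normr0 mulr_ge0// ltW// K0.
  have t0 : 0 < t by lra.
  have [t2|t2] := leP t (2 * r).
    apply: le_trans (step _ _ t0 _) _; first by apply/andP; split; lra.
    by apply: ler_wpM2r => //; exact: KS.
  rewrite KE//.
  have -> : grad T F r b x - grad T F t b x =
      (grad T F r b x - grad T F (t / 2) b x) + (grad T F (t / 2) b x - grad T F t b x) by rewrite addrA subrK.
  apply: le_trans (ler_normD _ _) _; apply: lerD; last by apply: step => //; apply/andP; split; lra.
  have tn' : t / 2 <= 2 ^+ n * r by move: tn; rewrite exprS -mulrA; lra.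
  apply: le_trans (IH _ _ tn') _; first by lra.
  apply: scal; first exact/ltW/K0.
  by apply: (energy_root_le qp0 sob); rewrite subrr normr0; lra.
move=> rt; have [n Hn] : exists n, t / r < 2 ^+ n.
  exists (Num.bound (t / r)); apply: upper_nthrootP; exact: leqnn.
by apply: (key n) => //; rewrite -ler_pdivrMr// ltW.
Qed.

Definition slope (r : R) (F : plane R -> R) (x : plane R) : plane R := (grad T F r false x, grad T F r true x).

(** Both estimates pass through the means and gradients at scale t at x and at y, which a single
    step joins. *)
Lemma slope_taylor : exists2 C, 0 < C & forall F g r t x y, sobolev p F g -> 0 < r -> r <= t -> `|y - x| <= t ->
  `|F y - F x - dot (slope r F x) (y - x)| <= C * (t `^ (2 - 2 / q) * energy q g (cbox x (4 * t)) `^ q^-1) /\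
  `|slope r F y - slope r F x| <= C * (t `^ (1 - 2 / q) * energy q g (cbox x (4 * t)) `^ q^-1).
Proof.
have a2 : 0 < 2 - 2 / q by move: a1; lra.
have K1 := K0 a1; have K2 := K0 a2; pose k1 := K (1 - 2 / q); pose k2 := K (2 - 2 / q).
exists (2 * k2 + 2 * k1 + S); first by rewrite addr_gt0// addr_gt0// mulr_gt0.
move=> F g r t x y sob r0 rt xy; have t0 : 0 < t by lra.
have tt : t / 2 <= t <= t by apply/andP; split; lra.
have xyb : cbox x t y by apply/cbox_norm.
set e := energy q g (cbox x (4 * t)) `^ q^-1.
have e0 : 0 <= e by exact: powR_ge0.
have ex : energy q g (cbox x (2 * t)) `^ q^-1 <= e.
  by apply: (energy_root_le qp0 sob); rewrite subrr normr0; lra.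
have ey : energy q g (cbox y (2 * t)) `^ q^-1 <= e by apply: (energy_root_le qp0 sob); lra.
have G z b : `|y - z| <= t -> z = x \/ z = y -> `|grad T F r b z - grad T F t b z| <= k1 * (t `^ (1 - 2 / q) * e).
  move=> _ zz; apply: le_trans (grad_taylor b z sob r0 rt) _; apply: scal; first exact: ltW.
  by case: zz => ->; [exact: ex|exact: ey].
have S2 b : `|grad T F t b y - grad T F t b x| <= S * (t `^ (1 - 2 / q) * e).
  by apply: le_trans (gradS b sob t0 tt xyb) _; exact: (scal _ _ (ltW S0) ex).
have Gx b : `|grad T F r b x - grad T F t b x| <= k1 * (t `^ (1 - 2 / q) * e) by apply: G => //; left.
have Gy b : `|grad T F r b y - grad T F t b y| <= k1 * (t `^ (1 - 2 / q) * e).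
  by apply: G; [rewrite subrr normr0 ltW|right].
have Ax : `|F x - avg T F t x| <= k2 * (t `^ (2 - 2 / q) * e).
  by apply: le_trans (avg_taylor x sob t0) _; exact: (scal _ _ (ltW K2) ex).
have Ay : `|F y - avg T F t y| <= k2 * (t `^ (2 - 2 / q) * e).
  by apply: le_trans (avg_taylor y sob t0) _; exact: (scal _ _ (ltW K2) ey).
have S1 : `|avg T F t y - avg T F t x - (y.1 - x.1) * grad T F t false x - (y.2 - x.2) * grad T F t true x| <=
    S * (t `^ (2 - 2 / q) * e).
  by apply: le_trans (avgS sob t0 tt xyb) _; exact: (scal _ _ (ltW S0) ex).
have tE : t * (t `^ (1 - 2 / q) * e) = t `^ (2 - 2 / q) * e.
  rewrite mulrA; congr (_ * _); have -> : 2 - 2 / q = 1 + (1 - 2 / q) by ring.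
  by rewrite [RHS]powRD ?powRr1 ?ltW// (gt_eqF t0) implybT.
have /andP[x1 x2] : (`|y.1 - x.1| <= t) && (`|y.2 - x.2| <= t) by move: xy; rewrite plane_norm_le.
have P b (h : R) : `|h| <= t -> `|h * (grad T F r b x - grad T F t b x)| <= k1 * (t `^ (2 - 2 / q) * e).
  by move=> ht; rewrite normrM -tE mulrCA ler_pM.
have P1 := P false _ x1; have P2 := P true _ x2.
split; rewrite -/k1 -/k2.
  rewrite /slope /dot /=; move: S1 Ax Ay P1 P2.
  set X := t `^ _ * e.
  move: (avg T F t y) (avg T F t x) (grad T F t false x) (grad T F t true x) (grad T F r false x) (grad T F r true x)
    (F x) (F y) (y.1 - x.1) (y.2 - x.2) => ay ax d1 d2 r1 r2 fx fy h1 h2 S1 Ax Ay P1 P2.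
  have -> : fy - fx - (r1 * h1 + r2 * h2) = (fy - ay) + ((- (fx - ax)) +
    ((ay - ax - h1 * d1 - h2 * d2) + (- (h1 * (r1 - d1)) + - (h2 * (r2 - d2))))) by ring.
  rewrite (_ : (2 * k2 + 2 * k1 + S) * X = k2 * X + (k2 * X + (S * X + (k1 * X + k1 * X)))); last by ring.
  by do 4 (apply: ler_normDl => //; rewrite ?normrN//).
have X0 : 0 <= t `^ (1 - 2 / q) * e by rewrite mulr_ge0// powR_ge0.
have fin b : `|grad T F r b y - grad T F r b x| <= (2 * k2 + 2 * k1 + S) * (t `^ (1 - 2 / q) * e).
  move: (S2 b) (Gx b) (Gy b); move: (grad T F t b y) (grad T F t b x) (grad T F r b y) (grad T F r b x) => a b' c d.
  move=> h1 h2 h3.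
  have -> : c - d = (c - a) + ((a - b') + - (d - b')) by ring.
  rewrite (_ : (2 * k2 + 2 * k1 + S) * _ = 2 * (k2 * (t `^ (1 - 2 / q) * e)) +
    (k1 * (t `^ (1 - 2 / q) * e) + (S * (t `^ (1 - 2 / q) * e) + k1 * (t `^ (1 - 2 / q) * e)))); last by ring.
  apply: ler_wpDl; first by apply: mulr_ge0 => //; apply: mulr_ge0; [exact: ltW K2|exact: X0].
  by do 2 (apply: ler_normDl => //; rewrite ?normrN//).
by rewrite plane_norm_le; apply/andP; split; exact: fin.
Qed.
End Taylor.

(* [D r F x] is the gradient at [x] of the mean of [F] at scale [r]; on the scales above [r] it behaves
   like the derivative of [F], and unlike the latter it is defined without an embedding theorem. *)
Lemma slope_exists (R : realType) : exists D : R -> (plane R -> R) -> plane R -> plane R,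
  (forall (r a : R) (F G : plane R -> R) x, 0 < r -> continuous F -> continuous G ->
     D r (fun w => a * F w + G w) x = (a * (D r F x).1 + (D r G x).1, a * (D r F x).2 + (D r G x).2)) /\
  forall p q, 2 < q <= p -> exists2 C, 0 < C &
    forall (F : plane R -> R) g (r t : R) x y, sobolev p F g -> 0 < r -> r <= t -> `|y - x| <= t ->
    `|F y - F x - dot (D r F x) (y - x)| <= C * (t `^ (2 - 2 / q) * energy q g (cbox x (4 * t)) `^ q^-1) /\
    `|D r F y - D r F x| <= C * (t `^ (1 - 2 / q) * energy q g (cbox x (4 * t)) `^ q^-1).
Proof.
have [T [M HT]] := bump_tower_exists R.
exists (slope T); split=> [r a F G x r0 cF cG|p q qp].
  by rewrite /slope /= !(grad_linear HT _ _ _ cF cG r0).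
have [M1 _] : 1 <= M /\ True by case: HT => _ _ _ _ [].
have M0 : 0 < 700 * M ^+ 2 by apply: mulr_gt0; [rewrite ltr0n|apply: exprn_gt0; linear].
have qp1 : 1 <= q <= p by case/andP: qp => a b; apply/andP; split; linear.
apply: (slope_taylor HT qp M0).
  by move=> F g x y t s sob t0 ts xy; exact: (avg_step HT qp1 sob t0 ts xy).
by move=> F g x y t s b sob t0 ts xy; exact: (grad_step HT qp1 sob t0 ts xy b).
Qed.

Lemma plane_contD (R : realType) (u v : plane R -> R) : continuous u -> continuous v ->
  continuous (fun w => u w + v w).
Proof. by move=> cu cv w; apply: continuousD; [exact: cu|exact: cv]. Qed.

Lemma plane_contM (R : realType) (u v : plane R -> R) : continuous u -> continuous v ->
  continuous (fun w => u w * v w).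
Proof. by move=> cu cv w; apply: continuousM; [exact: cu|exact: cv]. Qed.

(** * Twice differentiable functions *)

(** Derivatives are given as data along coordinate lines, [F2 i j] being the derivative of [F1 i] in
    direction j; sums and products then carry explicit second derivatives. *)
Definition C2 (R : realType) (F : plane R -> R) (F1 : bool -> plane R -> R) (F2 : bool -> bool -> plane R -> R) :=
  [/\ continuous F, forall b, continuous (F1 b), forall i j, continuous (F2 i j),
      forall b w, is_derive (coord b w) 1 (fun t : R => F (line b w t)) (F1 b w) &
      forall i j w, is_derive (coord j w) 1 (fun t : R => F1 i (line j w t)) (F2 i j w)].

Lemma line_coord (R : realType) b (w : plane R) : line b w (coord b w) = w.
Proof. by case: b; case: w. Qed.

Lemma partial_is_derive (R : realType) b (phi : plane R -> R) (w : plane R) : differentiable phi w ->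
  is_derive (coord b w) 1 (fun t => phi (line b w t)) (partial b phi w).
Proof.
move=> dphi; rewrite partial_line derive1E; apply/derivableP; apply/derivable1_diffP.
apply: (@differentiable_comp _ _ _ _ (line b w) phi); last by rewrite line_coord.
case: b; rewrite /line.
  by apply: differentiable_pair => //; exact: differentiable_cst.
by apply: differentiable_pair => //; exact: differentiable_cst.
Qed.

Definition boxed_test (R : realType) r (phi : plane R -> R) :=
  (forall s w, differentiable (dpart s phi) w) /\ forall w, ~ cbox 0 r w -> phi w = 0.

Lemma boxed_test_partial (R : realType) b (r : R) phi : boxed_test r phi -> boxed_test r (partial b phi).
Proof.
move=> [dphi sphi]; split=> [s w|w wr].
  have -> : dpart s (partial b phi) = dpart (rcons s b) phi by elim: s => //= c s ->.
  exact: dphi.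
rewrite partial_line derive1E.
have op : open (~` cbox (0 : plane R) r).
  by apply: closed_openC; apply: compact_closed; [exact: norm_hausdorff|exact: compact_cbox].
have nw : \forall t \near coord b w, phi (line b w t) = 0.
  have H : nbhs (line b w (coord b w)) (~` cbox (0 : plane R) r).
    by rewrite line_coord; exact: open_nbhs_nbhs (conj op wr).
  have H' := @continuous_line R b w (coord b w) _ H.
  by apply: (@filterS _ _ _ (line b w @^-1` (~` cbox (0 : plane R) r))) H' => t; exact: sphi.
have dz := @is_derive_cst R R R 0 (coord b w) 1.
have h : is_derive (coord b w) 1 (fun t => phi (line b w t)) 0.
  apply: (@near_eq_is_derive _ _ _ (fun=> 0) _ _ _ _ _ dz) => //.
  by apply: filterS nw => t ->.
exact: (@derive_val _ _ _ _ _ _ _ h).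
Qed.

Lemma test_function_boxed (R : realType) (phi : plane R -> R) : test_function phi ->
  exists r, boxed_test r phi.
Proof.
move=> [dphi cphi].
have [M [_ /(_ (`|M| + 1))]] := compact_bounded cphi.
rewrite ltr_pwDr// ?ler_norm// => /(_ isT) HM.
exists (`|M| + 1); split=> // w wr; apply: contrapT => /eqP nz; apply: wr; apply/cbox_norm.
by rewrite subr0; apply: HM; apply: subset_closure.
Qed.

Lemma integral_by_parts (R : realType) b (F F' phi : plane R -> R) r :
  continuous F -> continuous F' ->
  (forall w, is_derive (coord b w) 1 (fun t : R => F (line b w t)) (F' w)) -> boxed_test r phi ->
  (\int[leb R]_w (F w * partial b phi w)%:E = - \int[leb R]_w (F' w * phi w)%:E)%E.
Proof.
move=> cF cF' dF tphi; have [dphi sphi] := tphi; have [dphi' sphi'] := boxed_test_partial b tphi.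
have cphi : continuous phi by move=> w; apply: differentiable_continuous; exact: (dphi [::]).
have cphi' : continuous (partial b phi) by move=> w; apply: differentiable_continuous; exact: (dphi' [::]).
have i1 := pairing_integrable cF cphi' sphi'; have i2 := pairing_integrable cF' cphi sphi.
have : (\int[leb R]_w (F w * partial b phi w + F' w * phi w)%:E = 0)%E.
  apply: (@integral_partial_supported R b (fun w => F w * phi w) _ 0 r).
  - move=> w; have d2 := partial_is_derive b (dphi [::] w).
    have := @is_deriveM _ _ (fun t => F (line b w t)) (fun t => phi (line b w t)) _ _ _ _ (dF w) d2.
    by rewrite !line_coord /GRing.scale /= [X in _ + X]mulrC.
  - by apply: plane_contD; exact: plane_contM.
  - by move=> w /sphi ->; rewrite mulr0.
  - by move=> w h; rewrite sphi// sphi'// !mulr0 addr0.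
have f1 : (\int[leb R]_w (F w * partial b phi w)%:E \is a fin_num)%E by exact: integrable_fin_num.
have f2 : (\int[leb R]_w (F' w * phi w)%:E \is a fin_num)%E by exact: integrable_fin_num.
under eq_integral do rewrite EFinD.
rewrite (integralD_EFin measurableT i1 i2); move: f1 f2; rewrite /comp /=.
case: (\int[_]_x _)%E => // u _; case: (\int[_]_x _)%E => // v _ [] h.
by congr EFin; linear.
Qed.

Lemma C2_weak_hessian (R : realType) (F : plane R -> R) F1 F2 : C2 F F1 F2 -> weak_hessian F F2.
Proof.
move=> [cF c1 c2 d1 d2] i j; split; first exact: continuous_plane_measurable.
move=> phi /test_function_boxed [r tphi].
have tj := boxed_test_partial j tphi.
rewrite /= (integral_by_parts cF (c1 i) (d1 i) tj).
by rewrite (integral_by_parts (c1 i) (c2 i j) (d2 i j) tphi) oppeK.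
Qed.

Lemma C2_cst (R : realType) (c : R) : C2 (fun _ : plane R => c) (fun _ _ => 0) (fun _ _ _ => 0).
Proof.
by split=> *; first [exact: cst_continuous|exact: is_derive_cst].
Qed.

Lemma C2_coord (R : realType) b : C2 (@coord R b) (fun i _ => (i == b)%:R) (fun _ _ _ => 0).
Proof.
split; try by move=> *; first [exact: cst_continuous|exact: is_derive_cst].
  by case: b => w; [exact: cvg_snd|exact: cvg_fst].
by move=> c w; case: b; case: c; rewrite /line /coord /=; first [exact: is_derive_cst|exact: is_derive_id].
Qed.

Lemma C2D (R : realType) (F G : plane R -> R) F1 F2 G1 G2 : C2 F F1 F2 -> C2 G G1 G2 ->
  C2 (fun w => F w + G w) (fun b w => F1 b w + G1 b w) (fun i j w => F2 i j w + G2 i j w).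
Proof.
move=> [a1 a2 a3 a4 a5] [b1 b2 b3 b4 b5]; split.
- by move=> w; apply: continuousD; [exact: a1|exact: b1].
- by move=> b w; apply: continuousD; [exact: a2|exact: b2].
- by move=> i j w; apply: continuousD; [exact: a3|exact: b3].
- by move=> b w; exact: is_deriveD (a4 b w) (b4 b w).
- by move=> i j w; exact: is_deriveD (a5 i j w) (b5 i j w).
Qed.

Lemma C2M (R : realType) (F G : plane R -> R) F1 F2 G1 G2 : C2 F F1 F2 -> C2 G G1 G2 ->
  C2 (fun w => F w * G w) (fun b w => F w * G1 b w + G w * F1 b w)
     (fun i j w => (F w * G2 i j w + G1 i w * F1 j w) + (G w * F2 i j w + F1 i w * G1 j w)).
Proof.
move=> [a1 a2 a3 a4 a5] [b1 b2 b3 b4 b5].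
have dM b (u v : plane R -> R) w du dv : is_derive (coord b w) 1 (fun t : R => u (line b w t)) du ->
    is_derive (coord b w) 1 (fun t : R => v (line b w t)) dv ->
    is_derive (coord b w) 1 (fun t : R => u (line b w t) * v (line b w t)) (u w * dv + v w * du).
  move=> h1 h2; have := @is_deriveM _ _ _ _ _ _ _ _ h1 h2.
  by rewrite !line_coord.
split.
- exact: plane_contM.
- by move=> b; apply: plane_contD; exact: plane_contM.
- by move=> i j; do 2 apply: plane_contD; exact: plane_contM.
- by move=> b w; exact: dM.
- by move=> i j w; apply: is_deriveD; exact: dM.
Qed.

Lemma C2_sum (R : realType) (I : Type) (r : seq I) (F : I -> plane R -> R) F1 F2 :
  (forall i, C2 (F i) (F1 i) (F2 i)) ->
  C2 (fun w => \sum_(i <- r) F i w) (fun b w => \sum_(i <- r) F1 i b w) (fun a b w => \sum_(i <- r) F2 i a b w).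
Proof.
move=> h; elim: r => [|i r IH].
  rewrite (_ : (fun w => _) = fun=> 0); last by apply/funext => w; rewrite big_nil.
  rewrite (_ : (fun (b : bool) (w : plane R) => \sum_(i <- [::]) F1 i b w) = fun _ _ => 0); last by apply/funext => b; apply/funext => w; rewrite big_nil.
  rewrite (_ : (fun (a b : bool) (w : plane R) => \sum_(i <- [::]) F2 i a b w) = fun _ _ _ => 0); first exact: C2_cst.
  by apply/funext => a; apply/funext => b; apply/funext => w; rewrite big_nil.
rewrite (_ : (fun w : plane R => \sum_(k <- i :: r) F k w) = fun w => F i w + \sum_(i <- r) F i w); last by apply/funext => w; rewrite big_cons.
rewrite (_ : (fun (b : bool) (w : plane R) => \sum_(k <- i :: r) F1 k b w) = fun b w => F1 i b w + \sum_(i <- r) F1 i b w); last first.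
  by apply/funext => b; apply/funext => w; rewrite big_cons.
rewrite (_ : (fun (a b : bool) (w : plane R) => \sum_(k <- i :: r) F2 k a b w) = fun a b w => F2 i a b w + \sum_(i <- r) F2 i a b w); first exact: C2D.
by apply/funext => a; apply/funext => b; apply/funext => w; rewrite big_cons.
Qed.

(** * The seminormed space of pairs of a function and its weak Hessian *)

Lemma pairing_g_integrable (R : realType) (p : R) F g i j (phi : plane R -> R) r : 1 <= p -> sobolev p F g ->
  continuous phi -> (forall w, ~ cbox 0 r w -> phi w = 0) ->
  (leb R).-integrable setT (EFin \o (fun w => g i j w * phi w)).
Proof.
move=> p1 sob cphi sphi; have [cF wh fin] := sob; have [M M0 HM] := supported_bounded cphi sphi.
have [mg _] := wh i j; have mphi := continuous_plane_measurable cphi.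
have mP D := measurable_EFinS (D := D) (measurable_gam_powR 1 wh).
have p01 : 0 < (1 : R) <= p by rewrite ltr01.
have f1 := energy_fin 0 r p01 sob.
apply/integrableP; split; first by apply/measurable_EFinP; exact: measurable_funM.
have X : (M%:E * \int[leb R]_(w in cbox (0%R : plane R) r) (gam g w `^ 1)%:E < +oo)%E.
  by apply: lte_mul_pinfty => //; rewrite lee_fin ltW.
apply: le_lt_trans X.
rewrite -ge0_integralZl//; last 4 first.
- exact: measurable_cbox.
- exact: mP.
- by move=> w _; rewrite lee_fin powR_ge0.
- by rewrite lee_fin ltW.
rewrite [leRHS]integral_mkcond; apply: ge0_le_integral => //.
- by apply: measurableT_comp => //; apply/measurable_EFinP; exact: measurable_funM.
- apply: (iffLR (measurable_restrictT _ _)); first exact: measurable_cbox.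
  by under eq_fun do rewrite -EFinM; apply: measurable_EFinS; apply: measurable_funM => //; exact: measurable_gam_powR wh.
- move=> w _ /=; rewrite patchE; case: ifPn => [_|]; last first.
    by rewrite notin_setE => /sphi ->; rewrite mulr0 normr0.
  by rewrite -EFinM lee_fin normrM mulrC ler_pM// powRr1 ?gam_ge0// gam_ge.
Qed.

Definition hcomb (R : realType) (a : R) (g h : bool -> bool -> plane R -> R) : bool -> bool -> plane R -> R :=
  fun i j w => a * g i j w + h i j w.

Lemma gam_hcomb (R : realType) (a : R) g h w : gam (hcomb a g h) w <= `|a| * gam g w + gam h w.
Proof.
rewrite /gam mulr_sumr -big_split /=; apply: ler_sum => i _.
rewrite mulr_sumr -big_split /=; apply: ler_sum => j _.
by rewrite -normrM; exact: ler_normD.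
Qed.

Lemma gam0 (R : realType) (w : plane R) : gam (fun _ _ _ => 0) w = 0.
Proof. by rewrite /gam big1// => i _; rewrite big1// => j _; rewrite normr0. Qed.

Lemma sobolev_comb (R : realType) (p a : R) F G g h : 1 <= p -> sobolev p F g -> sobolev p G h ->
  sobolev p (fun w => a * F w + G w) (hcomb a g h).
Proof.
move=> p1 sF sG; have [cF wF fF] := sF; have [cG wG fG] := sG.
have mP k (K : plane R -> R) (wK : weak_hessian K k) := measurable_EFinS (D := setT) (measurable_gam_powR p wK).
have wh : weak_hessian (fun w => a * F w + G w) (hcomb a g h).
  move=> i j; have [mg eg] := wF i j; have [mh eh] := wG i j; split.
    by apply: measurable_funD => //; exact: measurable_funM.
  move=> phi tphi; have [r tb] := test_function_boxed tphi; have [dphi sphi] := tb.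
  have [ddphi sdphi] := boxed_test_partial i (boxed_test_partial j tb).
  have cphi : continuous phi by move=> w; apply: differentiable_continuous; exact: (dphi [::]).
  have cdphi : continuous (dpart [:: i; j] phi).
    by move=> w; apply: differentiable_continuous; exact: (ddphi [::]).
  have i1 := pairing_integrable cF cdphi sdphi; have i2 := pairing_integrable cG cdphi sdphi.
  have i3 := pairing_g_integrable i j p1 sF cphi sphi; have i4 := pairing_g_integrable i j p1 sG cphi sphi.
  have lin (u v f : plane R -> R) : (leb R).-integrable setT (EFin \o (fun w => u w * f w)) ->
      (leb R).-integrable setT (EFin \o (fun w => v w * f w)) ->
      (\int[leb R]_w ((a * u w + v w) * f w)%:E =
       a%:E * \int[leb R]_w (u w * f w)%:E + \int[leb R]_w (v w * f w)%:E)%E.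
    move=> iu iv; rewrite -integralZl//.
    rewrite -integralD//; last by have := integrableZl measurableT a iu.
    by apply: eq_integral => w _; rewrite -EFinM -EFinD; congr EFin; ring.
  rewrite /leb2 lin// [RHS]lin//.
  by have := eg _ tphi; rewrite /leb2 => ->; have := eh _ tphi; rewrite /leb2 => ->.
split; [|exact: wh|].
  by apply: plane_contD; [apply: plane_contM; [exact: cst_continuous|exact: cF]|exact: cG].
pose A := 2 `^ p * `|a| `^ p; pose B := (2 : R) `^ p.
have A0 : 0 <= A by rewrite mulr_ge0 ?powR_ge0.
apply: (@le_lt_trans _ _ (\int[leb R]_w (A%:E * (gam g w `^ p)%:E + B%:E * (gam h w `^ p)%:E))%E).
  apply: ge0_le_integral => //.
  - by move=> w _; rewrite lee_fin powR_ge0.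
  - exact: mP wh.
  - apply: emeasurable_funD; (under eq_fun do rewrite -EFinM); apply: measurable_EFinS; apply: measurable_funM => //.
      exact: measurable_gam_powR wF.
    exact: measurable_gam_powR wG.
  - move=> w _; rewrite -!EFinM -EFinD lee_fin.
    apply: (@le_trans _ _ ((`|a| * gam g w + gam h w) `^ p)).
      by apply: ge0_ler_powR (gam_hcomb a g h w); rewrite ?nnegrE ?gam_ge0 ?addr_ge0 ?mulr_ge0 ?gam_ge0//; linear.
    apply: le_trans (powR_addr_le _ _ _) _; rewrite ?mulr_ge0 ?gam_ge0//; first linear.
    by rewrite powRM ?gam_ge0// mulrDr mulrA.
rewrite ge0_integralD//.
- rewrite !ge0_integralZl//; try by move=> w _; rewrite lee_fin powR_ge0.
  + have fin (k : R) (I : \bar R) : 0 <= k -> (I < +oo)%E -> (k%:E * I < +oo)%E.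
      by move=> k0; apply: lte_mul_pinfty; rewrite ?lee_fin.
    by apply: lte_add_pinfty; [exact: (fin _ _ A0 fF)|exact: (fin _ _ (powR_ge0 2 p) fG)].
  + exact: mP wG.
  + by rewrite lee_fin powR_ge0.
  + exact: mP wF.
- by move=> w _; rewrite mule_ge0// lee_fin powR_ge0.
- by (under eq_fun do rewrite -EFinM); apply: measurable_EFinS; apply: measurable_funM => //; exact: measurable_gam_powR wF.
- by move=> w _; rewrite mule_ge0// lee_fin powR_ge0.
- by (under eq_fun do rewrite -EFinM); apply: measurable_EFinS; apply: measurable_funM => //; exact: measurable_gam_powR wG.
Qed.

Definition energy_norm (R : realType) (p : R) (g : bool -> bool -> plane R -> R) (B : set (plane R)) : R :=
  energy p g B `^ p^-1.

Lemma energy_finE (R : realType) (p : R) F g (B : set (plane R)) : measurable B -> sobolev p F g ->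
  (\int[leb R]_(w in B) (gam g w `^ p)%:E = (energy p g B)%:E)%E.
Proof.
move=> mB [cF wh fin]; rewrite /energy fineK// ge0_fin_numE; last first.
  by apply: integral_ge0 => w _; rewrite lee_fin powR_ge0.
apply: le_lt_trans fin; apply: ge0_subset_integral => //.
  by apply: measurable_EFinS; exact: measurable_gam_powR wh.
by move=> w _; rewrite lee_fin powR_ge0.
Qed.

(** Minkowski's inequality after the pointwise subadditivity of [gam]. This is the seminorm property
    on which the Hahn-Banach argument rests. *)
Lemma energy_norm_comb (R : realType) (p a : R) F G g h B : 1 <= p -> measurable B ->
  sobolev p F g -> sobolev p G h ->
  energy_norm p (hcomb a g h) B <= `|a| * energy_norm p g B + energy_norm p h B.
Proof.
move=> p1 mB sF sG; have [cF wF fF] := sF; have [cG wG fG] := sG.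
have sH := sobolev_comb a p1 sF sG; have [_ wH _] := sH.
have p0 : 0 < p by linear.
have NE k K : sobolev p K k -> ('N[leb R]_p%:E[EFin \o (gam k \_ B)] = (energy_norm p k B)%:E)%E.
  move=> sK; have := energy_finE mB sK; rewrite unlock /Lnorm /energy_norm => e.
  have -> : (energy p k B `^ p^-1)%:E = ((energy p k B)%:E `^ p^-1)%E by [].
  rewrite -e; apply: (congr1 (fun z : \bar R => (z `^ p^-1)%E)); rewrite [RHS]integral_mkcond.
  apply: eq_integral => w _; rewrite /= !patchE; case: ifPn => _; first by rewrite ger0_norm ?gam_ge0.
  by rewrite normr0 powR0// gt_eqF.
have mk k K : weak_hessian K k -> measurable_fun setT (gam k \_ B).
  move=> wK; apply: (iffLR (measurable_restrictT _ mB)); apply: measurable_funTS; exact: measurable_gam wK.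
have := @minkowski_EFin _ _ _ (leb R) (fun w => `|a| * (gam g \_ B) w) (gam h \_ B) p.
move=> /(_ (measurable_funM (measurable_cst _) (mk _ _ wF)) (mk _ _ wG) p1).
rewrite [X in (_ <= _ + X)%E](NE _ _ sG).
have -> : ('N[leb R]_p%:E[(EFin \o (fun w : plane R => (`|a| * (gam g \_ B) w)%R))] = (`|a| * energy_norm p g B)%:E)%E.
  rewrite EFinM -(NE _ _ sF) unlock /Lnorm /=.
  under eq_integral do rewrite normrM normr_id powRM// EFinM.
  have mg : measurable_fun setT (fun w => (`|(gam g \_ B) w| `^ p)%:E).
    apply: measurable_EFinS; apply: (@measurableT_comp _ _ _ _ _ _ (@powR R ^~ p)); first exact: measurable_powR.
    by apply: measurableT_comp => //; exact: mk wF.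
  have g0 w : (0 <= (`|(gam g \_ B) w| `^ p)%:E)%E by rewrite lee_fin powR_ge0.
  have a0 : (0 <= (`|a| `^ p)%:E)%E by rewrite lee_fin powR_ge0.
  transitivity (((`|a| `^ p)%:E * \int[leb R]_x (`|(gam g \_ B) x| `^ p)%:E) `^ p^-1)%E.
    by congr (_ `^ _)%E; exact: (ge0_integralZl (leb R) measurableT mg (fun w _ => g0 w) a0).
  rewrite poweRM//; last exact: integral_ge0.
  by rewrite /= -powRrM divff ?gt_eqF// powRr1.
rewrite -EFinD -lee_fin; apply: le_trans; rewrite -(NE _ _ sH) unlock /Lnorm /=.
apply: gt0_ler_poweR; first by rewrite invr_ge0 ltW.
- by rewrite in_itv/= leey andbT; apply: integral_ge0 => w _; rewrite lee_fin powR_ge0.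
- by rewrite in_itv/= leey andbT; apply: integral_ge0 => w _; rewrite lee_fin powR_ge0.
apply: ge0_le_integral => //.
- apply: measurable_EFinS; apply: (@measurableT_comp _ _ _ _ _ _ (@powR R ^~ p)); first exact: measurable_powR.
  by apply: measurableT_comp => //; exact: mk wH.
- apply: measurable_EFinS; apply: (@measurableT_comp _ _ _ _ _ _ (@powR R ^~ p)); first exact: measurable_powR.
  apply: measurableT_comp => //; apply: measurable_funD; last exact: mk wG.
  by apply: measurable_funM => //; exact: mk wF.
- move=> w _; rewrite lee_fin; apply: ge0_ler_powR; rewrite ?nnegrE ?(ltW p0)// /= !patchE.
  case: ifPn => _; last by rewrite normr0.
  rewrite ger0_norm ?gam_ge0// ger0_norm; last by rewrite addr_ge0 ?mulr_ge0 ?gam_ge0.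
  exact: gam_hcomb.
Qed.

(** * Discretisation of the energy *)

Lemma ge0_integral_scale (R : realType) (D : set (plane R)) (c : R) (f : plane R -> R) :
  measurable D -> measurable_fun setT f -> (forall w, 0 <= f w) -> 0 <= c ->
  (c%:E * \int[leb R]_(w in D) (f w)%:E = \int[leb R]_(w in D) (c * f w)%:E)%E.
Proof.
move=> mD mf f0 c0; under [RHS]eq_integral do rewrite EFinM.
rewrite ge0_integralZl//; first by apply: measurable_EFinS.
by move=> w _; rewrite lee_fin.
Qed.

Lemma measurable_patch (R : realType) (D : set (plane R)) (f : plane R -> \bar R) :
  measurable D -> measurable_fun setT f -> measurable_fun setT (f \_ D).
Proof. by move=> mD mf; apply: (iffLR (measurable_restrictT _ mD)); exact: measurable_funTS. Qed.

Lemma energyE (R : realType) (p q : R) F g (x : plane R) r B : 0 < q <= p -> sobolev p F g -> measurable B ->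
  B `<=` cbox x r -> (\int[leb R]_(w in B) (gam g w `^ q)%:E = (energy q g B)%:E)%E.
Proof.
move=> qp sob mB Bx; have [cF wh fin] := sob; rewrite /energy fineK// ge0_fin_numE; last first.
  by apply: integral_ge0 => w _; rewrite lee_fin powR_ge0.
apply: le_lt_trans (energy_fin x r qp sob); apply: ge0_subset_integral => //.
- exact: measurable_cbox.
- by apply: measurable_EFinS; exact: measurable_gam_powR wh.
- by move=> w _; rewrite lee_fin powR_ge0.
Qed.

Lemma integral_sum_patch (R : realType) (I : finType) (P : pred I) (D : I -> set (plane R)) (f : plane R -> \bar R) :
  measurable_fun setT f -> (forall w, 0 <= f w)%E -> (forall k, measurable (D k)) ->
  (\sum_(k | P k) \int[leb R]_(w in D k) f w = \int[leb R]_w \sum_(k | P k) (f \_ (D k)) w)%E.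
Proof.
move=> mf f0 mD; under [in RHS]eq_integral do rewrite -big_filter.
rewrite ge0_integral_sum//.
- by rewrite [RHS]big_filter; apply: eq_bigr => k _; exact: integral_mkcond.
- by move=> k; exact: measurable_patch.
- by move=> k w _; rewrite patchE; case: ifPn.
Qed.

Lemma integral_cover (R : realType) (I : finType) (P : pred I) (D : I -> set (plane R)) B (f : plane R -> \bar R) :
  measurable_fun setT f -> (forall w, 0 <= f w)%E -> (forall k, measurable (D k)) -> measurable B ->
  (forall w, B w -> exists2 k, P k & D k w) ->
  (\int[leb R]_(w in B) f w <= \sum_(k | P k) \int[leb R]_(w in D k) f w)%E.
Proof.
move=> mf f0 mD mB cov; rewrite integral_sum_patch// integral_mkcond.
have p0 k w : (0 <= (f \_ (D k)) w)%E by rewrite patchE; case: ifPn.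
apply: ge0_le_integral => //.
- by move=> w _; rewrite patchE; case: ifPn.
- by apply: (iffLR (measurable_restrictT _ _)) => //; exact: measurable_funTS.
- under eq_fun do rewrite -big_filter.
  by apply: emeasurable_sum => k; exact: measurable_patch.
- move=> w _; rewrite patchE; case: ifPn => [/set_mem/cov [k Pk Dk]|_]; last exact: sume_ge0.
  rewrite (bigD1 k)//= patchE mem_set// -[leLHS]adde0; apply: leeD => //; exact: sume_ge0.
Qed.

Lemma integral_packing (R : realType) (I : finType) (P : pred I) (D : I -> set (plane R)) B m (f : plane R -> R) :
  measurable_fun setT f -> (forall w, 0 <= f w) -> (forall k, measurable (D k)) -> measurable B ->
  (forall k, P k -> D k `<=` B) -> (forall w, #|[pred k | P k && (w \in D k)]| <= m)%N ->
  (\sum_(k | P k) \int[leb R]_(w in D k) (f w)%:E <= m%:R%:E * \int[leb R]_(w in B) (f w)%:E)%E.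
Proof.
have mE (h : plane R -> R) : measurable_fun setT h -> measurable_fun setT (fun w => (h w)%:E) by exact: measurable_EFinS.
move=> mf f0 mD mB DB ov; rewrite integral_sum_patch//; last exact: mE.
rewrite (ge0_integral_scale mB mf f0)//.
rewrite [leRHS]integral_mkcond; apply: ge0_le_integral => //.
- by move=> w _; apply: sume_ge0 => k _; rewrite patchE; case: ifPn => _; rewrite ?lee_fin.
- under eq_fun do rewrite -big_filter.
  by apply: emeasurable_sum => k; apply: measurable_patch => //; exact: mE.
- by apply: measurable_patch => //; apply: mE; exact: measurable_funM.
- move=> w _; rewrite [leRHS]patchE; case: ifPn => [_|wB]; last first.
    rewrite big1// => k Pk; rewrite patchE; case: ifPn => // /set_mem /(DB _ Pk) /mem_set.
    by rewrite (negPf wB).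
  rewrite (eq_bigr (fun k => if w \in D k then (f w)%:E else 0%E)); last by move=> k _; rewrite patchE.
  rewrite -big_mkcondr /= sumEFin lee_fin.
  rewrite (_ : \sum_(i | _) _ = f w *+ #|[pred k | P k && (w \in D k)]|); last first.
    by rewrite -sumr_const; apply: eq_bigl => k; rewrite inE.
  by rewrite -[leLHS]mulr_natl ler_wpM2r// ler_nat; exact: ov.
Qed.

Lemma energy_packing (R : realType) (p : R) F g (I : finType) (P : pred I) (D : I -> set (plane R)) B m :
  sobolev p F g -> (forall k, measurable (D k)) -> measurable B ->
  (forall k, P k -> D k `<=` B) -> (forall w, #|[pred k | P k && (w \in D k)]| <= m)%N ->
  \sum_(k | P k) energy p g (D k) <= m%:R * energy p g B.
Proof.
move=> sob mD mB DB ov; have [_ wh _] := sob.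
rewrite -lee_fin EFinM -(energy_finE mB sob) -sumEFin.
rewrite (eq_bigr (fun k => \int[leb R]_(w in D k) (gam g w `^ p)%:E)%E); last by move=> k _; rewrite (energy_finE (mD k) sob).
apply: (@integral_packing _ _ _ _ _ _ (fun w => gam g w `^ p)) => //; first exact: measurable_gam_powR wh.
by move=> w; exact: powR_ge0.
Qed.

Definition node (R : realType) (O : plane R) (rho : R) (i j : nat) : plane R :=
  (O.1 + rho * i%:R, O.2 + rho * j%:R).

(** Half-open, so that the cells are disjoint and those of a window cover it exactly. *)
Definition cell (R : realType) (O : plane R) (rho : R) (i j : nat) : set (plane R) :=
  `[O.1 + rho * i%:R, O.1 + rho * i.+1%:R[ `*` `[O.2 + rho * j%:R, O.2 + rho * j.+1%:R[.

Definition window (R : realType) (O : plane R) (rho : R) (n : nat) : set (plane R) :=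
  `[O.1, O.1 + rho * n%:R[ `*` `[O.2, O.2 + rho * n%:R[.

Section Cells.
Variables (R : realType) (O : plane R) (rho : R) (n : nat).
Hypothesis rho0 : 0 < rho.

Lemma measurable_cell i j : measurable (cell O rho i j).
Proof. by apply: measurableX; exact: measurable_itv. Qed.

Lemma cellP i j w : cell O rho i j w <->
  (rho * i%:R <= w.1 - O.1 < rho * i.+1%:R) /\ (rho * j%:R <= w.2 - O.2 < rho * j.+1%:R).
Proof.
rewrite /cell /= !in_itv/=; split=> -[/andP[a b] /andP[c d]]; split; apply/andP; split; lra.
Qed.

Lemma grid_index (u : R) : 0 <= u < rho * n%:R -> exists i : 'I_n, rho * i%:R <= u < rho * i.+1%:R.
Proof.
move=> /andP[u0 un]; have v0 : 0 <= u / rho by rewrite divr_ge0// ltW.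
have /andP[a b] := truncn_itv v0.
have kn : (Num.truncn (u / rho) < n)%N.
  by rewrite -(ltr_nat R) (le_lt_trans a)// ltr_pdivrMr// mulrC.
by exists (Ordinal kn); rewrite /= ![rho * _]mulrC -ler_pdivlMr// -ltr_pdivrMr// a.
Qed.

Lemma cell_exists w : window O rho n w -> exists i j : 'I_n, cell O rho i j w.
Proof.
rewrite /window /= !in_itv/= => -[/andP[a b] /andP[c d]].
have [|i hi] := @grid_index (w.1 - O.1); first by apply/andP; split; lra.
have [|j hj] := @grid_index (w.2 - O.2); first by apply/andP; split; lra.
by exists i, j; apply/cellP.
Qed.

Lemma grid_index_uniq (i k : nat) (u : R) : rho * i%:R <= u < rho * i.+1%:R -> rho * k%:R <= u < rho * k.+1%:R -> i = k.
Proof.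
move=> /andP[a b] /andP[c d].
have := le_lt_trans a d; have := le_lt_trans c b; rewrite !ltr_pM2l// !ltr_nat !ltnS => h1 h2.
by apply/eqP; rewrite eqn_leq h1 h2.
Qed.

Lemma cell_cbox i j : cell O rho i j `<=` cbox (O.1 + rho * i%:R + rho / 2, O.2 + rho * j%:R + rho / 2) (rho / 2).
Proof.
move=> w /cellP[/andP[a b] /andP[c d]]; apply/cboxP; rewrite /= !ler_norml.
by rewrite -natr1 mulrDr in b; rewrite -natr1 mulrDr in d; split; apply/andP; split; lra.
Qed.

(** Jensen's inequality, through the tangent of t^(p/r) at the mean u (Young's inequality)
    integrated over the cell. The mean is taken with respect to the area of the whole cell although
    B may cut it; this only lowers u. *)
Lemma cell_jensen (p r : R) F g i j B : 0 < r < p -> sobolev p F g -> measurable B ->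
  rho ^+ 2 * (rho ^- 2 * energy r g (cell O rho i j `&` B)) `^ (p / r) <= energy p g (cell O rho i j `&` B).
Proof.
move=> /andP[r0 rp] sob mB; have [_ wh _] := sob.
set D := cell O rho i j `&` B; set I := energy r g D; set u := rho ^- 2 * I.
have mD : measurable D by apply: measurableI => //; exact: measurable_cell.
have Dc : D `<=` cbox (O.1 + rho * i%:R + rho / 2, O.2 + rho * j%:R + rho / 2) (rho / 2).
  by move=> w [/cell_cbox].
have rp' : 0 < r <= p by rewrite r0 ltW.
have pp : 0 < p <= p by rewrite lexx andbT; lra.
have I0 : 0 <= I by exact: energy_ge0.
have u0 : 0 <= u by rewrite mulr_ge0// invr_ge0 sqr_ge0.
have k1 : 1 < p / r by rewrite ltr_pdivlMr// mul1r.
have [->|un] := eqVneq u 0; first by rewrite powR0 ?mulr0 ?energy_ge0// gt_eqF//; lra.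
have up : 0 < u by rewrite lt0r un.
set k := p / r in k1 *; have k0 : 0 < k by lra.
have mP s := measurable_EFinS (D := D) (measurable_gam_powR s wh).
have pw w : u `^ (k - 1) * gam g w `^ r <= (k - 1) / k * u `^ k + gam g w `^ p / k.
  have := young_powR k1 u0 (powR_ge0 (gam g w) r); rewrite -powRrM.
  by rewrite (_ : r * k = p)// /k; field; rewrite gt_eqF.
have le1 : u `^ (k - 1) * I <= (k - 1) / k * u `^ k * rho ^+ 2 + energy p g D / k.
  rewrite -lee_fin EFinD !EFinM -(energyE rp' sob mD Dc) -(energyE pp sob mD Dc).
  have c1 : 0 <= (k - 1) / k * u `^ k by rewrite mulr_ge0 ?powR_ge0// divr_ge0; lra.
  have c2 : 0 <= k^-1 by rewrite invr_ge0; lra.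
  have mf (c s : R) : measurable_fun setT (fun w => c * gam g w `^ s).
    by apply: measurable_funM => //; exact: measurable_gam_powR wh.
  rewrite (ge0_integral_scale mD (measurable_gam_powR r wh)) ?powR_ge0//; last by move=> w; exact: powR_ge0.
  rewrite [X in (_ <= _ + X)%E]muleC (ge0_integral_scale mD (measurable_gam_powR p wh))//; last by move=> w; exact: powR_ge0.
  apply: (@le_trans _ _ (((k - 1) / k * u `^ k)%:E * leb R D + \int[leb R]_(w in D) (k^-1 * gam g w `^ p)%:E)%E).
    rewrite -integral_cst// -ge0_integralD//; last 2 first.
    - by move=> w _; rewrite lee_fin mulr_ge0// powR_ge0.
    - exact: measurable_EFinS.
    apply: ge0_le_integral => //.
    - by move=> w _; rewrite lee_fin mulr_ge0 ?powR_ge0.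
    - exact: measurable_EFinS.
    - by apply: emeasurable_funD => //; exact: measurable_EFinS.
    - by move=> w _; rewrite -EFinD lee_fin [k^-1 * _]mulrC.
  apply: leeD => //; rewrite -!EFinM; apply: (@le_trans _ _ (((k - 1) / k * u `^ k)%:E * (rho ^+ 2)%:E)%E); last by rewrite !EFinM.
  apply: lee_wpmul2l; first by rewrite lee_fin.
  have := le_measure (leb R) (mem_set mD) (mem_set (measurable_cbox _ _)) Dc.
  have h2 : 0 <= rho / 2 by rewrite divr_ge0// ltW.
  move=> h; apply: (le_trans h); apply: (@eq_ind_r _ _ (fun z => (z <= _)%E) _ _ (leb2_cbox _ h2)); rewrite lee_fin.
  by rewrite mulrCA divff// mulr1.
have uI : I = u * rho ^+ 2 by rewrite /u mulrAC mulVf ?mul1r// sqrf_eq0 gt_eqF.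
have uk : u `^ (k - 1) * u = u `^ k.
  rewrite -{2}[u]powRr1// -powRD; last by rewrite un implybT.
  by rewrite subrK.
rewrite uI mulrA uk in le1.
have e : u `^ k * rho ^+ 2 = (k - 1) / k * u `^ k * rho ^+ 2 + rho ^+ 2 * u `^ k / k by field; rewrite gt_eqF.
by rewrite e lerD2l ler_pM2r ?invr_gt0 in le1.
Qed.

Lemma cells_packing (p : R) F g B : sobolev p F g -> measurable B ->
  \sum_(i < n) \sum_(j < n) energy p g (cell O rho i j `&` B) <= energy p g B.
Proof.
move=> sob mB; rewrite pair_big /= -[leRHS]mul1r.
apply: (@energy_packing _ _ _ _ ('I_n * 'I_n)%type xpredT (fun k => cell O rho k.1 k.2 `&` B) B 1 sob) => //.
- by move=> k; apply: measurableI => //; exact: measurable_cell.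
- move=> w; apply/card_le1P => -[i j]; rewrite !inE => /set_mem[/cellP[a b] wB] [k l].
  rewrite !inE; apply/idP/eqP => [/set_mem[/cellP[/= c d] _]|[-> ->]]; last by apply/mem_set; split => //; apply/cellP.
  by congr pair; apply/val_inj; [exact: grid_index_uniq c a|exact: grid_index_uniq d b].
Qed.

Lemma energy_cells (p r tau : R) F g B x i j s : 0 < r <= p -> sobolev p F g -> measurable B -> rho <= tau ->
  `|x - node O rho i j| <= tau -> cbox x tau `<=` window O rho n `&` B -> 2 * tau / rho + 1 <= s%:R ->
  energy r g (cbox x tau) <= \sum_(k < n | (k <= i + s)%N && (i <= k + s)%N)
           \sum_(l < n | (l <= j + s)%N && (j <= l + s)%N) energy r g (cell O rho k l `&` B).
Proof.
move=> rp sob mB rt xz xW ts; have [_ wh _] := sob.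
rewrite -lee_fin -(energyE rp sob (measurable_cbox _ _) (fun w => id)).
have mc k l : measurable (cell O rho k l `&` B) by apply: measurableI => //; exact: measurable_cell.
have cb k l : cell O rho k l `&` B `<=` cbox (O.1 + rho * k%:R + rho / 2, O.2 + rho * l%:R + rho / 2) (rho / 2).
  by move=> w [/cell_cbox].
rewrite pair_big_dep /= -sumEFin.
rewrite (eq_bigr (fun k : 'I_n * 'I_n => \int[leb R]_(w in cell O rho k.1 k.2 `&` B) (gam g w `^ r)%:E)%E); last first.
  by move=> k _; rewrite (energyE rp sob (mc _ _) (@cb _ _)).
apply: (@integral_cover R ('I_n * 'I_n)%type _ (fun k => cell O rho k.1 k.2 `&` B)) => //.
- by apply: measurable_EFinS; exact: measurable_gam_powR wh.
- by move=> w; rewrite lee_fin powR_ge0.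
- exact: measurable_cbox.
- move=> w wx; have [wW wB] := xW _ wx; have [k [l wkl]] := cell_exists wW.
  exists (k, l) => //=.
  have key (a b : nat) (u v : R) : `|u - v| <= tau -> `|v - rho * a%:R| <= tau -> rho * b%:R <= u < rho * b.+1%:R ->
      (b <= a + s)%N && (a <= b + s)%N.
    rewrite !ler_norml => /andP[h1 h2] /andP[h3 h4] /andP[h5 h6].
    have hs : 2 * tau + rho <= rho * s%:R.
      by have := ler_wpM2l (ltW rho0) ts; rewrite mulrDr mulr1 mulrC divfK// gt_eqF.
    rewrite -natr1 mulrDr in h6.
    have e1 : rho * b%:R <= rho * (a + s)%:R by rewrite natrD mulrDr; lra.
    have e2 : rho * a%:R <= rho * (b + s)%:R by rewrite natrD mulrDr; lra.
    by rewrite !ler_pM2l// !ler_nat in e1 e2; rewrite e1 e2.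
  move: wx xz => /cboxP[w1 w2]; rewrite plane_norm_le /node /= => /andP[x1 x2].
  move/cellP: wkl => [k1 k2].
  apply/andP; split.
    apply: (key i k (w.1 - O.1) (x.1 - O.1)) => //.
      by rewrite (_ : _ - _ = w.1 - x.1)//; ring.
    by rewrite (_ : _ - _ = x.1 - (O.1 + rho * i%:R))//; ring.
  apply: (key j l (w.2 - O.2) (x.2 - O.2)) => //.
    by rewrite (_ : _ - _ = w.2 - x.2)//; ring.
  by rewrite (_ : _ - _ = x.2 - (O.2 + rho * j%:R))//; ring.
Qed.
End Cells.

(** The maximal inequality for the exponent p/r > 1 is applied to the cell means of gam^r plus an
    arbitrary extra density u. The density will carry the errors of the keystone gradients, so that
    one majorant m controls both. *)
Lemma maximal_energy (R : realType) (p r : R) : 0 < r < p -> exists2 C, 0 < C &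
  forall (O : plane R) rho n F g B (u : nat -> nat -> R), 0 < rho -> sobolev p F g -> measurable B ->
  (forall i j, 0 <= u i j) ->
  exists m : nat -> nat -> R, [/\ forall i j, 0 <= m i j,
    forall i j x tau, (i < n)%N -> (j < n)%N -> rho <= tau -> `|x - node O rho i j| <= tau ->
      cbox x tau `<=` window O rho n `&` B -> energy r g (cbox x tau) `^ r^-1 <= C * (tau `^ (2 / r) * m i j),
    forall i j s, (i < n)%N -> (j < n)%N -> (0 < s)%N ->
        \sum_(k < n | (k <= i + s)%N && (i <= k + s)%N)
           \sum_(l < n | (l <= j + s)%N && (j <= l + s)%N) u k l <= C * s%:R ^+ 2 * m i j `^ r &
    rho ^+ 2 * \sum_(i < n) \sum_(j < n) m i j `^ p <=
      C * (energy p g B + rho ^+ 2 * \sum_(i < n) \sum_(j < n) u i j `^ (p / r))].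
Proof.
move=> rp; have /andP[r0 rp'] := rp.
have k1 : 1 < p / r by rewrite ltr_pdivlMr// mul1r.
have rp1 : 0 < r <= p by rewrite r0 ltW.
have [C0 C00 HC] := maximal_2D k1.
set k := p / r in k1 HC *.
pose C1 := (16 * C0) `^ r^-1; pose C2 := C0 * 2 `^ k.
have C10 : 0 <= C1 by exact: powR_ge0.
have C20 : 0 <= C2 by rewrite mulr_ge0 ?powR_ge0// ltW.
exists (C0 + C1 + C2); first by linear.
move=> O rho n F g B u rho0 sob mB u0.
pose v i j := rho ^- 2 * energy r g (cell O rho i j `&` B).
have v0 i j : 0 <= v i j by rewrite mulr_ge0 ?energy_ge0// invr_ge0 sqr_ge0.
have [mm [mm0 H1 H2]] := HC n (fun i j => v i j + u i j) (fun i j => addr_ge0 (v0 i j) (u0 i j)).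
have rn : r != 0 by rewrite gt_eqF.
have mE i j s : (mm i j `^ r^-1) `^ (s * r) = mm i j `^ s.
  by rewrite -powRrM mulrCA mulVf// mulr1.
have mEr i j : (mm i j `^ r^-1) `^ r = mm i j by rewrite -{2}(mul1r r) mE powRr1.
have rho2 : 0 < rho ^+ 2 by rewrite exprn_gt0.
(* The r-th root turns means of gam^r into a quantity of the size of the Hessian, and m^p into the
   (p/r)-th power that the maximal inequality bounds. *)
exists (fun i j => mm i j `^ r^-1); split.
- by move=> i j; exact: powR_ge0.
- move=> i j x tau il jl rt xz xW.
  have tau0 : 0 < tau by linear.
  have t1 : 1 <= tau / rho by rewrite ler_pdivlMr// mul1r.
  pose s := (Num.truncn (2 * tau / rho)).+2.
  have /andP[s1 s2] : (Num.truncn (2 * tau / rho))%:R <= 2 * tau / rho < (Num.truncn (2 * tau / rho)).+1%:R.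
    by apply: truncn_itv; rewrite -mulrA mulr_ge0//; linear.
  have sl : 2 * tau / rho + 1 <= s%:R.
    by rewrite [s%:R](_ : _ = (Num.truncn (2 * tau / rho)).+1%:R + 1) ?lerD2r ?ltW// natr1.
  have su : s%:R <= 4 * (tau / rho).
    have -> : s%:R = (Num.truncn (2 * tau / rho))%:R + 2 :> R by rewrite /s -addn2 natrD.
    have e : 2 * tau / rho = 2 * (tau / rho) by rewrite mulrA.
    by move: s1 t1; rewrite {2}e; linear.
  have E := energy_cells rho0 rp1 sob mB rt xz xW sl.
  have {}E : energy r g (cbox x tau) <= 16 * C0 * (tau ^+ 2 * mm i j).
    apply: le_trans E _.
    apply: (@le_trans _ _ (rho ^+ 2 * (C0 * s%:R ^+ 2 * mm i j))).
      apply: le_trans (ler_wpM2l (ltW rho2) (H1 i j s il jl isT)).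
      rewrite mulr_sumr; apply: ler_sum => a _; rewrite mulr_sumr; apply: ler_sum => b _.
      rewrite /v mulrDr mulrA divff ?gt_eqF// mul1r lerDl mulr_ge0// ltW//.
    have -> : 16 * C0 * (tau ^+ 2 * mm i j) = rho ^+ 2 * (C0 * (4 * (tau / rho)) ^+ 2 * mm i j).
      by field; rewrite gt_eqF.
    rewrite ler_pM2l// ler_wpM2r// ler_pM2l// ler_sqr ?nnegrE//; linear.
  apply: (@le_trans _ _ ((16 * C0 * (tau ^+ 2 * mm i j)) `^ r^-1)).
    by apply: ge0_ler_powR; rewrite ?nnegrE ?invr_ge0 ?energy_ge0 ?(ltW r0)// mulr_ge0 ?mulr_ge0 ?sqr_ge0// ltW.
  have c0 : 0 <= 16 * C0 by linear.
  have tm0 : 0 <= tau ^+ 2 * mm i j by rewrite mulr_ge0 ?sqr_ge0.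
  rewrite (powRM _ c0 tm0) (powRM _ (sqr_ge0 tau) (mm0 i j)).
  rewrite -(powR_mulrn 2 (ltW tau0)) -powRrM; apply: ler_wpM2r; first by rewrite mulr_ge0 ?powR_ge0.
  by rewrite -/C1; linear.
- move=> i j s il jl s0; rewrite mEr; apply: (@le_trans _ _ (C0 * s%:R ^+ 2 * mm i j)).
    apply: le_trans (H1 i j s il jl s0); apply: ler_sum => a _; apply: ler_sum => b _.
    by rewrite lerDr.
  by apply: ler_wpM2r => //; apply: ler_wpM2r; [exact: sqr_ge0|linear].
- have -> : \sum_(i < n) \sum_(j < n) (mm i j `^ r^-1) `^ p = \sum_(i < n) \sum_(j < n) mm i j `^ k.
    apply: eq_bigr => i _; apply: eq_bigr => j _; by rewrite -(mE i j k) /k divfK.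
  apply: le_trans (ler_wpM2l (ltW rho2) H2) _.
  have le3 : rho ^+ 2 * \sum_(i < n) \sum_(j < n) v i j `^ k <= energy p g B.
    apply: le_trans (cells_packing O n rho0 sob mB).
    rewrite mulr_sumr; apply: ler_sum => i _; rewrite mulr_sumr; apply: ler_sum => j _.
    exact: (cell_jensen O rho0 i j rp sob mB).
  have le4 : \sum_(i < n) \sum_(j < n) (v i j + u i j) `^ k <=
      2 `^ k * (\sum_(i < n) \sum_(j < n) v i j `^ k + \sum_(i < n) \sum_(j < n) u i j `^ k).
    rewrite -big_split mulr_sumr /=; apply: ler_sum => i _; rewrite -big_split mulr_sumr /=; apply: ler_sum => j _.
    by apply: powR_addr_le => //; linear.
  set SU := \sum_(i < n) \sum_(j < n) u i j `^ k in le4 *.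
  set SV := \sum_(i < n) \sum_(j < n) v i j `^ k in le3 le4 *.
  have SU0 : 0 <= SU by apply: sumr_ge0 => i _; apply: sumr_ge0 => j _; exact: powR_ge0.
  have e0 := energy_ge0 p g B.
  apply: (@le_trans _ _ (C2 * (rho ^+ 2 * SV + rho ^+ 2 * SU))).
    apply: (@le_trans _ _ (rho ^+ 2 * (C0 * (2 `^ k * (SV + SU))))).
      by apply: ler_wpM2l; [exact: ltW|apply: ler_wpM2l => //; exact: ltW].
    by rewrite /C2 le_eqVlt; apply/orP; left; apply/eqP; ring.
  apply: (@le_trans _ _ (C2 * (energy p g B + rho ^+ 2 * SU))); first by rewrite ler_wpM2l// lerD2r.
  apply: ler_wpM2r; last linear.
  by rewrite addr_ge0// mulr_ge0// ltW.
Qed.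

(** * Keystones *)

(** Two exponents with one constant: r is used against the maximal function, p against the energy of
    a single function around a keystone or in a flatness argument. *)
Definition slope_op (R : realType) (p r C : R) (D : R -> (plane R -> R) -> plane R -> plane R) :=
  [/\ 1 <= C, 2 < r < p,
      forall (t a : R) (F G : plane R -> R) x, 0 < t -> continuous F -> continuous G ->
        D t (fun w => a * F w + G w) x = (a * (D t F x).1 + (D t G x).1, a * (D t F x).2 + (D t G x).2) &
      forall q, q = p \/ q = r -> forall (F : plane R -> R) g (s t : R) x y,
        sobolev p F g -> 0 < s -> s <= t -> `|y - x| <= t ->
        `|F y - F x - dot (D s F x) (y - x)| <= C * (t `^ (2 - 2 / q) * energy q g (cbox x (4 * t)) `^ q^-1) /\
        `|D s F y - D s F x| <= C * (t `^ (1 - 2 / q) * energy q g (cbox x (4 * t)) `^ q^-1)].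

Lemma slope_op_exists (R : realType) (p r : R) : 2 < r < p -> exists C D, @slope_op R p r C D.
Proof.
move=> rp; have /andP[r2 rp'] := rp; have [D [lin tay]] := slope_exists R.
have pp : 2 < p <= p by rewrite lexx andbT; linear.
have rr : 2 < r <= p by rewrite r2 ltW.
have [C1 C10 H1] := tay p p pp; have [C2 C20 H2] := tay p r rr.
have C12 : 1 <= 1 + C1 + C2 by rewrite -addrA lerDl addr_ge0// ltW.
exists (1 + C1 + C2), D; split; [exact: C12|exact: rp|exact: lin|].
have mono (c b t a e : R) : 0 <= a -> 0 <= e -> c <= 1 + C1 + C2 -> t <= c * (a * e) -> t <= (1 + C1 + C2) * (a * e).
  by move=> a0 e0 cc h; apply: (le_trans h); apply: ler_wpM2r => //; exact: mulr_ge0.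
move=> q qq F g s t x y sob s0 st xy.
case: qq => ->.
  by have [h1 h2] := H1 F g s t x y sob s0 st xy; split; [apply: mono h1|apply: mono h2]; rewrite ?powR_ge0//; linear.
by have [h1 h2] := H2 F g s t x y sob s0 st xy; split; [apply: mono h1|apply: mono h2]; rewrite ?powR_ge0//; linear.
Qed.

Lemma dotBl (R : realType) (u v w : plane R) : dot (u - v) w = dot u w - dot v w.
Proof. by rewrite /dot /=; ring. Qed.

Lemma C2_affine (R : realType) (c : R) (v : plane R) :
  C2 (fun w => c + dot v w) (fun b _ => if b then v.2 else v.1) (fun _ _ _ => 0).
Proof.
have h := C2D (C2_cst c) (C2D (C2M (C2_cst v.1) (C2_coord R false)) (C2M (C2_cst v.2) (C2_coord R true))).
move: h; rewrite /C2 => -[h1 h2 h3 h4 h5]; split.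
- exact: h1.
- by move=> b; exact: cst_continuous.
- by move=> i j; exact: cst_continuous.
- move=> b w; have h : is_derive (coord b w) 1 (fun t : R => c + dot v (line b w t)) _ := h4 b w.
  by apply: (is_derive_eq h); case: b {h} => /=; ring.
- by move=> i j w; exact: is_derive_cst.
Qed.

Lemma sobolev_C2 (R : realType) (p : R) (F : plane R -> R) F1 : 0 < p -> C2 F F1 (fun _ _ _ => 0) ->
  sobolev p F (fun _ _ _ => 0).
Proof.
move=> p0 h; split; [by case: h|exact: C2_weak_hessian h|].
under eq_integral do rewrite gam0 powR0 ?gt_eqF//.
by rewrite integral0.
Qed.

Lemma energy0 (R : realType) (q : R) (B : set (plane R)) : 0 < q -> energy q (fun _ _ _ => 0) B = 0.
Proof.
move=> q0; rewrite /energy; under eq_integral do rewrite gam0 powR0 ?gt_eqF//.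
by rewrite integral0.
Qed.

Section Slope.
Variables (R : realType) (p r C : R) (D : R -> (plane R -> R) -> plane R -> plane R).
Hypothesis HD : slope_op p r C D.

Let C1 : 1 <= C. Proof. by case: HD. Qed.
Let r2 : 2 < r. Proof. by case: HD => _ /andP[]. Qed.
Let rp : r < p. Proof. by case: HD => _ /andP[]. Qed.
Let p0 : 0 < p. Proof. by apply: lt_trans rp; apply: lt_trans r2. Qed.
Let p1 : 1 <= p. Proof. by apply: ltW; apply: lt_trans rp; apply: lt_trans r2; rewrite ltr1n. Qed.

(** For zero Hessian the Taylor estimate is an equality; two displacements, one along each axis,
    determine the slope. *)
Lemma slope_affine (F : plane R -> R) (c t : R) v x : 0 < t -> (forall w, F w = c + dot v w) -> D t F x = v.
Proof.
move=> t0 /funext ->; set F' := fun w => _.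
have sob := sobolev_C2 p0 (C2_affine c v).
have [_ _ _ tay] := HD.
have key (y : plane R) : `|y - x| <= t -> dot (v - D t F' x) (y - x) = 0.
  move=> yx; have [h _] := tay p (or_introl erefl) F' _ t t x y sob t0 (lexx t) yx.
  move: h; rewrite energy0// powR0 ?invr_neq0 ?gt_eqF// !mulr0 normr_le0 => /eqP h.
  rewrite -[RHS]h /F' /dot /=; ring.
have t1 : `|(x.1 + t, x.2) - x| <= t by rewrite plane_norm_le /= addrAC subrr add0r subrr normr0 gtr0_norm// lexx ltW.
have t2 : `|(x.1, x.2 + t) - x| <= t by rewrite plane_norm_le /= addrAC !subrr add0r normr0 gtr0_norm// lexx ltW.
have := key _ t1; have := key _ t2; rewrite /dot /= => e2 e1.
have n0 : t != 0 by rewrite gt_eqF.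
have {}e1 : (v.1 - (D t F' x).1) * t = 0 by rewrite -[RHS]e1; ring.
have {}e2 : (v.2 - (D t F' x).2) * t = 0 by rewrite -[RHS]e2; ring.
move/eqP: e1; rewrite mulf_eq0 (negPf n0) orbF subr_eq0 => /eqP e1.
move/eqP: e2; rewrite mulf_eq0 (negPf n0) orbF subr_eq0 => /eqP e2.
by case: (v) (D t F' x) e1 e2 => a b [a' b'] /= -> ->.
Qed.

Lemma sobolev0 : sobolev p (fun=> 0) (fun _ _ _ => 0 : R).
Proof. exact: sobolev_C2 (C2_cst 0). Qed.

Lemma energy_norm0 (B : set (plane R)) : energy_norm p (fun _ _ _ => 0) B = 0.
Proof. by rewrite /energy_norm energy0// powR0// invr_neq0// gt_eqF. Qed.

Lemma energy_norm_ge0 g (B : set (plane R)) : 0 <= energy_norm p g B.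
Proof. exact: powR_ge0. Qed.

Lemma energy_normZ F g a (B : set (plane R)) : measurable B -> sobolev p F g ->
  energy_norm p (hcomb a g (fun _ _ _ => 0)) B <= `|a| * energy_norm p g B.
Proof.
by move=> mB sF; have := energy_norm_comb a p1 mB sF sobolev0; rewrite energy_norm0 addr0.
Qed.

(* A one-dimensional Hahn-Banach step: the functional is dominated by a seminorm on the functions that vanish at
   [x] and at the points of [s]; correcting it by a multiple of evaluation at [x], it remains dominated
   on the functions that vanish at the points of [s] only. *)
Lemma hahn_banach_step (l : (plane R -> R) -> R) (s : seq (plane R)) x S B : measurable B -> 0 <= S ->
  (forall a F g G h, sobolev p F g -> sobolev p G h -> l (fun w => a * F w + G w) = a * l F + l G) ->
  (forall F g, sobolev p F g -> (forall y, y \in x :: s -> F y = 0) -> `|l F| <= S * energy_norm p g B) ->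
  exists c, forall F g, sobolev p F g -> (forall y, y \in s -> F y = 0) ->
    `|l F - c * F x| <= S * energy_norm p g B.
Proof.
move=> mB S0 lin dom.
pose V F g := sobolev p F g /\ (forall y, y \in s -> F y = 0).
have comb a F g G h : V F g -> V G h -> V (fun w => a * F w + G w) (hcomb a g h).
  move=> [sF zF] [sG zG]; split; first exact: sobolev_comb.
  by move=> y ys; rewrite zF// zG// mulr0 addr0.
have V0 : V (fun=> 0) (fun _ _ _ => 0) by split=> //; exact: sobolev0.
have l0 : l (fun=> 0) = 0.
  by have := dom _ _ sobolev0 (fun _ _ => erefl); rewrite energy_norm0 mulr0 normr_le0 => /eqP.
have lZ a F g : V F g -> l (fun w => a * F w + 0) = a * l F.
  by move=> [sF _]; rewrite (lin a F g (fun=> 0) _ sF sobolev0) l0 addr0.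
(* The correction c has to lie above every lower bound in A and below every corresponding upper
   bound; [cross] makes these compatible, so the supremum of A qualifies. *)
pose A := [set z | exists F g, V F g /\ F x = 1 /\ z = l F - S * energy_norm p g B].
have cross F g G h : V F g -> V G h -> F x = 1 -> G x = 1 ->
    l F - S * energy_norm p g B <= l G + S * energy_norm p h B.
  move=> vF vG Fx Gx; have [sH zH] := comb (-1) G h F g vG vF.
  have := dom _ _ sH; rewrite (lin _ _ _ _ _ vG.1 vF.1).
  have := energy_norm_comb (-1) p1 mB vG.1 vF.1; rewrite normrN1 mul1r => tri.
  have tri' := ler_wpM2l S0 tri.
  move=> H; have {}H : `|-1 * l G + l F| <= S * energy_norm p (hcomb (-1) h g) B.
    by apply: H => y; rewrite inE => /orP[/eqP ->|/zH//]; rewrite Fx Gx; ring.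
  rewrite lerBlDr -addrA -lerBlDl -mulrDr; apply: le_trans tri'; apply: le_trans H.
  by rewrite mulN1r addrC; exact: ler_norm.
have bnd c : (forall F g, V F g -> F x = 1 -> `|l F - c| <= S * energy_norm p g B) ->
    forall F g, sobolev p F g -> (forall y, y \in s -> F y = 0) -> `|l F - c * F x| <= S * energy_norm p g B.
  move=> Hc F g sF zF; have vF : V F g by [].
  have [Fx|Fx] := eqVneq (F x) 0.
    rewrite Fx mulr0 subr0; apply: dom => // y; rewrite inE => /orP[/eqP -> //|]; exact: zF.
  have := Hc _ _ (comb (F x)^-1 F g _ _ vF V0); rewrite mulVf// addr0 => /(_ erefl).
  rewrite (lZ _ _ _ vF) => h.
  have := le_trans h (ler_wpM2l S0 (energy_normZ (F x)^-1 mB sF)).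
  rewrite (_ : (F x)^-1 * l F - c = (F x)^-1 * (l F - c * F x)); last by field.
  by rewrite normrM mulrCA ler_pM2l// normr_gt0 invr_eq0.
have [[z0 Az0]|An] := pselect (A !=set0); last first.
  (* If A is empty, no admissible function takes the value 1 at x, and every c qualifies. *)
  exists 0; apply: bnd => F g vF Fx; exfalso; apply: An.
  by exists (l F - S * energy_norm p g B), F, g.
have ubA z : (forall G h, V G h -> G x = 1 -> l G + S * energy_norm p h B <= z -> ubound A z).
  by move=> G h vG Gx Gz _ [F [g [vF [Fx ->]]]]; apply: le_trans Gz; exact: cross.
have supA : has_sup A.
  split; first by exists z0.
  by case: Az0 => G [h [vG [Gx _]]]; exists (l G + S * energy_norm p h B); exact: ubA vG Gx (lexx _).
exists (sup A); apply: bnd => F g vF Fx.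
have h1 : l F - S * energy_norm p g B <= sup A by apply: sup_upper_bound => //; exists F, g.
have h2 : sup A <= l F + S * energy_norm p g B.
  by apply: ge_sup; [exists z0|exact: ubA vF Fx (lexx _)].
by rewrite ler_norml; apply/andP; split; lra.
Qed.

(** One step for each point of s. In the end the domination holds on all functions, for [l] minus a
    combination of values at s: these values predict [l] up to the seminorm. *)
Lemma hahn_banach (s : seq (plane R)) (l : (plane R -> R) -> R) S B : measurable B -> 0 <= S -> uniq s ->
  (forall a F g G h, sobolev p F g -> sobolev p G h -> l (fun w => a * F w + G w) = a * l F + l G) ->
  (forall F g, sobolev p F g -> (forall y, y \in s -> F y = 0) -> `|l F| <= S * energy_norm p g B) ->
  exists c : plane R -> R, forall F g, sobolev p F g ->
    `|l F - \sum_(y <- s) c y * F y| <= S * energy_norm p g B.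
Proof.
move=> mB S0; elim: s l => [|x s IH] l us lin dom.
  by exists (fun=> 0) => F g sF; rewrite big_nil subr0; exact: dom.
move: us => /= /andP[xs us].
have [c Hc] := hahn_banach_step mB S0 lin dom.
have [|c' Hc'] := IH (fun F => l F - c * F x) us _ Hc.
  by move=> a F g G h sF sG; rewrite (lin a F g G h sF sG); ring.
exists (fun y => if y == x then c else c' y) => F g sF.
rewrite big_cons eqxx (eq_big_seq (fun y => c' y * F y)); last first.
  by move=> y ys; case: eqP => // yx; rewrite -yx ys in xs.
by rewrite opprD addrA; exact: Hc'.
Qed.

Variables (I : finType) (pt : I -> plane R) (rho : R).
Hypotheses (ptI : injective pt) (rho0 : 0 < rho).

(* At a flat place the data leaves the gradient undetermined in one direction, at a cost below the natural scaling. *)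
Definition flat (x : plane R) (d : R) := exists h g, [/\ sobolev p h g,
  forall i, `|pt i - x| <= d -> h (pt i) = 0 /\ 1 <= `|D rho h (pt i)| &
  energy p g (cbox x (8 * d)) <= d `^ (2 - p)].

(** Since 2 - p < 0, the admissible energy grows as the scale shrinks, so the same witness serves at
    half the scale or less, also around neighbouring points. *)
Lemma flat_half x y d e : flat x d -> `|y - x| <= d / 2 -> 0 < e -> e <= d / 2 -> flat y e.
Proof.
move=> [h [g [sob z en]]] yx e0 ed; exists h, g; split=> // [i iy|].
  apply: z; have -> : pt i - x = (pt i - y) + (y - x) by rewrite subrKA.
  by apply: le_trans (ler_normD _ _) _; lra.
have pp : 0 < p <= p by rewrite p0 lexx.
apply: (@le_trans _ _ (energy p g (cbox x (8 * d)))).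
  by apply: (energy_le pp sob); [exact: measurable_cbox|apply: cbox_sub; lra].
apply: (le_trans en); rewrite (_ : 2 - p = - (p - 2)); last by ring.
rewrite !powRN lef_pV2 ?posrE ?powR_gt0//; last lra.
by apply: ge0_ler_powR; rewrite ?nnegrE; move: r2 rp => ? ?; lra.
Qed.

(** An affine function of slope (1, 0) that vanishes at x is a witness of zero energy. *)
Lemma flat_isolated x d : 0 < d -> (forall i, `|pt i - x| <= d -> pt i = x) -> flat x d.
Proof.
move=> d0 iso; exists (fun w => - x.1 + dot (1, 0) w), (fun _ _ _ => 0); split.
- exact: sobolev_C2 (C2_affine _ _).
- move=> i /iso ->; split; first by rewrite /dot /=; ring.
  rewrite (@slope_affine _ (- x.1) rho (1, 0))//; apply: le_trans (plane_norm1 _).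
  by rewrite /= normr1.
- by rewrite energy0// powR_ge0.
Qed.

(** By contraposition. If the slope at pt k were large compared with the energy, the Taylor estimate
    would keep it large at all points within 2d, and F divided by a lower bound for these slopes
    would witness flatness at scale 2d. *)
Lemma not_flat_bound k d : rho <= d -> ~ flat (pt k) (2 * d) ->
  forall F g, sobolev p F g -> (forall i, `|pt i - pt k| <= 2 * d -> F (pt i) = 0) ->
  `|D rho F (pt k)| <= 4 * C * d `^ (1 - 2 / p) * energy_norm p g (cbox (pt k) (16 * d)).
Proof.
move=> rd nf F g sob z; set N := energy_norm _ _ _; have [_ _ lin tay] := HD.
have d0 : 0 < d := lt_le_trans rho0 rd.
set W := (2 * d) `^ (1 - 2 / p) * N.
have N0 : 0 <= N by exact: powR_ge0.
have W0 : 0 <= W by rewrite mulr_ge0// powR_ge0.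
have pp : 0 < p <= p by rewrite p0 lexx.
have Wle : W <= 2 * d `^ (1 - 2 / p) * N.
  apply: ler_wpM2r => //; rewrite powRM// ?(ltW d0)//; apply: ler_wpM2r; first exact: powR_ge0.
  rewrite -[leRHS]powRr1//; apply: ler_powR; first by rewrite ler1n.
  by rewrite gerBl divr_ge0// ltW.
have V i : `|pt i - pt k| <= 2 * d -> `|D rho F (pt i) - D rho F (pt k)| <= C * W.
  move=> ik; have [|_ h] := tay p (or_introl erefl) F g rho (2 * d) (pt k) (pt i) sob rho0 _ ik; first lra.
  apply: (le_trans h); apply: ler_wpM2l; first by move: C1 => ?; lra.
  apply: ler_wpM2l; first exact: powR_ge0.
  by apply: (energy_root_le pp sob); rewrite subrr normr0; lra.
rewrite leNgt; apply/negP => big.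
(* The lower bound for the slopes of F at the points within 2d; dividing by it normalises the
   witness. *)
set mu := `|D rho F (pt k)| - C * W.
have CW : 4 * C * d `^ (1 - 2 / p) * N = 2 * (C * (2 * d `^ (1 - 2 / p) * N)) by ring.
have Wmu : W < mu.
  rewrite /mu; move: big; rewrite CW.
  have := ler_wpM2l (le_trans ler01 C1) Wle; have : W <= C * W by rewrite ler_peMl.
  have := W0; have : 0 <= C * W by rewrite mulr_ge0// (le_trans ler01 C1).
  have := le_trans W0 Wle; have : W <= C * (2 * d `^ (1 - 2 / p) * N).
    by apply: (le_trans Wle); rewrite ler_peMl//; exact: le_trans W0 Wle.
  by lra.
have mu0 : 0 < mu by lra.
apply: nf; exists (fun w => mu^-1 * F w + 0), (hcomb mu^-1 g (fun _ _ _ => 0)); split.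
- exact: sobolev_comb sobolev0.
- move=> i ik; rewrite z// mulr0 addr0; split=> //.
  have cF : continuous F by case: sob.
  rewrite lin//; last exact: cst_continuous.
  rewrite (@slope_affine (fun=> 0) 0 rho 0)//; last by move=> w; rewrite /dot /=; ring.
  have -> : (mu^-1 * (D rho F (pt i)).1 + (0 : plane R).1, mu^-1 * (D rho F (pt i)).2 + (0 : plane R).2) = mu^-1 *: D rho F (pt i).
    by rewrite /= !addr0.
  rewrite normrZ gtr0_norm ?invr_gt0// mulrC ler_pdivlMr// mul1r /mu.
  have := V i ik; have := ler_normB (D rho F (pt i)) (D rho F (pt i) - D rho F (pt k)).
  by rewrite opprB addrC subrK; lra.
- have -> : 8 * (2 * d) = 16 * d by ring.
  have h := energy_normZ mu^-1 (measurable_cbox (pt k) (16 * d)) sob.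
  have {}h : energy_norm p (hcomb mu^-1 g (fun _ _ _ => 0)) (cbox (pt k) (16 * d)) <= (2 * d) `^ (2 / p - 1).
    apply: (le_trans h); rewrite gtr0_norm ?invr_gt0// mulrC ler_pdivrMr//.
    have e : (2 * d) `^ (2 / p - 1) * (2 * d) `^ (1 - 2 / p) = 1.
      have d2 : 0 < 2 * d by rewrite mulr_gt0.
      rewrite -powRD; last by rewrite (gt_eqF d2) implybT.
      by rewrite (_ : 2 / p - 1 + (1 - 2 / p) = 0) ?powRr0//; ring.
    apply: (@le_trans _ _ ((2 * d) `^ (2 / p - 1) * W)).
      by rewrite /W mulrA e mul1r.
    by apply: ler_wpM2l; [exact: powR_ge0|exact: ltW].
  set e := energy_norm _ _ _ in h.
  have eE : e `^ p = energy p (hcomb mu^-1 g (fun _ _ _ => 0)) (cbox (pt k) (16 * d)).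
    by rewrite /e /energy_norm -powRrM mulVf ?powRr1 ?energy_ge0// gt_eqF.
  rewrite -eE; apply: (@le_trans _ _ (((2 * d) `^ (2 / p - 1)) `^ p)).
    by apply: ge0_ler_powR; rewrite ?nnegrE ?powR_ge0// ltW.
  rewrite -powRrM (_ : (2 / p - 1) * p = 2 - p)//; field; rewrite gt_eqF//.
Qed.

(** Hahn-Banach for each coordinate of the gradient. The coefficients c depend on the points only,
    so the recovered gradient is linear in the data. *)
Lemma keystone_gradient k d : rho <= d -> ~ flat (pt k) (2 * d) ->
  exists c : I -> plane R, forall F g, sobolev p F g ->
    `|D rho F (pt k) - \sum_i F (pt i) *: c i| <=
      4 * C * d `^ (1 - 2 / p) * energy_norm p g (cbox (pt k) (16 * d)).
Proof.
move=> rd nf; have [_ _ lin _] := HD; have d0 : 0 < d := lt_le_trans rho0 rd.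
pose s := [seq pt i | i <- enum I & `|pt i - pt k| <= 2 * d].
have us : uniq s by rewrite map_inj_uniq// filter_uniq// enum_uniq.
have S0 : 0 <= 4 * C * d `^ (1 - 2 / p).
  by rewrite mulr_ge0 ?powR_ge0// mulr_ge0// (le_trans ler01 C1).
have mB := measurable_cbox (pt k) (16 * d).
have key (l : (plane R -> R) -> R) :
    (forall a (F G : plane R -> R), continuous F -> continuous G -> l (fun w => a * F w + G w) = a * l F + l G) ->
    (forall F, `|l F| <= `|D rho F (pt k)|) ->
    exists c : I -> R, forall F g, sobolev p F g ->
      `|l F - \sum_i F (pt i) * c i| <= 4 * C * d `^ (1 - 2 / p) * energy_norm p g (cbox (pt k) (16 * d)).
  move=> llin lD.
  have [||c Hc] := @hahn_banach s l _ _ mB S0 us.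
  - by move=> a F g G h [cF _ _] [cG _ _]; exact: llin.
  - move=> F g sob z; apply: (le_trans (lD F)); apply: (not_flat_bound rd nf sob) => i ik.
    by apply: z; apply/mapP; exists i => //; rewrite mem_filter ik mem_enum.
  exists (fun i => if `|pt i - pt k| <= 2 * d then c (pt i) else 0) => F g sob.
  have := Hc F g sob; rewrite /s big_map big_filter big_enum_cond/= big_mkcond/=.
  rewrite (eq_bigr (fun i => F (pt i) * (if `|pt i - pt k| <= 2 * d then c (pt i) else 0)))// => i _.
  by case: ifP => _; rewrite ?mulr0// mulrC.
have [||c1 H1] := key (fun F => (D rho F (pt k)).1).
- by move=> a F G cF cG; rewrite lin.
- by move=> F; exact: plane_norm1.
have [||c2 H2] := key (fun F => (D rho F (pt k)).2).
- by move=> a F G cF cG; rewrite lin.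
- by move=> F; exact: plane_norm2.
exists (fun i => (c1 i, c2 i)) => F g sob.
have fst_sum (v : I -> plane R) : (\sum_i v i).1 = \sum_i (v i).1.
  by elim/big_ind2: _ => // a b a' b' <- <-.
have snd_sum (v : I -> plane R) : (\sum_i v i).2 = \sum_i (v i).2.
  by elim/big_ind2: _ => // a b a' b' <- <-.
rewrite plane_norm_le /= fst_sum snd_sum /=; apply/andP; split; [exact: H1|exact: H2].
Qed.

(* If the data is flat at all large scales, an affine function of slope at least [1] vanishes on it in the limit. *)
Lemma flat_all_collinear k : (forall d, 0 < d -> exists2 e, d <= e & flat (pt k) e) ->
  forall i j, (pt i - pt k).1 * (pt j - pt k).2 = (pt i - pt k).2 * (pt j - pt k).1.
Proof.
move=> fl i j; set u := pt i - pt k; set v := pt j - pt k.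
have [_ _ _ tay] := HD.
set L := `|u| + `|v| + rho.
have L0 : 0 < L by rewrite ltr_wpDl// addr_ge0.
have uL : `|u| <= L by rewrite /L; have := normr_ge0 v; move: rho0; lra.
have vL : `|v| <= L by rewrite /L; have := normr_ge0 u; move: rho0; lra.
have p2 : 0 < 1 - 2 / p by rewrite subr_gt0 ltr_pdivrMr//; move: r2 rp => ? ?; lra.
pose X := C * L `^ (2 - 2 / p).
have X0 : 0 <= X by rewrite mulr_ge0 ?powR_ge0// (le_trans ler01 C1).
suff h e : 0 < e -> `|u.1 * v.2 - u.2 * v.1| <= 4 * L * X * e.
  apply/eqP; rewrite -subr_eq0 -normr_le0; apply/ler_addgt0Pl => e e0.
  have q0 : 0 < 4 * L * X + 1 by rewrite ltr_wpDl// mulr_ge0// mulr_ge0// ltW.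
  apply: le_trans (h _ (divr_gt0 e0 q0)) _.
  rewrite addr0 mulrA ler_pdivrMr// mulrC ler_pM2l//; lra.
move=> e0.
(* From this scale on a witness has energy norm at most e, because d^(2/p - 1) tends to 0; on the
   fixed square of radius 4L it is then affine up to an error of order e. *)
have [d [Ld de]] : exists d, L <= d /\ d `^ (2 / p - 1) <= e.
  exists (L + e `^ (- (1 - 2 / p)^-1)); have c0 := powR_gt0 (- (1 - 2 / p)^-1) e0; split; first lra.
  have h1 : (L + e `^ (- (1 - 2 / p)^-1)) `^ (1 - 2 / p) >= e^-1.
    apply: (@le_trans _ _ ((e `^ (- (1 - 2 / p)^-1)) `^ (1 - 2 / p))).
      by rewrite -powRrM mulNr mulVf ?gt_eqF// powR_inv1// ltW.
    by apply: ge0_ler_powR; rewrite ?nnegrE; lra.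
  rewrite (_ : 2 / p - 1 = - (1 - 2 / p)); last by ring.
  rewrite powRN -[leRHS]invrK lef_pV2// posrE ?invr_gt0// powR_gt0; lra.
have [d' dd' [h [g [sob z en]]]] := fl d (lt_le_trans L0 Ld).
have d'0 : 0 < d' by lra.
have pp : 0 < p <= p by rewrite p0 lexx.
have zero a : `|pt a - pt k| <= L -> h (pt a) = 0 by move=> aL; apply: (z a _).1; lra.
have [hk nk] : h (pt k) = 0 /\ 1 <= `|D rho h (pt k)| by apply: z; rewrite subrr normr0 ltW.
set n := D rho h (pt k) in nk.
have enL : energy p g (cbox (pt k) (4 * L)) `^ p^-1 <= e.
  apply: (@le_trans _ _ ((d' `^ (2 - p)) `^ p^-1)).
    apply: ge0_ler_powR; rewrite ?nnegrE ?energy_ge0 ?powR_ge0 ?invr_ge0 ?(ltW p0)//.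
    apply: le_trans en; apply: (energy_le pp sob); first exact: measurable_cbox.
    by apply: cbox_sub; rewrite subrr normr0; lra.
  rewrite -powRrM (_ : (2 - p) * p^-1 = - (1 - 2 / p)); last by field; rewrite gt_eqF.
  apply: le_trans de; rewrite (_ : 2 / p - 1 = - (1 - 2 / p)); last by ring.
  rewrite !powRN lef_pV2 ?posrE ?powR_gt0//; last lra.
  by apply: ge0_ler_powR; rewrite ?nnegrE; lra.
have small a : `|pt a - pt k| <= L -> `|dot n (pt a - pt k)| <= X * e.
  move=> aL; have rL : rho <= L by rewrite /L lerDr addr_ge0.
  have [+ _] := tay p (or_introl erefl) h g rho L (pt k) (pt a) sob rho0 rL aL.
  rewrite zero// hk subrr sub0r normrN => le1; apply: (le_trans le1).
  by rewrite /X -mulrA; apply: ler_wpM2l; [exact: le_trans ler01 C1|apply: ler_wpM2l => //; exact: powR_ge0].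
have su := small i uL; have sv := small j vL; rewrite -/u -/v in su sv.
have Xe0 : 0 <= X * e by rewrite mulr_ge0// ltW.
have u1 := le_trans (plane_norm1 u) uL; have u2 := le_trans (plane_norm2 u) uL.
have v1 := le_trans (plane_norm1 v) vL; have v2 := le_trans (plane_norm2 v) vL.
have prod (a b : R) : `|a| <= X * e -> `|b| <= L -> `|a * b| <= X * e * L by move=> ha hb; rewrite normrM ler_pM.
set cr := u.1 * v.2 - u.2 * v.1.
have c1 : `|n.1 * cr| <= 2 * (X * e * L).
  have -> : n.1 * cr = dot n u * v.2 - dot n v * u.2 by rewrite /cr /dot; ring.
  apply: le_trans (ler_normB _ _) _; have := prod _ _ su v2; have := prod _ _ sv u2; lra.
have c2 : `|n.2 * cr| <= 2 * (X * e * L).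
  have -> : n.2 * cr = dot n v * u.1 - dot n u * v.1 by rewrite /cr /dot; ring.
  apply: le_trans (ler_normB _ _) _; have := prod _ _ su v1; have := prod _ _ sv u1; lra.
have : `|cr| <= `|n| * `|cr| by rewrite ler_peMl.
rewrite prod_normE /=; rewrite !normrM in c1 c2.
have XL0 : 0 <= X * e * L by rewrite mulr_ge0// ltW.
by rewrite /Num.max; case: ifP => _ h1; lra.
Qed.

End Slope.

(** * Nets adapted to a scale function *)

(** Pigeonhole on a grid of side t/2: two points in the same small square are closer than t. The
    bound m is fixed before the points, so it may enter the constants. *)
Lemma packing_count (K : nat) : exists m : nat, forall (R : realType) (I : finType) (pt : I -> plane R) (S : {set I}) t z,
  0 < t -> (forall i, i \in S -> `|pt i - z| <= K%:R * t) ->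
  (forall i j, i \in S -> j \in S -> i != j -> t <= `|pt i - pt j|) -> (#|S| <= m)%N.
Proof.
exists ((4 * K).+1 * (4 * K).+1)%N => R I pt S t z t0 near sep.
have t20 : 0 < t / 2 by linear.
pose v (a : R) := (a + K%:R * t) / (t / 2).
have vb a : `|a| <= K%:R * t -> 0 <= v a <= (4 * K)%:R.
  rewrite ler_norml => /andP[h1 h2]; rewrite /v; apply/andP; split.
    by rewrite divr_ge0//; linear.
  by rewrite ler_pdivrMr// natrM; linear.
pose q (a : R) : 'I_(4 * K).+1 := inord (Num.truncn (v a)).
have qv a : `|a| <= K%:R * t -> (q a)%:R <= v a < (q a).+1%:R.
  move=> /vb /andP[h1 h2]; rewrite inordK; first exact: truncn_itv.
  have /andP[h3 _] := truncn_itv h1.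
  by rewrite ltnS -(ler_nat R); exact: le_trans h2.
have close a b : `|a| <= K%:R * t -> `|b| <= K%:R * t -> q a = q b -> `|a - b| < t.
  move=> /qv /andP[a1 a2] /qv /andP[b1 b2] e; rewrite e in a1 a2.
  rewrite -!natr1 in a2 b2.
  have h : `|v a - v b| < 1 by rewrite ltr_norml; apply/andP; split; linear.
  have e' : a - b = (v a - v b) * (t / 2) by rewrite /v; field; rewrite gt_eqF.
  by rewrite e' normrM (gtr0_norm t20); have := ltr_pM2r t20 `|v a - v b| 1; rewrite h; linear.
pose f i := (q (pt i - z).1, q (pt i - z).2).
have inj : {in S &, injective f}.
  move=> i j iS jS [e1 e2]; apply/eqP; apply: contraT => ij.
  have := sep i j iS jS ij; have ni := near i iS; have nj := near j jS.
  have h1 := close _ _ (le_trans (plane_norm1 _) ni) (le_trans (plane_norm1 _) nj) e1.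
  have h2 := close _ _ (le_trans (plane_norm2 _) ni) (le_trans (plane_norm2 _) nj) e2.
  have e3 : pt i - pt j = (pt i - z) - (pt j - z) by rewrite opprB addrA subrK.
  rewrite e3 prod_normE; set X := _ - _; rewrite leNgt gt_max => /negP[].
  by apply/andP.
rewrite -(card_in_imset inj); apply: leq_trans (max_card _) _.
by rewrite card_prod !card_ord.
Qed.

(** The scale varies slowly. For the flatness scale this follows from [flat_half]: a point j close
    to i with 4 del j < del i would be flat at scale 2 del j. *)
Definition adapted (R : realType) (I : finType) (pt : I -> plane R) (del : I -> R) :=
  (forall i, 0 < del i) /\ forall i j, `|pt j - pt i| <= del i / 2 -> del i <= 4 * del j.

Definition separated (R : realType) (I : finType) (pt : I -> plane R) (del : I -> R) (A : {set I}) :=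
  forall a b, a \in A -> b \in A -> a != b -> del a <= 64 * `|pt a - pt b|.

(** An inclusion-maximal separated set. A point i that no a covers could be added: if del i exceeded
    64 times its distance to some a, then del i <= 4 del a by adaptedness, and a would cover i. *)
Lemma net_exists (R : realType) (I : finType) (pt : I -> plane R) (del : I -> R) : adapted pt del ->
  exists A : {set I}, separated pt del A /\ forall i, exists2 a, a \in A & `|pt i - pt a| <= del a / 16.
Proof.
move=> [del0 comp].
pose P (B : {set I}) := [forall a in B, forall b in B, (a != b) ==> (del a <= 64 * `|pt a - pt b|)].
have P0 : P finset.set0 by apply/forall_inP => a; rewrite inE.
have [A /maxsetP[PA maxA] _] := maxset_exists P0.
have sepA : separated pt del A.
  by move=> a b aA bA ab; have /forall_inP/(_ a aA)/forall_inP/(_ b bA)/implyP := PA; exact.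
exists A; split=> // i.
have [iA|iA] := boolP (i \in A); first by exists i => //; rewrite subrr normr0 divr_ge0// ltW.
apply: contrapT => H; have far a : a \in A -> del a / 16 < `|pt i - pt a|.
  by move=> aA; rewrite ltNge; apply/negP => h; apply: H; exists a.
have := maxA (i |: A); rewrite finset.subsetUr => /(_ _ isT) e.
have : i \in A; last by rewrite (negPf iA).
rewrite -e ?setU11//; apply/forall_inP => a; rewrite !inE => aA; apply/forall_inP => b; rewrite !inE => bA.
apply/implyP => ab.
have key c : c \in A -> del i <= 64 * `|pt i - pt c| /\ del c <= 64 * `|pt i - pt c|.
  move=> cA; have := far c cA => fc; split; last by have := del0 c; linear.
  rewrite leNgt; apply/negP => lt; have h : `|pt c - pt i| <= del i / 2 by rewrite distrC; have := normr_ge0 (pt i - pt c); linear.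
  by have := comp _ _ h; linear.
case/orP: aA ab => [/eqP ->|aA]; case/orP: bA => [/eqP ->|bA].
- by rewrite eqxx.
- by move=> _; case: (key b bA).
- by move=> _; rewrite distrC; case: (key a aA).
- exact: sepA.
Qed.

(* The points [k] minimising [b |-> del b + |pt a - pt b| / 64] for some [a] in the net satisfy this condition,
   and it forces the balls of radius [16 * del k] around them to have bounded overlap. *)
Definition keystone (R : realType) (I : finType) (pt : I -> plane R) (del : I -> R) (A : {set I}) k :=
  forall b, b \in A -> del k <= del b + `|pt k - pt b| / 64.

Lemma key_exists (R : realType) (I : finType) (pt : I -> plane R) (del : I -> R) (A : {set I}) : adapted pt del ->
  exists key : I -> I, forall a, a \in A -> [/\ key a \in A, del (key a) <= del a,
    `|pt (key a) - pt a| <= 64 * del a & keystone pt del A (key a)].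
Proof.
move=> [del0 _].
pose W a k := del k + `|pt a - pt k| / 64.
suff /boolp.choice [key Hk] : forall a, exists k, a \in A -> [/\ k \in A, del k <= del a,
    `|pt k - pt a| <= 64 * del a & keystone pt del A k] by exists key.
move=> a; have [aA|aA] := boolP (a \in A); last by exists a.
exists (Order.arg_min a (mem A) (W a)) => _; case: arg_minP => //= k kA minW.
have ka := minW a aA; rewrite /W subrr normr0 mul0r addr0 in ka.
have n0 := normr_ge0 (pt a - pt k); have d0 := del0 k; have da := del0 a.
split=> //.
- by linear.
- by rewrite distrC; linear.
- move=> b bA; have := minW b bA; rewrite /W.
  have : `|pt a - pt b| <= `|pt a - pt k| + `|pt k - pt b| by apply: le_trans (ler_normD _ _); rewrite subrKA.
  by linear.
Qed.

(** Among the keystones whose balls contain z, let d be the largest scale. The keystone inequality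
    at that point forces every other scale to be at least d/2, so these points are d/128-separated
    and lie within 16d = 2048 (d/128) of z. *)
Lemma keystone_overlap : exists m : nat, forall (R : realType) (I : finType) (pt : I -> plane R) (del : I -> R) (A : {set I}) z,
  adapted pt del -> separated pt del A ->
  (#|[set k in A | `[< keystone pt del A k >] && (`|z - pt k| <= 16 * del k)%R]| <= m)%N.
Proof.
have [m Hm] := packing_count 2048.
exists m => R I pt del A z [del0 _] sep; set S := [set k in A | _].
have [->|[k0 k0S]] := set_0Vmem S; first by rewrite cards0.
have [k1 k1S maxk] : exists2 k, k \in S & forall j, j \in S -> del j <= del k.
  case: (@arg_maxP _ R I k0 (mem S) del k0S) => k kS Hk; exists k => // j jS; exact: Hk.
move: k1S; rewrite inE => /and3P[k1A /asboolP key1 z1].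
have half j : j \in S -> del k1 <= 2 * del j.
  move=> jS; have := maxk j jS; move: jS; rewrite inE => /and3P[jA _ zj] dj.
  have := key1 j jA; have : `|pt k1 - pt j| <= `|z - pt k1| + `|z - pt j|.
    by rewrite -(normrN (z - pt k1)) opprB; apply: le_trans (ler_normD _ _); rewrite subrKA.
  by linear.
have d0 := del0 k1.
apply: (Hm R I pt S (del k1 / 128) z); first by linear.
- move=> i iS; have := maxk i iS; move: iS; rewrite inE => /and3P[iA _ zi] di.
  by rewrite distrC; linear.
- move=> i j iS jS ij; have := half i iS; move: iS jS; rewrite !inE => /and3P[iA _ _] /and3P[jA _ _].
  by have := sep i j iA jA ij; linear.
Qed.

(** The points of the net counted here have scales comparable to del y within a factor 4; hence they
    are separated by del y / 256 and lie within 128 times that distance of y. *)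
Lemma active_count : exists m : nat, forall (R : realType) (I : finType) (pt : I -> plane R) (del : I -> R) (A : {set I}) y,
  adapted pt del -> separated pt del A -> (#|[set a in A | (`|pt y - pt a| <= del a / 8)%R]| <= m)%N.
Proof.
have [m Hm] := packing_count 128.
exists m => R I pt del A y [del0 comp] sep; set S := [set a in A | _].
have cmp a : a \in S -> del a <= 4 * del y /\ del y <= 4 * del a.
  rewrite inE => /andP[aA ya]; have d := del0 a.
  have h1 : del a <= 4 * del y by apply: comp; linear.
  by split=> //; apply: comp; rewrite distrC; linear.
have d0 := del0 y.
apply: (Hm R I pt S (del y / 256) (pt y)); first by linear.
- move=> a aS; have [h1 _] := cmp a aS; move: aS; rewrite inE => /andP[_ ya].
  by rewrite distrC; linear.
- move=> a b aS bS ab; have [_ h1] := cmp a aS; move: aS bS; rewrite !inE => /andP[aA _] /andP[bA _].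
  by have := sep a b aA bA ab; linear.
Qed.

(** The support radius del a / 8 is twice the covering radius of the net, so at every point some
    tent is at least 1/2 and the normalisation in [bump] is harmless. *)
Definition tent (R : realType) (I : finType) (pt : I -> plane R) (del : I -> R) a y :=
  Num.max 0 (1 - 8 * `|pt y - pt a| / del a).

Definition bump (R : realType) (I : finType) (pt : I -> plane R) (del : I -> R) (A : {set I}) a y :=
  tent pt del a y / \sum_(b in A) tent pt del b y.

Section Bump.
Variables (R : realType) (I : finType) (pt : I -> plane R) (del : I -> R) (A : {set I}).
Hypotheses (ad : adapted pt del) (cov : forall i, exists2 a, a \in A & `|pt i - pt a| <= del a / 16).

Let del0 i : 0 < del i. Proof. by case: ad. Qed.

Lemma tent_ge0 a y : 0 <= tent pt del a y. Proof. by rewrite /tent le_max lexx. Qed.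

Lemma tent_supp a y : tent pt del a y != 0 -> `|pt y - pt a| <= del a / 8.
Proof.
apply: contraNT; rewrite -ltNge => h; rewrite /tent; apply/eqP/max_idPl.
by rewrite subr_le0 ler_pdivlMr// mul1r; lra.
Qed.

Lemma tent_le1 a y : tent pt del a y <= 1.
Proof. by rewrite /tent ge_max ler01 gerBl divr_ge0// ?mulr_ge0// ltW. Qed.

Lemma tent_sum y : 1 / 2 <= \sum_(b in A) tent pt del b y.
Proof.
have [a aA ya] := cov y; rewrite (bigD1 a)//= -[leLHS]addr0; apply: lerD; last first.
  by apply: sumr_ge0 => b _; exact: tent_ge0.
rewrite /tent le_max; apply/orP; right.
have : 8 * `|pt y - pt a| / del a <= 1 / 2 by rewrite ler_pdivrMr//; lra.
by lra.
Qed.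

Lemma bump_sum y : \sum_(a in A) bump pt del A a y = 1.
Proof. by rewrite -mulr_suml divff// gt_eqF//; have := tent_sum y; lra. Qed.

Lemma bump_ge0 a y : 0 <= bump pt del A a y.
Proof. by rewrite divr_ge0 ?tent_ge0//; have := tent_sum y; lra. Qed.

Lemma bump_le1 a y : a \in A -> bump pt del A a y <= 1.
Proof.
move=> aA; rewrite -(bump_sum y) (bigD1 a)//= lerDl; apply: sumr_ge0 => b _; exact: bump_ge0.
Qed.

Lemma bump_supp a y : bump pt del A a y != 0 -> `|pt y - pt a| <= del a / 8.
Proof. by rewrite /bump mulf_eq0 negb_or => /andP[/tent_supp]. Qed.

Lemma tent_lip a x y : `|tent pt del a x - tent pt del a y| <= 8 * `|pt x - pt y| / del a.
Proof.
have maxlip (u v : R) : `|Num.max 0 u - Num.max 0 v| <= `|u - v|.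
  by rewrite /Num.max; case: ltP => hu; case: ltP => hv; rewrite ?subrr ?subr0 ?sub0r ?normrN ?normr0// ler_norml;
    apply/andP; split; have := ler_norm (u - v); have := ler_norm (v - u); rewrite (distrC v u); lra.
apply: le_trans (maxlip _ _) _.
rewrite (_ : 1 - _ - _ = 8 * (`|pt y - pt a| - `|pt x - pt a|) / del a); last by ring.
rewrite !normrM normfV (gtr0_norm (del0 a)) ger0_norm// ler_wpM2r ?invr_ge0 ?(ltW (del0 a))//.
apply: ler_wpM2l => //; apply: le_trans (ler_dist_dist _ _) _.
by rewrite opprB addrA subrK distrC.
Qed.

(** The quotient rule: numerator and denominator are Lipschitz with constants of order 1 / del a,
    since at most 2m tents are active at x or y and none of their scales is much smaller than del a.
    The condition 8s <= del a keeps x and y in the same neighbourhood of a. *)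
Lemma bump_lip m a x y s : (forall y, #|[set a in A | (`|pt y - pt a| <= del a / 8)%R]| <= m)%N -> a \in A ->
  `|pt x - pt y| <= 2 * s -> 8 * s <= del a -> `|pt x - pt a| <= del a / 8 \/ `|pt y - pt a| <= del a / 8 ->
  `|bump pt del A a x - bump pt del A a y| <= (32 + 64 * 32 * m%:R) * s / del a.
Proof.
move=> act aA; wlog ya : x y / `|pt x - pt a| <= del a / 8.
  move=> h xy sd [xa|ya]; first by apply: h => //; left.
  by rewrite distrC; apply: h => //; [rewrite distrC|left].
move=> xy sd _; have [_ comp] := ad.
have s0 : 0 <= s by have := normr_ge0 (pt x - pt y); lra.
have da := del0 a.
have cx : del a <= 4 * del x by apply: comp; lra.
have cy : del a <= 4 * del y.
  apply: comp; have : `|pt y - pt a| <= `|pt x - pt y| + `|pt x - pt a|.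
    by rewrite -(normrN (pt x - pt y)) opprB; apply: le_trans (ler_normD _ _); rewrite subrKA.
  by lra.
have db b z : z = x \/ z = y -> `|pt z - pt b| <= del b / 8 -> del a <= 16 * del b.
  move=> zz zb; have dbb := del0 b.
  have h1 : del b <= 4 * del z by apply: comp; lra.
  have h2 : del z <= 4 * del b by apply: comp; rewrite distrC; lra.
  by case: zz => e; rewrite e in h2; lra.
pose sd0 := s / del a.
have sd0' : 0 <= sd0 by rewrite divr_ge0// ltW.
pose Ax := [set b in A | `|pt x - pt b| <= del b / 8].
pose Ay := [set b in A | `|pt y - pt b| <= del b / 8].
have lipb b : b \in Ax :|: Ay -> `|tent pt del b x - tent pt del b y| <= 256 * sd0.
  move=> bA; apply: le_trans (tent_lip b x y) _.
  have h : del a <= 16 * del b.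
    by move: bA; rewrite !inE => /orP[/andP[_ h]|/andP[_ h]]; apply: db h; [left|right].
  rewrite ler_pdivrMr// /sd0 -mulrA mulrCA; have : 1 <= 16 * (del b / del a) by rewrite mulrA ler_pdivlMr// mul1r.
  have xy0 := normr_ge0 (pt x - pt y).
  rewrite (_ : s / del a * (256 * del b) = 16 * s * (16 * (del b / del a))); last by field; rewrite gt_eqF.
  move=> h1; have : 16 * s * 1 <= 16 * s * (16 * (del b / del a)) by apply: ler_wpM2l => //; lra.
  by lra.
have Sxy : `|\sum_(b in A) tent pt del b x - \sum_(b in A) tent pt del b y| <= 512 * m%:R * sd0.
  rewrite -sumrB (bigID (mem (Ax :|: Ay)))/= [X in _ + X]big1 ?addr0; last first.
    move=> b /andP[bA]; rewrite !inE bA /= negb_or => /andP[n1 n2].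
    have [/eqP ->|/tent_supp h] := boolP (tent pt del b x == 0); last by rewrite h in n1.
    have [/eqP ->|/tent_supp h] := boolP (tent pt del b y == 0); last by rewrite h in n2.
    by rewrite subrr.
  apply: le_trans (ler_norm_sum _ _ _) _.
  apply: (@le_trans _ _ (\sum_(b in Ax :|: Ay) 256 * sd0)).
    rewrite [leRHS](bigID (mem A))/= [X in _ <= _ + X]big1 ?addr0; last first.
      by move=> b /andP[]; rewrite !inE => /orP[/andP[-> _]|/andP[-> _]].
    rewrite (eq_bigl (fun b => (b \in Ax :|: Ay) && (b \in A))); last by move=> b; rewrite andbC.
    by apply: ler_sum => b /andP[/lipb].
  rewrite sumr_const -[leLHS]mulr_natl mulrA; apply: ler_wpM2r => //.
  have : (#|Ax :|: Ay| <= m + m)%N.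
    by apply: leq_trans (leq_add (act x) (act y)); rewrite cardsU leq_subr.
  by rewrite -(ler_nat R) natrD; lra.
have Sx := tent_sum x; have Sy := tent_sum y.
have ta := lipb a; have {}ta : `|tent pt del a x - tent pt del a y| <= 16 * sd0.
  apply: le_trans (tent_lip a x y) _; rewrite /sd0 mulrA ler_wpM2r ?invr_ge0 ?(ltW da)//; lra.
rewrite /bump -mulrA -/sd0; move: Sxy Sx Sy ta.
set X := \sum_(b in A) _; set Y := \sum_(b in A) _.
have := tent_le1 a y; have := tent_ge0 a y; set tx := tent _ _ _ x; set ty := tent _ _ _ y => t0 t1 Sxy Sx Sy ta.
have X0 : 0 < X by lra. have Y0 : 0 < Y by lra.
have -> : tx / X - ty / Y = (tx - ty) / X + ty * ((Y - X) / (X * Y)) by field; rewrite !gt_eqF.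
have Xi : X^-1 <= 2 by rewrite invf_ple ?posrE//; lra.
have Yi : Y^-1 <= 2 by rewrite invf_ple ?posrE//; lra.
have Xi0 : 0 <= X^-1 by rewrite invr_ge0 ltW.
have Yi0 : 0 <= Y^-1 by rewrite invr_ge0 ltW.
rewrite (_ : (32 + 64 * 32 * m%:R) * sd0 = 16 * sd0 * 2 + 1 * (512 * m%:R * sd0 * (2 * 2))); last by ring.
apply: ler_normDl; first by rewrite normrM (ger0_norm Xi0) ler_pM.
rewrite normrM (ger0_norm t0) ler_pM// normrM distrC ler_pM//.
by rewrite invfM ger0_norm ?mulr_ge0// ler_pM.
Qed.
End Bump.

(** * Correcting gradients along the nearest neighbour *)

Definition cross (R : realType) (u v : plane R) : R := u.1 * v.2 - u.2 * v.1.

(** The component of b orthogonal to v for the Euclidean product, whereas lengths are taken in the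
    max norm; hence the numerical factors in the estimates. *)
Definition perp (R : realType) (v b : plane R) : plane R := b - (dot b v / dot v v) *: v.

Lemma plane_eq (R : realType) (u v : plane R) : u.1 = v.1 -> u.2 = v.2 -> u = v.
Proof. by case: u v => [a b] [c d] /= -> ->. Qed.

Lemma dot_self_ge (R : realType) (v : plane R) : `|v| ^+ 2 <= dot v v.
Proof.
rewrite prod_normE /dot /Num.max -!expr2.
by case: ifP => _; rewrite real_normK ?num_real// ?lerDl ?lerDr sqr_ge0.
Qed.

Lemma dot_self_gt0 (R : realType) (v : plane R) : v != 0 -> 0 < dot v v.
Proof. by move=> v0; apply: lt_le_trans (dot_self_ge v); rewrite exprn_gt0// normr_gt0. Qed.

Lemma cross_le (R : realType) (u v : plane R) : `|cross u v| <= 2 * `|u| * `|v|.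
Proof.
rewrite /cross; apply: le_trans (ler_normB _ _) _; rewrite !normrM.
have := plane_norm1 u; have := plane_norm2 u; have := plane_norm1 v; have := plane_norm2 v => a b c d.
have : `|u.1| * `|v.2| <= `|u| * `|v| by rewrite ler_pM.
have : `|u.2| * `|v.1| <= `|u| * `|v| by rewrite ler_pM.
by linear.
Qed.

(** In the plane two vectors nearly orthogonal to the same n are nearly parallel: each coordinate of
    n times the cross product is a combination of [dot n u] and [dot n v]. *)
Lemma cross_small (R : realType) (n u v : plane R) a b : 1 <= `|n| -> `|dot n u| <= a * `|u| -> `|dot n v| <= b * `|v| ->
  `|cross u v| <= (a + b) * (`|u| * `|v|).
Proof.
move=> n1 hu hv; have u1 := plane_norm1 u; have u2 := plane_norm2 u; have v1 := plane_norm1 v; have v2 := plane_norm2 v.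
have P (x y z c : R) (w w' : plane R) : `|x| <= c * `|w| -> `|y| <= `|w'| -> `|x * y| <= c * (`|w| * `|w'|).
  by move=> hx hy; rewrite normrM mulrA ler_pM.
have c1 : `|n.1 * cross u v| <= (a + b) * (`|u| * `|v|).
  rewrite (_ : n.1 * _ = dot n u * v.2 - dot n v * u.2); last by rewrite /cross /dot; ring.
  apply: le_trans (ler_normB _ _) _; rewrite [leRHS]mulrDl; apply: lerD; first exact: P.
  by rewrite [ `|u| * _ ]mulrC; exact: P.
have c2 : `|n.2 * cross u v| <= (a + b) * (`|u| * `|v|).
  rewrite (_ : n.2 * _ = dot n v * u.1 - dot n u * v.1); last by rewrite /cross /dot; ring.
  apply: le_trans (ler_normB _ _) _; rewrite [leRHS]mulrDl addrC; apply: lerD; first exact: P.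
  by rewrite [ `|u| * _ ]mulrC; exact: P.
rewrite !normrM in c1 c2.
have : `|cross u v| <= `|n| * `|cross u v| by rewrite ler_peMl.
by rewrite prod_normE /Num.max; case: ifP => _ h; [apply: le_trans c2|apply: le_trans c1].
Qed.

Lemma perp_le (R : realType) (v b : plane R) : v != 0 -> `|perp v b| <= 3 * `|b|.
Proof.
move=> v0; have q0 := dot_self_gt0 v0; rewrite /perp; apply: le_trans (ler_normB _ _) _.
rewrite normrZ normrM normfV (gtr0_norm q0).
have h : `|dot b v| / dot v v * `|v| <= 2 * `|b|.
  rewrite mulrAC ler_pdivrMr//; apply: le_trans (_ : 2 * `|b| * `|v| * `|v| <= _).
    by apply: ler_wpM2r => //; exact: dot_le.
  by rewrite -!mulrA -expr2 !ler_wpM2l// dot_self_ge.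
by linear.
Qed.

Lemma perpB (R : realType) (v b c : plane R) : perp v (b - c) = perp v b - perp v c.
Proof. by rewrite /perp dotBl; apply: plane_eq; rewrite /= /GRing.scale /=; ring. Qed.

(** The projection orthogonal to v depends on the direction of v only, and [cross v u] measures the
    sine of the angle between v and u. *)
Lemma perp_tilt (R : realType) (u v b : plane R) e : u != 0 -> v != 0 -> `|cross v u| <= e * (`|v| * `|u|) ->
  `|perp v b - perp u b| <= 4 * e * `|b|.
Proof.
move=> u0 v0 cr; have qu := dot_self_gt0 u0; have qv := dot_self_gt0 v0.
have e0 : 0 <= e.
  by have := le_trans (normr_ge0 _) cr; rewrite pmulr_lge0// mulr_gt0// normr_gt0.
have b1 := plane_norm1 b; have b2 := plane_norm2 b.
have u1 := plane_norm1 u; have u2 := plane_norm2 u; have v1 := plane_norm1 v; have v2 := plane_norm2 v.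
have qq : (`|v| * `|u|) ^+ 2 <= dot v v * dot u u by rewrite exprMn ler_pM ?sqr_ge0 ?dot_self_ge.
have key (a c : R) : `|a| <= 2 * (`|v| * `|u|) -> `|c| <= `|b| ->
    `|c * (cross v u * a / (dot v v * dot u u))| <= 2 * e * `|b|.
  move=> ha hc; rewrite normrM mulrC ler_pM//.
  rewrite normrM normfV (gtr0_norm (mulr_gt0 qv qu)) ler_pdivrMr ?mulr_gt0// normrM.
  apply: le_trans (ler_pM _ _ cr ha) _ => //.
  rewrite (_ : _ * _ * _ = 2 * e * (`|v| * `|u|) ^+ 2); last by ring.
  by apply: ler_wpM2l qq; rewrite mulr_ge0.
have pr (x y : R) : `|x| <= `|v| -> `|y| <= `|u| -> `|x * y| <= `|v| * `|u| by move=> ? ?; rewrite normrM ler_pM.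
have A1 : `|v.1 * u.2 + v.2 * u.1| <= 2 * (`|v| * `|u|).
  by apply: le_trans (ler_normD _ _) _; have := pr _ _ v1 u2; have := pr _ _ v2 u1; linear.
have A2 : `|v.2 * u.2 - v.1 * u.1| <= 2 * (`|v| * `|u|).
  by apply: le_trans (ler_normB _ _) _; have := pr _ _ v1 u1; have := pr _ _ v2 u2; linear.
have nq : (dot u u != 0) && (dot v v != 0) by rewrite !gt_eqF.
have E1 : (perp v b - perp u b).1 = - (b.1 * (cross v u * (v.1 * u.2 + v.2 * u.1) / (dot v v * dot u u)) +
    b.2 * (cross v u * (v.2 * u.2 - v.1 * u.1) / (dot v v * dot u u))).
  rewrite /perp /= /GRing.scale /=; move: nq; rewrite /dot /cross /= => /andP[n1 n2]; field; by rewrite n1 n2.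
have E2 : (perp v b - perp u b).2 = - (b.1 * (cross v u * (v.2 * u.2 - v.1 * u.1) / (dot v v * dot u u)) -
    b.2 * (cross v u * (v.1 * u.2 + v.2 * u.1) / (dot v v * dot u u))).
  rewrite /perp /= /GRing.scale /=; move: nq; rewrite /dot /cross /= => /andP[n1 n2]; field; by rewrite n1 n2.
rewrite plane_norm_le E1 E2 !normrN (_ : 4 * e * `|b| = 2 * e * `|b| + 2 * e * `|b|); last by ring.
apply/andP; split; first by apply: ler_normDl; exact: key.
by apply: ler_normDl; rewrite ?normrN; exact: key.
Qed.

(** A vector orthogonal to u pairs with w only through the part of w transversal to u, that is
    through [cross w u]. *)
Lemma perp_dot (R : realType) (u b w : plane R) e : u != 0 -> `|cross w u| <= e * (`|w| * `|u|) ->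
  `|dot (perp u b) w| <= 2 * e * `|b| * `|w|.
Proof.
move=> u0 cr; have qu := dot_self_gt0 u0.
have -> : dot (perp u b) w = cross b u * cross w u / dot u u.
  by move: (qu); rewrite /perp /cross /dot /= /GRing.scale /= => q; field; rewrite gt_eqF.
rewrite normrM normfV (gtr0_norm qu) ler_pdivrMr// normrM.
apply: le_trans (ler_pM _ _ (cross_le b u) cr) _ => //.
have e0 : 0 <= e * (`|w| * `|u|) by exact: le_trans (normr_ge0 _) cr.
have [->|w0] := eqVneq w 0; first by rewrite normr0 !(mul0r, mulr0).
have {}e0 : 0 <= e by rewrite pmulr_lge0// in e0; rewrite mulr_gt0// normr_gt0.
rewrite (_ : 2 * `|b| * `|u| * (e * (`|w| * `|u|)) = 2 * e * `|b| * `|w| * `|u| ^+ 2); last by ring.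
by apply: ler_wpM2l (dot_self_ge u); rewrite !mulr_ge0.
Qed.

(** G is changed along v only, so that for nonzero v its product with v becomes d. With v the vector
    to the nearest neighbour and d the difference of the values, no error is left along that
    segment. *)
Definition correct (R : realType) (G v : plane R) (d : R) : plane R := G + ((d - dot G v) / dot v v) *: v.

Lemma correct_split (R : realType) (G D v : plane R) d : v != 0 ->
  correct G v d = D + (perp v (G - D) + ((d - dot D v) / dot v v) *: v).
Proof.
move=> v0; have q0 := dot_self_gt0 v0; rewrite /correct /perp dotBl.
rewrite (_ : (d - dot G v) / dot v v = - ((dot G v - dot D v) / dot v v) + (d - dot D v) / dot v v); last by field; rewrite gt_eqF.
by apply: plane_eq; rewrite /= /GRing.scale /=; ring.
Qed.

Lemma along_le (R : realType) (v : plane R) (e K : R) : v != 0 -> `|e| <= K * `|v| -> `|(e / dot v v) *: v| <= K.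
Proof.
move=> v0 eK; have q0 := dot_self_gt0 v0; rewrite normrZ normrM normfV (gtr0_norm q0) mulrAC ler_pdivrMr//.
apply: (@le_trans _ _ (K * `|v| * `|v|)); first by rewrite ler_wpM2r.
have K0 : 0 <= K by have := le_trans (normr_ge0 _) eK; rewrite pmulr_lge0// normr_gt0.
by rewrite -mulrA -expr2; apply: ler_wpM2l (dot_self_ge v).
Qed.

(** By [correct_split] the corrected gradient differs from the slope D by a Taylor error along the
    segment and by the transversal part of b = G - D. Either b is itself at most K at y, or nx and
    ny, of size at least 1, are nearly orthogonal to v, u and w; these are then nearly parallel, so
    the transversal parts at x and y nearly agree and are hardly seen by w. The price is e times
    |b|, collected in mu. *)
Lemma corrected_gradients (R : realType) (Gx Gy Dx Dy u v w : plane R) (dx dy dw K mu : R) :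
  v != 0 -> u != 0 -> 0 <= mu ->
  `|dx - dot Dx v| <= K * `|v| -> `|dy - dot Dy u| <= K * `|u| -> `|dw - dot Dy w| <= K * `|w| ->
  `|Dx - Dy| <= K -> `|(Gx - Dx) - (Gy - Dy)| <= K ->
  `|Gy - Dy| <= K \/ (exists nx ny e, [/\ 1 <= `|nx| /\ 1 <= `|ny|, `|nx - ny| <= e, `|dot nx v| <= e * `|v|,
     `|dot ny u| <= e * `|u| /\ `|dot ny w| <= e * `|w| & e * `|Gy - Dy| <= mu]) ->
  `|correct Gx v dx - correct Gy u dy| <= 16 * (K + mu) /\
  `|dw - dot (correct Gy u dy) w| <= 16 * (K + mu) * `|w|.
Proof.
move=> v0 u0 mu0 ex ey ew Dxy bxy alt.
rewrite (correct_split Gx Dx dx v0) (correct_split Gy Dy dy u0).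
set bx := Gx - Dx in bxy *; set b := Gy - Dy in bxy alt *.
have K0 : 0 <= K := le_trans (normr_ge0 _) Dxy.
have [t1 t2] : `|perp v b - perp u b| <= 6 * K + 16 * mu /\ `|dot (perp u b) w| <= (6 * K + 16 * mu) * `|w|.
  case: alt => [bK|[nx [ny [e [[n1 n2] nxy nv [nu nw] em]]]]].
    have pu := perp_le b u0; have pv := perp_le b v0; split.
      by apply: le_trans (ler_normB _ _) _; linear.
    apply: le_trans (dot_le _ _) _; apply: ler_wpM2r => //; linear.
  have e0 : 0 <= e := le_trans (normr_ge0 _) nxy.
  have nu' : `|dot nx u| <= (3 * e) * `|u|.
    rewrite (_ : dot nx u = dot (nx - ny) u + dot ny u); last by rewrite dotBl subrK.
    rewrite (_ : 3 * e * `|u| = 2 * e * `|u| + e * `|u|); last by ring.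
    apply: ler_normDl => //; apply: le_trans (dot_le _ _) _.
    by rewrite ler_wpM2r// ler_wpM2l.
  have c1 := cross_small n1 nv nu'; have c2 := cross_small n2 nw nu.
  have := perp_tilt b u0 v0 c1; have := perp_dot b u0 c2 => h2 h1; split.
    by apply: (le_trans h1); linear.
  apply: (le_trans h2); apply: ler_wpM2r => //; linear.
have a1 := along_le v0 ex; have a2 := along_le u0 ey.
set tx := (_ / dot v v) *: v in a1 *; set ty := (_ / dot u u) *: u in a2 *.
have pb : `|perp v (bx - b)| <= 3 * K by apply: le_trans (perp_le _ v0) _; rewrite ler_wpM2l.
split.
  rewrite (_ : _ - _ = (Dx - Dy) + (perp v (bx - b) + ((perp v b - perp u b) + (tx - ty)))); last first.
    by rewrite perpB; apply: plane_eq; rewrite /=; ring.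
  apply: le_trans (ler_normD _ _) _; have := ler_normD (perp v (bx - b)) ((perp v b - perp u b) + (tx - ty)).
  have := ler_normD (perp v b - perp u b) (tx - ty); have := ler_normB tx ty; linear.
rewrite (_ : dw - _ = (dw - dot Dy w) - (dot (perp u b) w + dot ty w)); last by rewrite /dot /=; ring.
apply: le_trans (ler_normB _ _) _; have := ler_normD (dot (perp u b) w) (dot ty w).
have : `|dot ty w| <= 2 * K * `|w| by apply: le_trans (dot_le _ _) _; rewrite ler_wpM2r// ler_wpM2l.
have : 0 <= K * `|w| by rewrite mulr_ge0.
have : 0 <= mu * `|w| by rewrite mulr_ge0.
by linear.
Qed.

(** * Taylor estimates against a discrete maximal function *)

(** The Taylor error carries a factor |y - x| in place of t: the correction along the nearest
    neighbour divides by the length of that segment, which may be far below t. *)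
Definition controls (R : realType) (C : R) (D : R -> (plane R -> R) -> plane R -> plane R) O rho n (F : plane R -> R)
    (B : set (plane R)) (m : nat -> nat -> R) :=
  forall i j x y t, (i < n)%N -> (j < n)%N -> rho <= t -> `|x - node O rho i j| <= t -> `|y - node O rho i j| <= t ->
    cbox x (8 * t) `<=` window O rho n `&` B ->
    (rho <= `|y - x| -> `|F y - F x - dot (D rho F x) (y - x)| <= C * (t * m i j) * `|y - x|) /\
    `|D rho F y - D rho F x| <= C * (t * m i j).

(** With d = |y - x| the Taylor error is d times d^(1 - 2/r) times a root of the energy. As r > 2,
    the middle factor is at most (8t)^(1 - 2/r), which combines with the (8t)^(2/r) of
    [maximal_energy] to 8t. *)
Lemma maximal_controls (R : realType) (p r C0 : R) D : slope_op p r C0 D -> exists2 C, 0 < C &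
  forall (O : plane R) rho n F g B (u : nat -> nat -> R), 0 < rho -> sobolev p F g -> measurable B ->
  (forall i j, 0 <= u i j) ->
  exists m : nat -> nat -> R, [/\ forall i j, 0 <= m i j, controls C D O rho n F B m,
    forall i j s, (i < n)%N -> (j < n)%N -> (0 < s)%N ->
        \sum_(k < n | (k <= i + s)%N && (i <= k + s)%N)
           \sum_(l < n | (l <= j + s)%N && (j <= l + s)%N) u k l <= C * s%:R ^+ 2 * m i j `^ r &
    rho ^+ 2 * \sum_(i < n) \sum_(j < n) m i j `^ p <=
      C * (energy p g B + rho ^+ 2 * \sum_(i < n) \sum_(j < n) u i j `^ (p / r))].
Proof.
move=> HD; have [C01 /andP[r2 rp] _ tay] := HD.
have r0 : 0 < r by linear.
have rp' : 0 < r < p by rewrite r0.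
have rr : 0 < r <= p by rewrite r0 ltW.
have [C1 C10 H] := maximal_energy rp'.
have C0C1 : 0 < C0 * C1 by rewrite mulr_gt0//; linear.
exists (8 * (C0 * C1) + C1); first by rewrite addr_gt0// mulr_gt0.
move=> O rho n F g B u rho0 sob mB u0; have [m [m0 H1 H2 H3]] := H O rho n F g B u rho0 sob mB u0.
exists m; split=> //; last 2 first.
- move=> i j s il jl s0; apply: le_trans (H2 i j s il jl s0) _.
  by rewrite !ler_wpM2r ?powR_ge0 ?sqr_ge0// lerDr mulr_ge0// ltW.
- apply: (le_trans H3); apply: ler_wpM2r; last by rewrite lerDr mulr_ge0// ltW.
  rewrite addr_ge0 ?energy_ge0// mulr_ge0 ?sqr_ge0// sumr_ge0// => i _; rewrite sumr_ge0// => j _; exact: powR_ge0.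
move=> i j x y t il jl rt xz yz xW; have t0 : 0 < t by linear.
have a0 : 0 < 1 - 2 / r by rewrite subr_gt0 ltr_pdivrMr; linear.
have xy : `|y - x| <= 2 * t.
  have -> : y - x = (y - node O rho i j) - (x - node O rho i j) by rewrite opprB addrA subrK.
  by apply: le_trans (ler_normB _ _) _; linear.
have tm0 : 0 <= t * m i j by rewrite mulr_ge0// ltW.
have E8 : energy r g (cbox x (8 * t)) `^ r^-1 <= C1 * ((8 * t) `^ (2 / r) * m i j) by apply: H1 => //; linear.
have key d : 0 < d -> d <= 2 * t -> d `^ (1 - 2 / r) * energy r g (cbox x (4 * d)) `^ r^-1 <= 8 * C1 * (t * m i j).
  move=> d0 dt; apply: (@le_trans _ _ ((8 * t) `^ (1 - 2 / r) * (C1 * ((8 * t) `^ (2 / r) * m i j)))).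
    have t8 : d <= 8 * t by linear.
    apply: ler_pM; [exact: powR_ge0|exact: powR_ge0| |].
      by apply: ge0_ler_powR; rewrite ?nnegrE ?(ltW a0) ?(ltW d0)//; apply: le_trans t8; exact: ltW.
    apply: le_trans E8; apply: (energy_root_le rr sob); rewrite subrr normr0 add0r; linear.
  rewrite mulrCA mulrA -[C1 * _ * _]mulrA [(8 * t) `^ (1 - _) * (_ * _)]mulrA -powRD; last first.
    by rewrite (gt_eqF (_ : 0 < 8 * t)) ?implybT//; linear.
  have t8 : 0 <= 8 * t by linear.
  rewrite subrK (powRr1 t8) (_ : C1 * (8 * t * m i j) = 8 * C1 * (t * m i j)); first exact: lexx.
  by ring.
have Cle : C0 * (8 * C1 * (t * m i j)) <= (8 * (C0 * C1) + C1) * (t * m i j).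
  rewrite (_ : C0 * (8 * C1 * (t * m i j)) = 8 * (C0 * C1) * (t * m i j)); last by ring.
  by apply: ler_wpM2r => //; rewrite lerDl ltW.
have C00 : 0 <= C0 by linear.
split=> [ryx|].
  have d0 : 0 < `|y - x| by linear.
  have [h _] := tay r (or_intror erefl) F g rho `|y - x| x y sob rho0 ryx (lexx _).
  apply: (le_trans h).
  rewrite (_ : 2 - 2 / r = 1 + (1 - 2 / r)); last by ring.
  rewrite powRD; last by rewrite (gt_eqF d0) implybT.
  rewrite powRr1// -mulrA mulrCA [leRHS]mulrC; apply: ler_wpM2l => //.
  by apply: le_trans Cle; apply: ler_wpM2l => //; exact: key.
have [|_ h] := tay r (or_intror erefl) F g rho (2 * t) x y sob rho0 _ xy; first by linear.
apply: (le_trans h); apply: le_trans Cle.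
have t20 : 0 < 2 * t by rewrite mulr_gt0.
exact: (ler_wpM2l C00 (key (2 * t) t20 (lexx _))).
Qed.

Lemma sum_block (R : realType) n i0 S (c : R) : (i0 + S <= n)%N ->
  \sum_(i < n | (i0 <= i)%N && (i < i0 + S)%N) c = S%:R * c.
Proof.
move=> iSn; rewrite -(big_mkord (fun i => (i0 <= i)%N && (i < i0 + S)%N) (fun=> c)).
transitivity (\sum_(i0 <= i < i0 + S) c); last by rewrite sumr_const_nat addKn mulr_natl.
rewrite (big_nat_widen i0 _ n)// (big_nat_widenl i0 0)//; apply: eq_bigl => i; by rewrite /= andbC.
Qed.

Definition block (i0 j0 S i j : nat) := [&& (i0 <= i)%N, (i < i0 + S)%N, (j0 <= j)%N & (j < j0 + S)%N].

Lemma sum_block2 (R : realType) n i0 j0 S (c : R) : (i0 + S <= n)%N -> (j0 + S <= n)%N ->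
  \sum_(i < n) \sum_(j < n | block i0 j0 S i j) c = S%:R ^+ 2 * c.
Proof.
move=> h1 h2; rewrite (bigID (fun i : 'I_n => (i0 <= i)%N && (i < i0 + S)%N))/= [X in _ + X]big1 ?addr0; last first.
  by move=> i /negPf h; rewrite big1// => j; rewrite /block andbA h.
rewrite (eq_bigr (fun=> S%:R * c)); first by rewrite sum_block// expr2 mulrA.
by move=> i h; rewrite -(sum_block c h2); apply: eq_bigl => j; rewrite /block andbA h.
Qed.

Lemma block_node (R : realType) (O a : plane R) rho i0 j0 S i j : 0 < rho -> cell O rho i0 j0 a ->
  block i0 j0 S i j -> `|node O rho i j - a| <= rho * S%:R.
Proof.
move=> r0 /cellP[/andP[a1 a2] /andP[b1 b2]] /and4P[h1 h2 h3 h4].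
have key (k0 k : nat) (u : R) : (k0 <= k)%N -> (k < k0 + S)%N -> rho * k0%:R <= u < rho * k0.+1%:R -> `|rho * k%:R - u| <= rho * S%:R.
  move=> kk kS /andP[u1 u2].
  have e1 : rho * k0%:R <= rho * k%:R by rewrite ler_pM2l// ler_nat.
  have e2 : rho * k.+1%:R <= rho * (k0 + S)%:R by rewrite ler_pM2l// ler_nat.
  have S1 : rho * 1 <= rho * S%:R by rewrite ler_pM2l// ler1n; lia.
  rewrite -!natr1 natrD !mulrDr in u2 e2.
  by rewrite ler_norml; apply/andP; split; linear.
rewrite plane_norm_le /node /=; apply/andP; split.
  rewrite (_ : _ - _ = rho * i%:R - (a.1 - O.1)); last by ring.
  by apply: key h1 h2 _; rewrite a1.
rewrite (_ : _ - _ = rho * j%:R - (a.2 - O.2)); last by ring.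
by apply: key h3 h4 _; rewrite b1.
Qed.

Lemma window_exists (R : realType) (I : finType) (pt : I -> plane R) rho L : 0 < rho -> exists O n,
  forall i, cbox (pt i) L `<=` window O rho n.
Proof.
move=> r0; have [K [K0 HK]] : exists K, 0 < K /\ forall i, L + `|pt i| + 1 <= K.
  have S0 : 0 <= \sum_i `|pt i| by apply: sumr_ge0.
  exists (`|L| + \sum_i `|pt i| + 1); split; first by rewrite ltr_pwDr// addr_ge0.
  by move=> i; rewrite lerD2r; apply: lerD; [exact: ler_norm|rewrite (bigD1 i)//= lerDl sumr_ge0].
exists (- K, - K), (Num.truncn (2 * K / rho)).+1 => i w /cboxP[w1 w2].
have /andP[_ n1] : (Num.truncn (2 * K / rho))%:R <= 2 * K / rho < (Num.truncn (2 * K / rho)).+1%:R.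
  by apply: truncn_itv; rewrite divr_ge0// ?mulr_ge0// ltW.
rewrite ltr_pdivrMr// [_ * rho]mulrC in n1; have KL := HK i.
have key (a b : R) : `|a - b| <= L -> `|b| <= `|pt i| -> (- K <= a) && (a < - K + rho * (Num.truncn (2 * K / rho)).+1%:R).
  by rewrite !ler_norml => /andP[h1 h2] /andP[h3 h4]; apply/andP; split; linear.
by split; rewrite /= in_itv/=; [exact: key w1 (plane_norm1 _)|exact: key w2 (plane_norm2 _)].
Qed.

(** * Gradients from keystones *)

Lemma card_setU_le (T : finType) (X Y : {set T}) m : (#|X| <= m)%N -> (#|Y| <= m)%N -> (#|X :|: Y| <= m + m)%N.
Proof. by move=> hx hy; apply: leq_trans (leq_add hx hy); rewrite cardsU leq_subr. Qed.

Lemma norm_sumZ_le (R : realType) (I : finType) (P : pred I) (c : I -> R) (v : I -> plane R) K :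
  (forall i, P i -> c i != 0 -> `|v i| <= K) -> 0 <= K ->
  `|\sum_(i | P i) c i *: v i| <= (\sum_(i | P i) `|c i|) * K.
Proof.
move=> h K0; apply: le_trans (ler_norm_sum _ _ _) _; rewrite mulr_suml; apply: ler_sum => i Pi.
rewrite normrZ; have [->|ci] := eqVneq (c i) 0; first by rewrite normr0 !mul0r.
by apply: ler_wpM2l => //; exact: h.
Qed.

Section Keystones.
Variables (R : realType) (r C : R) (D : R -> (plane R -> R) -> plane R -> plane R).
Variables (I : finType) (pt : I -> plane R) (rho : R) (nb : I -> I) (del : I -> R) (A : {set I}) (key : I -> I)
  (m0 : nat).
Hypotheses (r2 : 2 < r) (C1 : 1 <= C) (rho0 : 0 < rho).
Hypothesis sep : forall i j, i != j -> rho <= `|pt i - pt j|.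
Hypothesis nbP : forall i, nb i != i /\ forall j, j != i -> `|pt (nb i) - pt i| <= `|pt j - pt i|.
Hypotheses (ad : adapted pt del) (sepA : separated pt del A).
Hypothesis cov : forall i, exists2 a, a \in A & `|pt i - pt a| <= del a / 16.
Hypothesis keyP : forall a, a \in A -> [/\ key a \in A, del (key a) <= del a,
    `|pt (key a) - pt a| <= 64 * del a & keystone pt del A (key a)].
Hypothesis act : forall y, (#|[set a in A | (`|pt y - pt a| <= del a / 8)%R]| <= m0)%N.
Hypothesis big : forall a, 16 * (16 * rho) <= del a.

(** The number of cells along a block of side about del a / 256 attached to a. Blocks carry
    quantities indexed by the net onto the grid: separation makes them disjoint, and their area is
    comparable to del a^2 because del a is at least 256 rho. *)
Definition side (a : I) : nat := Num.truncn (del a / (16 * (16 * rho))).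

Let del0 a : 0 < del a. Proof. by case: ad. Qed.
Let barrier1 : barrier := Barrier.

Lemma side_le a : rho * (side a)%:R <= del a / 16 / 16.
Proof.
have b0 : 0 < 16 * (16 * rho) by do 2 apply: mulr_gt0 => //.
have /andP[h _] := truncn_itv (ltW (divr_gt0 (del0 a) b0)).
rewrite ler_pdivlMr// -/(side a) in h; rewrite !ler_pdivlMr//.
by rewrite (_ : rho * (side a)%:R * 16 * 16 = (side a)%:R * (16 * (16 * rho)))//; ring.
Qed.

Lemma side_ge a : del a <= 32 * (16 * (rho * (side a)%:R)).
Proof.
have b0 : 0 < 16 * (16 * rho) by do 2 apply: mulr_gt0 => //.
have /andP[_ h] := truncn_itv (ltW (divr_gt0 (del0 a) b0)).
rewrite ltr_pdivrMr// -natr1 -/(side a) in h.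
have s1 : 1 <= (side a)%:R :> R.
  have b1 : 1 <= del a / (16 * (16 * rho)) by rewrite ler_pdivlMr// mul1r; exact: big.
  have /andP[_ h2] := truncn_itv (ltW (divr_gt0 (del0 a) b0)).
  have : (1 : R) < (side a).+1%:R by exact: le_lt_trans h2.
  by rewrite ltr1n ltnS ler1n.
have : 16 * (16 * rho) * 1 <= 16 * (16 * rho) * (side a)%:R by rewrite ler_pM2l.
rewrite mulrDl mul1r in h; linear.
Qed.

Lemma side_gt0 a : 0 < (side a)%:R :> R.
Proof.
have h := lt_le_trans (del0 a) (side_ge a).
have {}h : 0 < rho * (side a)%:R by move: h; rewrite pmulr_rgt0// pmulr_rgt0.
by rewrite pmulr_rgt0 in h.
Qed.

Variables (O : plane R) (n : nat) (L : R) (i0 j0 : I -> nat).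
Hypothesis win : forall i, cbox (pt i) L `<=` window O rho n.
Hypothesis corner : forall a, cell O rho (i0 a) (j0 a) (pt a).
Hypothesis inside : forall a, (i0 a + side a <= n)%N /\ (j0 a + side a <= n)%N.
Hypothesis delL : forall a, 100 * (100 * del a) <= L.
Let barrier2 : barrier := Barrier.

Lemma win_sub k t : t <= L -> cbox (pt k) t `<=` window O rho n `&` setT.
Proof.
by move=> tL w wk; split=> //; apply: (win (i := k)); apply: cbox_sub wk; rewrite subrr normr0 add0r.
Qed.

Definition ablock a i j := block (i0 a) (j0 a) (side a) i j.

Lemma ablock_near a i j : ablock a i j -> `|node O rho i j - pt a| <= del a / 16 / 16.
Proof. by move=> b; apply: le_trans (side_le a); exact: block_node (corner a) b. Qed.

Lemma ablock_disjoint a b i j : a \in A -> b \in A -> ablock a i j -> ablock b i j -> a = b.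
Proof.
move=> aA bA /ablock_near ha /ablock_near hb; apply/eqP; apply: contraT => ab.
have h1 := sepA aA bA ab; rewrite eq_sym in ab; have := sepA bA aA ab; rewrite distrC => h2.
have : `|pt a - pt b| <= `|node O rho i j - pt a| + `|node O rho i j - pt b|.
  by rewrite -(normrN (_ - pt a)) opprB; apply: le_trans (ler_normD _ _); rewrite subrKA.
by have := del0 a; have := del0 b; linear.
Qed.

Variables (F : plane R -> R) (G : I -> plane R) (nu : I -> R) (m : nat -> nat -> R).
Hypothesis m_ge0 : forall i j, 0 <= m i j.
Hypothesis ctl : controls C D O rho n F setT m.
Hypothesis nu0 : forall k, 0 <= nu k.
Hypothesis keyG : forall k, `|D rho F (pt k) - G k| <= C * (del k * nu k).

(** nu k^r spread over the block of each keystone k, where del k nu k controls the error of its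
    recovered gradient. The sum of its (p/r)-th powers, times the area of a cell, is at most the sum
    of del k^2 nu k^p. *)
Definition umass i j := \sum_(k in A | `[< keystone pt del A k >]) (if ablock k i j then nu k `^ r else 0).

Hypothesis usum : forall i j s, (i < n)%N -> (j < n)%N -> (0 < s)%N ->
  \sum_(k < n | (k <= i + s)%N && (i <= k + s)%N)
    \sum_(l < n | (l <= j + s)%N && (j <= l + s)%N) umass k l <= C * s%:R ^+ 2 * m i j `^ r.

Let K0 : R := (C * (67 * (32 * 16)) ^+ 2) `^ r^-1.
Let barrier3 : barrier := Barrier.

Lemma K0_ge0 : 0 <= K0. Proof. exact: powR_ge0. Qed.

(** A window of radius about 66t around the node contains the block of the keystone, so the maximal
    function gives nu^r <= C' (t / del k)^2 m^r. As r > 2 and t >= del k, the exponent 2 may be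
    raised to r, which yields del k nu k <= K0 t m. *)
Lemma nu_le a i j t : a \in A -> (i < n)%N -> (j < n)%N -> del a <= t -> `|node O rho i j - pt a| <= t ->
  del (key a) * nu (key a) <= K0 * (t * m i j).
Proof.
move=> aA il jl at' za; have [kA kd ka kk] := keyP aA; set k := key a in kA kd ka kk *.
have da := del0 a; have dk := del0 k; have t0 : 0 < t by linear.
have X0 : 0 <= 66 * t / rho by rewrite divr_ge0 ?mulr_ge0// ltW.
pose s := (Num.truncn (66 * t / rho)).+1.
have /andP[s1 s2] := truncn_itv X0.
rewrite -/s in s2; have rt : 1 <= t / rho by rewrite ler_pdivlMr// mul1r; have := big a; move: (rho0); linear.
have su : s%:R <= 67 * (t / rho).
  have e : 66 * t / rho = 66 * (t / rho) by rewrite mulrA.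
  by rewrite /s -natr1; rewrite e in s1 *; move: s1; rewrite -e; linear.
have sS : (side k)%:R ^+ 2 * nu k `^ r <= C * s%:R ^+ 2 * m i j `^ r.
  apply: le_trans (usum il jl (ltn0Sn _) : _ <= C * s%:R ^+ 2 * m i j `^ r).
  have [ins1 ins2] := inside k; rewrite -(sum_block2 (nu k `^ r) ins1 ins2).
  have un i' j' : 0 <= umass i' j' by apply: sumr_ge0 => b _; case: ifP => // _; exact: powR_ge0.
  have uge i' j' : ablock k i' j' -> nu k `^ r <= umass i' j'.
    move=> b; rewrite /umass (bigD1 k)/=; last by rewrite kA; apply/asboolP.
    by rewrite b lerDl; apply: sumr_ge0 => b' _; case: ifP => // _; exact: powR_ge0.
  have near i' j' : ablock k i' j' -> [&& (i' <= i + s)%N, (i <= i' + s)%N, (j' <= j + s)%N & (j <= j' + s)%N].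
    move=> /ablock_near h.
    have zz : `|node O rho i' j' - node O rho i j| <= 66 * t.
      rewrite (_ : _ - _ = (node O rho i' j' - pt k) + ((pt k - pt a) - (node O rho i j - pt a))); last by apply: plane_eq; rewrite /=; ring.
      apply: le_trans (ler_normD _ _) _; have := ler_normB (pt k - pt a) (node O rho i j - pt a); linear.
    rewrite ltr_pdivrMr// [_ * rho]mulrC in s2.
    have key2 (x y : nat) : `|rho * x%:R - rho * y%:R| <= 66 * t -> (x <= y + s)%N /\ (y <= x + s)%N.
      rewrite ler_norml => /andP[h1 h2].
      by split; rewrite -(ler_nat R) -(ler_pM2l rho0) natrD mulrDr; linear.
    have [//|h1 h2] := key2 i' i _.
      rewrite (_ : _ - _ = (node O rho i' j' - node O rho i j).1); last by rewrite /=; ring.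
      exact: le_trans (plane_norm1 _) zz.
    have [//|h3 h4] := key2 j' j _.
      rewrite (_ : _ - _ = (node O rho i' j' - node O rho i j).2); last by rewrite /=; ring.
      exact: le_trans (plane_norm2 _) zz.
    by rewrite h1 h2 h3 h4.
  rewrite [leRHS]big_mkcond /=; apply: ler_sum => i' _.
  case: ifP => [hi|hi]; last first.
    rewrite big1// => j' b; have := near _ _ b; rewrite andbA hi//.
  rewrite big_mkcond [leRHS]big_mkcond /=; apply: ler_sum => j' _.
  case: ifP => [b|_]; last by case: ifP.
  by have := near _ _ b; rewrite !andbA => /andP[/andP[_ h3] h4]; rewrite h3 h4; exact: uge.
have td : 1 <= t / del k by rewrite ler_pdivlMr// mul1r; linear.
have nur : nu k `^ r <= C * (67 * (32 * 16)) ^+ 2 * (t / del k * m i j) `^ r.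
  have S0 := side_gt0 k; rewrite -(ler_pM2l (exprn_gt0 2 S0)); apply: le_trans sS _.
  have sS : s%:R <= (67 * (32 * 16)) * (side k)%:R * (t / del k).
    apply: le_trans su _; rewrite -ler_pdivlMr; last by rewrite divr_gt0.
    rewrite (_ : _ / (t / rho) = 67 * (32 * (16 * (rho * (side k)%:R))) / del k); last by field; rewrite !gt_eqF.
    by rewrite ler_pdivlMr// ler_pM2l//; exact: side_ge.
  rewrite powRM ?(m_ge0) ?divr_ge0 ?(ltW t0) ?(ltW dk)//.
  rewrite (_ : _ * (C * _ * _) = C * ((67 * (32 * 16)) * (side k)%:R) ^+ 2 * (t / del k) `^ r * m i j `^ r); last by ring.
  apply: ler_wpM2r; first exact: powR_ge0.
  rewrite -mulrA; apply: ler_wpM2l; first exact: le_trans ler01 C1.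
  apply: (@le_trans _ _ (((67 * (32 * 16)) * (side k)%:R * (t / del k)) ^+ 2)).
    by rewrite ler_sqr ?nnegrE//; apply: le_trans sS.
  rewrite exprMn; apply: ler_wpM2l; first exact: sqr_ge0.
  rewrite -[leLHS](powR_mulrn 2); last exact: le_trans ler01 td.
  by apply: ler_powR => //; exact: ltW.
have nuk : nu k <= K0 * (t / del k * m i j).
  have r0 : 0 < r by apply: lt_trans r2.
  have tm0 : 0 <= t / del k * m i j by rewrite mulr_ge0// divr_ge0// ltW.
  have c0 : 0 <= C * (67 * (32 * 16)) ^+ 2 by rewrite mulr_ge0 ?sqr_ge0// (le_trans ler01 C1).
  have -> : nu k = (nu k `^ r) `^ r^-1 by rewrite -powRrM divff ?powRr1// gt_eqF.
  have -> : K0 * (t / del k * m i j) = (C * (67 * (32 * 16)) ^+ 2 * (t / del k * m i j) `^ r) `^ r^-1.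
    by rewrite powRM ?powR_ge0// -powRrM divff ?powRr1// gt_eqF.
  by apply: ge0_ler_powR; rewrite ?nnegrE ?powR_ge0 ?invr_ge0 ?(ltW r0)// mulr_ge0// powR_ge0.
rewrite mulrC -ler_pdivlMr//; apply: (le_trans nuk).
by rewrite le_eqVlt; apply/orP; left; apply/eqP; field; rewrite gt_eqF.
Qed.

Let K1 : R := C * K0 + 65 * C.
Let barrier4 : barrier := Barrier.

Lemma K1_ge0 : 0 <= K1.
Proof. by rewrite addr_ge0 ?mulr_ge0 ?K0_ge0// (le_trans ler01 C1). Qed.

Lemma key_gradient a y i j t : a \in A -> (i < n)%N -> (j < n)%N -> del a <= t -> `|node O rho i j - pt a| <= t ->
  `|node O rho i j - pt y| <= t -> 520 * t <= L -> `|G (key a) - D rho F (pt y)| <= K1 * (t * m i j).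
Proof.
move=> aA il jl at' za zy tL; have [_ _ ka _] := keyP aA.
have := nu_le aA il jl at' za; have C0 := le_trans ler01 C1 => h1.
have da := del0 a; have ra := big a.
have h2 : `|D rho F (pt y) - D rho F (pt (key a))| <= C * (65 * t * m i j).
  have [||||_ //] := ctl (x := pt (key a)) (y := pt y) (t := 65 * t) il jl.
  - by move: (rho0); linear.
  - rewrite (_ : _ - _ = (pt (key a) - pt a) - (node O rho i j - pt a)); last by apply: plane_eq; rewrite /=; ring.
    by apply: le_trans (ler_normB _ _) _; linear.
  - by rewrite distrC; linear.
  - by apply: win_sub; linear.
rewrite (_ : _ - _ = (G (key a) - D rho F (pt (key a))) - (D rho F (pt y) - D rho F (pt (key a)))); last by rewrite opprB addrA subrK.
apply: le_trans (ler_normB _ _) _; rewrite distrC.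
apply: le_trans (lerD (keyG (key a)) h2) _.
have := ler_wpM2l C0 h1; rewrite /K1; linear.
Qed.

Definition blend y : plane R := \sum_(a in A) bump pt del A a y *: G (key a).

Lemma blend_sub y (v : plane R) : blend y - v = \sum_(a in A) bump pt del A a y *: (G (key a) - v).
Proof.
rewrite -[v in LHS]scale1r -(bump_sum ad cov y) scaler_suml -sumrB; apply: eq_bigr => a _.
by rewrite scalerBr.
Qed.

(** From the scale of y upwards the blend is as good as the keystone gradients it is made of; below
    that scale only its variation is controlled, by [blend_lip]. *)
Lemma blend_error y i j t : (i < n)%N -> (j < n)%N -> 4 * del y <= t -> `|node O rho i j - pt y| <= t / 2 -> 520 * t <= L ->
  `|blend y - D rho F (pt y)| <= K1 * (t * m i j).
Proof.
move=> il jl dt zy tL; rewrite blend_sub; have dy := del0 y.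
have t0 : 0 < t by linear.
have Kt0 : 0 <= K1 * (t * m i j) by rewrite mulr_ge0 ?K1_ge0// mulr_ge0// ltW.
apply: le_trans (norm_sumZ_le _ Kt0) _; last first.
  rewrite (eq_bigr (fun a => bump pt del A a y)) ?(bump_sum ad cov) ?mul1r//.
  by move=> a _; rewrite ger0_norm// (bump_ge0 ad cov).
move=> a aA /(bump_supp ad) ya; have [_ comp] := ad; have da := del0 a.
have ad4 : del a <= 4 * del y by apply: comp; linear.
apply: key_gradient => //; try linear.
rewrite (_ : _ - pt a = (node O rho i j - pt y) + (pt y - pt a)); last by rewrite addrA subrK.
by apply: le_trans (ler_normD _ _) _; linear.
Qed.

Let K3 : R := (m0 + m0)%:R * ((32 + 64 * 32 * m0%:R) * K1 + 9 * K1).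
Let barrier5 : barrier := Barrier.

(** The weights sum to 1, so a fixed vector may be subtracted from all keystone gradients. For del a
    >= 8s the Lipschitz constant 1 / del a of the weight cancels the order del a m of the gradient
    error; for smaller del a that error is itself of order s m. *)
Lemma blend_lip x y i j s : (i < n)%N -> (j < n)%N -> rho <= s -> `|node O rho i j - pt x| <= s ->
  `|node O rho i j - pt y| <= s -> 100 * (100 * s) <= L -> `|blend x - blend y| <= K3 * (s * m i j).
Proof.
move=> il jl rs zx zy sL; have s0 : 0 < s by move: (rho0); linear.
have K10 := K1_ge0; have sm0 : 0 <= s * m i j by rewrite mulr_ge0// ltW.
pose v := D rho F (pt y).
have -> : blend x - blend y = \sum_(a in A) (bump pt del A a x - bump pt del A a y) *: (G (key a) - v).
  rewrite (_ : _ - _ = (blend x - v) - (blend y - v)); last by rewrite opprB addrA subrK.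
  by rewrite !blend_sub -sumrB; apply: eq_bigr => a _; rewrite scalerBl.
pose X := [set a in A | `|pt x - pt a| <= del a / 8]; pose Y := [set a in A | `|pt y - pt a| <= del a / 8].
rewrite (bigID (mem (X :|: Y)))/= [X in _ + X]big1 ?addr0; last first.
  move=> a /andP[aA]; rewrite !inE aA /= negb_or => /andP[n1 n2].
  have [/eqP ->|/(bump_supp ad) h] := boolP (bump pt del A a x == 0); last by rewrite h in n1.
  have [/eqP ->|/(bump_supp ad) h] := boolP (bump pt del A a y == 0); last by rewrite h in n2.
  by rewrite subrr scale0r.
have term a : a \in A -> a \in X :|: Y -> `|(bump pt del A a x - bump pt del A a y) *: (G (key a) - v)| <=
    ((32 + 64 * 32 * m0%:R) * K1 + 9 * K1) * (s * m i j).
  move=> aA aXY; have da := del0 a.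
  have near : `|pt x - pt a| <= del a / 8 \/ `|pt y - pt a| <= del a / 8.
    by move: aXY; rewrite !inE aA /= => /orP.
  have za : `|node O rho i j - pt a| <= s + del a / 8.
    case: near => h.
      rewrite (_ : _ - pt a = (node O rho i j - pt x) + (pt x - pt a)); last by rewrite addrA subrK.
      by apply: le_trans (ler_normD _ _) _; linear.
    rewrite (_ : _ - pt a = (node O rho i j - pt y) + (pt y - pt a)); last by rewrite addrA subrK.
    by apply: le_trans (ler_normD _ _) _; linear.
  have xy : `|pt x - pt y| <= 2 * s.
    rewrite (_ : _ - _ = (node O rho i j - pt y) - (node O rho i j - pt x)); last by apply: plane_eq; rewrite /=; ring.
    by apply: le_trans (ler_normB _ _) _; linear.
  have m00 : 0 <= m0%:R :> R by [].
  have B0 : 0 <= 32 + 64 * 32 * m0%:R :> R by linear.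
  have b0 : 0 <= (32 + 64 * 32 * m0%:R) * K1 * (s * m i j) by apply: mulr_ge0 => //; exact: mulr_ge0.
  have b1 : 0 <= 9 * K1 * (s * m i j) by apply: mulr_ge0 => //; apply: mulr_ge0.
  have dL := delL a; rewrite normrZ mulrDl.
  have [sd|sd] := leP (8 * s) (del a).
    have h1 := bump_lip ad cov act aA xy sd near.
    have q1 : `|node O rho i j - pt a| <= del a by linear.
    have q2 : `|node O rho i j - pt y| <= del a by linear.
    have q3 : 520 * del a <= L by linear.
    have h2 := key_gradient aA il jl (lexx _) q1 q2 q3.
    apply: le_trans (ler_pM _ _ h1 h2) _ => //.
    rewrite (_ : _ * s / del a * _ = (32 + 64 * 32 * m0%:R) * K1 * (s * m i j)); last by field; rewrite gt_eqF.
    by rewrite lerDl.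
  have q1 : del a <= 9 * s by linear.
  have q2 : `|node O rho i j - pt a| <= 9 * s by linear.
  have q3 : `|node O rho i j - pt y| <= 9 * s by linear.
  have q4 : 520 * (9 * s) <= L by linear.
  have h2 := key_gradient aA il jl q1 q2 q3 q4.
  have h1 : `|bump pt del A a x - bump pt del A a y| <= 1.
    have := bump_ge0 ad cov a x; have := bump_ge0 ad cov a y; have := bump_le1 ad cov x aA; have := bump_le1 ad cov y aA.
    by rewrite ler_norml => *; apply/andP; split; linear.
  apply: le_trans (ler_pM _ _ h1 h2) _ => //; rewrite mul1r.
  rewrite (_ : K1 * (9 * s * m i j) = 9 * K1 * (s * m i j)); last by ring.
  by rewrite lerDr.
apply: le_trans (ler_norm_sum _ _ _) _.
apply: (@le_trans _ _ (\sum_(a in X :|: Y) ((32 + 64 * 32 * m0%:R) * K1 + 9 * K1) * (s * m i j))).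
  rewrite [leRHS](bigID (mem A))/= [X in _ <= _ + X]big1 ?addr0; last first.
    by move=> b /andP[]; rewrite !inE => /orP[/andP[-> _]|/andP[-> _]].
  rewrite (eq_bigl (fun b => (b \in X :|: Y) && (b \in A))); last by move=> b; rewrite andbC.
  by apply: ler_sum => b /andP[bX bA]; exact: term.
rewrite sumr_const -[leLHS]mulr_natl mulrA; apply: ler_wpM2r => //.
apply: ler_wpM2r; last by rewrite ler_nat; exact: card_setU_le (act x) (act y).
by rewrite addr_ge0// mulr_ge0// addr_ge0// mulr_ge0.
Qed.

Variables (h : I -> plane R -> R) (mh : I -> nat -> nat -> R).
Hypothesis mh_ge0 : forall a i j, 0 <= mh a i j.
Hypothesis ctlh : forall a, controls C D O rho n (h a) (cbox (pt a) (8 * del a)) (mh a).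
Hypothesis hP : forall a i, `|pt i - pt a| <= del a -> h a (pt i) = 0 /\ 1 <= `|D rho (h a) (pt i)|.
Let barrier6 : barrier := Barrier.

(** A maximum over all points that a covers, so that the error enters through a number attached to a
    and can be summed over the net. *)
Definition worst a := \big[Num.max/0]_(y | `|pt y - pt a| <= del a / 16) `|blend y - D rho F (pt y)|.

Lemma worst_ge0 a : 0 <= worst a.
Proof. exact: bigmax_ge_id. Qed.

Lemma worst_block a i j : (i < n)%N -> (j < n)%N -> ablock a i j -> worst a <= 16 * K1 * (del a * m i j).
Proof.
move=> il jl b; have K10 := K1_ge0; have da := del0 a; have dL := delL a; have [_ comp] := ad.
apply: bigmax_le => [|y ya].
  by rewrite !mulr_ge0// ltW.
have d1 : del a <= 4 * del y by apply: comp; linear.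
have d2 : del y <= 4 * del a by apply: comp; rewrite distrC; linear.
have zb := ablock_near b.
rewrite (_ : 16 * K1 * _ = K1 * (16 * del a * m i j)); last by ring.
apply: blend_error => //; try linear.
rewrite (_ : _ - _ = (node O rho i j - pt a) - (pt y - pt a)); last by rewrite opprB addrA subrK.
by apply: le_trans (ler_normB _ _) _; linear.
Qed.

Definition gradient y : plane R := correct (blend y) (pt (nb y) - pt y) (F (pt (nb y)) - F (pt y)).

(** [corrected_gradients] with K of order s m. If del a < 64 s the blend itself is accurate.
    Otherwise x, y and their neighbours lie where the witness h of a vanishes, so the Taylor
    estimate makes its slopes nearly orthogonal to the segments between them, with e of order s mh;
    the price is of order s times worst times mh. *)
Lemma gradient_bounds : exists2 K, K = 32 * 32 * K1 + K3 + 6 * C &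
  forall x y i j s, x != y -> (i < n)%N -> (j < n)%N -> rho <= s -> `|node O rho i j - pt x| <= s ->
  `|node O rho i j - pt y| <= s -> 100 * (100 * (100 * s)) <= L -> exists2 a, a \in A &
    `|gradient x - gradient y| <= 16 * (K * (s * (m i j + worst a * mh a i j))) /\
    `|F (pt x) - F (pt y) - dot (gradient y) (pt x - pt y)| <=
      16 * (K * (s * (m i j + worst a * mh a i j))) * `|pt x - pt y|.
Proof.
exists (32 * 32 * K1 + K3 + 6 * C) => // x y i j s xy il jl rs zx zy sL.
set K := 32 * 32 * K1 + K3 + 6 * C.
have s0 : 0 < s by move: (rho0); linear.
have K10 := K1_ge0; have C0 := le_trans ler01 C1.
have K30 : 0 <= K3 by rewrite mulr_ge0// addr_ge0// !mulr_ge0// addr_ge0// mulr_ge0.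
have sm0 : 0 <= s * m i j by rewrite mulr_ge0// ltW.
have Kle c : 0 <= c -> c <= K -> c * (s * m i j) <= K * (s * m i j) by move=> _ h1; apply: ler_wpM2r.
have [a aA ya] := cov y; exists a => //.
have da := del0 a; have [_ comp] := ad; have dL := delL a.
have d1 : del a <= 4 * del y by apply: comp; linear.
have d2 : del y <= 4 * del a by apply: comp; rewrite distrC; linear.
have xy2 : `|pt x - pt y| <= 2 * s.
  rewrite (_ : _ - _ = (node O rho i j - pt y) - (node O rho i j - pt x)); last by apply: plane_eq; rewrite /=; ring.
  by apply: le_trans (ler_normB _ _) _; linear.
have [nx nxm] := nbP x; have [ny nym] := nbP y.
have vs : `|pt (nb x) - pt x| <= 2 * s by apply: le_trans (nxm y _) _; rewrite ?[y == x]eq_sym// distrC.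
have us : `|pt (nb y) - pt y| <= 2 * s by apply: le_trans (nym x xy) _.
have z3 k : `|node O rho i j - pt k| <= s -> `|pt (nb k) - pt k| <= 2 * s -> `|pt (nb k) - node O rho i j| <= 3 * s.
  move=> h1 h2; rewrite (_ : _ - _ = (pt (nb k) - pt k) - (node O rho i j - pt k)); last by rewrite opprB addrA subrK.
  by apply: le_trans (ler_normB _ _) _; linear.
have zx3 : `|pt x - node O rho i j| <= 3 * s by rewrite distrC; linear.
have zy3 : `|pt y - node O rho i j| <= 3 * s by rewrite distrC; linear.
have boxT k : cbox (pt k) (8 * (3 * s)) `<=` window O rho n `&` setT.
  by apply: win_sub; linear.
have r3 : rho <= 3 * s by linear.
have tF k l : k != l -> `|pt k - node O rho i j| <= 3 * s -> `|pt l - node O rho i j| <= 3 * s ->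
    `|F (pt l) - F (pt k) - dot (D rho F (pt k)) (pt l - pt k)| <= K * (s * m i j) * `|pt l - pt k|.
  move=> kl zk zl; have [h1 _] := ctl il jl r3 zk zl (boxT k).
  rewrite eq_sym in kl; apply: le_trans (h1 (sep kl)) _; apply: ler_wpM2r => //.
  rewrite (_ : C * _ = 3 * C * (s * m i j)); last by ring.
  by apply: Kle; rewrite ?mulr_ge0// /K; linear.
have DF : `|D rho F (pt x) - D rho F (pt y)| <= K * (s * m i j).
  have [_ h1] := ctl il jl r3 zy3 zx3 (boxT y); apply: (le_trans h1).
  rewrite (_ : C * _ = 3 * C * (s * m i j)); last by ring.
  by apply: Kle; rewrite ?mulr_ge0// /K; linear.
have BB : `|blend x - D rho F (pt x) - (blend y - D rho F (pt y))| <= K * (s * m i j).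
  rewrite (_ : _ - _ - _ = (blend x - blend y) - (D rho F (pt x) - D rho F (pt y))); last by rewrite !opprB addrACA [RHS]addrACA; congr (_ + _); rewrite addrC.
  have [_ h1] := ctl il jl r3 zy3 zx3 (boxT y); apply: le_trans (ler_normB _ _) _.
  have h2 : `|blend x - blend y| <= K3 * (s * m i j) by apply: blend_lip => //; linear.
  apply: le_trans (lerD h2 h1) _.
  rewrite (_ : C * _ = 3 * C * (s * m i j)); last by ring.
  by rewrite -mulrDl; apply: ler_wpM2r => //; rewrite /K; linear.
have v0 : pt (nb x) - pt x != 0 by rewrite -normr_gt0; apply: lt_le_trans (sep nx).
have u0 : pt (nb y) - pt y != 0 by rewrite -normr_gt0; apply: lt_le_trans (sep ny).
have mu0 : 0 <= K * (s * (worst a * mh a i j)).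
  have Kn : 0 <= K by rewrite /K; linear.
  apply: mulr_ge0 => //; apply: mulr_ge0; first exact: ltW.
  by apply: mulr_ge0 => //; exact: worst_ge0.
have e1 : K * (s * (m i j + worst a * mh a i j)) = K * (s * m i j) + K * (s * (worst a * mh a i j)) by ring.
rewrite e1; apply: (corrected_gradients v0 u0 mu0) => //.
- by apply: tF => //; [rewrite eq_sym|exact: z3].
- by apply: tF => //; [rewrite eq_sym|exact: z3].
- by apply: tF => //; rewrite eq_sym.
- exact: DF.
- exact: BB.
have [sd|sd] := ltP (del a) (64 * s).
  have q1 : 4 * del y <= 32 * 32 * s by linear.
  have q2 : `|node O rho i j - pt y| <= 32 * 32 * s / 2 by linear.
  have q3 : 520 * (32 * 32 * s) <= L by linear.
  left; apply: le_trans (blend_error il jl q1 q2 q3) _.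
  rewrite (_ : K1 * _ = 32 * 32 * K1 * (s * m i j)); last by ring.
  by apply: Kle; rewrite ?mulr_ge0// /K; linear.
right; exists (D rho (h a) (pt x)), (D rho (h a) (pt y)), (C * (3 * s * mh a i j)).
have nearA k : `|pt k - node O rho i j| <= 3 * s -> `|pt k - pt a| <= del a.
  move=> zk; rewrite (_ : _ - _ = (pt k - node O rho i j) + ((node O rho i j - pt y) + (pt y - pt a))); last first.
    by apply: plane_eq; rewrite /=; ring.
  apply: le_trans (ler_normD _ _) _; have := ler_normD (node O rho i j - pt y) (pt y - pt a); linear.
have boxA k : `|pt k - node O rho i j| <= 3 * s -> cbox (pt k) (8 * (3 * s)) `<=` window O rho n `&` cbox (pt a) (8 * del a).
  move=> zk w wk; split; first by have := boxT k w wk; rewrite setIT.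
  by apply: cbox_sub wk; have := nearA k zk; linear.
have tH k l : k != l -> `|pt k - node O rho i j| <= 3 * s -> `|pt l - node O rho i j| <= 3 * s ->
    `|dot (D rho (h a) (pt k)) (pt l - pt k)| <= C * (3 * s * mh a i j) * `|pt l - pt k|.
  move=> kl zk zl; have [h1 _] := ctlh il jl r3 zk zl (boxA k zk).
  have [hk _] := hP (nearA k zk); have [hl _] := hP (nearA l zl).
  rewrite eq_sym in kl; have := h1 (sep kl).
  by rewrite hk hl subrr sub0r normrN.
split.
- by split; [case: (hP (nearA x zx3))|case: (hP (nearA y zy3))].
- by have [_ h1] := ctlh il jl r3 zy3 zx3 (boxA y zy3).
- by apply: tH => //; [rewrite eq_sym|exact: z3].
- by split; apply: tH => //; [rewrite eq_sym|exact: z3|rewrite eq_sym].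
- have w1 : `|blend y - D rho F (pt y)| <= worst a by rewrite /worst; apply: le_bigmax_cond.
  apply: (@le_trans _ _ (C * (3 * s * mh a i j) * worst a)).
    by apply: ler_wpM2l => //; rewrite !mulr_ge0// ltW.
  rewrite (_ : C * _ * _ = 3 * C * (s * (worst a * mh a i j))); last by ring.
  apply: ler_wpM2r; first by rewrite !mulr_ge0 ?worst_ge0// ltW.
  by rewrite /K; linear.
Qed.
End Keystones.

(** * Summing the errors over the net *)

Lemma blocks_sum_le (R : realType) (I : finType) (P : pred I) n (b : I -> nat -> nat -> bool) (f : nat -> nat -> R) :
  (forall a c i j, P a -> P c -> b a i j -> b c i j -> a = c) -> (forall i j, 0 <= f i j) ->
  \sum_(a | P a) \sum_(i < n) \sum_(j < n | b a i j) f i j <= \sum_(i < n) \sum_(j < n) f i j.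
Proof.
move=> dis f0; rewrite exchange_big /=; apply: ler_sum => i _.
rewrite (exchange_big_dep predT)//=; apply: ler_sum => j _; rewrite sumr_const.
have le1 : (#|[pred a | P a & b a i j]| <= 1)%N.
  apply/card_le1P => c cP d; rewrite !inE in cP *; apply/idP/eqP => [dP|->//].
  move: cP dP => /andP[c1 c2] /andP[d1 d2]; exact: dis d1 c1 d2 c2.
by case: (#|_|) le1 => [|[|//]] _; rewrite ?mulr0n ?mulr1n.
Qed.

Lemma powR_disjoint_sum (R : realType) (I : finType) (P b : pred I) (f : I -> R) q :
  (forall a c, P a -> P c -> b a -> b c -> a = c) -> 0 < q ->
  (\sum_(a | P a) (if b a then f a else 0)) `^ q = \sum_(a | P a) (if b a then f a `^ q else 0).
Proof.
move=> dis q0; have [[a /andP[Pa ba]]|no] := pselect (exists a, P a && b a).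
  rewrite (bigD1 a)//= [in RHS](bigD1 a)//= ba !big1 ?addr0// => c /andP[Pc ca]; case: ifP => // bc.
    by rewrite (dis c a Pc Pa bc ba) eqxx in ca.
  by rewrite (dis c a Pc Pa bc ba) eqxx in ca.
rewrite !big1 ?powR0 ?gt_eqF// => a Pa; case: ifP => // ba; exfalso; apply: no; exists a; exact/andP.
Qed.

Section Mass.
Variables (R : realType) (p r C W E : R) (I : finType) (pt : I -> plane R) (rho : R) (del : I -> R) (A : {set I}).
Variables (O : plane R) (n : nat) (i0 j0 : I -> nat) (m : nat -> nat -> R) (nu : I -> R) (mh : I -> nat -> nat -> R) (w : I -> R).
Hypotheses (r0 : 0 < r) (rp : r < p) (C0 : 0 <= C) (W0 : 0 <= W) (rho0 : 0 < rho).
Hypotheses (ad : adapted pt del) (sepA : separated pt del A) (big : forall a, 16 * (16 * rho) <= del a).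
Hypothesis corner : forall a, cell O rho (i0 a) (j0 a) (pt a).
Hypothesis inside : forall a, (i0 a + side rho del a <= n)%N /\ (j0 a + side rho del a <= n)%N.
Hypotheses (m_ge0 : forall i j, 0 <= m i j) (nu0 : forall k, 0 <= nu k) (mh_ge0 : forall a i j, 0 <= mh a i j).
Hypothesis w0 : forall a, 0 <= w a.

Let blk := ablock rho del i0 j0.

Let blk_sum a c : \sum_(i < n) \sum_(j < n | blk a i j) c = (side rho del a)%:R ^+ 2 * c :> R.
Proof. by case: (inside a) => h1 h2; exact: sum_block2. Qed.

(** On disjoint blocks the power of the sum is the sum of the powers, and a block has area at most
    del k^2. *)
Lemma umass_mass : \sum_(k in A | `[< keystone pt del A k >]) del k ^+ 2 * nu k `^ p <= E ->
  rho ^+ 2 * \sum_(i < n) \sum_(j < n) umass r pt rho del A i0 j0 nu i j `^ (p / r) <= E.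
Proof.
move=> h; apply: le_trans h; have pr : 0 < p / r by rewrite divr_gt0//; move: r0 rp; lra.
have e1 (i j : nat) : umass r pt rho del A i0 j0 nu i j `^ (p / r) =
    \sum_(k in A | `[< keystone pt del A k >]) (if blk k i j then nu k `^ p else 0).
  rewrite /umass powR_disjoint_sum//; last first.
    by move=> a c /andP[aA _] /andP[cA _]; exact: (ablock_disjoint rho0 ad sepA corner).
  apply: eq_bigr => k _; rewrite /blk; case: ifP => // _; by rewrite -powRrM mulrCA divff ?mulr1 ?lt0r_neq0.
under eq_bigr do under eq_bigr do rewrite e1.
under eq_bigr do rewrite exchange_big.
rewrite exchange_big /= mulr_sumr; apply: ler_sum => k _.
under eq_bigr do rewrite -big_mkcond.
rewrite blk_sum mulrA; apply: ler_wpM2r; first exact: powR_ge0.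
rewrite -exprMn; have [d0 _] := ad; apply: lerXn2r; rewrite ?nnegrE.
- by rewrite mulr_ge0// ltW.
- exact: ltW.
by have := side_le rho0 ad k; have dk := d0 k; lra.
Qed.

(** The witness of a contributes w^p del a^(2 - p). Since w <= W del a m on the block of a, whose
    area is comparable to del a^2, this is at most a constant times the integral of m^p over the
    block, and the blocks are disjoint. *)
Lemma worst_mass : (forall a i j, (i < n)%N -> (j < n)%N -> blk a i j -> w a <= W * (del a * m i j)) ->
  (forall a, rho ^+ 2 * \sum_(i < n) \sum_(j < n) mh a i j `^ p <= C * del a `^ (2 - p)) ->
  rho ^+ 2 * \sum_(i < n) \sum_(j < n) \sum_(a in A) (w a * mh a i j) `^ p <=
    C * ((32 * 16) ^+ 2 * W `^ p) * (rho ^+ 2 * \sum_(i < n) \sum_(j < n) m i j `^ p).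
Proof.
move=> hw hm; have p0 : 0 < p by move: r0 rp; lra.
have term a : a \in A -> w a `^ p * del a `^ (2 - p) <=
    (32 * 16) ^+ 2 * W `^ p * (rho ^+ 2 * \sum_(i < n) \sum_(j < n | blk a i j) m i j `^ p).
  move=> aA; have [/(_ a) d0 _] := ad; have s1 := side_ge rho0 ad big a.
  have h1 : w a `^ p * (side rho del a)%:R ^+ 2 <= W `^ p * del a `^ p * \sum_(i < n) \sum_(j < n | blk a i j) m i j `^ p.
    rewrite mulrC -blk_sum mulr_sumr; apply: ler_sum => i _; rewrite mulr_sumr; apply: ler_sum => j b.
    rewrite -powRM ?(ltW d0)// -powRM ?mulr_ge0 ?(ltW d0)// -mulrA.
    apply: ge0_ler_powR; rewrite ?nnegrE ?(ltW p0) ?mulr_ge0 ?(ltW d0)//; exact: hw.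
  have dp : 0 < del a `^ p by exact: powR_gt0.
  rewrite powRB ?(gt_eqF d0) ?implybT// powR_mulrn ?(ltW d0)// mulrA ler_pdivrMr//.
  apply: (@le_trans _ _ (w a `^ p * (32 * (16 * (rho * (side rho del a)%:R))) ^+ 2)).
    apply: ler_wpM2l; first exact: powR_ge0.
    by apply: lerXn2r; rewrite ?nnegrE ?(ltW d0)// (le_trans (ltW d0)).
  rewrite (_ : _ * _ ^+ 2 = (32 * 16) ^+ 2 * rho ^+ 2 * (w a `^ p * (side rho del a)%:R ^+ 2)); last by ring.
  apply: le_trans (ler_wpM2l _ h1) _; first by apply: mulr_ge0; apply: sqr_ge0.
  by rewrite le_eqVlt; apply/orP; left; apply/eqP; ring.
apply: (@le_trans _ _ (\sum_(a in A) w a `^ p * (rho ^+ 2 * \sum_(i < n) \sum_(j < n) mh a i j `^ p))).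
  rewrite le_eqVlt; apply/orP; left; apply/eqP.
  under eq_bigr do rewrite exchange_big.
  rewrite exchange_big /= mulr_sumr; apply: eq_bigr => a _; rewrite mulrCA; congr (_ * _).
  rewrite mulr_sumr; apply: eq_bigr => i _; rewrite mulr_sumr; apply: eq_bigr => j _; rewrite powRM//.
apply: (@le_trans _ _ (\sum_(a in A) C * (w a `^ p * del a `^ (2 - p)))).
  by apply: ler_sum => a _; rewrite [leRHS]mulrCA; apply: ler_wpM2l; rewrite ?powR_ge0.
rewrite -mulr_sumr -mulrA; apply: ler_wpM2l => //.
apply: (@le_trans _ _ (\sum_(a in A) (32 * 16) ^+ 2 * W `^ p * (rho ^+ 2 * \sum_(i < n) \sum_(j < n | blk a i j) m i j `^ p))).
  exact: ler_sum.
rewrite -!mulr_sumr; apply: ler_wpM2l; first by rewrite mulr_ge0 ?powR_ge0// sqr_ge0.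
apply: ler_wpM2l; first exact: sqr_ge0.
apply: (@blocks_sum_le _ _ (mem A) n blk (fun i j => m i j `^ p)) => [a c i j aA cA|i j]; last exact: powR_ge0.
exact: (ablock_disjoint rho0 ad sepA corner).
Qed.

End Mass.

(** * Linear recovery of gradients from the data *)

Lemma controls_le (R : realType) (C C' : R) D O rho n F (B : set (plane R)) m : 0 <= rho -> C <= C' ->
  (forall i j, 0 <= m i j) -> controls C D O rho n F B m -> controls C' D O rho n F B m.
Proof.
move=> rho0 CC m0 H i j x y t il jl rt zx zy sub; have [h1 h2] := H i j x y t il jl rt zx zy sub.
have tm : 0 <= t * m i j by rewrite mulr_ge0// (le_trans rho0).
split=> [h|]; [apply: le_trans (h1 h) _; apply: ler_wpM2r => //|apply: le_trans h2 _]; exact: ler_wpM2r.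
Qed.

Lemma correct_comb (R : realType) (a d e : R) (G H v : plane R) :
  correct (a *: G + H) v (a * d + e) = a *: correct G v d + correct H v e.
Proof. by apply: plane_eq; rewrite /correct /dot /= /GRing.scale /=; ring. Qed.

(** The order of quantifiers matters: [gr] is fixed by the points and linear in the data, the window
    depends on the largest scale S of interest, and only the majorant M depends on F. *)
Definition gradient_scheme (R : realType) (p C : R) (I : finType) (pt : I -> plane R) (rho : R) (gr : (I -> R) -> I -> plane R) :=
  (forall a f h x, gr (fun y => a * f y + h y) x = a *: gr f x + gr h x) /\
  forall S, exists O n, (forall i, cbox (pt i) S `<=` window O rho n) /\
    forall F g, sobolev p F g -> exists2 M : nat -> nat -> R, forall i j, 0 <= M i j &
      rho ^+ 2 * \sum_(i < n) \sum_(j < n) M i j `^ p <= C * energy p g setT /\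
      forall x y i j s, x != y -> (i < n)%N -> (j < n)%N -> rho <= s -> s <= S ->
        `|node O rho i j - pt x| <= s -> `|node O rho i j - pt y| <= s ->
        `|gr (F \o pt) x - gr (F \o pt) y| <= C * (s * M i j) /\
        `|F (pt x) - F (pt y) - dot (gr (F \o pt) y) (pt x - pt y)| <= C * (s * M i j) * `|pt x - pt y|.

Lemma keystone_scheme (R : realType) (p r C0 : R) D : slope_op p r C0 D -> exists2 C, 0 < C &
  forall (I : finType) (pt : I -> plane R) rho nb (del : I -> R), injective pt -> 0 < rho ->
  (forall i j, i != j -> rho <= `|pt i - pt j|) ->
  (forall i, nb i != i /\ forall j, j != i -> `|pt (nb i) - pt i| <= `|pt j - pt i|) ->
  (forall a, 16 * (16 * rho) <= del a) -> (forall a, flat p D pt rho (pt a) (del a)) ->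
  (forall a, ~ flat p D pt rho (pt a) (2 * del a)) -> exists gr, gradient_scheme p C pt rho gr.
Proof.
move=> HD; have [C01 /andP[r2 rp] _ _] := HD.
have [Cm Cm0 Hm] := maximal_controls HD; have [m0 act0] := active_count; have [m1 ov] := keystone_overlap.
set C := Cm + 4 * C0 + m1%:R.
have m10 : 0 <= m1%:R :> R by [].
have C1 : 1 <= C by rewrite /C; linear.
have Cge0 : 0 <= C := le_trans ler01 C1.
have CmC : Cm <= C by rewrite /C; linear.
have m1C : m1%:R <= C by rewrite /C; linear.
have r0 : 0 < r by linear.
have p0 : 0 < p by linear.
set K1 := C * (C * (67 * (32 * 16)) ^+ 2) `^ r^-1 + 65 * C.
set K3 := (m0 + m0)%:R * ((32 + 64 * 32 * m0%:R) * K1 + 9 * K1).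
set K := 32 * 32 * K1 + K3 + 6 * C.
have K10 : 0 <= K1 by rewrite addr_ge0 ?mulr_ge0 ?powR_ge0.
have m00 : 0 <= m0%:R :> R by [].
have K30 : 0 <= K3 by rewrite mulr_ge0// addr_ge0// !mulr_ge0// addr_ge0// mulr_ge0.
have K0 : 0 <= K by rewrite !addr_ge0// !mulr_ge0.
set W := 16 * K1; have W0 : 0 <= W by rewrite mulr_ge0.
set Z := (32 * 16) ^+ 2 * W `^ p; have Z0 : 0 <= Z by rewrite mulr_ge0 ?powR_ge0// sqr_ge0.
set Q := 2 `^ p * ((1 + C * Z) * (C * (1 + C))).
have Q0 : 0 <= Q by rewrite /Q; apply: mulr_ge0; [exact: powR_ge0|apply: mulr_ge0; [|apply: mulr_ge0 => //]; rewrite addr_ge0// mulr_ge0].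
exists (16 * K + Q + 1); first by rewrite ltr_wpDl// addr_ge0// mulr_ge0.
move=> I pt rho nb del ptI rho0 sep nbP big fl nfl.
have del0 a : 0 < del a by apply: lt_le_trans (big a); do 2 apply: mulr_gt0 => //.
have ad : adapted pt del.
  split=> // i j ij; rewrite leNgt; apply/negP => lt; apply: (nfl j).
  have dj := del0 j; apply: (flat_half HD (fl i)) => //; linear.
have [A [sepA cov]] := net_exists ad; have [key keyP] := key_exists A ad.
have rd a : rho <= del a by move: (big a) (rho0); linear.
have /boolp.choice[c Hc] : forall k, exists c : I -> plane R, forall F g, sobolev p F g ->
    `|D rho F (pt k) - \sum_i F (pt i) *: c i| <=
      4 * C0 * del k `^ (1 - 2 / p) * energy_norm p g (cbox (pt k) (16 * del k)).
  by move=> k; exact: (keystone_gradient HD ptI rho0 (rd k) (nfl k)).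
have /boolp.choice[h /boolp.choice[hg Hh]] := fl.
pose G (f : I -> R) k := \sum_i f i *: c k i.
pose bl f := blend pt del A key (G f).
have GD a f f' k : G (fun y => a * f y + f' y) k = a *: G f k + G f' k.
  by rewrite /G scaler_sumr -big_split; apply: eq_bigr => i _; rewrite scalerDl scalerA.
have blD a f f' y : bl (fun y => a * f y + f' y) y = a *: bl f y + bl f' y.
  by rewrite /bl /blend scaler_sumr -big_split; apply: eq_bigr => b _; rewrite GD scalerDr !scalerA mulrC.
exists (fun f x => correct (bl f x) (pt (nb x) - pt x) (f (nb x) - f x)); split.
  by move=> a f f' x; rewrite blD -correct_comb; congr correct; ring.
move=> S; have act y : (#|[set a in A | (`|pt y - pt a| <= del a / 8)%R]| <= m0)%N by exact: act0.
(* A radius that accommodates all scales up to S and all [del a], with the margins that the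
   estimates ask for. *)
pose L := 100 * (100 * (100 * `|S|)) + \sum_a 100 * (100 * del a).
have dsum : 0 <= \sum_a 100 * (100 * del a) by apply: sumr_ge0 => a _; have := del0 a; linear.
have delL a : 100 * (100 * del a) <= L.
  have h100 : 0 <= 100 :> R by exact: ler0n.
  have pos b : 0 <= 100 * (100 * del b) by exact: (mulr_ge0 h100 (mulr_ge0 h100 (ltW (del0 b)))).
  apply: (@le_trans _ _ (\sum_b 100 * (100 * del b))).
    by rewrite (bigD1 a)//= lerDl; apply: sumr_ge0 => b _; exact: pos.
  by rewrite /L lerDr; exact: (mulr_ge0 h100 (mulr_ge0 h100 (mulr_ge0 h100 (normr_ge0 S)))).
have SL s : s <= S -> 100 * (100 * (100 * s)) <= L by move=> sS; have := ler_norm S; rewrite /L; linear.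
have S0 := normr_ge0 S.
have [org [n win]] := window_exists pt L rho0; exists org, n; split.
  move=> i z zS; apply: (win i); apply: cbox_sub zS; rewrite subrr normr0 add0r; have := ler_norm S; rewrite /L; linear.
move=> F g sob.
have L0 : 0 <= L by rewrite /L; linear.
have /boolp.choice[i0 /boolp.choice[j0 corner]] : forall a, exists i j : nat, cell org rho i j (pt a).
  move=> a; have [|i [j ij]] := @cell_exists _ org rho n rho0 (pt a); last by exists i, j.
  by apply: (win a); apply/cboxP; rewrite !subrr normr0.
have inside a : (i0 a + side rho del a <= n)%N /\ (j0 a + side rho del a <= n)%N.
  have sl := side_le rho0 ad a; have da := del0 a; have dL := delL a.
  have s0 : 0 <= rho * (side rho del a)%:R by rewrite mulr_ge0// ltW.
  pose w : plane R := ((pt a).1 + rho * (side rho del a)%:R, (pt a).2 + rho * (side rho del a)%:R).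
  have : window org rho n w.
    have sL : rho * (side rho del a)%:R <= L by clear - sl da dL; linear.
    by apply: (win a); apply/cboxP; rewrite /w /= ![_ + _ - _]addrAC !subrr !add0r (ger0_norm s0).
  have /cellP[/andP[u1 _] /andP[u2 _]] := corner a.
  rewrite /window /w /= !in_itv /= => -[/andP[_ v1] /andP[_ v2]].
  have key1 (k : nat) : rho * k%:R + rho * (side rho del a)%:R < rho * n%:R -> (k + side rho del a <= n)%N.
    by rewrite -mulrDr -natrD ltr_pM2l// ltr_nat => /ltnW.
  by split; apply: key1; [clear - u1 v1|clear - u2 v2]; linear.
(* Normalised so that del k^2 nu k^p is the energy around the keystone; by the bounded overlap these
   energies add up to a multiple of the total energy. *)
pose nu k := del k `^ (- (2 / p)) * energy_norm p g (cbox (pt k) (16 * del k)).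
have nu0 k : 0 <= nu k by rewrite mulr_ge0 ?powR_ge0// (energy_norm_ge0 HD).
pose u := umass r pt rho del A i0 j0 nu.
have u0 i j : 0 <= u i j by apply: sumr_ge0 => k _; case: ifP => // _; exact: powR_ge0.
have [m [m_ge0 ctl usum mE]] := Hm org rho n F g setT u rho0 sob measurableT u0.
have {}ctl := controls_le (ltW rho0) CmC m_ge0 ctl.
have keyG k : `|D rho F (pt k) - G (F \o pt) k| <= C * (del k * nu k).
  apply: le_trans (Hc k F g sob) _.
  rewrite (_ : _ * energy_norm _ _ _ = 4 * C0 * (del k * nu k)).
    apply: ler_wpM2r; first by rewrite mulr_ge0// ltW.
    by rewrite /C; linear.
  have e : del k `^ (1 - 2 / p) = del k * del k `^ (- (2 / p)).
    by rewrite powRD ?powRr1 ?(ltW (del0 k))// (gt_eqF (del0 k)) implybT.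
  by rewrite /nu e -!mulrA.
have {}usum i j s : (i < n)%N -> (j < n)%N -> (0 < s)%N ->
    \sum_(k < n | (k <= i + s)%N && (i <= k + s)%N)
      \sum_(l < n | (l <= j + s)%N && (j <= l + s)%N) u k l <= C * s%:R ^+ 2 * m i j `^ r.
  move=> il jl s0; apply: le_trans (usum i j s il jl s0) _; apply: ler_wpM2r; first exact: powR_ge0.
  by apply: ler_wpM2r => //; exact: sqr_ge0.
have z0 (i j : nat) : 0 <= (fun _ _ : nat => 0 : R) i j by [].
have /boolp.choice[mh Hmh] : forall a, exists mh : nat -> nat -> R, [/\ forall i j, 0 <= mh i j,
    controls C D org rho n (h a) (cbox (pt a) (8 * del a)) mh &
    rho ^+ 2 * \sum_(i < n) \sum_(j < n) mh i j `^ p <= C * del a `^ (2 - p)].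
  move=> a; have [sh _ eh] := Hh a.
  have [mh [h0 h1 _ h2]] := Hm org rho n (h a) (hg a) (cbox (pt a) (8 * del a)) _ rho0 sh (measurable_cbox _ _) z0.
  exists mh; split=> //; first exact: (controls_le (ltW rho0) CmC h0 h1).
  apply: (le_trans h2); rewrite [X in _ * (_ + _ * X)]big1 => [|i _]; last first.
    by rewrite big1// => j _; rewrite powR0// gt_eqF// divr_gt0.
  by rewrite mulr0 addr0; apply: ler_pM => //; [exact: ltW|exact: energy_ge0].
have mh0 a i j : 0 <= mh a i j by have [] := Hmh a.
have ctlh a : controls C D org rho n (h a) (cbox (pt a) (8 * del a)) (mh a) by have [] := Hmh a.
have mhE a : rho ^+ 2 * \sum_(i < n) \sum_(j < n) mh a i j `^ p <= C * del a `^ (2 - p) by have [] := Hmh a.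
have hP a i : `|pt i - pt a| <= del a -> h a (pt i) = 0 /\ 1 <= `|D rho (h a) (pt i)| by have [_ + _] := Hh a; exact.
pose w := worst D pt rho del A key F (G (F \o pt)).
have wb a i j : (i < n)%N -> (j < n)%N -> ablock rho del i0 j0 a i j -> w a <= W * (del a * m i j).
  exact: (worst_block r2 C1 rho0 ad cov keyP big win corner inside delL m_ge0 ctl nu0 keyG usum).
have w0 a : 0 <= w a by exact: worst_ge0.
pose X (i j : nat) := \sum_(a in A) (w a * mh a i j) `^ p.
have X0 i j : 0 <= X i j by apply: sumr_ge0 => a _; exact: powR_ge0.
(* The net point a in the gradient bounds varies with y; the l^p sum over the net dominates each of
   its terms, and its own norm is bounded by [worst_mass]. *)
pose M i j := m i j + X i j `^ p^-1.
have M0 i j : 0 <= M i j by rewrite addr_ge0 ?powR_ge0.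
have E0 : 0 <= energy p g setT by exact: energy_ge0.
have r20 : 0 <= rho ^+ 2 by exact: sqr_ge0.
exists M => //; split.
  have h1 : rho ^+ 2 * \sum_(i < n) \sum_(j < n) u i j `^ (p / r) <= C * energy p g setT.
    apply: (umass_mass r0 rp rho0 ad sepA corner inside).
    rewrite (eq_bigr (fun k => energy p g (cbox (pt k) (16 * del k)))) => [|k _]; last first.
      have dk := del0 k; rewrite /nu powRM ?powR_ge0 ?(energy_norm_ge0 HD)// -!powRrM mulVf ?gt_eqF// powRr1 ?energy_ge0//.
      rewrite mulNr mulfVK ?gt_eqF// mulrA -powR_mulrn ?(ltW dk)// -powRD ?(gt_eqF dk) ?implybT//.
      by rewrite subrr powRr0 mul1r.
    apply: le_trans (energy_packing sob (m := m1) _ measurableT _ _) _ => [k|k _|z|].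
    - exact: measurable_cbox.
    - exact: subsetT.
    - apply: leq_trans (ov _ _ pt del A z ad sepA); apply: subset_leq_card; apply/fintype.subsetP => k.
      rewrite !inE => /andP[/andP[-> ->]] /set_mem kz /=.
      by move: kz => /cbox_norm; rewrite distrC.
    exact: (ler_wpM2r E0 m1C).
  have h2 : rho ^+ 2 * \sum_(i < n) \sum_(j < n) m i j `^ p <= C * (1 + C) * energy p g setT.
    apply: (le_trans mE); rewrite -mulrA; apply: ler_pM => //; first exact: ltW.
    - by rewrite addr_ge0// mulr_ge0// sumr_ge0// => i _; rewrite sumr_ge0// => j _; exact: powR_ge0.
    - by rewrite mulrDl mul1r lerD2l.
  have h3 := worst_mass r0 rp Cge0 W0 rho0 ad sepA big corner inside m_ge0 mh0 w0 wb mhE.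
  apply: (@le_trans _ _ (Q * energy p g setT)); last first.
    by apply: ler_wpM2r => //; rewrite addrAC lerDr addr_ge0// mulr_ge0.
  apply: (@le_trans _ _ (2 `^ p * (rho ^+ 2 * \sum_(i < n) \sum_(j < n) m i j `^ p + rho ^+ 2 * \sum_(i < n) \sum_(j < n) X i j))).
    rewrite -mulrDr [leRHS]mulrCA; apply: ler_wpM2l => //; rewrite -big_split mulr_sumr; apply: ler_sum => i _.
    rewrite -big_split mulr_sumr; apply: ler_sum => j _; rewrite /M.
    apply: le_trans (powR_addr_le (ltW p0) (m_ge0 i j) (powR_ge0 _ _)) _.
    by rewrite -powRrM mulVf ?gt_eqF// powRr1.
  rewrite /Q -mulrA; apply: ler_wpM2l; first exact: powR_ge0.
  apply: (@le_trans _ _ ((1 + C * Z) * (rho ^+ 2 * \sum_(i < n) \sum_(j < n) m i j `^ p))).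
    by rewrite mulrDl mul1r lerD2l.
  have cz : 0 <= 1 + C * Z by rewrite addr_ge0// mulr_ge0.
  by rewrite -[leRHS]mulrA; exact: (ler_wpM2l cz h2).
move=> x y i j s xy il jl rs sS zx zy.
have [_ -> H] := gradient_bounds r2 C1 rho0 sep nbP ad cov keyP act big win corner inside delL m_ge0 ctl nu0 keyG usum mh0 ctlh hP.
have {H}[a aA [b1 b2]] := H x y i j s xy il jl rs zx zy (SL s sS).
have s0 : 0 <= s := le_trans (ltW rho0) rs.
have wM : m i j + w a * mh a i j <= M i j.
  rewrite lerD2l -[leLHS]powRr1 ?mulr_ge0// -(mulfV (_ : p != 0)) ?gt_eqF// powRrM.
  apply: ge0_ler_powR; rewrite ?nnegrE ?invr_ge0 ?powR_ge0 ?(ltW p0)//.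
  by rewrite /X (bigD1 a)//= lerDl sumr_ge0// => b _; exact: powR_ge0.
have le1 : 16 * (K * (s * (m i j + w a * mh a i j))) <= (16 * K + Q + 1) * (s * M i j).
  apply: (@le_trans _ _ (16 * K * (s * M i j))).
    by rewrite mulrA; apply: ler_wpM2l; [rewrite mulr_ge0|apply: ler_wpM2l].
  by apply: ler_wpM2r; [rewrite mulr_ge0|rewrite -addrA lerDl addr_ge0].
split; first exact: le_trans b1 le1.
by apply: le_trans b2 _; apply: ler_wpM2r.
Qed.

(** On a line the correction alone suffices: with G = 0 the recovered gradient comes from the
    difference with the nearest neighbour, and a normal of the line plays the part of nx and ny with
    e = 0, so the transversal price vanishes. *)
Lemma collinear_scheme (R : realType) (p r C0 : R) D : slope_op p r C0 D -> exists2 C, 0 < C &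
  forall (I : finType) (pt : I -> plane R) rho nb k, 0 < rho ->
  (forall i j, i != j -> rho <= `|pt i - pt j|) ->
  (forall i, nb i != i /\ forall j, j != i -> `|pt (nb i) - pt i| <= `|pt j - pt i|) ->
  (forall i j, (pt i - pt k).1 * (pt j - pt k).2 = (pt i - pt k).2 * (pt j - pt k).1) ->
  exists gr, gradient_scheme p C pt rho gr.
Proof.
move=> HD; have [C01 /andP[r2 rp] _ _] := HD.
have [C Cgt0 Hm] := maximal_controls HD.
have C0' : 0 <= C by exact: ltW.
have p0 : 0 < p by linear.
have pr0 : p / r != 0 by rewrite gt_eqF// divr_gt0//; linear.
exists (16 * 3 * C + C); first by rewrite addr_gt0// !mulr_gt0.
move=> I pt rho nb k rho0 sep nbP col.
exists (fun f x => correct 0 (pt (nb x) - pt x) (f (nb x) - f x)); split.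
  move=> a f f' x; rewrite -correct_comb scaler0 addr0; congr correct; ring.
move=> S; have [org [n win]] := window_exists pt (24 * `|S|) rho0; exists org, n; split.
  by move=> i z zS; apply: (win i); apply: cbox_sub zS; rewrite subrr normr0 add0r; have := ler_norm S; have := normr_ge0 S; linear.
move=> F g sob.
have [|m [m_ge0 ctl _ mE]] := Hm org rho n F g setT (fun _ _ => 0) rho0 sob measurableT; first by [].
have E0 : 0 <= energy p g setT by exact: energy_ge0.
exists m => //; split.
  apply: (le_trans mE); rewrite [X in _ * (_ + _ * X)]big1 => [|i _]; last first.
    by rewrite big1// => j _; rewrite powR0.
  by rewrite mulr0 addr0; apply: ler_wpM2r => //; rewrite lerDr !mulr_ge0.
move=> x y i j s xy il jl rs sS zx zy.
have s0 : 0 < s by linear.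
have sm0 : 0 <= s * m i j by rewrite mulr_ge0// ltW.
have xy2 : `|pt x - pt y| <= 2 * s.
  rewrite (_ : _ - _ = (node org rho i j - pt y) - (node org rho i j - pt x)); last by apply: plane_eq; rewrite /=; ring.
  by apply: le_trans (ler_normB _ _) _; linear.
have [nx nxm] := nbP x; have [ny nym] := nbP y.
have vs : `|pt (nb x) - pt x| <= 2 * s by apply: le_trans (nxm y _) _; rewrite ?[y == x]eq_sym// distrC.
have us : `|pt (nb y) - pt y| <= 2 * s by apply: le_trans (nym x xy) _.
have z3 l : `|node org rho i j - pt l| <= s -> `|pt (nb l) - pt l| <= 2 * s -> `|pt (nb l) - node org rho i j| <= 3 * s.
  move=> h1 h2; rewrite (_ : _ - _ = (pt (nb l) - pt l) - (node org rho i j - pt l)); last by rewrite opprB addrA subrK.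
  by apply: le_trans (ler_normB _ _) _; linear.
have zx3 : `|pt x - node org rho i j| <= 3 * s by rewrite distrC; linear.
have zy3 : `|pt y - node org rho i j| <= 3 * s by rewrite distrC; linear.
have boxT l : cbox (pt l) (8 * (3 * s)) `<=` window org rho n `&` setT.
  move=> z zl; split=> //; apply: (win l); apply: cbox_sub zl; rewrite subrr normr0 add0r.
  by have := ler_norm S; linear.
have r3 : rho <= 3 * s by linear.
have tF l l' : l != l' -> `|pt l - node org rho i j| <= 3 * s -> `|pt l' - node org rho i j| <= 3 * s ->
    `|F (pt l') - F (pt l) - dot (D rho F (pt l)) (pt l' - pt l)| <= 3 * C * (s * m i j) * `|pt l' - pt l|.
  move=> ll zl zl'; have [h1 _] := ctl i j _ _ _ il jl r3 zl zl' (boxT l).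
  rewrite eq_sym in ll; apply: le_trans (h1 (sep _ _ ll)) _; apply: ler_wpM2r => //.
  by rewrite (_ : C * _ = 3 * C * (s * m i j)); last by ring.
have DF : `|D rho F (pt x) - D rho F (pt y)| <= 3 * C * (s * m i j).
  have [_ h1] := ctl i j _ _ _ il jl r3 zy3 zx3 (boxT y); apply: (le_trans h1).
  by rewrite (_ : C * _ = 3 * C * (s * m i j)); last by ring.
have BB : `|0 - D rho F (pt x) - (0 - D rho F (pt y))| <= 3 * C * (s * m i j).
  by rewrite !sub0r opprK addrC distrC.
have v0 : pt (nb x) - pt x != 0 by rewrite -normr_gt0; apply: lt_le_trans (sep _ _ nx).
have u0 : pt (nb y) - pt y != 0 by rewrite -normr_gt0; apply: lt_le_trans (sep _ _ ny).
have [nk _] := nbP k; set d := pt (nb k) - pt k.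
have d0 : 0 < `|d| by apply: lt_le_trans (sep _ _ nk).
(* A normal of the line, of length 1 in the max norm. *)
pose e : plane R := (- (d.2 / `|d|), d.1 / `|d|).
have e1 : 1 <= `|e|.
  rewrite prod_normE /= normrN !normrM normfV normr_id maxC -maxr_pMl ?invr_ge0//.
  by rewrite (_ : Num.max _ _ = `|d|); [rewrite divff// gt_eqF|rewrite /d prod_normE].
have ed l l' : dot e (pt l - pt l') = 0.
  have h1 := col (nb k) l; have h2 := col (nb k) l'; rewrite -/d in h1 h2.
  have -> : dot e (pt l - pt l') = (d.1 * (pt l - pt k).2 - d.2 * (pt l - pt k).1
      - (d.1 * (pt l' - pt k).2 - d.2 * (pt l' - pt k).1)) / `|d| by rewrite /dot /=; ring.
  by rewrite h1 h2 !subrr mul0r.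
have xn : x != nb x by rewrite eq_sym.
have yn : y != nb y by rewrite eq_sym.
have yx : y != x by rewrite eq_sym.
have [|b1 b2] := @corrected_gradients R 0 0 _ _ _ _ (pt x - pt y) _ _ (F (pt x) - F (pt y)) _ 0 v0 u0 (lexx 0)
  (tF x (nb x) xn zx3 (z3 x zx vs)) (tF y (nb y) yn zy3 (z3 y zy us)) (tF y x yx zy3 zx3) DF BB _.
  by right; exists e, e, 0; rewrite subrr normr0 !ed !mul0r !normr0.
have le1 : 16 * (3 * C * (s * m i j) + 0) <= (16 * 3 * C + C) * (s * m i j).
  rewrite (_ : 16 * _ = 16 * 3 * C * (s * m i j)); last by ring.
  by apply: ler_wpM2r => //; rewrite lerDl.
split; first exact: le_trans b1 le1.
by apply: le_trans b2 _; apply: ler_wpM2r.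
Qed.

Lemma separation_exists (R : realType) (I : finType) (pt : I -> plane R) : injective pt ->
  exists2 e, 0 < e & forall i j, i != j -> e <= `|pt i - pt j|.
Proof.
move=> ptI; exists (\big[Num.min/1]_(x : I * I | x.1 != x.2) `|pt x.1 - pt x.2|).
  apply: lt_bigmin => // -[i j] /= ij; rewrite normr_gt0 subr_eq0.
  by apply: contraNneq ij => /ptI ->.
by move=> i j ij; exact: (bigmin_le_cond _ (fun x : I * I => `|pt x.1 - pt x.2|) (j := (i, j))).
Qed.

Lemma nearest_exists (R : realType) (I : finType) (pt : I -> plane R) : (1 < #|I|)%N -> exists nb : I -> I,
  forall i, nb i != i /\ forall j, j != i -> `|pt (nb i) - pt i| <= `|pt j - pt i|.
Proof.
move=> I1; suff : forall i, exists k, k != i /\ forall j, j != i -> `|pt k - pt i| <= `|pt j - pt i|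
  by move=> /boolp.choice[nb Hnb]; exists nb.
move=> i.
have /card_gt0P[j0 j0i] : (0 < #|predC1 i|)%N by rewrite cardC1; lia.
by case: (arg_minP (fun j => `|pt j - pt i|) j0i) => nb n1 n2; exists nb.
Qed.

(** The exponent r is the midpoint of 2 and p. Either some point is flat at arbitrarily large scales
    and the collinear scheme applies, or at every point flatness fails at some dyadic multiple of
    sep / 2, and [del] is half of the first such scale. *)
Lemma gradient_estimate (R : realType) (p : R) : 2 < p -> exists2 C, 0 < C & forall (I : finType) (pt : I -> plane R),
  injective pt -> (1 < #|I|)%N -> exists2 rho, 0 < rho /\ forall i j, i != j -> 64 * rho <= `|pt i - pt j| &
    exists gr, gradient_scheme p C pt rho gr.
Proof.
move=> p2; have [|C0 [D HD]] := @slope_op_exists R p ((2 + p) / 2); first by apply/andP; split; linear.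
have [C1 C10 H1] := keystone_scheme HD; have [C2 C20 H2] := collinear_scheme HD.
have scheme_le c c' I pt rho gr : c <= c' -> 0 < c -> 0 < rho -> @gradient_scheme R p c I pt rho gr -> gradient_scheme p c' pt rho gr.
  move=> cc c0 rho0 [lin est]; split=> // S; have [org [n [w est']]] := est S; exists org, n; split=> // F g sob.
  have [M M0 [EM HM]] := est' F g sob; exists M => //; split.
    by apply: le_trans EM _; apply: ler_wpM2r => //; exact: energy_ge0.
  move=> x y i j s xy il jl rs sS zx zy; have [b1 b2] := HM x y i j s xy il jl rs sS zx zy.
  have sM : 0 <= s * M i j by rewrite mulr_ge0// (le_trans (ltW rho0)).
  split; [apply: le_trans b1 _|apply: le_trans b2 _; apply: ler_wpM2r => //]; exact: ler_wpM2r.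
exists (C1 + C2); first exact: addr_gt0.
move=> I pt ptI I1; have [sep sep0 Hsep] := separation_exists ptI; have [nb nbP] := nearest_exists pt I1.
(* Chosen so that 256 rho = sep / 2, the initial scale: every point is flat at that scale because no
   other point is that close. *)
set rho := sep / 2 / 16 / 16; have rho0 : 0 < rho by rewrite !divr_gt0.
have rb : 16 * (16 * rho) = sep / 2 by rewrite /rho; linear.
have rsep i j : i != j -> rho <= `|pt i - pt j| by move/Hsep; apply: le_trans; linear.
exists rho.
  by split=> // i j /Hsep; apply: le_trans; linear.
have [[k Hk]|no] := pselect (exists k, forall d, 0 < d -> exists2 e, d <= e & flat p D pt rho (pt k) e).
  have [gr Hgr] := H2 I pt rho nb k rho0 rsep nbP (flat_all_collinear HD rho0 Hk).
  by exists gr; apply: scheme_le Hgr => //; rewrite lerDr ltW.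
suff /boolp.choice[del Hdel] : forall k, exists d, [/\ 16 * (16 * rho) <= d, flat p D pt rho (pt k) d & ~ flat p D pt rho (pt k) (2 * d)].
  have [gr Hgr] : exists gr, gradient_scheme p C1 pt rho gr.
    apply: (H1 I pt rho nb del ptI rho0 rsep nbP) => a; by have [] := Hdel a.
  by exists gr; apply: scheme_le Hgr => //; rewrite lerDl ltW.
move=> k; have s2 : 0 < sep / 2 by rewrite divr_gt0.
have f0 : flat p D pt rho (pt k) (sep / 2 * 2 ^+ 0).
  rewrite expr0 mulr1; apply: (flat_isolated HD) => // i ik; apply/eqP; apply: contraT => n.
  have : sep <= `|pt i - pt k| by apply: Hsep; apply: contraNneq n => ->.
  by move=> h; have := le_trans h ik; rewrite leNgt ltr_pdivrMr//; move: sep0; clear; linear.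
have [d d0 Hd] : exists2 d, 0 < d & forall e, d <= e -> ~ flat p D pt rho (pt k) e.
  apply: contrapT => h; apply: no; exists k => d d0; apply: contrapT => h'; apply: h; exists d => // e de fe.
  by apply: h'; exists e.
have ex : exists l, `[< ~ flat p D pt rho (pt k) (sep / 2 * 2 ^+ l) >].
  exists (Num.bound `|d / (sep / 2)|); apply/asboolP; apply: Hd.
  rewrite mulrC -ler_pdivrMr//; apply: le_trans (ler_norm _) _; apply: ltW; apply: lt_trans (archi_boundP _) _ => //.
  by rewrite -natrX ltr_nat ltn_expl.
case: (ex_minnP ex) => -[|l] /asboolP nf minl; first by [].
exists (sep / 2 * 2 ^+ l); split.
- rewrite rb ler_peMr ?(ltW s2)// exprn_ege1//; linear.
- apply: contrapT => nf'; have := minl l; rewrite ltnn => h; have /h : `[< ~ flat p D pt rho (pt k) (sep / 2 * 2 ^+ l) >] by exact/asboolP.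
  by [].
by rewrite mulrCA -exprS.
Qed.

(** * Second-order jets *)

(** A function bundled with the data of [C2], so that products of cut-offs and polynomials carry
    their derivatives along and are estimated at one point by a single number [jN]. *)
Record jet (R : realType) := Jet { j0 : plane R -> R; j1 : bool -> plane R -> R; j2 : bool -> bool -> plane R -> R }.

Section Jets.
Variable R : realType.
Implicit Types (u v : jet R) (z : plane R).

Definition C2j u := C2 (j0 u) (j1 u) (j2 u).

Definition jcst (c : R) : jet R := Jet (fun=> c) (fun _ _ => 0) (fun _ _ _ => 0).

Definition jaff (c : R) (v : plane R) : jet R :=
  Jet (fun w => c + dot v w) (fun b _ => if b then v.2 else v.1) (fun _ _ _ => 0).

Definition jD u v := Jet (fun w => j0 u w + j0 v w) (fun b w => j1 u b w + j1 v b w)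
  (fun i j w => j2 u i j w + j2 v i j w).

Definition jB u v := Jet (fun w => j0 u w - j0 v w) (fun b w => j1 u b w - j1 v b w)
  (fun i j w => j2 u i j w - j2 v i j w).

Definition jM u v := Jet (fun w => j0 u w * j0 v w) (fun b w => j0 u w * j1 v b w + j0 v w * j1 u b w)
  (fun i j w => (j0 u w * j2 v i j w + j1 v i w * j1 u j w) + (j0 v w * j2 u i j w + j1 u i w * j1 v j w)).

Definition jsum (I : Type) (r : seq I) (u : I -> jet R) := Jet (fun w => \sum_(i <- r) j0 (u i) w)
  (fun b w => \sum_(i <- r) j1 (u i) b w) (fun a b w => \sum_(i <- r) j2 (u i) a b w).

Definition jsingle (b : bool) (f f' f'' : R -> R) : jet R := Jet (fun w => f (coord b w))
  (fun i w => if i == b then f' (coord b w) else 0) (fun i j w => if (i == b) && (j == b) then f'' (coord b w) else 0).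

Lemma jetP u v : (forall w, j0 u w = j0 v w) -> (forall b w, j1 u b w = j1 v b w) ->
  (forall i j w, j2 u i j w = j2 v i j w) -> u = v.
Proof.
case: u v => [a b c] [a' b' c'] /= h0 h1 h2; congr Jet; first exact/funext.
  by apply/funext => i; exact/funext.
by apply/funext => i; apply/funext => j; exact/funext.
Qed.

Lemma C2j_cst c : C2j (jcst c). Proof. exact: C2_cst. Qed.

Lemma C2j_aff c (d : plane R) : C2j (jaff c d). Proof. exact: C2_affine. Qed.

Lemma C2jD u v : C2j u -> C2j v -> C2j (jD u v). Proof. exact: C2D. Qed.

Lemma C2jM u v : C2j u -> C2j v -> C2j (jM u v). Proof. exact: C2M. Qed.

Lemma C2jB u v : C2j u -> C2j v -> C2j (jB u v).
Proof.
move=> hu hv; rewrite (_ : jB u v = jD u (jM (jcst (-1)) v)); first by apply: C2jD => //; apply: C2jM => //; exact: C2j_cst.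
by apply: jetP => *; rewrite /=; ring.
Qed.

Lemma C2j_sum (I : Type) (r : seq I) (u : I -> jet R) : (forall i, C2j (u i)) -> C2j (jsum r u).
Proof. exact: C2_sum. Qed.

Lemma C2j_single b (f f' f'' : R -> R) : (forall x : R, is_derive x 1 f (f' x)) ->
  (forall x : R, is_derive x 1 f' (f'' x)) -> continuous f'' -> C2j (jsingle b f f' f'').
Proof.
move=> h1 h2 c2; have cd (g g' : R -> R) : (forall x : R, is_derive x 1 g (g' x)) -> continuous g.
  move=> h x; apply: differentiable_continuous; apply/derivable1_diffP.
  exact: (@ex_derive _ _ _ _ _ _ _ (h x)).
have cc (g : R -> R) : continuous g -> continuous (fun w : plane R => g (coord b w)).
  move=> cg w; apply: (@continuous_comp _ _ _ (coord b) g); last exact: cg.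
  by case: b; [exact: cvg_snd|exact: cvg_fst].
have c0 : continuous (fun _ : plane R => 0 : R) by exact: cst_continuous.
have dl (g g' : R -> R) i (w : plane R) : (forall x : R, is_derive x 1 g (g' x)) ->
    is_derive (coord i w) 1 (fun t : R => g (coord b (line i w t))) (if i == b then g' (coord b w) else 0).
  move=> h; clear cc; case: b i => [] [] /=; rewrite /coord /line /=; [exact: h|exact: is_derive_cst|exact: is_derive_cst|exact: h].
split.
- by apply: cc; exact: cd h1.
- by move=> i; rewrite /=; case: (i == b) => //; apply: cc; exact: cd h2.
- by move=> i j; rewrite /=; case: (_ && _) => //; exact: cc.
- by move=> i w; exact: dl.
- move=> i j w; rewrite /=; case: (i == b) => /=; first exact: dl.
  exact: is_derive_cst.
Qed.

(* The weights [1], [s], [s ^+ 2 / 2] make this norm submultiplicative. *)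
Definition jN (s : R) z u := `|j0 u z| + s * (`|j1 u false z| + `|j1 u true z|) +
  s ^+ 2 / 2 * (`|j2 u false false z| + `|j2 u false true z| + `|j2 u true false z| + `|j2 u true true z|).

Lemma jN_ge0 s z u : 0 <= s -> 0 <= jN s z u.
Proof. by move=> s0; rewrite /jN !addr_ge0// mulr_ge0 ?addr_ge0// divr_ge0// sqr_ge0. Qed.

Lemma jND s z u v : 0 <= s -> jN s z (jD u v) <= jN s z u + jN s z v.
Proof.
move=> s0; rewrite /jN /=; have s2 : 0 <= s ^+ 2 / 2 by rewrite divr_ge0// sqr_ge0.
have a1 := ler_normD (j1 u false z) (j1 v false z); have a2 := ler_normD (j1 u true z) (j1 v true z).
have b1 := ler_normD (j2 u false false z) (j2 v false false z); have b2 := ler_normD (j2 u false true z) (j2 v false true z).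
have b3 := ler_normD (j2 u true false z) (j2 v true false z); have b4 := ler_normD (j2 u true true z) (j2 v true true z).
rewrite [leRHS]addrACA; apply: lerD; last by rewrite -mulrDr; apply: ler_wpM2l => //; lra.
rewrite [leRHS]addrACA; apply: lerD; first exact: ler_normD.
by rewrite -mulrDr; apply: ler_wpM2l => //; lra.
Qed.

Lemma jN_sum s z (I : Type) (r : seq I) (u : I -> jet R) : 0 <= s -> jN s z (jsum r u) <= \sum_(i <- r) jN s z (u i).
Proof.
move=> s0; elim: r => [|i r IH].
  by rewrite /jN /= !big_nil !normr0 !addr0 !mulr0 addr0.
rewrite big_cons; apply: le_trans (lerD (lexx _) IH); rewrite (_ : jsum _ _ = jD (u i) (jsum r u)); first exact: jND.
by apply: jetP => *; rewrite /= big_cons.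
Qed.

(** By Leibniz' rule the products of first derivatives occur twice, which the weight [s ^+ 2 / 2]
    compensates; the remaining terms of the product on the right are nonnegative. *)
Lemma jNM s z u v : 0 <= s -> jN s z (jM u v) <= jN s z u * jN s z v.
Proof.
move=> s0; rewrite /jN /=.
have tri (a b c d e f g h : R) : `|(a * b + c * d) + (e * f + g * h)| <= `|a| * `|b| + `|c| * `|d| + (`|e| * `|f| + `|g| * `|h|).
  by apply: le_trans (ler_normD _ _) _; apply: lerD; apply: le_trans (ler_normD _ _) _; rewrite !normrM.
have tri2 (a b c d : R) : `|a * b + c * d| <= `|a| * `|b| + `|c| * `|d|.
  by apply: le_trans (ler_normD _ _) _; rewrite !normrM.
apply: (@le_trans _ _ (`|j0 u z| * `|j0 v z| +
  s * ((`|j0 u z| * `|j1 v false z| + `|j0 v z| * `|j1 u false z|) + (`|j0 u z| * `|j1 v true z| + `|j0 v z| * `|j1 u true z|)) +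
  s ^+ 2 / 2 * (
   (`|j0 u z| * `|j2 v false false z| + `|j1 v false z| * `|j1 u false z| + (`|j0 v z| * `|j2 u false false z| + `|j1 u false z| * `|j1 v false z|)) +
   (`|j0 u z| * `|j2 v false true z| + `|j1 v false z| * `|j1 u true z| + (`|j0 v z| * `|j2 u false true z| + `|j1 u false z| * `|j1 v true z|)) +
   (`|j0 u z| * `|j2 v true false z| + `|j1 v true z| * `|j1 u false z| + (`|j0 v z| * `|j2 u true false z| + `|j1 u true z| * `|j1 v false z|)) +
   (`|j0 u z| * `|j2 v true true z| + `|j1 v true z| * `|j1 u true z| + (`|j0 v z| * `|j2 u true true z| + `|j1 u true z| * `|j1 v true z|))))).
  apply: lerD; last by apply: ler_wpM2l; [rewrite divr_ge0// sqr_ge0|do 3 apply: lerD => //; exact: tri].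
  apply: lerD; first by rewrite normrM.
  by apply: ler_wpM2l => //; apply: lerD; exact: tri2.
set S1 := `|j1 u false z| + `|j1 u true z|; set T1 := `|j1 v false z| + `|j1 v true z|.
set S2 := `|j2 u false false z| + _ + _ + _; set T2 := `|j2 v false false z| + _ + _ + _.
rewrite (_ : (_ + _) * (_ + _) = `|j0 u z| * `|j0 v z| + s * (`|j0 u z| * T1 + `|j0 v z| * S1) +
  s ^+ 2 / 2 * (`|j0 u z| * T2 + `|j0 v z| * S2 + 2 * (S1 * T1)) +
  (s ^+ 2 / 2 * S2 * (s * T1 + s ^+ 2 / 2 * T2) + s * S1 * (s ^+ 2 / 2 * T2))); last by field.
rewrite -[leLHS]addr0; apply: lerD.
  by rewrite le_eqVlt; apply/orP; left; apply/eqP; rewrite /S1 /T1 /S2 /T2; field.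
have s2 : 0 <= s ^+ 2 / 2 by rewrite divr_ge0// sqr_ge0.
have [p1 p2 p3 p4] : [/\ 0 <= S1, 0 <= T1, 0 <= S2 & 0 <= T2] by split; rewrite !addr_ge0.
by apply: addr_ge0; apply: mulr_ge0; rewrite ?addr_ge0 ?mulr_ge0.
Qed.

Lemma jM_sumB (I : Type) (r : seq I) (e u : I -> jet R) v :
  jsum r (fun i => jM (e i) (jB (u i) v)) = jB (jsum r (fun i => jM (e i) (u i))) (jM (jsum r e) v).
Proof.
elim: r => [|i r IH].
  by apply: jetP => *; rewrite /= !big_nil; ring.
rewrite (_ : jsum (i :: r) _ = jD (jM (e i) (jB (u i) v)) (jsum r (fun i => jM (e i) (jB (u i) v)))); last first.
  by apply: jetP => *; rewrite /= big_cons.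
by rewrite IH; apply: jetP => *; rewrite /= !big_cons; ring.
Qed.

(** Where the cut-offs e do not add up to 1, the rest of the weight goes to w. The blend is an
    affine combination, hence commutes with the subtraction of a fixed jet. *)
Definition blend_jet (I : Type) (r : seq I) (e u : I -> jet R) w :=
  jD (jM (jB (jcst 1) (jsum r e)) w) (jsum r (fun i => jM (e i) (u i))).

Lemma blend_jetB (I : Type) (r : seq I) (e u : I -> jet R) w v :
  jB (blend_jet r e u w) v = blend_jet r e (fun i => jB (u i) v) (jB w v).
Proof. by rewrite /blend_jet jM_sumB; apply: jetP => *; rewrite /=; ring. Qed.

Lemma C2j_blend (I : Type) (r : seq I) (e u : I -> jet R) w : (forall i, C2j (e i)) -> (forall i, C2j (u i)) -> C2j w ->
  C2j (blend_jet r e u w).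
Proof.
move=> he hu hw; apply: C2jD; first by apply: C2jM => //; apply: C2jB; [exact: C2j_cst|exact: C2j_sum].
by apply: C2j_sum => i; exact: C2jM.
Qed.

Lemma blend_jet_le s z (I : eqType) (r : seq I) (e u : I -> jet R) w B : 0 <= s -> 0 <= B ->
  (forall i, i \in r -> jN s z (e i) != 0 -> jN s z (u i) <= B) ->
  jN s z (blend_jet r e u w) <= jN s z (jB (jcst 1) (jsum r e)) * jN s z w + (\sum_(i <- r) jN s z (e i)) * B.
Proof.
move=> s0 B0 h; apply: le_trans (jND _ _ _ s0) _; apply: lerD; first exact: jNM.
apply: le_trans (jN_sum _ _ _ s0) _; rewrite mulr_suml big_seq [leRHS]big_seq; apply: ler_sum => i ir.
apply: le_trans (jNM _ _ _ s0) _; have [->|e0] := eqVneq (jN s z (e i)) 0; first by rewrite !mul0r.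
by apply: ler_wpM2l; [exact: jN_ge0|exact: h].
Qed.

Lemma jN_one_sub s z (I : Type) (r : seq I) (e : I -> jet R) : 0 <= s ->
  jN s z (jB (jcst 1) (jsum r e)) <= 1 + \sum_(i <- r) jN s z (e i).
Proof.
move=> s0; rewrite (_ : jB _ _ = jD (jcst 1) (jM (jcst (-1)) (jsum r e))); last by apply: jetP => *; rewrite /=; ring.
apply: le_trans (jND _ _ _ s0) _; apply: lerD.
  by rewrite /jN /= normr1 !normr0 !addr0 !mulr0 !addr0.
apply: le_trans (jNM _ _ _ s0) _; rewrite [jN s z (jcst _)](_ : _ = 1); first by rewrite mul1r; exact: jN_sum.
by rewrite /jN /= normrN1 !normr0 !addr0 !mulr0 !addr0.
Qed.

Section Tower.
Variables (I : eqType) (r : nat -> seq I) (e u : nat -> I -> jet R) (w0 : jet R).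

(** The lowest level is the finest and is applied last; each level overrides the coarser ones where
    its weights add up to 1. *)
Definition tower J k := foldr (fun k w => blend_jet (r k) (e k) (u k) w) w0 (iota k (J - k)).

Lemma tower_top J : tower J J = w0. Proof. by rewrite /tower subnn. Qed.

Lemma tower_step J k : (k < J)%N -> tower J k = blend_jet (r k) (e k) (u k) (tower J k.+1).
Proof. by move=> kJ; rewrite /tower -[(J - k)%N](@ltn_predK 0) ?subn_gt0//= -subnS. Qed.

Lemma C2j_tower J k : (forall k i, C2j (e k i)) -> (forall k i, C2j (u k i)) -> C2j w0 -> C2j (tower J k).
Proof. by move=> he hu hw; rewrite /tower; elim: iota => //= l ls IH; exact: C2j_blend. Qed.

(** At the level l of the point the weights add up to 1, so the coarser levels drop out, and the
    levels k with k + 4 < l are inactive. At most five levels remain, and each finer one multiplies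
    the norm plus B by at most 1 + C. *)
Lemma tower_bound J l s z v B C : 0 <= s -> 0 <= B -> 0 <= C -> (l <= J)%N ->
  (forall k i, (k <= l)%N -> (k < J)%N -> i \in r k -> jN s z (e k i) != 0 -> jN s z (jB (u k i) v) <= B) ->
  ((l < J)%N -> jN s z (jB (jcst 1) (jsum (r l) (e l))) = 0) -> (l = J -> jN s z (jB w0 v) <= B) ->
  (forall k, (k <= l)%N -> (k < J)%N -> \sum_(i <- r k) jN s z (e k i) <= C) ->
  (forall k, (k + 4 < l)%N -> \sum_(i <- r k) jN s z (e k i) = 0) ->
  jN s z (jB (tower J 0) v) <= 2 * (1 + C) ^+ 5 * B.
Proof.
move=> s0 B0 C0 lJ hB one top hC far.
suff H d : (d <= l)%N -> jN s z (jB (tower J (l - d)) v) + B <= (1 + C) ^+ minn d 4 * (2 * (1 + C) * B).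
  have := H l (leqnn l); rewrite subnn => h.
  apply: (@le_trans _ _ ((1 + C) ^+ minn l 4 * (2 * (1 + C) * B))); first by apply: le_trans h; rewrite lerDl.
  rewrite (_ : 2 * (1 + C) ^+ 5 * B = (1 + C) ^+ 4 * (2 * (1 + C) * B)); last by rewrite exprS; ring.
  by apply: ler_wpM2r; [rewrite !mulr_ge0// addr_ge0|apply: ler_weXn2l; rewrite ?geq_minr// lerDl].
elim: d => [_|d IH dl].
  rewrite subn0 min0n expr0 mul1r; move: lJ; rewrite leq_eqVlt => /orP[/eqP lJ|lJ].
    have := top lJ; rewrite lJ tower_top => h.
    have : 0 <= C * B by exact: mulr_ge0.
    by move: h; clear; lra.
  rewrite (tower_step lJ) blend_jetB.
  have h := @blend_jet_le s z _ (r l) (e l) (fun i => jB (u l i) v) (jB (tower J l.+1) v) B s0 B0 (fun i => hB l i (leqnn l) lJ).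
  have : \sum_(i <- r l) jN s z (e l i) * B <= C * B by rewrite -mulr_suml; apply: ler_wpM2r => //; exact: hC.
  have : 0 <= C * B by exact: mulr_ge0.
  by move: h; rewrite one// mul0r add0r mulr_suml; lra.
have kl : (l - d.+1 < l)%N by lia.
have kJ : (l - d.+1 < J)%N by lia.
have ek : (l - d.+1).+1 = (l - d)%N by lia.
set k := (l - d.+1)%N in kl kJ ek *; set a := \sum_(i <- r k) jN s z (e k i).
have a0 : 0 <= a by apply: sumr_ge0 => i _; exact: jN_ge0.
have step : jN s z (jB (tower J k) v) + B <= (1 + a) * (jN s z (jB (tower J (l - d)) v) + B).
  rewrite (tower_step kJ) blend_jetB ek.
  have h := @blend_jet_le s z _ (r k) (e k) (fun i => jB (u k i) v) (jB (tower J (l - d)) v) B s0 B0 (fun i => hB k i (ltnW kl) kJ).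
  have h1 : jN s z (jB (jcst 1) (jsum (r k) (e k))) <= 1 + a by exact: jN_one_sub.
  have h2 := ler_wpM2r (jN_ge0 z (jB (tower J (l - d)) v) s0) h1.
  by move: h h2; rewrite -/a; set x := jN _ _ (blend_jet _ _ _ _); set y := jN _ _ _ * _; lra.
have IHd := IH (ltnW dl).
apply: (le_trans step); have [d4|d4] := ltnP d 4.
  have m1 : minn d.+1 4 = (minn d 4).+1 by move: d4; clear; rewrite /minn; do 2 case: ifP; lia.
  have aC : 1 + a <= 1 + C by rewrite lerD2l; exact: (hC k (ltnW kl) kJ).
  rewrite m1 exprS -[leRHS]mulrA; apply: (ler_pM _ _ aC IHd); first by rewrite addr_ge0.
  by rewrite addr_ge0// jN_ge0.
rewrite /a (far k) ?addr0 ?mul1r; last by rewrite /k; lia.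
by rewrite (_ : minn d.+1 4 = minn d 4)//; move: d4; clear; rewrite /minn; do 2 case: ifP; lia.
Qed.
End Tower.

End Jets.

(** * Partitions of unity on grids *)

Lemma partition_profile (R : realType) : exists (K : R) (e e' e'' : R -> R), 0 < K /\
  [/\ forall x : R, is_derive x 1 e (e' x), forall x : R, is_derive x 1 e' (e'' x), continuous e'',
    forall x, [/\ `|e x| <= K, `|e' x| <= K & `|e'' x| <= K] &
    (forall x, x < -1 \/ 2 < x -> [/\ e x = 0, e' x = 0 & e'' x = 0]) /\
    forall n u, 1 < u -> u + 1 < n%:R -> [/\ \sum_(a < n) e (u - a%:R) = 1, \sum_(a < n) e' (u - a%:R) = 0 &
      \sum_(a < n) e'' (u - a%:R) = 0]].
Proof.
have [s [sm s0 s1]] := smooth_step R.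
have [d1 sm1] := smooth_derive sm; have [d2 sm2] := smooth_derive sm1.
set s' := derive1 s in d1 sm1 d2 sm2; set s'' := derive1 s' in d2 sm2.
have loc0 (f f' : R -> R) (c x : R) (A : set R) : open A -> A x -> (forall y, A y -> f y = c) ->
    (forall y : R, is_derive y 1 f (f' y)) -> f' x = 0.
  move=> oA Ax fA df; have h1 := df x.
  have h2 : is_derive x 1 f 0.
    apply: (@near_eq_is_derive _ _ _ (fun=> c)).
    have nA : \forall y \near x, A y by exact: open_nbhs_nbhs.
    by near=> y; rewrite fA//; near: y.
  by rewrite -(@derive_val _ _ _ _ _ _ _ h1) (@derive_val _ _ _ _ _ _ _ h2).
have z1 x : x < -1 \/ 1 < x -> s' x = 0.
  case=> h.
    apply: (loc0 s s' 0 x [set y | y < -1] (@open_lt _ _) h _ d1).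
    by move=> y /ltW; exact: s0.
  apply: (loc0 s s' 1 x [set y | 1 < y] (@open_gt _ _) h _ d1).
  by move=> y /ltW; exact: s1.
have z2 x : x < -1 \/ 1 < x -> s'' x = 0.
  case=> h.
    apply: (loc0 s' s'' 0 x [set y | y < -1] (@open_lt _ _) h _ d2).
    by move=> y h'; apply: z1; left.
  apply: (loc0 s' s'' 0 x [set y | 1 < y] (@open_gt _ _) h _ d2).
  by move=> y h'; apply: z1; right.
have sh (f f' : R -> R) : (forall x : R, is_derive x 1 f (f' x)) ->
    forall x : R, is_derive x 1 (fun y => f y - f (y - 1)) (f' x - f' (x - 1)).
  move=> df x; apply: is_deriveB => //.
  have h := @is_derive1_comp _ f (fun y : R => 1 * y + (- 1)) x _ _ (df _) (is_derive_affine 1 (-1) x).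
  rewrite mulr1 in h; rewrite mul1r in h.
  by rewrite (_ : (fun y : R => f (y - 1)) = f \o (fun y : R => 1 * y + (- 1)))//; apply/funext => y; rewrite /= mul1r.
(* The integer translates of this difference telescope: their sum over a < n is s(u) - s(u - n),
   which is 1 for u in the range considered. *)
pose e x := s x - s (x - 1); pose e' x := s' x - s' (x - 1); pose e'' x := s'' x - s'' (x - 1).
have h0 := sh _ _ d1; have h1 := sh _ _ d2.
have zero x : x < -1 \/ 2 < x -> [/\ e x = 0, e' x = 0 & e'' x = 0].
  case=> h; rewrite /e /e' /e''.
    by rewrite !s0 ?z1 ?z2 ?subrr//; first [left; linear|linear].
  by rewrite !s1 ?z1 ?z2 ?subrr//; first [right; linear|linear].
have cont (f f' : R -> R) : (forall x : R, is_derive x 1 f (f' x)) -> continuous f.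
  by move=> h x; apply: differentiable_continuous; apply/derivable1_diffP; exact: (@ex_derive _ _ _ _ _ _ _ (h x)).
have cs2 := smooth_cont sm2.
have c2 : continuous e''.
  move=> x; apply: continuousB; first exact: cs2.
  apply: (@continuous_comp _ _ _ (fun y : R => y - 1) s''); last exact: cs2.
  by apply: continuousB; [exact: cvg_id|exact: cst_continuous].
have bnd (f : R -> R) : continuous f -> (forall x, x < -1 \/ 2 < x -> f x = 0) -> exists2 M, 0 < M & forall x, `|f x| <= M.
  move=> cf f0; apply: (cont_supp_bounded (L := 2)) => // x x2; apply: f0; move: x2.
  by rewrite ltr_normr => /orP[]; [right|left; linear].
have [|K0 K00 HK0] := bnd e (cont _ _ h0); first by move=> x /zero[].
have [|K1 K10 HK1] := bnd e' (cont _ _ h1); first by move=> x /zero[].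
have [|K2 K20 HK2] := bnd e'' c2; first by move=> x /zero[].
exists (K0 + K1 + K2), e, e', e''; split; first by rewrite !addr_gt0.
split=> //.
  move=> x; move: (HK0 x) (HK1 x) (HK2 x); split; linear.
split=> // n u u1 un.
have tel (f : R -> R) : \sum_(a < n) (f (u - a%:R) - f (u - a%:R - 1)) = f u - f (u - n%:R).
  have := telescope_sumr (fun k => f (u - k%:R)) (leq0n n); rewrite /= subr0 big_mkord => h; rewrite -opprB -h -sumrN.
  by apply: eq_bigr => a _; rewrite opprB -natr1 opprD addrA.
rewrite /e /e' /e'' !tel; split.
- by rewrite s1 ?s0 ?subr0//; linear.
- by rewrite !z1 ?subrr//; [left; linear|right; linear].
- by rewrite !z2 ?subrr//; [left; linear|right; linear].
Unshelve. all: by end_near.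
Qed.

Lemma jN_eq0 (R : realType) s z (u : jet R) : 0 < s -> jN s z u = 0 ->
  [/\ j0 u z = 0, forall b, j1 u b z = 0 & forall i j, j2 u i j z = 0].
Proof.
move=> s0 /eqP; have s1 := ltW s0; have s2 : 0 < s ^+ 2 / 2 by rewrite divr_gt0// exprn_gt0.
rewrite /jN paddr_eq0; [|by rewrite addr_ge0// mulr_ge0// addr_ge0|by rewrite mulr_ge0 ?addr_ge0// ltW].
rewrite paddr_eq0//; last by rewrite mulr_ge0// addr_ge0.
rewrite normr_eq0 (mulf_eq0 s) (gt_eqF s0) (mulf_eq0 (s ^+ 2 / 2)) (gt_eqF s2) /= !paddr_eq0 ?addr_ge0// !normr_eq0.
move=> /andP[/andP[/eqP h0 /andP[/eqP a1 /eqP a2]] /andP[/andP[/andP[/eqP b1 /eqP b2] /eqP b3] /eqP b4]].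
by split=> //; [case|case; case].
Qed.

Lemma jN_single (R : realType) s z b (f f' f'' : R -> R) :
  jN s z (jsingle b f f' f'') = `|f (coord b z)| + s * `|f' (coord b z)| + s ^+ 2 / 2 * `|f'' (coord b z)|.
Proof. by rewrite /jN /jsingle; case: b => /=; rewrite !normr0 ?add0r ?addr0. Qed.

Lemma jN_unit (R : realType) s z (I : Type) (r : seq I) (u : I -> jet R) : \sum_(i <- r) j0 (u i) z = 1 ->
  (forall b, \sum_(i <- r) j1 (u i) b z = 0) -> (forall a b, \sum_(i <- r) j2 (u i) a b z = 0) ->
  jN s z (jB (jcst 1) (jsum r u)) = 0.
Proof. by move=> E0 E1 E2; rewrite /jN /= E0 !E1 !E2 !subrr !normr0 !addr0 !mulr0 !addr0. Qed.

Lemma axis_points (R : realType) n (u : R) (m : nat) : (#|[pred a : 'I_n | (`|u - a%:R| <= m%:R)%R]| <= (m + m).+1)%N.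
Proof.
pose S : pred 'I_n := [pred a : 'I_n | (`|u - a%:R| <= m%:R)%R]; change (#|S| <= (m + m).+1)%N.
have [a0 a0S|S0] := pickP S; last by rewrite eq_card0.
case: (arg_minnP (fun a : 'I_n => a : nat) a0S) => k kS mink.
have us : uniq [seq val a | a <- enum S] by rewrite map_inj_uniq ?enum_uniq//; exact: val_inj.
rewrite cardE -(size_map val) -[X in (_ <= X)%N](size_iota k); apply: uniq_leq_size => // _ /mapP[a + ->].
rewrite mem_enum => aS; rewrite mem_iota (mink a aS) /=.
have := kS; have := aS; rewrite unfold_in /S /= !ler_norml => /andP[a1 a2] /andP[m1 m2].
have : a%:R <= k%:R + (m%:R + m%:R) :> R by linear.
by rewrite -!natrD ler_nat; lia.
Qed.

Section Grid.
Variables (R : realType) (K : R) (e e' e'' : R -> R).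
Hypothesis de : forall x : R, is_derive x 1 e (e' x).
Hypothesis de' : forall x : R, is_derive x 1 e' (e'' x).
Hypothesis ce : continuous e''.
Hypothesis eK : forall x, [/\ `|e x| <= K, `|e' x| <= K & `|e'' x| <= K].
Hypothesis e0 : forall x, x < -1 \/ 2 < x -> [/\ e x = 0, e' x = 0 & e'' x = 0].
Hypothesis e1 : forall n u, 1 < u -> u + 1 < n%:R -> [/\ \sum_(a < n) e (u - a%:R) = 1,
  \sum_(a < n) e' (u - a%:R) = 0 & \sum_(a < n) e'' (u - a%:R) = 0].

Let K0 : 0 <= K. Proof. by have [h _ _] := eK 0; exact: le_trans h. Qed.

Definition axis_jet (O : plane R) t b (a : nat) := jsingle b (fun x => e ((x - coord b O) / t - a%:R))
  (fun x => t^-1 * e' ((x - coord b O) / t - a%:R)) (fun x => t^-1 ^+ 2 * e'' ((x - coord b O) / t - a%:R)).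

Definition grid_jet O t (i j : nat) := jM (axis_jet O t false i) (axis_jet O t true j).

Lemma C2j_grid O t i j : C2j (grid_jet O t i j).
Proof.
apply: C2jM.
all: apply: C2j_single.
all: have D (f f' : R -> R) o a (x : R) : (forall x : R, is_derive x 1 f (f' x)) ->
    is_derive x 1 (fun x => f ((x - o) / t - a)) (t^-1 * f' ((x - o) / t - a)).
all: try (by move=> df; have h := @is_derive1_comp _ f (fun y : R => t^-1 * y + (- o / t - a)) x _ _ (df _) (is_derive_affine t^-1 (- o / t - a) x);
   rewrite (_ : (x - o) / t - a = t^-1 * x + (- o / t - a)); [|by ring]; rewrite mulrC;
   rewrite (_ : (fun x : R => f ((x - o) / t - a)) = f \o (fun y : R => t^-1 * y + (- o / t - a)))//;
   apply/funext => y /=; congr f; ring).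
all: try (by move=> x; exact: D).
all: try (by move=> x; rewrite expr2 -mulrA; apply: (@is_deriveZ _ _ _ _ t^-1); exact: D).
all: have cM (u v : R -> R) : continuous u -> continuous v -> continuous (fun x => u x * v x) by
  move=> cu cv x; apply: continuousM; [exact: cu|exact: cv].
all: have cB (u v : R -> R) : continuous u -> continuous v -> continuous (fun x => u x - v x) by
  move=> cu cv x; apply: continuousB; [exact: cu|exact: cv].
all: have cc (c : R) : continuous (fun _ : R => c) by exact: cst_continuous.
all: have cf o a : continuous (fun x : R => (x - o) / t - a) by
  apply: (cB _ _ _ (cc _)); apply: (cM _ _ _ (cc _)); apply: (cB _ _ _ (cc _)) => y; exact: cvg_id.
all: have cC o a : continuous (fun x : R => e'' ((x - o) / t - a)) by
  move=> x; apply: (@continuous_comp _ _ _ (fun x : R => (x - o) / t - a) e''); [exact: cf|exact: ce].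
all: exact: (cM _ _ (cc _) (cC _ _)).
Qed.

(** Levels up to four below that of the point are measured at its scale, hence s up to 16t; the sum
    1 + 16 + 128 is below 256. *)
Lemma axis_jet_le s t O z b a : 0 < t -> 0 <= s -> s <= 16 * t -> jN s z (axis_jet O t b a) <= 16 * (16 * K).
Proof.
move=> t0 s0 st; rewrite jN_single; have [h0 h1 h2] := eK ((coord b z - coord b O) / t - a%:R).
set x := _ - a%:R in h0 h1 h2 *; rewrite (normrM t^-1) (normrM (t^-1 ^+ 2)) normrX (gtr0_norm (_ : 0 < t^-1)) ?invr_gt0//.
have st' : s * t^-1 <= 16 by rewrite ler_pdivrMr.
have st0 : 0 <= s * t^-1 by rewrite mulr_ge0// invr_ge0 ltW.
rewrite mulrA (_ : s ^+ 2 / 2 * _ = (s * t^-1) ^+ 2 / 2 * `|e'' x|); last by ring.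
have q : (s * t^-1) ^+ 2 <= 16 * 16 by rewrite expr2; apply: ler_pM.
have m1 : s * t^-1 * `|e' x| <= 16 * K by apply: ler_pM.
have m2 : (s * t^-1) ^+ 2 / 2 * `|e'' x| <= 128 * K by apply: ler_pM => //; [rewrite divr_ge0// sqr_ge0|lra].
move: (K0); lra.
Qed.

Lemma axis_jet_supp s t O z b a : jN s z (axis_jet O t b a) != 0 -> 0 < t ->
  `|(coord b z - coord b O) / t - a%:R| <= 2 /\ -1 <= (coord b z - coord b O) / t - a%:R <= 2.
Proof.
move=> h t0; set x := _ - _; suff hx : -1 <= x <= 2 by split=> //; move: hx => /andP[h1 h2]; rewrite ler_norml; apply/andP; split; lra.
apply: contraNT h; rewrite negb_and -!ltNge => /orP h; have [z0 z1 z2] := e0 h.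
by rewrite jN_single -/x z0 z1 z2 !mulr0 !normr0 !mulr0 !addr0.
Qed.

Lemma axis_sum_le s t O z b n : 0 < t -> 0 <= s -> s <= 16 * t ->
  \sum_(a < n) jN s z (axis_jet O t b a) <= 5 * (16 * (16 * K)).
Proof.
move=> t0 s0 st; pose S : pred 'I_n := [pred a : 'I_n | (`|(coord b z - coord b O) / t - a%:R| <= 2)%R].
rewrite (bigID (mem S))/= [X in _ + X]big1 ?addr0; last first.
  move=> a; apply: contraNeq => h; rewrite inE; exact: (axis_jet_supp h t0).1.
apply: (@le_trans _ _ (\sum_(a in S) 16 * (16 * K))); first by apply: ler_sum => a _; exact: axis_jet_le.
rewrite sumr_const -[leLHS]mulr_natl; apply: ler_wpM2r; first by rewrite !mulr_ge0.
by rewrite (ler_nat _ _ 5); exact: (axis_points _ _ 2).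
Qed.

Lemma grid_sum_le s t O z n : 0 < t -> 0 <= s -> s <= 16 * t ->
  \sum_(i : 'I_n * 'I_n) jN s z (grid_jet O t i.1 i.2) <= (5 * (16 * (16 * K))) ^+ 2.
Proof.
move=> t0 s0 st; apply: (@le_trans _ _ (\sum_(i : 'I_n * 'I_n) jN s z (axis_jet O t false i.1) * jN s z (axis_jet O t true i.2))).
  by apply: ler_sum => i _; exact: jNM.
rewrite -(pair_bigA _ (fun i j : 'I_n => jN s z (axis_jet O t false i) * jN s z (axis_jet O t true j)))/= -big_distrlr /= expr2.
by apply: ler_pM; rewrite ?axis_sum_le// sumr_ge0// => a _; exact: jN_ge0.
Qed.

Lemma grid_supp s t O z i j : 0 <= s -> 0 < t -> jN s z (grid_jet O t i j) != 0 -> `|z - node O t i j| <= 2 * t.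
Proof.
move=> s0 t0 h; have h' : 0 < jN s z (axis_jet O t false i) * jN s z (axis_jet O t true j).
  by apply: lt_le_trans (jNM _ _ _ s0); rewrite lt_neqAle eq_sym h jN_ge0.
have [f1 f2] : jN s z (axis_jet O t false i) != 0 /\ jN s z (axis_jet O t true j) != 0.
  by split; apply: contraTneq h' => ->; rewrite ?mul0r ?mulr0 ltxx.
have [g1 _] := axis_jet_supp f1 t0; have [g2 _] := axis_jet_supp f2 t0.
have k (x o : R) (m : nat) : `|(x - o) / t - m%:R| <= 2 -> `|x - (o + t * m%:R)| <= 2 * t.
  move=> hx; rewrite (_ : x - _ = ((x - o) / t - m%:R) * t); last by field; rewrite gt_eqF.
  by rewrite normrM (gtr0_norm t0); apply: ler_wpM2r => //; exact: ltW.
by rewrite prod_normE /= ge_max !k.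
Qed.

(** The selected indices may replace the full grid because the others vanish to second order at z.
    The conditions on z keep it away from the border of the grid, where translates are missing. *)
Lemma grid_unit s t (O z : plane R) n (P : pred ('I_n * 'I_n)) : 0 < s -> 0 < t ->
  (forall b, 1 < (coord b z - coord b O) / t /\ (coord b z - coord b O) / t + 1 < n%:R) ->
  (forall i : 'I_n * 'I_n, jN s z (grid_jet O t i.1 i.2) != 0 -> P i) ->
  jN s z (jB (jcst 1) (jsum [seq i <- index_enum _ | P i] (fun i : 'I_n * 'I_n => grid_jet O t i.1 i.2))) = 0.
Proof.
move=> s0 t0 hz hP.
have z0 i : ~~ P i -> [/\ j0 (grid_jet O t i.1 i.2) z = 0, forall b, j1 (grid_jet O t i.1 i.2) b z = 0 &
    forall a b, j2 (grid_jet O t i.1 i.2) a b z = 0].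
  by move=> nP; apply: (jN_eq0 s0); apply/eqP; apply: contraNT nP; exact: hP.
have [[f1 f2] [g1 g2]] := (hz false, hz true).
have [a0 a1 a2] := e1 f1 f2; have [b0 b1 b2] := e1 g1 g2.
set x := (coord false z - _) / t in a0 a1 a2; set y := (coord true z - _) / t in b0 b1 b2.
have full (F : 'I_n * 'I_n -> R) : (forall i, ~~ P i -> F i = 0) -> \sum_(i <- [seq i <- index_enum _ | P i]) F i = \sum_i F i.
  by move=> F0; rewrite big_filter [RHS](bigID P)/= [X in _ + X]big1 ?addr0.
have prod (c : R) (F G : R -> R) : \sum_(i : 'I_n * 'I_n) c * (F (x - (i.1 : nat)%:R) * G (y - (i.2 : nat)%:R)) =
    c * ((\sum_(i < n) F (x - i%:R)) * \sum_(i < n) G (y - i%:R)).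
  by rewrite -mulr_sumr big_distrlr /= pair_bigA.
have e00 := prod 1 e e; have e10 := prod t^-1 e' e; have e01 := prod t^-1 e e'.
have e20 := prod (t^-1 ^+ 2) e'' e; have e02 := prod (t^-1 ^+ 2) e e''; have e11 := prod (t^-1 ^+ 2) e' e'.
rewrite a0 b0 !mulr1 in e00; rewrite a1 mul0r mulr0 in e10; rewrite b1 !mulr0 in e01.
rewrite a2 mul0r mulr0 in e20; rewrite b2 !mulr0 in e02; rewrite a1 mul0r mulr0 in e11.
have E0 : \sum_(i <- [seq i <- index_enum _ | P i]) j0 (grid_jet O t i.1 i.2) z = 1.
  rewrite full; last by move=> i /z0[].
  by rewrite -[RHS]e00; apply: eq_bigr => i _; rewrite mul1r.
have E1 b : \sum_(i <- [seq i <- index_enum _ | P i]) j1 (grid_jet O t i.1 i.2) b z = 0.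
  rewrite full; last by move=> i /z0[].
  case: b; [rewrite -[RHS]e01|rewrite -[RHS]e10]; apply: eq_bigr => i _; rewrite /= -/x -/y; ring.
have E2 a b : \sum_(i <- [seq i <- index_enum _ | P i]) j2 (grid_jet O t i.1 i.2) a b z = 0.
  rewrite full; last by move=> i /z0[].
  case: a b => [] []; [rewrite -[RHS]e02|rewrite -[RHS]e11|rewrite -[RHS]e11|rewrite -[RHS]e20]; apply: eq_bigr => i _; rewrite /= -/x -/y; ring.
exact: jN_unit.
Qed.
End Grid.

(** * The extension *)

Lemma tower_comb (R : realType) (I : eqType) (r : nat -> seq I) (e u v w : nat -> I -> jet R) u0 v0 w0 a z J k :
  (forall k i, j0 (w k i) z = a * j0 (u k i) z + j0 (v k i) z) -> j0 w0 z = a * j0 u0 z + j0 v0 z ->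
  j0 (tower r e w w0 J k) z = a * j0 (tower r e u u0 J k) z + j0 (tower r e v v0 J k) z.
Proof.
move=> hw hw0; rewrite /tower; elim: iota => //= l ls IH; rewrite IH.
rewrite [X in _ + X = _](eq_bigr (fun i => a * (j0 (e l i) z * j0 (u l i) z) + j0 (e l i) z * j0 (v l i) z)); last first.
  by move=> i _; rewrite hw; ring.
by rewrite big_split /= -mulr_sumr; ring.
Qed.

Lemma cell_node (R : realType) (O z : plane R) rho i j : 0 < rho -> cell O rho i j z -> `|z - node O rho i j| <= rho.
Proof.
move=> r0 /cellP[/andP[a1 a2] /andP[b1 b2]]; move: a2 b2; rewrite -!natr1 !mulrDr !mulr1 => a2 b2.
by rewrite prod_normE /= ge_max !ler_norml; apply/andP; split; apply/andP; split; linear.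
Qed.

Section Extension.
Variables (R : realType) (K : R) (e e' e'' : R -> R).
Hypothesis de : forall x : R, is_derive x 1 e (e' x).
Hypothesis de' : forall x : R, is_derive x 1 e' (e'' x).
Hypothesis ce : continuous e''.
Hypothesis eK : forall x, [/\ `|e x| <= K, `|e' x| <= K & `|e'' x| <= K].
Hypothesis e0 : forall x, x < -1 \/ 2 < x -> [/\ e x = 0, e' x = 0 & e'' x = 0].
Hypothesis e1 : forall n u, 1 < u -> u + 1 < n%:R -> [/\ \sum_(a < n) e (u - a%:R) = 1,
  \sum_(a < n) e' (u - a%:R) = 0 & \sum_(a < n) e'' (u - a%:R) = 0].
Variables (I : finType) (pt : I -> plane R) (rho S : R) (O : plane R) (n J : nat) (x0 : I).
Hypotheses (rho0 : 0 < rho) (J0 : (0 < J)%N).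
Hypothesis sep : forall i j, i != j -> 64 * rho <= `|pt i - pt j|.

Definition scale (k : nat) : R := 2 ^+ k * rho.

Hypothesis diam : forall i j, `|pt i - pt j| <= scale J.
Hypothesis SJ : 32 * scale J <= S.
Hypothesis win : forall i, cbox (pt i) S `<=` window O rho n.

Definition close k (i : 'I_n * 'I_n) x := `|pt x - node O (scale k) i.1 i.2| <= 4 * scale k.

(** The default [x0] is returned at nodes without a close point; these do not belong to [level k]
    and get no weight in [ext]. *)
Definition rep k i : I := odflt x0 [pick x | close k i x].

Definition level k := [seq i <- index_enum ('I_n * 'I_n)%type | [exists x, close k i x]].

Definition taylor (f : I -> R) (g : I -> plane R) x := jaff (f x - dot (g x) (pt x)) (g x).

Definition gridj k (i : 'I_n * 'I_n) := grid_jet e e' e'' O (scale k) i.1 i.2.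

(** At level k the Taylor polynomials of the representatives are blended near E on the grid of side
    2^k rho; the coarsest layer is a single affine function, so the Hessian vanishes far from E. *)
Definition ext f g := tower level gridj (fun k i => taylor f g (rep k i)) (taylor f g x0) J 0.

Lemma scale_gt0 k : 0 < scale k. Proof. by rewrite mulr_gt0// exprn_gt0. Qed.

Lemma scaleS k : scale k.+1 = 2 * scale k. Proof. by rewrite /scale exprS mulrA. Qed.

Lemma scale_le k l : (k <= l)%N -> scale k <= scale l.
Proof. by move=> kl; rewrite /scale ler_pM2r//; apply: ler_weXn2l; rewrite ?ler1n. Qed.

Lemma scale0 : scale 0 = rho. Proof. by rewrite /scale expr0 mul1r. Qed.

Lemma scaleD k l : scale (k + l) = 2 ^+ k * scale l. Proof. by rewrite /scale exprD mulrA. Qed.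

Lemma level_rep k i : i \in level k -> close k i (rep k i).
Proof.
rewrite mem_filter => /andP[/existsP[x cx] _]; rewrite /rep; case: pickP => [y //|/(_ x)].
by rewrite cx.
Qed.

Lemma ext_C2 f g : C2j (ext f g).
Proof.
apply: C2j_tower => [k i|k i|]; [|exact: C2j_aff|exact: C2j_aff].
exact: (C2j_grid de de' ce).
Qed.

Lemma ext_comb a f g f' g' z : j0 (ext (fun x => a * f x + f' x) (fun x => a *: g x + g' x)) z =
  a * j0 (ext f g) z + j0 (ext f' g') z.
Proof.
have h x : j0 (taylor (fun x => a * f x + f' x) (fun x => a *: g x + g' x) x) z =
    a * j0 (taylor f g x) z + j0 (taylor f' g' x) z.
  by rewrite /= /dot /= /GRing.scale /=; ring.
by apply: tower_comb => [k i|]; exact: h.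
Qed.

(** The grids of all levels share the origin and the number of nodes; a coarser grid covers a larger
    square, so the window of the finest one suffices. *)
Lemma inside_window x k z : (k <= J)%N -> `|pt x - z| <= 8 * scale k ->
  forall b, 1 < (coord b z - coord b O) / scale k /\ (coord b z - coord b O) / scale k + 1 < n%:R.
Proof.
move=> kJ xz; have t0 := scale_gt0 k; have tJ := scale_le kJ.
have rt : rho <= scale k by rewrite -scale0; exact: scale_le.
have S0 : 0 <= S by move: SJ (scale_gt0 J); lra.
have w1 : window O rho n ((pt x).1 - S, (pt x).2 - S).
  by apply: (win (i := x)); apply/cboxP; rewrite /= ![_ - S - _]addrAC !subrr !sub0r !normrN (ger0_norm S0).
have w2 : window O rho n ((pt x).1 + S, (pt x).2 + S).
  by apply: (win (i := x)); apply/cboxP; rewrite /= ![_ + S - _]addrAC !subrr !add0r (ger0_norm S0).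
move: w1 w2; rewrite /window /= !in_itv /= => -[/andP[a1 a2] /andP[b1 b2]] [/andP[c1 c2] /andP[d1 d2]].
have z1 : `|(pt x).1 - z.1| <= 8 * scale k by apply: le_trans xz; exact: plane_norm1 (pt x - z).
have z2 : `|(pt x).2 - z.2| <= 8 * scale k by apply: le_trans xz; exact: plane_norm2 (pt x - z).
move: z1 z2; rewrite !ler_norml => /andP[z1 z1'] /andP[z2 z2'].
have nn : rho * n%:R <= scale k * n%:R by apply: ler_wpM2r.
have key (c o q : R) : o <= q - S -> q + S < o + rho * n%:R -> - (8 * scale k) <= q - c -> q - c <= 8 * scale k ->
    1 < (c - o) / scale k /\ (c - o) / scale k + 1 < n%:R.
  move=> h1 h2 h3 h4; split; first by rewrite ltr_pdivlMr// mul1r; move: SJ tJ; lra.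
  rewrite (_ : _ / _ + 1 = (c - o + scale k) / scale k); last by field; rewrite gt_eqF.
  by rewrite ltr_pdivrMr// mulrC; move: SJ tJ; lra.
by case; [exact: key b1 d2 z2 z2'|exact: key a1 c2 z1 z1'].
Qed.

(** At the finest level the weights add up to 1 at pt x, and a node active there has x as its
    representative: the representative and x are both within 4 rho of the node, while distinct
    points are at least 64 rho apart. *)
Lemma ext_interp f g x : j0 (ext f g) (pt x) = f x.
Proof.
rewrite /ext (tower_step _ _ _ _ J0) /blend_jet; set w := tower _ _ _ _ _ _.
have r0 := scale_gt0 0.
have close_x i : jN rho (pt x) (gridj 0 i) != 0 -> close 0 i x.
  by move=> h; apply: le_trans (grid_supp e0 (ltW rho0) r0 h) _; rewrite scale0; move: (rho0); lra.
have xx : `|pt x - pt x| <= 8 * scale 0 by rewrite subrr normr0 mulr_ge0// ltW.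
have iw := inside_window (leq0n J) xx.
have unit : jN rho (pt x) (jB (jcst 1) (jsum (level 0) (gridj 0))) = 0.
  apply: (grid_unit e1 rho0 r0 iw) => i h; apply/existsP; exists x; exact: close_x.
have [z0 _ _] := jN_eq0 rho0 unit.
have {}z0 : \sum_(i <- level 0) j0 (gridj 0 i) (pt x) = 1.
  by move/eqP: z0; rewrite subr_eq0 eq_sym => /eqP.
rewrite [LHS](_ : _ = (1 - \sum_(i <- level 0) j0 (gridj 0 i) (pt x)) * j0 w (pt x) +
  \sum_(i <- level 0) j0 (gridj 0 i) (pt x) * j0 (taylor f g (rep 0 i)) (pt x)); last by [].
rewrite z0 subrr mul0r add0r -[RHS]mul1r -z0 mulr_suml big_seq [RHS]big_seq; apply: eq_bigr => i il.
have [h|h] := eqVneq (jN rho (pt x) (gridj 0 i)) 0.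
  by have [-> _ _] := jN_eq0 rho0 h; rewrite !mul0r.
have c1 := close_x i h; have c2 := level_rep il.
suff -> : rep 0 i = x by congr (_ * _); rewrite /= subrK.
apply/eqP; apply: contraT => ne; have := sep ne.
rewrite (_ : pt _ - pt x = (pt (rep 0 i) - node O (scale 0) i.1 i.2) - (pt x - node O (scale 0) i.1 i.2)); last first.
  by rewrite opprB addrA subrK.
move=> h1; have := le_trans h1 (ler_normB _ _); move: c1 c2; rewrite /close scale0; move: (rho0); lra.
Qed.

Lemma grid_active k i s z : i \in level k -> 0 <= s -> jN s z (gridj k i) != 0 ->
  `|z - node O (scale k) i.1 i.2| <= 2 * scale k /\ `|pt (rep k i) - z| <= 6 * scale k.
Proof.
move=> il s0 h; have t0 := scale_gt0 k; have h1 := grid_supp e0 s0 t0 h.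
split=> //; have := level_rep il; rewrite /close => h2.
rewrite (_ : _ - z = (pt (rep k i) - node O (scale k) i.1 i.2) - (z - node O (scale k) i.1 i.2)); last by rewrite opprB addrA subrK.
by apply: le_trans (ler_normB _ _) _; lra.
Qed.

(** The level of a cell as in a Whitney decomposition: [cscale] is comparable to the distance of the
    node from E, cut off below at rho and above at 2^J rho, since [find] returns J when no level
    qualifies. *)
Definition lev i j := find (fun k => [exists x, `|pt x - node O rho i j| <= scale k / 2]) (iota 0 J).

Definition cscale i j := scale (lev i j).

Definition around i j d : pred ('I_n * 'I_n) :=
  [pred q : 'I_n * 'I_n | `|node O (scale (lev i j - d)) q.1 q.2 - node O rho i j| <= 3 * scale (lev i j - d)].

(* The points whose Taylor polynomials can influence the extension on the cell [(i, j)]. *)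
Definition reps i j := [seq x <- x0 :: [seq rep (lev i j - d) q | d <- iota 0 5, q <- enum (around i j d)] |
  `|pt x - node O rho i j| <= 8 * cscale i j].

(** The base point to which all representatives of the cell are compared, so that only pairs of
    points occur. The radius 5 also admits [x0] in the cells of top level: 4 for the distance of the
    cell from E and 1 for the diameter of E. *)
Definition anchor i j := odflt x0 [pick y | `|pt y - node O rho i j| <= 5 * cscale i j].

Definition near i j := [exists x, `|pt x - node O rho i j| <= 4 * scale J].

Definition dev (f : I -> R) (g : I -> plane R) x y := f x + dot (g x) (pt y - pt x) - f y.

Lemma lev_le i j : (lev i j <= J)%N.
Proof. by rewrite -[leqRHS](size_iota 0) find_size. Qed.

Lemma lev_lt i j : (lev i j < J)%N -> exists x, `|pt x - node O rho i j| <= cscale i j / 2.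
Proof.
move=> lJ; have h : has (fun k => [exists x, `|pt x - node O rho i j| <= scale k / 2]) (iota 0 J) by rewrite has_find size_iota.
by have := nth_find 0%N h; rewrite nth_iota// add0n => /existsP.
Qed.

Lemma lev_min i j k x : (k < lev i j)%N -> scale k / 2 < `|pt x - node O rho i j|.
Proof.
move=> kl; have := before_find 0%N kl; rewrite nth_iota ?add0n; last exact: leq_trans (lev_le i j).
by move/negbT; rewrite negb_exists => /forallP/(_ x); rewrite -ltNge.
Qed.

(** The point [x0], and at each of five levels at most 7 by 7 nodes: 1 + 5 * 49 = 246. *)
Lemma reps_size i j : (size (reps i j) <= 246)%N.
Proof.
rewrite size_filter; apply: leq_trans (count_size _ _) _.
have -> (s : seq I) : size (x0 :: s) = (size s).+1 by [].
rewrite ltnS size_allpairs_dep.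
have h d : (size (enum (around i j d)) <= 49)%N.
  set t := scale (lev i j - d); have t0 : 0 < t := scale_gt0 _.
  pose U (c o : R) := [pred a : 'I_n | `|(c - o) / t - a%:R| <= 3%:R].
  rewrite -cardE; apply: (@leq_trans #|[predX (U (node O rho i j).1 O.1) & (U (node O rho i j).2 O.2)]|).
    apply: subset_leq_card; apply/fintype.subsetP => -[a b]; rewrite !inE /= -/t => h.
    have k (x o : R) (m : nat) : `|o + t * m%:R - x| <= 3 * t -> `|(x - o) / t - m%:R| <= 3.
      move=> hx; rewrite (_ : _ - m%:R = - (o + t * m%:R - x) / t); last by field; rewrite gt_eqF.
      by rewrite normrM normrN normfV (gtr0_norm t0) ler_pdivrMr.
    apply/andP; split; apply: k; apply: le_trans h.
      exact: (plane_norm1 (node O t a b - node O rho i j)).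
    exact: (plane_norm2 (node O t a b - node O rho i j)).
  by rewrite cardX; apply: (@leq_mul _ _ 7 7); exact: axis_points.
suff le s : (sumn [seq size (enum (around i j x)) | x <- s] <= size s * 49)%N by exact: le (iota 0 5).
by elim: s => //= a s IH; rewrite mulSn leq_add.
Qed.

Lemma reps_near i j x : x \in reps i j -> `|pt x - node O rho i j| <= 8 * cscale i j.
Proof. by rewrite mem_filter => /andP[]. Qed.

Lemma node_diam x y z t : `|pt x - z| <= t -> `|pt y - z| <= t + scale J.
Proof.
move=> h; rewrite (_ : _ - z = (pt x - z) + (pt y - pt x)); last by rewrite [RHS]addrC addrA subrK.
by apply: le_trans (ler_normD _ _) _; apply: lerD.
Qed.

Lemma anchor_near i j : near i j -> `|pt (anchor i j) - node O rho i j| <= 5 * cscale i j.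
Proof.
move=> /existsP[x xn]; rewrite /anchor; case: pickP => [y //|no].
have := lev_le i j; rewrite leq_eqVlt => /orP[/eqP lJ|/lev_lt[y hy]]; last first.
  by have := no y; rewrite (le_trans hy)//; have := scale_gt0 (lev i j); rewrite /cscale; lra.
have := no x0; rewrite /cscale lJ (le_trans (node_diam x0 xn))//; have := scale_gt0 J; lra.
Qed.

Let C : R := (5 * (16 * (16 * K))) ^+ 2.

Lemma level_sum k s z : 0 <= s -> s <= 16 * scale k -> \sum_(i <- level k) jN s z (gridj k i) <= C.
Proof.
move=> s0 st; apply: le_trans (grid_sum_le eK e0 O z n (scale_gt0 k) s0 st).
rewrite /level big_filter [leRHS](bigID (fun i => [exists x, close k i x]))/= lerDl.
by apply: sumr_ge0 => i _; exact: jN_ge0.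
Qed.

(** A Taylor polynomial has no Hessian, so a comparison with one at scale s bounds the Hessian of u
    at the cost of a factor of order s^-2. *)
Lemma jN_hessian s z (f : I -> R) g y (u : jet R) : 0 < s -> gam (j2 u) z <= 2 / s ^+ 2 * jN s z (jB u (taylor f g y)).
Proof.
move=> s0; have s2 : 0 < s ^+ 2 by exact: exprn_gt0.
rewrite /jN /= !subr0 mulrDr (_ : 2 / s ^+ 2 * (s ^+ 2 / 2 * _) = gam (j2 u) z).
  by rewrite lerDr mulr_ge0 ?divr_ge0 ?(ltW s2)// addr_ge0// mulr_ge0 ?addr_ge0// ltW.
rewrite /gam !big_bool /= mulrA (_ : 2 / s ^+ 2 * (s ^+ 2 / 2) = 1); last by field; rewrite gt_eqF.
by rewrite mul1r; ring.
Qed.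

(** At this distance no cut-off is active, and the extension agrees to second order with the affine
    top layer: [tower_bound] applies with B = 0. *)
Lemma ext_far f g z : (forall x, 3 * scale J < `|pt x - z|) -> gam (j2 (ext f g)) z = 0.
Proof.
move=> far; have s0 := scale_gt0 J; have C0 : 0 <= C by exact: sqr_ge0.
have dead k i : (k < J)%N -> i \in level k -> jN (scale J) z (gridj k i) = 0.
  move=> kJ il; apply/eqP; apply: contraT => h.
  have [_ h1] := grid_active il (ltW s0) h.
  have := far (rep k i); have := scale_le kJ; rewrite scaleS; move: h1; lra.
have z0 : jN (scale J) z (jB (ext f g) (taylor f g x0)) = 0.
  apply/eqP; rewrite eq_le (jN_ge0 z _ (ltW s0)) andbT.
  rewrite -(mulr0 (2 * (1 + C) ^+ 5)).
  have dsum k : (k < J)%N -> \sum_(i <- level k) jN (scale J) z (gridj k i) = 0.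
    by move=> kJ; rewrite big_seq big1// => i il; exact: dead.
  apply: (tower_bound (l := J)) => //; first exact: ltW.
  - by move=> k i _ kJ il; rewrite dead// eqxx.
  - by rewrite ltnn.
  - by move=> _; rewrite /jN /= !subrr !normr0 !addr0 !mulr0 !addr0.
  - by move=> k _ kJ; rewrite dsum.
  - by move=> k kJ; apply: dsum; lia.
have := jN_hessian z f g x0 (ext f g) s0; rewrite z0 mulr0 => h.
by apply/eqP; rewrite eq_le h; apply: sumr_ge0 => i _; apply: sumr_ge0.
Qed.

Lemma taylor_jet f g x y s z c : 0 <= s -> `|z - c| <= s -> `|pt y - c| <= 8 * s ->
  jN s z (jB (taylor f g x) (taylor f g y)) <= 20 * (`|dev f g x y| + s * `|g x - g y|).
Proof.
move=> s0 zc yc; have zy : `|z - pt y| <= 9 * s.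
  rewrite (_ : z - pt y = (z - c) - (pt y - c)); last by rewrite opprB addrA subrK.
  by apply: le_trans (ler_normB _ _) _; lra.
have g0 : 0 <= `|g x - g y| by [].
have e2 : j0 (jB (taylor f g x) (taylor f g y)) z = dev f g x y + dot (g x - g y) (z - pt y).
  by rewrite /dev /= /dot /=; ring.
have d1 : `|dot (g x - g y) (z - pt y)| <= 18 * (s * `|g x - g y|).
  apply: le_trans (dot_le _ _) _; rewrite (_ : 18 * _ = 2 * `|g x - g y| * (9 * s)); last by ring.
  by apply: ler_wpM2l => //; rewrite mulr_ge0.
have d2 : `|j0 (jB (taylor f g x) (taylor f g y)) z| <= `|dev f g x y| + 18 * (s * `|g x - g y|).
  by rewrite e2; apply: le_trans (ler_normD _ _) _; rewrite lerD2l.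
have a1 : s * `|(g x).1 - (g y).1| <= s * `|g x - g y| by apply: ler_wpM2l => //; exact: (plane_norm1 (g x - g y)).
have a2 : s * `|(g x).2 - (g y).2| <= s * `|g x - g y| by apply: ler_wpM2l => //; exact: (plane_norm2 (g x - g y)).
have p0 : 0 <= s * `|g x - g y| by exact: mulr_ge0.
have p1 : 0 <= `|dev f g x y| by [].
rewrite /jN; move: d2; set w := `|j0 _ _| => d2; rewrite /= !subrr !normr0 !addr0 mulr0 addr0 mulrDr; lra.
Qed.

(** [tower_bound] at level [lev i j] with the Taylor polynomial of the anchor as reference: all
    active polynomials belong to [reps i j], and their distance from the reference is a difference
    of jets. *)
Lemma cell_bound f g i j z B : cell O rho i j z -> near i j -> 0 <= B ->
  (forall x, x \in reps i j -> 20 * (`|dev f g x (anchor i j)| + cscale i j * `|g x - g (anchor i j)|) <= B) ->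
  gam (j2 (ext f g)) z <= 2 / cscale i j ^+ 2 * (2 * (1 + C) ^+ 5 * B).
Proof.
move=> zc nr B0 HB; have s0 := scale_gt0 (lev i j); have C0 : 0 <= C by exact: sqr_ge0.
have zn := cell_node rho0 zc; have lJ := lev_le i j.
have rs k : rho <= scale k by rewrite -scale0; exact: scale_le.
have yn := anchor_near nr.
apply: le_trans (jN_hessian z f g (anchor i j) (ext f g) s0) _.
apply: ler_wpM2l; first by rewrite divr_ge0// sqr_ge0.
have active k q : (k <= lev i j)%N -> q \in level k -> jN (scale (lev i j)) z (gridj k q) != 0 ->
    [/\ (lev i j <= k + 4)%N, `|pt (rep k q) - node O rho i j| <= 7 * scale k &
      `|node O (scale k) q.1 q.2 - node O rho i j| <= 3 * scale k].
  move=> kl ql h; have [h1 h2] := grid_active ql (ltW s0) h.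
  have rk := rs k.
  have h3 : `|pt (rep k q) - node O rho i j| <= 7 * scale k.
    rewrite (_ : _ - _ = (pt (rep k q) - z) + (z - node O rho i j)); last by rewrite addrA subrK.
    by apply: le_trans (ler_normD _ _) _; lra.
  split=> //; last first.
    rewrite (_ : _ - _ = (z - node O rho i j) - (z - node O (scale k) q.1 q.2)); last by rewrite opprB [RHS]addrC addrA subrK.
    by apply: le_trans (ler_normB _ _) _; lra.
  (* An active representative is within 7 * 2^k rho of the node. Five or more levels below [lev i j]
     this contradicts the minimality of that level, which puts all points beyond 8 * 2^k rho. *)
  rewrite leqNgt; apply/negP => k4; have := @lev_min i j (k + 4) (rep k q) k4; rewrite addnC scaleD.
  rewrite !exprS expr0; move: h3 (scale_gt0 k); lra.
have inreps k q : (k <= lev i j)%N -> q \in level k -> jN (scale (lev i j)) z (gridj k q) != 0 -> rep k q \in reps i j.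
  move=> kl ql h; have [k4 h1 h2] := active k q kl ql h.
  rewrite mem_filter inE; apply/andP; split.
    by apply: (le_trans h1); rewrite /cscale; have := scale_le kl; move: s0; lra.
  apply/orP; right; apply/allpairsPdep; exists (lev i j - k)%N, q; split.
  - by rewrite mem_iota /= ltnS leq_subLR.
  - by rewrite mem_enum inE /around /= subKn.
  - by rewrite subKn.
have yn8 : `|pt (anchor i j) - node O rho i j| <= 8 * cscale i j by move: yn s0; rewrite /cscale; lra.
have zs : `|z - node O rho i j| <= cscale i j by apply: le_trans zn _; exact: rs.
apply: (tower_bound (l := lev i j)) => //; first exact: ltW.
- move=> k q kl kJ ql h; apply: le_trans (HB _ (inreps k q kl ql h)).
  exact: (taylor_jet f g _ (ltW s0) zs yn8).
(* The point x that defines the level is close to every node active at z, so no active node is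
   missing from [level] and the weights add up to 1. *)
- move=> lJ'; have [x hx] := lev_lt lJ'.
  have hxz : `|pt x - z| <= 8 * scale (lev i j).
    rewrite (_ : pt x - z = (pt x - node O rho i j) - (z - node O rho i j)); last by rewrite opprB addrA subrK.
    by apply: le_trans (ler_normB _ _) _; move: hx zs s0; rewrite /cscale; lra.
  have iw := inside_window (ltnW lJ') hxz.
  apply: (grid_unit e1 s0 s0 iw) => q h; apply/existsP; exists x.
  have h2 := grid_supp e0 (ltW s0) s0 h; rewrite /close.
  rewrite (_ : pt x - _ = (pt x - node O rho i j) + (- (z - node O rho i j) + (z - node O (scale (lev i j)) q.1 q.2))); last first.
    by apply: plane_eq; rewrite /=; ring.
  apply: le_trans (ler_normD _ _) _; have := ler_normD (- (z - node O rho i j)) (z - node O (scale (lev i j)) q.1 q.2).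
  rewrite normrN; move: hx zn h2 (rs (lev i j)); rewrite /cscale.
  lra.
- move=> lE; have /existsP[x xn] := nr.
  have x0r : x0 \in reps i j.
    rewrite mem_filter inE eqxx andbT; apply: le_trans (node_diam x0 xn) _; rewrite /cscale lE; have := scale_gt0 J; lra.
  by apply: le_trans (HB _ x0r); exact: (taylor_jet f g _ (ltW s0) zs yn8).
- move=> k kl kJ; have [k4|k4] := leqP (lev i j) (k + 4).
    apply: level_sum; first exact: ltW.
    apply: le_trans (scale_le k4) _; rewrite addnC scaleD !exprS expr0; have := scale_gt0 k; lra.
  rewrite big_seq big1 ?sqr_ge0// => q ql; apply/eqP; apply: contraT => h.
  by have [] := active k q kl ql h; rewrite leqNgt k4.
- move=> k k4; rewrite big_seq big1// => q ql; apply/eqP; apply: contraT => h.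
  by have [] := active k q (ltnW (leq_ltn_trans (leq_addr 4 k) k4)) ql h; rewrite leqNgt k4.
Qed.
End Extension.

(** * The functionals *)

(** Used with k a cell, [a k] its anchor and [X k] its representatives. The number of cells is not
    bounded in terms of E, that of pairs is; after regrouping the cells enter only through the
    weights. *)
Lemma regroup_pairs (R : realType) (I K : finType) (b : pred K) (a : K -> I) (X : K -> pred I) (w : K -> R) (G : I -> I -> R) :
  \sum_x \sum_y (\sum_(k | [&& b k, a k == y & X k x]) w k) * G x y = \sum_(k | b k) \sum_(x | X k x) w k * G x (a k).
Proof.
transitivity (\sum_x \sum_y \sum_k (if [&& b k, a k == y & X k x] then w k * G x y else 0)).
  by apply: eq_bigr => x _; apply: eq_bigr => y _; rewrite mulr_suml big_mkcond.
transitivity (\sum_k \sum_x \sum_y (if [&& b k, a k == y & X k x] then w k * G x y else 0)).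
  by rewrite [RHS]exchange_big; apply: eq_bigr => x _; rewrite exchange_big.
rewrite [RHS]big_mkcond; apply: eq_bigr => k _; case: ifP => bk; last first.
  by rewrite big1// => x _; rewrite big1// => y _.
rewrite [RHS]big_mkcond; apply: eq_bigr => x _; rewrite (bigD1 (a k))//= eqxx /=.
by rewrite [X in _ + X]big1 ?addr0// => y; rewrite eq_sym => /negPf ->.
Qed.

Lemma plane_powR_le (R : realType) (v : plane R) q : 0 <= q -> `|v| `^ q <= `|v.1| `^ q + `|v.2| `^ q.
Proof.
by move=> q0; rewrite prod_normE /= /Num.max; case: ifP => _; rewrite ?lerDl ?lerDr powR_ge0.
Qed.

(** The p-th power of the discrete norm M(f), for the weights defined next: for each pair, one term
    for the values and two for the gradients. *)
Definition jump_energy (R : realType) (p : R) (I : finType) (pt : I -> plane R) (c0 c1 : I -> I -> R) f g :=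
  \sum_x \sum_y (c0 x y * `|dev pt f g x y| `^ p + c1 x y * (`|(g x - g y).1| `^ p + `|(g x - g y).2| `^ p)).

Lemma scale_exists (R : realType) (I : finType) (pt : I -> plane R) rho : 0 < rho ->
  exists2 J, (0 < J)%N & forall i j, `|pt i - pt j| <= scale rho J.
Proof.
move=> rho0; pose D := \sum_(x : I * I) `|pt x.1 - pt x.2|.
exists (Num.bound (D / rho)).+1 => // i j; apply: (@le_trans _ _ D).
  by rewrite /D (bigD1 (i, j))//= lerDl sumr_ge0.
have D0 : 0 <= D / rho by rewrite divr_ge0 ?sumr_ge0// ltW.
rewrite /scale -ler_pdivrMr//; apply: ltW; apply: lt_trans (archi_boundP D0) _.
by rewrite -natrX ltr_nat; apply: leq_trans (ltn_expl _ (ltnSn 1)) _; rewrite leq_exp2l.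
Qed.

Section Assembly.
Variables (R : realType) (p K : R) (e e' e'' : R -> R).
Hypothesis p2 : 2 < p.
Hypothesis de : forall x : R, is_derive x 1 e (e' x).
Hypothesis de' : forall x : R, is_derive x 1 e' (e'' x).
Hypothesis ce : continuous e''.
Hypothesis eK : forall x, [/\ `|e x| <= K, `|e' x| <= K & `|e'' x| <= K].
Hypothesis e0 : forall x, x < -1 \/ 2 < x -> [/\ e x = 0, e' x = 0 & e'' x = 0].
Hypothesis e1 : forall n u, 1 < u -> u + 1 < n%:R -> [/\ \sum_(a < n) e (u - a%:R) = 1,
  \sum_(a < n) e' (u - a%:R) = 0 & \sum_(a < n) e'' (u - a%:R) = 0].
Variables (I : finType) (pt : I -> plane R) (rho : R) (O : plane R) (n J : nat) (x0 : I).
Hypotheses (rho0 : 0 < rho) (J0 : (0 < J)%N).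
Hypothesis sep : forall i j, i != j -> 64 * rho <= `|pt i - pt j|.
Hypothesis diam : forall i j, `|pt i - pt j| <= scale rho J.
Hypothesis win : forall i, cbox (pt i) (32 * scale rho J) `<=` window O rho n.

Let s (k : 'I_n * 'I_n) := cscale pt rho O J k.1 k.2.
Let nearb : pred ('I_n * 'I_n) := fun k => near pt rho O J k.1 k.2.
Let anc (k : 'I_n * 'I_n) := anchor pt rho O J x0 k.1 k.2.
Let rp (k : 'I_n * 'I_n) := reps pt rho O n J x0 k.1 k.2.

(** A jump v of the values on a cell of scale s costs a Hessian of size v / s^2, a jump v of the
    gradients ([weight1]) one of size v / s; the p-th powers are multiplied by the area of the
    cell. *)
Definition weight0 x y := \sum_(k | [&& nearb k, anc k == y & x \in rp k]) rho ^+ 2 * ((s k)^-1 ^+ 2) `^ p.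

Definition weight1 x y := \sum_(k | [&& nearb k, anc k == y & x \in rp k]) rho ^+ 2 * (s k)^-1 `^ p.

Let p0 : 0 < p. Proof. by move: p2; lra. Qed.

Let sk0 k : 0 < s k. Proof. exact: scale_gt0. Qed.

Lemma jump_energyE f g : jump_energy p pt weight0 weight1 f g = \sum_(k | nearb k) \sum_(x | x \in rp k)
  rho ^+ 2 * (((s k)^-1 ^+ 2) `^ p * `|dev pt f g x (anc k)| `^ p +
    (s k)^-1 `^ p * (`|(g x - g (anc k)).1| `^ p + `|(g x - g (anc k)).2| `^ p)).
Proof.
rewrite /jump_energy; under eq_bigr do rewrite big_split.
rewrite big_split /=.
rewrite (regroup_pairs nearb anc (fun k => mem (rp k)) (fun k => rho ^+ 2 * ((s k)^-1 ^+ 2) `^ p) (fun x y => `|dev pt f g x y| `^ p)).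
rewrite (regroup_pairs nearb anc (fun k => mem (rp k)) (fun k => rho ^+ 2 * (s k)^-1 `^ p)
  (fun x y => `|(g x - g y).1| `^ p + `|(g x - g y).2| `^ p)).
rewrite -big_split; apply: eq_bigr => k _; rewrite -big_split; apply: eq_bigr => x _.
by rewrite /= [RHS]mulrDr !mulrA.
Qed.

Let A : R := 2 * (1 + (5 * (16 * (16 * K))) ^+ 2) ^+ 5.

Let A0 : 0 <= A. Proof. by rewrite mulr_ge0// exprn_ge0// addr_ge0// sqr_ge0. Qed.

Lemma cell_powR (f : I -> R) (g : I -> plane R) (k : 'I_n * 'I_n) z : cell O rho k.1 k.2 z -> nearb k ->
  gam (j2 (ext e e' e'' pt rho O n J x0 f g)) z `^ p <= (2 * A) `^ p * (40 `^ p * \sum_(x | x \in rp k)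
    (((s k)^-1 ^+ 2) `^ p * `|dev pt f g x (anc k)| `^ p +
    (s k)^-1 `^ p * (`|(g x - g (anc k)).1| `^ p + `|(g x - g (anc k)).2| `^ p))).
Proof.
move=> zk nk; have sk := sk0 k; have ski : 0 <= (s k)^-1 by rewrite invr_ge0 ltW.
pose b x := 20 * (`|dev pt f g x (anc k)| + s k * `|g x - g (anc k)|).
have b0 x : 0 <= b x by rewrite mulr_ge0// addr_ge0// mulr_ge0// ltW.
(* An l^p sum over the boundedly many representatives takes the place of their maximum, so that its
   p-th power is a sum of functionals. *)
pose B := (\sum_(x | x \in rp k) b x `^ p) `^ p^-1.
have Bp : B `^ p = \sum_(x | x \in rp k) b x `^ p.
  by rewrite -powRrM mulVf ?gt_eqF// powRr1// sumr_ge0// => x _; exact: powR_ge0.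
have B0 : 0 <= B by exact: powR_ge0.
have bB x : x \in rp k -> b x <= B.
  move=> xr; rewrite -[leLHS]powRr1// -(mulfV (_ : p != 0)) ?gt_eqF// powRrM.
  apply: ge0_ler_powR; rewrite ?nnegrE ?invr_ge0 ?powR_ge0 ?(ltW p0)//.
    by rewrite sumr_ge0// => y _; exact: powR_ge0.
  by rewrite (bigD1 x)//= lerDl sumr_ge0// => y _; exact: powR_ge0.
have gb := cell_bound eK e0 e1 rho0 diam (lexx _) win zk nk B0 bB.
have gam0 : 0 <= gam (j2 (ext e e' e'' pt rho O n J x0 f g)) z by apply: sumr_ge0 => i _; apply: sumr_ge0.
apply: (@le_trans _ _ ((2 * A * ((s k)^-1 ^+ 2 * B)) `^ p)).
  apply: ge0_ler_powR; rewrite ?nnegrE ?(ltW p0)//.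
    by apply: mulr_ge0; [exact: mulr_ge0|apply: mulr_ge0 => //; exact: sqr_ge0].
  by apply: (le_trans gb); rewrite le_eqVlt; apply/orP; left; apply/eqP; rewrite /A exprVn; ring.
have A20 : 0 <= 2 * A by exact: mulr_ge0.
have s20 : 0 <= (s k)^-1 ^+ 2 by exact: sqr_ge0.
rewrite (powRM _ A20 (mulr_ge0 s20 B0)); apply: ler_wpM2l; first exact: powR_ge0.
rewrite (powRM _ s20 B0) Bp !mulr_sumr; apply: ler_sum => x _.
rewrite -powRM ?sqr_ge0//.
have -> : (s k)^-1 ^+ 2 * b x = 20 * ((s k)^-1 ^+ 2 * `|dev pt f g x (anc k)| + (s k)^-1 * `|g x - g (anc k)|).
  by rewrite /b; field; rewrite gt_eqF.
have u0 : 0 <= (s k)^-1 ^+ 2 * `|dev pt f g x (anc k)| by rewrite mulr_ge0// sqr_ge0.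
have v0 : 0 <= (s k)^-1 * `|g x - g (anc k)| by rewrite mulr_ge0.
rewrite powRM ?addr_ge0// (_ : 40 = 20 * 2 :> R); last by ring.
rewrite powRM// -[leRHS]mulrA; apply: ler_wpM2l; first exact: powR_ge0.
apply: le_trans (powR_addr_le (ltW p0) u0 v0) _; apply: ler_wpM2l; first exact: powR_ge0.
rewrite !powRM ?sqr_ge0// lerD2l; apply: ler_wpM2l; first exact: powR_ge0.
exact: plane_powR_le (ltW p0).
Qed.

(** The bound is summed over the cells, each inside a square of area (2 rho)^2, whence the factor 4.
    Cells that are not [near] lie in the region where the Hessian of the extension vanishes. *)
Lemma ext_energy (f : I -> R) (g : I -> plane R) : (\int[leb R]_w (gam (j2 (ext e e' e'' pt rho O n J x0 f g)) w `^ p)%:E <=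
  (4 * ((2 * A) `^ p * 40 `^ p) * jump_energy p pt weight0 weight1 f g)%:E)%E.
Proof.
set u := ext _ _ _ _ _ _ _ _ _ _ _; have T0 := scale_gt0 rho0 J.
have wh := C2_weak_hessian (ext_C2 de de' ce pt rho O n J x0 f g); rewrite -/u in wh.
have mE := measurable_EFinS (D := setT) (measurable_gam_powR p wh).
have far (z : plane R) : (forall x, 3 * scale rho J < `|pt x - z|) -> gam (j2 u) z `^ p = 0.
  by move=> h; rewrite (@ext_far R K e e' e'' e0 I pt rho _ O n J x0 rho0 J0 (lexx _) f g z h) powR0// gt_eqF.
have out (z : plane R) : ~ window O rho n z -> gam (j2 u) z `^ p = 0.
  move=> zW; apply: far => x; rewrite ltNge; apply/negP => h; apply: zW; apply: (win (i := x)).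
  have {}h : `|z - pt x| <= 32 * scale rho J by rewrite distrC; apply: (le_trans h); lra.
  by apply/cboxP; split; apply: le_trans h; [exact: (plane_norm1 (z - pt x))|exact: (plane_norm2 (z - pt x))].
have mW : measurable (window O rho n) by apply: measurableX; exact: measurable_itv.
have p0' w : (0 <= (gam (j2 u) w `^ p)%:E)%E by rewrite lee_fin powR_ge0.
have -> : (\int[leb R]_w (gam (j2 u) w `^ p)%:E = \int[leb R]_(w in window O rho n) (gam (j2 u) w `^ p)%:E)%E.
  rewrite [RHS]integral_mkcond; apply: eq_integral => w _; rewrite patchE; case: ifPn => // /negP wW.
  by rewrite out// => h; apply: wW; exact/mem_set.
have mC (k : 'I_n * 'I_n) : measurable (cell O rho k.1 k.2) by exact: measurable_cell.
have cov w : window O rho n w -> exists2 k : 'I_n * 'I_n, xpredT k & cell O rho k.1 k.2 w.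
  by move=> /(cell_exists rho0)[i [j ij]]; exists (i, j).
apply: le_trans (integral_cover mE p0' mC mW cov) _.
pose c (k : 'I_n * 'I_n) := (2 * A) `^ p * (40 `^ p * \sum_(x | x \in rp k)
    (((s k)^-1 ^+ 2) `^ p * `|dev pt f g x (anc k)| `^ p +
    (s k)^-1 `^ p * (`|(g x - g (anc k)).1| `^ p + `|(g x - g (anc k)).2| `^ p))).
have c0 k : 0 <= c k.
  apply: mulr_ge0; first exact: powR_ge0.
  apply: mulr_ge0; first exact: powR_ge0.
  apply: sumr_ge0 => x _; apply: addr_ge0; apply: mulr_ge0; try exact: powR_ge0.
  by apply: addr_ge0; exact: powR_ge0.
have bnd (k : 'I_n * 'I_n) : (\int[leb R]_(w in cell O rho k.1 k.2) (gam (j2 u) w `^ p)%:E <= (if nearb k then c k * (2 * rho) ^+ 2 else 0)%:E)%E.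
  case: ifP => nk; last first.
    rewrite integral0_eq// => w wk; rewrite far// => x; rewrite ltNge; apply/negP => h.
    suff : nearb k by rewrite nk.
    apply/existsP; exists x.
    have wn := cell_node rho0 wk; have rJ : rho <= scale rho J by rewrite -[leLHS]scale0; exact: scale_le.
    rewrite (_ : _ - _ = (pt x - w) + (w - node O rho k.1 k.2)); last by rewrite addrA subrK.
    by apply: le_trans (ler_normD _ _) _; lra.
  apply: (@le_trans _ _ (\int[leb R]_(w in cell O rho k.1 k.2) (c k)%:E)%E).
    apply: ge0_le_integral => //.
    - exact: mC.
    - by apply: measurable_EFinS; exact: measurable_gam_powR wh.
    - by move=> w wk; rewrite lee_fin; exact: cell_powR.
  rewrite integral_cst; last exact: mC.
  apply: (@le_trans _ _ ((c k)%:E * leb R (cbox (node O rho k.1 k.2) rho))%E); last first.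
    apply: (@eq_ind_r _ _ (fun z => (_ * z <= _)%E) _ _ (leb2_cbox _ (ltW rho0))).
    by rewrite -EFinM.
  apply: lee_wpmul2l; first by rewrite lee_fin.
  apply: (le_measure (leb R) (mem_set (mC k)) (mem_set (measurable_cbox _ _))).
  move=> w /(cell_node rho0) wn; apply/cboxP; split; apply: le_trans wn.
    exact: (plane_norm1 (w - node O rho k.1 k.2)).
  exact: (plane_norm2 (w - node O rho k.1 k.2)).
apply: (@le_trans _ _ (\sum_(k : 'I_n * 'I_n) (if nearb k then c k * (2 * rho) ^+ 2 else 0)%:E)%E).
  by apply: lee_sum => k _; exact: bnd.
rewrite sumEFin lee_fin -big_mkcond jump_energyE mulr_sumr le_eqVlt; apply/orP; left; apply/eqP.
apply: eq_bigr => k _; rewrite /c -mulr_sumr; ring.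
Qed.

Variables (C : R) (gr : (I -> R) -> I -> plane R).
Hypothesis C0 : 0 <= C.
Hypothesis est : forall F g, sobolev p F g -> exists2 M : nat -> nat -> R, forall i j, 0 <= M i j &
  rho ^+ 2 * \sum_(i < n) \sum_(j < n) M i j `^ p <= C * energy p g setT /\
  forall x y i j s, x != y -> (i < n)%N -> (j < n)%N -> rho <= s -> s <= 32 * scale rho J ->
    `|node O rho i j - pt x| <= s -> `|node O rho i j - pt y| <= s ->
    `|gr (F \o pt) x - gr (F \o pt) y| <= C * (s * M i j) /\
    `|F (pt x) - F (pt y) - dot (gr (F \o pt) y) (pt x - pt y)| <= C * (s * M i j) * `|pt x - pt y|.

(** The representatives and the anchor lie within 8s of the node, so the gradient scheme bounds
    their jumps by multiples of s M and s^2 M, and the weights cancel the powers of s. The factor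
    738 is 3 functionals times 246 representatives; 128 is 8 times 16. *)
Lemma jump_energy_le F g : sobolev p F g ->
  jump_energy p pt weight0 weight1 (F \o pt) (gr (F \o pt)) <= 738 * ((128 * C) `^ p * C) * energy p g setT.
Proof.
move=> sob; have [M M0 [EM HM]] := est sob; rewrite jump_energyE.
set G := gr (F \o pt).
have key k x : nearb k -> x \in rp k -> ((s k)^-1 ^+ 2) `^ p * `|dev pt (F \o pt) G x (anc k)| `^ p +
    (s k)^-1 `^ p * (`|(G x - G (anc k)).1| `^ p + `|(G x - G (anc k)).2| `^ p) <= 3 * ((128 * C) `^ p * M k.1 k.2 `^ p).
  move=> nk xr; have sk := sk0 k; have xn := reps_near xr; have an := anchor_near x0 rho0 diam nk.
  rewrite -/(s k) in xn an; have ski : 0 <= (s k)^-1 by rewrite invr_ge0 ltW.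
  have m0 := M0 k.1 k.2; have CM : 0 <= C * M k.1 k.2 by exact: mulr_ge0.
  have [b1 b2] : `|G x - G (anc k)| <= 8 * (C * M k.1 k.2) * s k /\
      `|dev pt (F \o pt) G x (anc k)| <= 128 * (C * M k.1 k.2) * s k ^+ 2.
    have [->|ne] := eqVneq x (anc k).
      rewrite /dev !subrr /dot /= !mulr0 !addr0 subrr !normr0.
      by split; apply: mulr_ge0; rewrite ?mulr_ge0 ?sqr_ge0// ltW.
    have r8 : rho <= 8 * s k by have : rho <= s k; [rewrite -[leLHS]scale0; exact: scale_le|lra].
    have s32 : 8 * s k <= 32 * scale rho J.
      by have : s k <= scale rho J; [exact: (scale_le rho0 (lev_le _ _ _ _ _ _))|have := scale_gt0 rho0 J; lra].
    have a8 : `|node O rho k.1 k.2 - pt (anc k)| <= 8 * s k by rewrite distrC; apply: le_trans an _; lra.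
    rewrite distrC in xn; rewrite eq_sym in ne.
    have [h1 h2] := HM (anc k) x k.1 k.2 (8 * s k) ne (ltn_ord _) (ltn_ord _) r8 s32 a8 xn.
    have ax : `|pt (anc k) - pt x| <= 16 * s k.
      rewrite (_ : _ - pt x = (node O rho k.1 k.2 - pt x) - (node O rho k.1 k.2 - pt (anc k))); last by apply: plane_eq; rewrite /=; ring.
      by apply: le_trans (ler_normB _ _) _; lra.
    split.
      by rewrite distrC; apply: (le_trans h1); rewrite le_eqVlt; apply/orP; left; apply/eqP; ring.
    rewrite /dev (_ : _ - _ = - (F (pt (anc k)) - F (pt x) - dot (G x) (pt (anc k) - pt x))); last by rewrite /=; ring.
    rewrite normrN; apply: (le_trans h2).
    apply: (@le_trans _ _ (C * (8 * s k * M k.1 k.2) * (16 * s k))).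
      by apply: ler_wpM2l => //; rewrite !mulr_ge0// ltW.
    by rewrite le_eqVlt; apply/orP; left; apply/eqP; ring.
  have q1 : ((s k)^-1 ^+ 2) `^ p * `|dev pt (F \o pt) G x (anc k)| `^ p <= (128 * C) `^ p * M k.1 k.2 `^ p.
    rewrite -!powRM ?sqr_ge0 ?mulr_ge0//; apply: ge0_ler_powR; rewrite ?nnegrE ?(ltW p0) ?mulr_ge0 ?sqr_ge0//.
    by rewrite exprVn ler_pdivrMl ?exprn_gt0// mulrC; apply: le_trans b2 _; rewrite !mulrA.
  have q2 (v : R) : `|v| <= `|G x - G (anc k)| -> (s k)^-1 `^ p * `|v| `^ p <= (128 * C) `^ p * M k.1 k.2 `^ p.
    move=> hv; rewrite -!powRM ?mulr_ge0//; apply: ge0_ler_powR; rewrite ?nnegrE ?(ltW p0) ?mulr_ge0//.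
    rewrite ler_pdivrMl//; apply: (le_trans hv); apply: (le_trans b1); rewrite mulrC; apply: ler_wpM2l; first exact: ltW.
    by rewrite -[leRHS]mulrA; apply: ler_wpM2r => //; lra.
  rewrite mulrDr; have := q2 _ (plane_norm1 (G x - G (anc k))); have := q2 _ (plane_norm2 (G x - G (anc k))); lra.
have n0 : 0 <= 738 :> R by exact: ler0n.
have size_rp k : (#|[pred x | x \in rp k]| <= 246)%N.
  by apply: leq_trans (card_size _) _; exact: (reps_size _ _ _ _ _ rho0).
apply: (@le_trans _ _ (\sum_(k : 'I_n * 'I_n) 738 * (128 * C) `^ p * (rho ^+ 2 * M k.1 k.2 `^ p))).
  rewrite big_mkcond; apply: ler_sum => k _.
  have z0 : 0 <= (128 * C) `^ p * M k.1 k.2 `^ p by rewrite mulr_ge0// powR_ge0.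
  have r0 : 0 <= rho ^+ 2 * M k.1 k.2 `^ p by apply: mulr_ge0; [exact: sqr_ge0|exact: powR_ge0].
  case: ifP => nk; last by apply: (mulr_ge0 _ r0); apply: (mulr_ge0 n0); exact: powR_ge0.
  rewrite -mulr_sumr (_ : 738 * _ * _ = rho ^+ 2 * (246 * (3 * ((128 * C) `^ p * M k.1 k.2 `^ p)))); last by ring.
  apply: ler_wpM2l; first exact: sqr_ge0.
  apply: le_trans (ler_sum _ (fun x xr => key k x nk xr)) _; rewrite sumr_const -[leLHS]mulr_natl.
  apply: ler_wpM2r; first by rewrite mulr_ge0.
  by rewrite (ler_nat _ _ 246); exact: size_rp.
rewrite -mulr_sumr -[leLHS]mulrA -[leRHS]mulrA; apply: (ler_wpM2l n0).
rewrite -[leRHS]mulrA; apply: ler_wpM2l; first exact: powR_ge0.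
apply: le_trans EM; rewrite -mulr_sumr pair_bigA /=; exact: lexx.
Qed.
End Assembly.

Lemma jump_scheme (R : realType) (p : R) : 2 < p -> exists2 C, 0 < C & forall (I : finType) (pt : I -> plane R),
  injective pt -> (1 < #|I|)%N -> exists (T : (I -> R) -> jet R) (c0 c1 : I -> I -> R) (gr : (I -> R) -> I -> plane R),
  [/\ forall x y, 0 <= c0 x y /\ 0 <= c1 x y,
    forall a f h x, gr (fun y => a * f y + h y) x = a *: gr f x + gr h x,
    forall a f h w, j0 (T (fun y => a * f y + h y)) w = a * j0 (T f) w + j0 (T h) w,
    forall f, C2j (T f) /\ forall x, j0 (T f) (pt x) = f x &
    (forall f, (\int[leb R]_w (gam (j2 (T f)) w `^ p)%:E <= (C * jump_energy p pt c0 c1 f (gr f))%:E)%E) /\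
    forall F g, sobolev p F g -> jump_energy p pt c0 c1 (F \o pt) (gr (F \o pt)) <= C * energy p g setT].
Proof.
move=> p2; have [C C0 HC] := gradient_estimate p2.
have [K [e [e' [e'' [K0 [de de' ce eK [e0 e1]]]]]]] := partition_profile R.
have k0 : 0 < 4 * ((2 * (2 * (1 + (5 * (16 * (16 * K))) ^+ 2) ^+ 5)) `^ p * 40 `^ p) :> R.
  apply: mulr_gt0 => //; apply: mulr_gt0; apply: powR_gt0 => //.
  by do 2 apply: mulr_gt0 => //; rewrite exprn_gt0// ltr_wpDr// sqr_ge0.
have n0 : 0 < 738 :> R by exact: ltr0Sn.
have k1 : 0 < 738 * ((128 * C) `^ p * C).
  by apply: (mulr_gt0 n0); apply: (mulr_gt0 _ C0); apply: powR_gt0; apply: mulr_gt0 => //; exact: ltr0Sn.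
set c := 4 * _ in k0; set c' := 738 * _ in k1.
exists (c + c'); first exact: addr_gt0.
move=> I pt ptI I1; have [rho [rho0 sep] [gr [lin est]]] := HC I pt ptI I1.
have /card_gt0P[x0 _] : (0 < #|I|)%N by exact: ltnW.
(* The scale 32 * 2^J rho exceeds all scales at which jets are compared and leaves a margin between
   E and the border of the window. *)
have [J J0 diam] := scale_exists pt rho0; have [org [n [win {}est]]] := est (32 * scale rho J).
exists (fun f => ext e e' e'' pt rho org n J x0 f (gr f)), (weight0 p pt rho org n J x0), (weight1 p pt rho org n J x0), gr.
have w0 x y : 0 <= weight0 p pt rho org n J x0 x y by apply: sumr_ge0 => k _; apply: mulr_ge0; [exact: sqr_ge0|exact: powR_ge0].
have w1 x y : 0 <= weight1 p pt rho org n J x0 x y by apply: sumr_ge0 => k _; apply: mulr_ge0; [exact: sqr_ge0|exact: powR_ge0].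
have j0' f g : 0 <= jump_energy p pt (weight0 p pt rho org n J x0) (weight1 p pt rho org n J x0) f g.
  apply: sumr_ge0 => x _; apply: sumr_ge0 => y _; apply: addr_ge0; apply: mulr_ge0 => //.
split=> //.
- move=> a f h w; rewrite -ext_comb; congr (j0 (ext _ _ _ _ _ _ _ _ _ _ _) w).
  by apply/funext => x; exact: lin.
- move=> f; split; first exact: (ext_C2 de de' ce).
  by move=> x; exact: (ext_interp e0 e1 x0 rho0 J0 sep (lexx _) win).
split=> [f|F g sob].
  apply: le_trans (ext_energy p2 de de' ce eK e0 e1 x0 rho0 J0 diam win f (gr f)) _.
  by rewrite lee_fin; apply: ler_wpM2r => //; rewrite lerDl ltW.
apply: le_trans (jump_energy_le p2 x0 rho0 diam (ltW C0) est sob) _.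
by apply: ler_wpM2r; [exact: energy_ge0|rewrite lerDr ltW].
Qed.

(** * Comparison with the seminorms of the statement *)

Section Norms.
Variables (R : realType) (p : R).
Hypothesis p0 : 0 < p.

(** The integrand of [hess_Lp_norm]. It is comparable with gam^p up to the factors 4 and 4^p that a
    sum of four terms costs. *)
Definition gamp (g : bool -> bool -> plane R -> R) w := \sum_(i : bool) \sum_(j : bool) `|g i j w| `^ p.

Lemma gamp_le g w : gamp g w <= 4 * gam g w `^ p.
Proof.
have h i j : `|g i j w| `^ p <= gam g w `^ p.
  apply: ge0_ler_powR; rewrite ?nnegrE ?(ltW p0)//; first by apply: sumr_ge0 => k _; exact: sumr_ge0.
  rewrite /gam (bigD1 i)//= (bigD1 j)//= -addrA lerDl addr_ge0//; apply: sumr_ge0 => // k _; exact: sumr_ge0.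
rewrite /gamp !big_bool /=; have := h true true; have := h true false; have := h false true; have := h false false; lra.
Qed.

Lemma gam_le g w : gam g w `^ p <= 4 `^ p * gamp g w.
Proof.
have h (a b : R) (a0 : 0 <= a) (b0 : 0 <= b) := powR_addr_le (ltW p0) a0 b0.
rewrite /gam /gamp !big_bool /= (_ : 4 = 2 * 2 :> R); last by ring.
rewrite powRM// -mulrA; apply: le_trans (h _ _ _ _) _; rewrite ?addr_ge0//.
by apply: ler_wpM2l; [exact: powR_ge0|rewrite mulrDr; apply: lerD; exact: h].
Qed.

Lemma measurable_gamp F g : weak_hessian F g -> measurable_fun setT (gamp g).
Proof.
move=> wh; apply: measurable_sum => i; apply: measurable_sum => j.
apply: (@measurableT_comp _ _ _ _ _ _ (@powR R ^~ p)); [exact: measurable_powR|apply: measurableT_comp => //; by have [] := wh i j].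
Qed.

Lemma hess_norm_powR g (c : R) : 0 <= c -> (\int[leb R]_w (gamp g w)%:E <= (c `^ p)%:E)%E -> (hess_Lp_norm p g <= c%:E)%E.
Proof.
move=> c0 h; rewrite /hess_Lp_norm.
have e : (c%:E = (c `^ p)%:E `^ p^-1)%E by rewrite poweR_EFin -powRrM divff ?powRr1// gt_eqF.
rewrite e; apply: gt0_ler_poweR; first by rewrite invr_ge0 ltW.
- by rewrite in_itv/= leey andbT integral_ge0// => w _; rewrite lee_fin; apply: sumr_ge0 => i _; apply: sumr_ge0 => j _; exact: powR_ge0.
- by rewrite in_itv/= leey andbT lee_fin powR_ge0.
- exact: h.
Qed.
Lemma gamp_ge0 g w : 0 <= gamp g w.
Proof. by apply: sumr_ge0 => i _; apply: sumr_ge0 => j _; exact: powR_ge0. Qed.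

Lemma gam_integral_le F g : weak_hessian F g ->
  (\int[leb R]_w (gam g w `^ p)%:E <= (4 `^ p)%:E * \int[leb R]_w (gamp g w)%:E)%E.
Proof.
move=> wh; have mP := measurable_gamp wh; have g0 := gamp_ge0 g.
rewrite (ge0_integral_scale measurableT mP g0) ?powR_ge0//; apply: ge0_le_integral => //.
- by move=> w _; rewrite lee_fin powR_ge0.
- by apply: measurable_EFinS; exact: measurable_gam_powR wh.
- by apply: measurable_EFinS; exact: measurable_funM.
- by move=> w _; rewrite lee_fin; exact: gam_le.
Qed.

Lemma gamp_integral_le F g : weak_hessian F g ->
  (\int[leb R]_w (gamp g w)%:E <= 4%:E * \int[leb R]_w (gam g w `^ p)%:E)%E.
Proof.
move=> wh; have mP := measurable_gam_powR p wh.
rewrite (ge0_integral_scale measurableT mP (fun w => powR_ge0 _ _))//; apply: ge0_le_integral => //.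
- by move=> w _; rewrite lee_fin gamp_ge0.
- by apply: measurable_EFinS; exact: measurable_gamp wh.
- by apply: measurable_EFinS; exact: measurable_funM.
- by move=> w _; rewrite lee_fin; exact: gamp_le.
Qed.

Lemma weak_hessian_sobolev F g : continuous F -> weak_hessian F g -> (hess_Lp_norm p g < +oo)%E -> sobolev p F g.
Proof.
move=> cF wh fin; split=> //; apply: (le_lt_trans (gam_integral_le wh)).
apply: lte_mul_pinfty; rewrite ?lee_fin ?powR_ge0//.
by apply: lty_poweRy fin; rewrite invr_eq0 gt_eqF.
Qed.

Lemma energy_hess_norm F g : sobolev p F g -> ((energy p g setT `^ p^-1)%:E <= 4%:E * hess_Lp_norm p g)%E.
Proof.
move=> sob; have [_ wh _] := sob; have h := gam_integral_le wh; rewrite (energy_finE measurableT sob) in h.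
have I0 : (0 <= \int[leb R]_w (gamp g w)%:E)%E by apply: integral_ge0 => w _; rewrite lee_fin gamp_ge0.
have q0 : (0 <= (4 `^ p)%:E :> \bar R)%E by rewrite lee_fin powR_ge0.
rewrite -poweR_EFin (_ : 4%:E = (4 `^ p)%:E `^ p^-1)%E; last first.
  by rewrite poweR_EFin -powRrM divff ?powRr1// gt_eqF.
rewrite /hess_Lp_norm -poweRM//; apply: gt0_ler_poweR; first by rewrite invr_ge0 ltW.
- by rewrite in_itv/= leey andbT lee_fin energy_ge0.
- by rewrite in_itv/= leey andbT mule_ge0.
- exact: h.
Qed.
End Norms.

(** The formal part: M is at most C1 times the norm of every extension, and F0 is an extension of
    norm at most C2 M. Passing to the infimum gives all the inequalities for any C above C1, C2 and
    C2 C1. *)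
Lemma trace_bounds (R : realType) (p : R) (E : {fset plane R}) (f : E -> R) (F0 : plane R -> R) (M C1 C2 C : R) :
  0 < C1 -> C1 <= C -> 0 <= C2 -> C2 <= C -> C2 * C1 <= C -> 0 <= M -> L2p p F0 -> (forall x : E, F0 (fsval x) = f x) ->
  (L2p_norm p F0 <= (C2 * M)%:E)%E ->
  (forall F g, L2p p F -> (forall x : E, F (fsval x) = f x) -> weak_hessian F g -> (M%:E <= C1%:E * hess_Lp_norm p g)%E) ->
  ((C^-1 * M)%:E <= trace_norm p f)%E /\ (trace_norm p f <= L2p_norm p F0)%E /\
  (L2p_norm p F0 <= C%:E * trace_norm p f)%E /\ (C%:E * trace_norm p f <= (C ^+ 2 * M)%:E)%E.
Proof.
move=> C10 C1C C20 C2C CC M0 LF0 F0f up lo; have C0 := lt_le_trans C10 C1C.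
have lb : ((C1^-1 * M)%:E <= trace_norm p f)%E.
  apply: le_ereal_inf_tmp => _ [F [LF Ff] <-]; apply: le_ereal_inf_tmp => _ [g wg <-].
  have h := lo F g LF Ff wg; have C1i : (0 <= (C1^-1)%:E)%E by rewrite lee_fin invr_ge0 ltW.
  have := lee_wpmul2l C1i h; rewrite -EFinM => h'; apply: (le_trans h').
  by rewrite muleA -EFinM mulVf ?gt_eqF// mul1e.
have t0 : (0 <= trace_norm p f)%E by apply: le_trans lb; rewrite lee_fin mulr_ge0// invr_ge0 ltW.
have tr : (trace_norm p f <= L2p_norm p F0)%E by apply: ereal_inf_lbound; exists F0.
split; last split => //; last split.
- by apply: le_trans lb; rewrite lee_fin; apply: ler_wpM2r => //; rewrite lef_pV2.
- apply: (le_trans up); apply: (@le_trans _ _ ((C2 * C1)%:E * (C1^-1 * M)%:E)%E).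
    by rewrite -EFinM lee_fin le_eqVlt; apply/orP; left; apply/eqP; field; rewrite gt_eqF.
  apply: lee_pmul => //; rewrite lee_fin; first by rewrite mulr_ge0// ltW.
  by rewrite mulr_ge0// invr_ge0 ltW.
- apply: (@le_trans _ _ (C%:E * (C2 * M)%:E)%E).
    by apply: lee_wpmul2l; [rewrite lee_fin ltW|exact: le_trans up].
  rewrite -EFinM lee_fin expr2 -[leRHS]mulrA; apply: ler_wpM2l; first exact: ltW.
  exact: ler_wpM2r.
Qed.

Lemma sum_enum_val (R : realType) (T : finType) (F : T -> R) : \sum_(i < #|T|) F (enum_val i) = \sum_x F x.
Proof. by rewrite -(big_enum_val (A := T)) //=. Qed.

Theorem theorem1 (R : realType) (p : R) (hp : 2 < p) :
  exists C : R, 0 < C /\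
  forall E : {fset plane R},
  exists (T : (E -> R) -> plane R -> R) (N0 : nat)
         (lambda : 'I_N0 -> (E -> R) -> R),
    (forall (a : R) (f g : E -> R),
        T (fun x => a * f x + g x) = (fun y => a * T f y + T g y)) /\
    (forall i (a : R) (f g : E -> R),
        lambda i (fun x => a * f x + g x) = a * lambda i f + lambda i g) /\
    (N0%:R <= C * (#|` E|%:R) ^+ 2) /\
    forall f : E -> R,
      let M := (\sum_(i < N0) `|lambda i f| `^ p) `^ p^-1 in
      L2p p (T f) /\
      (forall x : E, T f (fsval x) = f x) /\
      ((C^-1 * M)%:E <= trace_norm p f)%E /\
      (trace_norm p f <= L2p_norm p (T f))%E /\
      (L2p_norm p (T f) <= C%:E * trace_norm p f)%E /\
      (C%:E * trace_norm p f <= (C ^+ 2 * M)%:E)%E.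
Proof.
have p0 : 0 < p by linear.
have pi0 : 0 <= p^-1 by rewrite invr_ge0 ltW.
have [C0 C00 HC] := jump_scheme hp.
pose C1 := C0 `^ p^-1 * 4; pose C2 := (4 * C0) `^ p^-1.
have C10 : 0 < C1 by rewrite mulr_gt0// powR_gt0.
have C20 : 0 < C2 by rewrite powR_gt0// mulr_gt0.
have C21 : 0 < C2 * C1 by exact: mulr_gt0.
(* The summand 3 pays for the number of functionals, three per ordered pair; the others are the
   requirements of [trace_bounds]. *)
pose C := C1 + C2 + C2 * C1 + 3.
have [Ca [Cb [Cc Cd]]] : C1 <= C /\ C2 <= C /\ C2 * C1 <= C /\ 3 <= C by rewrite /C; linear.
have cpos : 0 < C by linear.
exists C; split=> // E.
have hess_ge0 g : (0 <= hess_Lp_norm p g)%E by exact: poweR_ge0.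
have L0 (F : plane R -> R) g : continuous F -> weak_hessian F g -> (hess_Lp_norm p g < +oo)%E -> L2p p F.
  by move=> cF wg fin; split=> //; exists g.
(* With at most one point there is no nearest neighbour; a constant extends the data with zero
   Hessian, and the list of functionals is empty. *)
have [I1|I1] := leqP #|{: E}| 1.
  (* The sum over E is its only value, or 0 when E is empty. *)
  exists (fun f _ => \sum_x f x), 0%N, (fun _ _ => 0); split.
    by move=> a f g; apply/funext => w; rewrite big_split /= -mulr_sumr.
  split; first by move=> i a f g; rewrite mulr0 addr0.
  split; first by rewrite mulr_ge0 ?sqr_ge0// ltW.
  move=> f M; have M0 : M = 0 by rewrite /M big_ord0 powR0// invr_neq0// gt_eqF.
  have wg := C2_weak_hessian (C2_cst (\sum_x f x)).
  have nrm : (hess_Lp_norm p (fun _ _ (_ : plane R) => 0%R) <= 0)%E.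
    apply: (@hess_norm_powR _ _ p0 _ 0) => //; rewrite powR0 ?gt_eqF//.
    rewrite integral0_eq// => w _; rewrite /gamp big1// => i _; rewrite big1// => j _.
    by rewrite normr0 powR0// gt_eqF.
  have LT : L2p p (fun _ : plane R => \sum_x f x).
    by apply: (L0 _ _ _ wg); [exact: cst_continuous|apply: le_lt_trans nrm _].
  have Tf (x : E) : \sum_x f x = f x.
    rewrite (bigD1 x)//= big1 ?addr0// => y yx; exfalso.
    by move: yx; rewrite (fintype_le1P I1 y x) eqxx.
  split=> //; split=> //.
  apply: (trace_bounds C10 Ca (ltW C20) Cb Cc _ LT Tf) => //; rewrite M0//.
    by rewrite mulr0; apply: le_trans nrm; apply: ereal_inf_lbound; exists (fun _ _ _ => 0).
  by move=> F g _ _ _; rewrite mule_ge0// lee_fin ltW.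
have ptI : injective (fun x : E => fsval x) by exact: val_inj.
have [T [c0 [c1 [gr [cc lin linT TC2 [TJ JE]]]]]] := HC E _ ptI I1.
(* One functional per ordered pair for the values and one for each coordinate of the gradient jump.
   The p-th roots of the weights make |lambda|^p the terms of the jump energy. *)
pose S := ((E * E) + (bool * (E * E)))%type.
pose lam (q : S) (f : E -> R) := match q with
  | inl xy => c0 xy.1 xy.2 `^ p^-1 * dev (fun x : E => fsval x) f (gr f) xy.1 xy.2
  | inr b => c1 b.2.1 b.2.2 `^ p^-1 * coord b.1 (gr f b.2.1 - gr f b.2.2) end.
exists (fun f => j0 (T f)), #|{: S}|, (fun i f => lam (enum_val i) f); split.
  by move=> a f g; apply/funext => w; exact: linT.
split.
  move=> i a f g; case: (enum_val i) => [[x y]|[b [x y]]] /=; rewrite /dev !lin /dot /coord /= /GRing.scale /=; last case: b => /=; ring.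
have card : #|{: S}| = (3 * #|` E| ^ 2)%N.
  by rewrite card_sum !card_prod card_bool cardfE -mulnn mulSn.
split; first by rewrite card natrM natrX; apply: ler_wpM2r => //; exact: sqr_ge0.
move=> f M; have [CT Tf] := TC2 f.
pose Jf := jump_energy p (fun x : E => fsval x) c0 c1 f (gr f).
have powroot (c x : R) : 0 <= c -> `|c `^ p^-1 * x| `^ p = c * `|x| `^ p.
  by move=> c00; rewrite normrM ger0_norm ?powR_ge0// powRM ?powR_ge0// -powRrM mulVf ?gt_eqF// powRr1.
have MJ : M = Jf `^ p^-1.
  rewrite /M (sum_enum_val (fun q => `|lam q f| `^ p)) big_sumType /= /Jf /jump_energy pair_bigA /=.
  rewrite -(pair_bigA _ (fun b (xy : E * E) => `|c1 xy.1 xy.2 `^ p^-1 * coord b (gr f xy.1 - gr f xy.2)| `^ p)) big_bool /= -!big_split /=; congr (_ `^ _).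
  apply: eq_bigr => -[x y] _ /=; have [h0 h1] := cc x y; rewrite !powroot// /coord /=; ring.
have J0 : 0 <= Jf.
  apply: sumr_ge0 => x _; apply: sumr_ge0 => y _; have [h0 h1] := cc x y.
  by apply: addr_ge0; apply: mulr_ge0 => //.
have M0 : 0 <= M by exact: powR_ge0.
have wT := C2_weak_hessian CT; have [cT _ _ _ _] := CT.
have nT : (hess_Lp_norm p (j2 (T f)) <= (C2 * M)%:E)%E.
  apply: (hess_norm_powR p0); first by rewrite mulr_ge0// ltW.
  apply: (le_trans (gamp_integral_le p0 wT)).
  apply: (@le_trans _ _ (4%:E * (C0 * Jf)%:E)%E); first by apply: lee_wpmul2l; [rewrite lee_fin|exact: TJ].
  rewrite -EFinM lee_fin MJ powRM ?powR_ge0// -!powRrM mulVf ?gt_eqF// !powRr1 ?mulrA//.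
  by rewrite mulr_ge0// ltW.
have LT : L2p p (j0 (T f)) by apply: (L0 _ _ cT wT); apply: le_lt_trans nT _; exact: ltry.
split=> //; split=> //.
apply: (trace_bounds C10 Ca (ltW C20) Cb Cc M0 LT Tf).
  by apply: le_trans nT; apply: ereal_inf_lbound; exists (j2 (T f)).
(* The bound is asked for every weak Hessian g of F; for one of infinite norm it is trivial, since
   C1 > 0. *)
move=> F g [cF _] Ff wg; have [fin|inf] := boolP (hess_Lp_norm p g < +oo)%E; last first.
  have -> : hess_Lp_norm p g = +oo%E by move: inf; rewrite -leNgt leye_eq => /eqP.
  by rewrite gt0_muley ?leey// lte_fin.
have sob := weak_hessian_sobolev p0 cF wg fin.
have fE : f = F \o (fun x : E => fsval x) by apply/funext => x; rewrite /= Ff.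
have h : Jf <= C0 * energy p g setT by rewrite /Jf fE; exact: JE.
have E0 : 0 <= energy p g setT by exact: energy_ge0.
apply: (@le_trans _ _ ((C0 `^ p^-1)%:E * (energy p g setT `^ p^-1)%:E)%E).
  rewrite -EFinM lee_fin MJ -powRM ?(ltW C00)//; apply: ge0_ler_powR; rewrite ?nnegrE//.
  by rewrite mulr_ge0// ltW.
rewrite /C1 EFinM -muleA; apply: lee_wpmul2l; first by rewrite lee_fin powR_ge0.
exact: (energy_hess_norm p0 sob).
Qed.
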